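(* Let $G$ be a loopless multigraph and let $\rho:V(G)\to\{3,4,6\}$ be a potential function. If $G$ is $(\rho,\frac15)$-critical, then one of the following holds: \begin{itemize} \item $G\in\mathcal I$ (up to isomorphism) and $\rho(v)=6$ for all $v\in V(G)$; \item $G$ is a $C_2$ (two vertices joined by exactly two parallel edges) satisfying $\rho_G(V(G))=2$; or \item $\rho_G(V(G))\le 0$. \end{itemize}
   Context: Multigraphs are finite; they may have parallel edges but no loops; edges are counted with multiplicity. For $m\ge1$, $I_m$ is the multigraph obtained from a $(2m+1)$-cycle $v_1v_2\ldots v_{2m+1}v_1$ by duplicating the edge $v_{2i-1}v_{2i}$ for each $i\in\{1,\dots,m\}$; $\mathcal I=\{I_m:m\ge1\}$. Covers. A DP $3$-cover $(H,L)$ of $G$ is a graph $H$ together with pairwise disjoint sets $L(v)$, $v\in V(G)$, with union $V(H)$, such that each $L(v)$ is a clique of size $3$ in $H$, and for each pair $\{x,y\}$ of distinct vertices of $G$ joined by exactly $s\ge0$ edges, the set of edges of $H$ between $L(x)$ and $L(y)$ is the union of at most $s$ matchings. Each $L(v)$ is a pointed set: it comes with a distinguished basepoint $\omega(v)\in L(v)$, which is part of the data of the cover. If $L'(v)\subseteq L(v)$ for each $v$, an $(H,L')$-coloring of $G$ is a map $\varphi:V(G)\to V(H)$ with $\varphi(v)\in L'(v)$ for all $v$ and whose image is an independent set of $H$. Potential functions. A potential function is a map $\rho:V(G)\to\{3,4,6\}$. It defines $h_\rho(v)=2$ if $\rho(v)=3$ and $h_\rho(v)=3$ if $\rho(v)\in\{4,6\}$.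 For $U\subseteq V(G)$, $\rho_G(U)=\sum_{v\in U}\rho(v)-4|E(G[U])|$. List distributions. An $h_\rho$-list assignment assigns to each $v\in V(G)$ a set $L'(v)\subseteq L(v)$ of size $h_\rho(v)$. A list distribution $\mathcal D$ on $(G,\rho,H,L)$ is a probability distribution on $h_\rho$-list assignments; its random outcome is denoted $L_{\mathcal D}$. It is $\varepsilon$-admissible if for each $v$ with $h_\rho(v)=2$ and each $c\in L(v)$, $\Pr(L(v)\setminus L_{\mathcal D}(v)=\{c\})\ge\varepsilon$. Coloring distributions. A coloring distribution $\Phi$ on $(G,\rho,H,L,\mathcal D)$ assigns to each outcome $L_{\mathcal D}$ of $\mathcal D$ a probability distribution on $(H,L_{\mathcal D})$-colorings of $G$; together with $\mathcal D$ it gives a joint distribution on pairs $(L_{\mathcal D},\phi)$ with first marginal $\mathcal D$ and with $\phi$ an $(H,L_{\mathcal D})$-coloring, and hence a random $(H,L)$-coloring $\phi$ of $G$. $\Phi$ is an $\varepsilon$-distribution if, with probabilities taken with respect to the overall joint distribution, for every $v\in V(G)$: (i) $\Pr(\phi(v)=c)\ge\varepsilon$ for each $c\in L(v)$; and (ii) if $\rho(v)=4$, then $\Pr(\phi(v)=\omega(v))=2\varepsilon$ and $\Pr(\phi(v)=c)=\frac12-\varepsilon$ for each $c\in L(v)\setminus\{\omega(v)\}$. Flexibility and criticality. $(G,\rho,H,L,\mathcal D)$ is $\varepsilon$-flexible if it has an $\varepsilon$-distribution. $(G,\rho)$ is $\varepsilon$-flexible if $(G,\rho,H,L,\mathcal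 D)$ is $\varepsilon$-flexible for every DP $3$-cover $(H,L)$ of $G$ (with every choice of basepoints) and every $\varepsilon$-admissible list distribution $\mathcal D$ on $(G,\rho,H,L)$. $G$ is $(\rho,\varepsilon)$-critical if $(G,\rho)$ is not $\varepsilon$-flexible, but $(G',\rho|_{V(G')})$ is $\varepsilon$-flexible for every proper subgraph $G'$ of $G$. *)

(* Defs.v *)
From HB Require Import structures.
From mathcomp Require Import all_boot all_order all_algebra.
From mathcomp Require Import reals.

Set Implicit Arguments.
Unset Strict Implicit.
Unset Printing Implicit Defensive.

Import Order.TTheory GRing.Theory Num.Theory.

Local Open Scope ring_scope.

(* [mult x y] is the number of parallel edges joining x and y. *)
Record mgraph : Type := MGraph {
  vertex :> finType;
  mult : vertex -> vertex -> nat;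
  mult_sym : forall x y, mult x y = mult y x;
  mult_irr : forall x, mult x x = 0%N }.

Definition mgraph_iso (G G' : mgraph) : Prop :=
  exists f : G -> G', bijective f /\ forall x y, mult (f x) (f y) = mult x y.

Record subgraph (G : mgraph) : Type := SubGraph {
  sub_verts : {set G};
  sub_mult : G -> G -> nat;
  sub_mult_sym : forall x y, sub_mult x y = sub_mult y x;
  sub_mult_le : forall x y, (sub_mult x y <= mult x y)%N;
  sub_mult_in : forall x y, (0 < sub_mult x y)%N ->
    (x \in sub_verts) && (y \in sub_verts) }.

Definition proper_subgraph (G : mgraph) (S : subgraph G) : Prop :=
  ~ (sub_verts S = [set: G] /\ forall x y, sub_mult S x y = mult x y).

Section SubgraphGraph.
Variables (G : mgraph) (S : subgraph G).

Definition sub_vertex : finType := {x : G | x \in sub_verts S}.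

Definition sub_vertex_mult (x y : sub_vertex) : nat :=
  sub_mult S (val x) (val y).

Lemma sub_vertex_mult_sym x y : sub_vertex_mult x y = sub_vertex_mult y x.
Proof. exact: sub_mult_sym. Qed.

Lemma sub_vertex_mult_irr x : sub_vertex_mult x x = 0%N.
Proof.
by apply/eqP; rewrite -leqn0 -(mult_irr (val x)); apply: sub_mult_le.
Qed.

Definition subgraph_mgraph : mgraph :=
  MGraph sub_vertex_mult_sym sub_vertex_mult_irr.

Definition sub_restrict (T : Type) (f : G -> T) : subgraph_mgraph -> T :=
  fun x : sub_vertex => f (val x).

End SubgraphGraph.

(* Each edge is seen twice in the sum over ordered pairs. *)
Definition edges_in (G : mgraph) (U : {set G}) : nat :=
  (\sum_(x in U) \sum_(y in U) mult x y)./2.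

(* The graphs I_m, with v_k encoded as the ordinal k - 1: the duplicated edges
   v_(2i-1) v_(2i), 1 <= i <= m, are those leaving an even ordinal below 2m. *)
Section GraphI.
Variable m : nat.

Definition I_arc (x y : 'I_(m.*2.+1)) : nat :=
  if val y == (x.+1 %% m.*2.+1)%N then
    (if ~~ odd x && (x < m.*2)%N then 2 else 1)%N
  else 0%N.

(* The test [x == y] only matters for m = 0. *)
Definition I_mult (x y : 'I_(m.*2.+1)) : nat :=
  if x == y then 0%N else (I_arc x y + I_arc y x)%N.

Lemma I_mult_sym x y : I_mult x y = I_mult y x.
Proof. by rewrite /I_mult eq_sym addnC. Qed.

Lemma I_mult_irr x : I_mult x x = 0%N.
Proof. by rewrite /I_mult eqxx. Qed.

Definition I_graph : mgraph := MGraph I_mult_sym I_mult_irr.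

End GraphI.

Definition in_family_I (G : mgraph) : Prop :=
  exists2 m : nat, (1 <= m)%N & mgraph_iso G (I_graph m).

Definition is_C2 (G : mgraph) : Prop :=
  #|G| = 2%N /\ forall x y : G, x != y -> mult x y = 2%N.

Definition potential_function (G : mgraph) (rho : G -> nat) : Prop :=
  forall v, rho v \in [:: 3; 4; 6]%N.

Definition h_of (G : mgraph) (rho : G -> nat) (v : G) : nat :=
  if rho v == 3%N then 2%N else 3%N.

Definition potential (G : mgraph) (rho : G -> nat) (U : {set G}) : int :=
  \sum_(v in U) (rho v)%:Z - 4%:Z * (edges_in U)%:Z.

Section SimpleGraphs.
Variables (V : finType) (e : rel V).

Definition edges_between (A B : {set V}) : {set {set V}} :=
  [set [set p.1; p.2] | p in [set p : V * V | [&& p.1 \in A, p.2 \in B & e p.1 p.2]]].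

Definition clique (A : {set V}) : Prop :=
  {in A &, forall a b, a != b -> e a b}.

Definition independent (A : {set V}) : Prop :=
  {in A &, forall a b, ~~ e a b}.

Definition matching (M : {set {set V}}) : bool :=
  (M \subset edges_between setT setT) && trivIset M.

End SimpleGraphs.

Record dp3_cover (G : mgraph) : Type := DPCover {
  cvert : finType;
  cadj : rel cvert;
  cadj_sym : symmetric cadj;
  cadj_irr : irreflexive cadj;
  clist : G -> {set cvert};
  clist_disjoint : forall x y, x != y -> [disjoint clist x & clist y];
  clist_union : \bigcup_x clist x = [set: cvert];
  clist_card : forall x, #|clist x| = 3%N;
  clist_clique : forall x, clique cadj (clist x);
  clist_matchings : forall x y, x != y ->
    exists Ms : seq {set {set cvert}},
      [/\ (size Ms <= mult x y)%N, all (matching cadj) Ms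
        & edges_between cadj (clist x) (clist y) = \bigcup_(M <- Ms) M];
  basepoint : G -> cvert;
  basepoint_in : forall x, basepoint x \in clist x }.

Section Distributions.
Variable R : realType.

Definition is_distr (T : finType) (p : T -> R) : Prop :=
  (forall x, 0 <= p x) /\ \sum_x p x = 1.

Definition Prob (T : finType) (p : T -> R) (E : pred T) : R :=
  \sum_(x | E x) p x.

Section OnCover.
Variables (G : mgraph) (rho : G -> nat) (C : dp3_cover G).

Definition assignment : finType := {ffun G -> {set cvert C}}.
Definition vmap : finType := {ffun G -> cvert C}.

Definition is_list_assignment (L' : assignment) : Prop :=
  forall v, L' v \subset clist C v /\ #|L' v| = h_of rho v.

Definition is_coloring (L' : assignment) (phi : vmap) : Prop :=
  (forall v, phi v \in L' v) /\ independent (@cadj _ C) (phi @: [set: G]).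

Definition list_distribution (D : assignment -> R) : Prop :=
  is_distr D /\ forall L', 0 < D L' -> is_list_assignment L'.

Definition admissible (eps : R) (D : assignment -> R) : Prop :=
  forall v, h_of rho v = 2%N -> forall c, c \in clist C v ->
  eps <= Prob D (fun L' => clist C v :\: L' v == [set c]).

(* The values of [Phi] at list assignments of probability 0 are irrelevant:
   these are not outcomes of [D], and [joint] vanishes there. *)
Definition coloring_distribution (D : assignment -> R)
    (Phi : assignment -> vmap -> R) : Prop :=
  forall L', 0 < D L' ->
  is_distr (Phi L') /\ forall phi, 0 < Phi L' phi -> is_coloring L' phi.

Definition joint (D : assignment -> R) (Phi : assignment -> vmap -> R)
    (w : assignment * vmap) : R := D w.1 * Phi w.1 w.2.

Definition Prob_color (D : assignment -> R) (Phi : assignment -> vmap -> R)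
    (v : G) (c : cvert C) : R :=
  Prob (joint D Phi) (fun w => w.2 v == c).

Definition eps_distribution (eps : R) (D : assignment -> R)
    (Phi : assignment -> vmap -> R) : Prop :=
  coloring_distribution D Phi /\
  forall v,
    (forall c, c \in clist C v -> eps <= Prob_color D Phi v c) /\
    (rho v = 4%N ->
       Prob_color D Phi v (basepoint C v) = 2 * eps /\
       forall c, c \in clist C v -> c != basepoint C v ->
         Prob_color D Phi v c = 1 / 2 - eps).

Definition flexible_for (eps : R) (D : assignment -> R) : Prop :=
  exists Phi, eps_distribution eps D Phi.

End OnCover.

Definition flexible (eps : R) (G : mgraph) (rho : G -> nat) : Prop :=
  forall (C : dp3_cover G) (D : assignment C -> R),
  list_distribution rho D -> admissible rho eps D -> flexible_for rho eps D.

Definition critical (eps : R) (G : mgraph) (rho : G -> nat) : Prop :=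
  ~ flexible eps rho /\
  forall S : subgraph G, proper_subgraph S ->
    flexible eps (sub_restrict (S := S) rho).

End Distributions.

(* Main.v *)
(** By induction on the graph, in a critical graph of positive potential every proper nonempty vertex set has
    larger potential than the whole: otherwise one colors a set of least potential first. Give [v] the charge
    rho(v) - 2 deg(v), so that the charges sum to the potential. A tree of vertices of nonnegative charge can be
    colored last, its conditional laws being coupled along the edges; criticality therefore restricts how the
    vertices of positive charge attach to the rest, and discharging leaves exactly one vertex [p] of nonzero
    charge, with rho(p) = 6 and degree 2.

    If all edges are simple, an induced path between the two neighbors of [p] is colored after the rest of the
    graph and [p] last; a color of [p] can be forced too often only by one value, and shifting the excess mass
    of that value makes the law admissible, a contradiction. A double edge ab whose other edges are ua and bw can
    be replaced by a new edge uw without losing flexibility, so by induction the smaller graph is a [C_2], which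
    is treated by hand, or some [I_m], and reinserting the pair a, b yields [I_(m+1)]. *)

Require Import Defs.
From mathcomp Require Import all_boot all_order all_algebra.
From mathcomp Require Import reals.
From mathcomp Require Import zify ring lra.
From Stdlib Require Import Classical.

Set Implicit Arguments.
Unset Strict Implicit.
Unset Printing Implicit Defensive.

Import Order.TTheory GRing.Theory Num.Theory.

Local Open Scope ring_scope.

(** * Finite probability *)

(** Two laws on three colors can be coupled off a matching exactly when matched colors have masses
    of sum at most 1. With epsilon = 1/5 every vertex has masses between 1/5 and 3/5, which explains
    the potentials. A 4-vertex has masses at most 2/5, so it can be coupled along an edge with any
    vertex; as its law is known in advance, colorings can also be glued along it. A 6-vertex with
    one colored neighbor loses a random color of masses at least 1/5 and so becomes a 3-vertex: this
    costs 3, less than the 4 of the edge. The first obstacle is a double edge whose two matchings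
    agree at exactly one color: two colors at the other end are then available only through that
    color, which needs mass 2/5. This is the origin of the basepoint of mass 2 epsilon: lowering a
    6-vertex to a 4-vertex allows that mass to be placed on the critical color. Hence the recurring
    step: lower a vertex to 4, and if flexibility is lost, the induction yields a set of small
    potential or a double edge at that vertex. The second obstacle is closing a cycle at its last
    vertex, where no color may be forced with probability above 3/5. *)

Section Probability.
Variable R : realFieldType.

Definition isd (A : finType) (P : A -> R) := (forall a, 0 <= P a) /\ \sum_a P a = 1.
Definition pr (A : finType) (P : A -> R) (E : pred A) := \sum_(a | E a) P a.
Definition bind (A B : finType) (P : A -> R) (K : A -> B -> R) (b : B) :=
  \sum_a P a * K a b.
Definition push (A B : finType) (f : A -> B) (P : A -> R) (b : B) :=
  \sum_(a | f a == b) P a.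

Section Basics.
Variables (A B : finType).
Implicit Types (P : A -> R) (K : A -> B -> R) (E F : pred A).

Lemma prE P E : pr P E = \sum_a P a * (E a)%:R.
Proof. by rewrite /pr big_mkcond /=; apply: eq_bigr => a _; case: (E a); rewrite ?mulr1 ?mulr0. Qed.

Lemma eq_pr P E F : E =1 F -> pr P E = pr P F.
Proof. by move=> h; apply: eq_bigl. Qed.

Lemma pr_ge0 P E : (forall a, 0 <= P a) -> 0 <= pr P E.
Proof. by move=> h; apply: sumr_ge0. Qed.

Lemma pr_mono P E F : (forall a, 0 <= P a) -> (forall a, 0 < P a -> E a -> F a) -> pr P E <= pr P F.
Proof.
move=> h s; rewrite !prE; apply: ler_sum => a _.
have := h a; rewrite le_eqVlt => /orP[/eqP <-|ha]; first by rewrite !mul0r.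
by apply: ler_wpM2l => //; case: (E a) (s a ha) => [/(_ isT) ->|_] //; case: (F a).
Qed.

Lemma pr_supp P E F : (forall a, 0 <= P a) -> (forall a, 0 < P a -> E a = F a) -> pr P E = pr P F.
Proof. by move=> h s; apply/eqP; rewrite eq_le; apply/andP; split; apply: pr_mono => // a /s ->. Qed.

Lemma pr_all P E : isd P -> (forall a, 0 < P a -> E a) -> pr P E = 1.
Proof. by case=> h <- s; rewrite (@pr_supp P E xpredT) // => a /s ->. Qed.

Lemma pr_none P E : (forall a, 0 <= P a) -> (forall a, 0 < P a -> ~~ E a) -> pr P E = 0.
Proof. by move=> h s; rewrite (@pr_supp P E xpred0) ?/pr ?big_pred0 // => a /s /negbTE ->. Qed.

Lemma pr_split P E F : pr P E = pr P (predI E F) + pr P (predI E (predC F)).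
Proof. by rewrite /pr (bigID F). Qed.

Lemma prC P E : isd P -> pr P (predC E) = 1 - pr P E.
Proof. by case=> _ <-; rewrite (bigID E) /= addrAC subrr add0r. Qed.

Lemma pr_le1 P E : isd P -> pr P E <= 1.
Proof. by move=> [h <-]; apply: pr_mono. Qed.

Lemma prU P E F : (forall a, 0 <= P a) -> pr P (predU E F) <= pr P E + pr P F.
Proof.
move=> h; rewrite !prE -big_split; apply: ler_sum => a _ /=; rewrite -mulrDr.
by apply: ler_wpM2l => //; case: (E a); case: (F a) => //=; rewrite ?addr0 ?add0r // ler_wpDr.
Qed.

Lemma pr_bind P K (G : pred B) : pr (bind P K) G = \sum_a P a * pr (K a) G.
Proof.
rewrite /pr /bind exchange_big /=; apply: eq_bigr => a _.
by rewrite mulr_sumr.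
Qed.

Lemma isd_bind P K : isd P -> (forall a, isd (K a)) -> isd (bind P K).
Proof.
move=> [h0 h1] k; split=> [b|]; first by apply: sumr_ge0 => a _; apply: mulr_ge0 => //; case: (k a).
rewrite /bind exchange_big /= -h1; apply: eq_bigr => a _.
by rewrite -mulr_sumr; case: (k a) => _ ->; rewrite mulr1.
Qed.

Lemma bind_supp P K b : 0 < bind P K b -> exists a, P a * K a b != 0.
Proof.
move=> h; apply: NNPP => n; move: h; rewrite /bind big1 ?ltxx // => a _.
by apply/eqP/negPn/negP => x; apply: n; exists a.
Qed.

Lemma bind_gt0 P K b : (forall a, 0 <= P a) -> (forall a b, 0 <= K a b) ->
  0 < bind P K b -> exists a, 0 < P a /\ 0 < K a b.
Proof.
move=> h k /bind_supp[a]; rewrite mulf_eq0 negb_or => /andP[x y]; exists a.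
by rewrite !lt_def x y h k.
Qed.

Lemma pr_push P (f : A -> B) (G : pred B) : pr (push f P) G = pr P (fun a => G (f a)).
Proof.
rewrite /pr /push [RHS](partition_big f G) //=; apply: eq_bigr => b gb.
by apply: eq_bigl => a; case: eqP => [->|]; rewrite ?gb ?andbF.
Qed.

Lemma isd_push P (f : A -> B) : isd P -> isd (push f P).
Proof.
move=> [h0 h1]; split=> [b|]; first exact: sumr_ge0.
by rewrite -h1 -[LHS]/(pr _ xpredT) pr_push.
Qed.

Lemma push_gt0 P (f : A -> B) b : (forall a, 0 <= P a) -> 0 < push f P b -> exists a, f a = b /\ 0 < P a.
Proof.
move=> h; rewrite /push => s; apply: NNPP => n; move: s; rewrite big1 ?ltxx // => a /eqP e.
by apply/eqP; rewrite eq_le h andbT leNgt; apply/negP => x; apply: n; exists a.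
Qed.

Lemma isd_point (a0 : A) : isd (fun a => (a == a0)%:R : R).
Proof.
split=> [a|]; first by case: (_ == _).
by rewrite (bigD1 a0) //= eqxx big1 ?addr0 // => a /negbTE ->.
Qed.

Lemma isd_mix P Q (l : R) : 0 <= l <= 1 -> isd P -> isd Q -> isd (fun a => (1 - l) * P a + l * Q a).
Proof.
move=> /andP[l0 l1] [p0 p1] [q0 q1]; split=> [a|].
  by rewrite addr_ge0 // mulr_ge0 // subr_ge0.
by rewrite big_split /= -!mulr_sumr p1 q1; ring.
Qed.

Lemma pr_mix P Q (l : R) E : pr (fun a => (1 - l) * P a + l * Q a) E = (1 - l) * pr P E + l * pr Q E.
Proof. by rewrite /pr big_split /= -!mulr_sumr. Qed.

End Basics.

Lemma pr_partition (A I : finType) (P : A -> R) (E : pred A) (f : A -> I) :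
  pr P E = \sum_i pr P (fun a => E a && (f a == i)).
Proof. by rewrite /pr (partition_big f xpredT). Qed.

Lemma pr_prod (A B : finType) (P : A -> R) (Q : B -> R) (E : pred A) (F : pred B) :
  pr (fun w : A * B => P w.1 * Q w.2) (fun w => E w.1 && F w.2) = pr P E * pr Q F.
Proof.
by rewrite /pr mulr_suml -(pair_big_dep E (fun _ => F) (fun a b => P a * Q b)) /=; apply: eq_bigr => a _; rewrite mulr_sumr.
Qed.

Lemma isd_prod (A B : finType) (P : A -> R) (Q : B -> R) : isd P -> isd Q ->
  isd (fun w : A * B => P w.1 * Q w.2).
Proof.
move=> [p0 p1] [q0 q1]; split=> [w|]; first exact: mulr_ge0.
rewrite -(pair_bigA _ (fun a b => P a * Q b)) /= -p1; apply: eq_bigr => a _.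
by rewrite -mulr_sumr q1 mulr1.
Qed.

End Probability.

(** * Three colors: couplings and the choice of a last color *)

Notation C3 := (option bool).

Lemma sum3 (R : nmodType) (F : C3 -> R) : \sum_c F c = F None + (F (Some true) + F (Some false)).
Proof.
rewrite (bigD1 None) //=; congr (_ + _); rewrite (bigD1 (Some true)) //=; congr (_ + _).
by rewrite (bigD1 (Some false)) //= big1 ?addr0 // => -[[]|].
Qed.

Definition third (x y : C3) : C3 :=
  if (None != x) && (None != y) then None
  else if (Some true != x) && (Some true != y) then Some true else Some false.

Lemma thirdP x y : third x y != x /\ third x y != y.
Proof. by move: x y => [[]|] [[]|]. Qed.

Lemma third_uniq x y z : x != y -> z != x -> z != y -> z = third x y.
Proof. by move: x y z => [[]|] [[]|] [[]|]. Qed.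

Lemma sum3d (R : nmodType) (F : C3 -> R) x y : x != y ->
  \sum_c F c = F x + (F y + F (third x y)).
Proof.
move=> n; rewrite (bigD1 x) //=; congr (_ + _); rewrite (bigD1 y) ?[y == x]eq_sym //=; congr (_ + _).
have [t1 t2] := thirdP x y; rewrite (bigD1 (third x y)) ?t1 ?t2 //= big1 ?addr0 // => c /andP[/andP[a b] d].
by move: d; rewrite (third_uniq n a b) eqxx.
Qed.

Section Couplings.
Variable R : realFieldType.

(** Hall's condition on three points. With an empty diagonal, six entries remain under five
    independent marginal constraints, so there is one free parameter [x], the mass going from [None]
    to [Some true]. *)
Lemma coupling_id (a b : C3 -> R) : isd a -> isd b -> (forall c, a c + b c <= 1) ->
  exists k : C3 -> C3 -> R, [/\ forall c d, 0 <= k c d, forall c, \sum_d k c d = a c,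
    forall d, \sum_c k c d = b d & forall c, k c c = 0].
Proof.
move=> [a0 a1] [b0 b1] ab; move: a1 b1; rewrite !sum3 => a1 b1.
have := (a0 None, a0 (Some true), a0 (Some false), b0 None, b0 (Some true), b0 (Some false)).
have := (ab None, ab (Some true), ab (Some false)).
case=> [[A1 A2] A3] [[[[[A4 A5] A6] A7] A8] A9].
set x1 := a None in a1 A1 A4 *; set x2 := a (Some true) in a1 A2 A5 *; set x3 := a (Some false) in a1 A3 A6 *.
set y1 := b None in b1 A1 A7 *; set y2 := b (Some true) in b1 A2 A8 *; set y3 := b (Some false) in b1 A3 A9 *.
(* The lower bounds for [x] are 0, [y2 - x3] and [x1 - y3]; the largest of them is taken. *)
have [x [h1 h2 h3 [h4 h5 h6]]] : exists x, [/\ 0 <= x, x <= x1, x <= y2 & [/\ y2 - x3 <= x, x1 - y3 <= x & x <= y1 + y2 - x3]].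
  have [e|e] := lerP (y2 - x3) (x1 - y3); have [e'|e'] := lerP 0 (x1 - y3).
  - exists (x1 - y3) ; repeat split; lra.
  - exists 0 ; repeat split; lra.
  - exists (y2 - x3) ; repeat split; lra.
  - have [e''|e''] := lerP 0 (y2 - x3); [exists (y2 - x3)|exists 0] ; repeat split; lra.
exists (fun c d => match c, d with
  | None, Some true => x | None, Some false => x1 - x
  | Some true, None => y1 - (x3 - y2 + x) | Some true, Some false => y3 - (x1 - x)
  | Some false, None => x3 - y2 + x | Some false, Some true => y2 - x
  | _, _ => 0 end).
split.
- by move=> [[]|] [[]|]; lra.
- by move=> [[]|]; rewrite sum3 -/x1 -/x2 -/x3; lra.
- by move=> [[]|]; rewrite sum3 -/y1 -/y2 -/y3; lra.
- by move=> [[]|].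
Qed.

(** The joint law of [coupling_id] is turned into conditional laws, so that a color [c] already
    drawn can be followed by a color off [f c]. *)
Lemma coupling (a b : C3 -> R) (f : C3 -> C3) : injective f -> isd a -> isd b ->
  (forall c, a c + b (f c) <= 1) ->
  exists k : C3 -> C3 -> R, [/\ forall c, isd (k c), forall c, k c (f c) = 0 &
    forall d, \sum_c a c * k c d = b d].
Proof.
move=> inj da [b0 b1] ab.
have [g fg gf] : bijective f by exact: (@injF_bij (option bool : finType) f inj).
have db : isd (fun c => b (f c)).
  by split=> [c|]; rewrite ?b0 // -b1 [RHS](reindex f) //=; by exists g => x _; [exact: fg|exact: gf].
have [k [k0 k1 k2 k3]] := coupling_id da db ab.
pose u c d : R := if d == f c then 0 else 1 / 2.
have du c : isd (u c).
  split=> [d|]; first by rewrite /u; case: ifP => _; lra.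
  rewrite /u sum3; move: (f c) => [[]|] /=; lra.
case: (da) => a0 _.
(* A row of mass zero cannot be normalized; the uniform law off [f c] replaces it. *)
exists (fun c d => if a c == 0 then u c d else k c (g d) / a c); split.
- move=> c; case: (eqVneq (a c) 0) => [//|n0]; split=> [d|].
    by rewrite divr_ge0.
  rewrite -mulr_suml (reindex f) /=; last by (exists g => x _; [exact: fg|exact: gf]).
  by rewrite (eq_bigr (k c)) ?k1 ?divff // => d _; rewrite fg.
- by move=> c; case: eqP => _; rewrite /u ?eqxx ?fg ?k3 ?mul0r.
move=> d; rewrite -[d]gf -k2 gf; apply: eq_bigr => c _.
case: (eqVneq (a c) 0) => [e|n0]; last by rewrite mulrC divfK.
rewrite e mul0r; apply/eqP; rewrite eq_le k0 /= -e -k1.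
by rewrite (bigD1 (g d)) //= lerDl sumr_ge0.
Qed.

Lemma frac_exists (g a : R) : 0 <= a -> a <= g -> exists t, [/\ 0 <= t, t <= 1 & g * t = a].
Proof.
move=> a0 ag; case: (eqVneq g 0) => [e|n0].
  by exists 0; split; rewrite ?mulr0; lra.
exists (a / g); split; first by rewrite divr_ge0 //; lra.
  by rewrite ler_pdivrMr ?mul1r // lt_def n0; lra.
by rewrite mulrC divfK.
Qed.

(** A transport problem: each color is forced with mass [f], and the mass [g] on which only that
    color is excluded may be shared by the two others. [a] and [b] are the parts of [gB] and [gC]
    given to the first color, [c] the part of [gA] given to the second. *)
Lemma split_amounts (fA fB fC gA gB gC : R) : 0 <= fA -> 0 <= fB -> 0 <= fC ->
  0 <= gA -> 0 <= gB -> 0 <= gC -> fA + (fB + fC) + (gA + (gB + gC)) = 1 ->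
  fA <= 3 / 5 -> fB <= 3 / 5 -> fC <= 3 / 5 ->
  1 / 5 <= fA + (gA + (gB + gC) - gA) -> 1 / 5 <= fB + (gA + (gB + gC) - gB) ->
  1 / 5 <= fC + (gA + (gB + gC) - gC) ->
  exists a b c, [/\ 0 <= a /\ a <= gB, 0 <= b /\ b <= gC,
    0 <= c /\ c <= gA & [/\ 1 / 5 <= fA + a + b, 1 / 5 <= fB + (gC - b) + c & 1 / 5 <= fC + (gA - c) + (gB - a)]].
Proof.
move=> pA pB pC qA qB qC tot lA lB lC vA vB vC.
have [a [b [[a0 a1 a2] [b0 b1 b2] [ab1 ab2]]]] : exists a b, [/\ [/\ 0 <= a, a <= gB & a <= fC + gA + gB - 1 / 5],
   [/\ 0 <= b, b <= gC & b <= fB + gA + gC - 1 / 5] & 1 / 5 - fA <= a + b /\ a + b <= 3 / 5 - fA].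
  have [e|e] := lerP (1 / 5) fA; first by exists 0, 0; repeat split; lra.
  have [e1|e1] := lerP gB (fC + gA + gB - 1 / 5).
    have [e2|e2] := lerP gB (1 / 5 - fA).
      by exists gB, (1 / 5 - fA - gB); repeat split; lra.
    by exists (1 / 5 - fA), 0; repeat split; lra.
  have [e2|e2] := lerP (fC + gA + gB - 1 / 5) (1 / 5 - fA).
    by exists (fC + gA + gB - 1 / 5), (1 / 5 - fA - (fC + gA + gB - 1 / 5)); repeat split; lra.
  by exists (1 / 5 - fA), 0; repeat split; lra.
exists a, b; have [e|e] := lerP 0 (1 / 5 - fB - gC + b).
  by exists (1 / 5 - fB - gC + b); repeat split; lra.
by exists 0; repeat split; lra.
Qed.

Lemma split_exists (f g : C3 -> R) : (forall c, 0 <= f c) -> (forall c, 0 <= g c) ->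
  \sum_c f c + \sum_c g c = 1 ->
  (forall c, f c <= 3 / 5) -> (forall c, 1 / 5 <= f c + \sum_(d | d != c) g d) ->
  exists s : C3 -> C3 -> R, [/\ forall d, isd (s d), forall d, s d d = 0 &
    forall c, 1 / 5 <= f c + \sum_d g d * s d c].
Proof.
move=> f0 g0; rewrite !sum3 => tot fle av.
have sD (h : C3 -> R) c : \sum_(d | d != c) h d = \sum_d h d - h c.
  by rewrite [\sum_d h d](bigD1 c) //= [h c + _]addrC addrK.
have := (av None, av (Some true), av (Some false)); rewrite !sD !sum3 => -[[vA vB] vC].
have := (fle None, fle (Some true), fle (Some false)); case=> [[lA lB] lC].
have := (f0 None, f0 (Some true), f0 (Some false), g0 None, g0 (Some true), g0 (Some false)).
case=> [[[[[pA pB] pC] qA] qB] qC].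
set fA := f None in tot vA vB vC lA pA *; set fB := f (Some true) in tot vA vB vC lB pB *.
set fC := f (Some false) in tot vA vB vC lC pC *; set gA := g None in tot vA vB vC qA *.
set gB := g (Some true) in tot vA vB vC qB *; set gC := g (Some false) in tot vA vB vC qC *.
have [a [b [c [[a0 ag] [b0 bg] [c0 cg] [e1 e2 e3]]]]] := split_amounts pA pB pC qA qB qC tot lA lB lC vA vB vC.
have [ta [ta0 ta1 ea]] := frac_exists a0 ag.
have [tb [tb0 tb1 eb]] := frac_exists b0 bg.
have [tc [tc0 tc1 ec]] := frac_exists c0 cg.
exists (fun d c => match d, c with
  | None, Some true => tc | None, Some false => 1 - tc
  | Some true, None => ta | Some true, Some false => 1 - ta
  | Some false, None => tb | Some false, Some true => 1 - tb
  | _, _ => 0 end).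
split.
- by move=> d; split=> [c'|]; [case: d c' => [[]|] [[]|] //=; rewrite subr_ge0|rewrite sum3; case: d => [[]|] /=; ring].
- by move=> [[]|].
- by move=> [[]|]; rewrite sum3 -/fA -/fB -/fC -/gA -/gB -/gC; lra.
Qed.

(** The last vertex has no choice where its two excluded colors differ; where they coincide, the
    mass is shared by [split_exists]. A color must be available with mass 1/5, and none may be
    forced above 3/5 because the two others need 1/5 each. *)
Lemma closing (Om : finType) (P : Om -> R) (x z : Om -> C3) : isd P ->
  (forall c, 1 / 5 <= pr P (fun w => (x w != c) && (z w != c))) ->
  (forall k, pr P (fun w => [&& x w != z w, x w != k & z w != k]) <= 3 / 5) ->
  exists K : Om -> C3 -> R, [/\ forall w, isd (K w), forall w, K w (x w) = 0, forall w, K w (z w) = 0 &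
    forall c, 1 / 5 <= \sum_w P w * K w c].
Proof.
move=> dP av fo; have [P0 P1] := dP.
pose f c := pr P (fun w => [&& x w != z w, x w != c & z w != c]).
pose g c := pr P (fun w => (x w == c) && (z w == c)).
have [s [s1 s2 s3]] : exists s : C3 -> C3 -> R, [/\ forall d, isd (s d), forall d, s d d = 0 &
    forall c, 1 / 5 <= f c + \sum_d g d * s d c].
  apply: split_exists => //.
  - by move=> c; exact: pr_ge0.
  - by move=> c; exact: pr_ge0.
  - rewrite /f /g -big_split /= -P1 -[RHS]/(pr P xpredT).
    rewrite (pr_partition P _ (fun w => if x w == z w then x w else third (x w) (z w))).
    apply: eq_bigr => c _; rewrite !prE -big_split; apply: eq_bigr => w _ /=; rewrite -mulrDr; congr (_ * _).
    by move: (x w) (z w) c => [[]|] [[]|] [[]|]; rewrite /= ?addr0 ?add0r.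
  - move=> c; apply: le_trans (av c) _; rewrite /f /g prE.
    rewrite [X in _ <= X + _]prE (eq_bigr _ (fun d _ => prE _ _)) exchange_big -big_split /=.
    apply: ler_sum => w _ /=; rewrite -mulr_sumr -mulrDr ler_wpM2l // big_mkcond sum3.
    by move: (x w) (z w) c => [[]|] [[]|] [[]|]; rewrite /= ?addr0 ?add0r ?lexx ?ler01 ?ler0n // ?ler_wpDr.
exists (fun w c => if x w == z w then s (x w) c else (c == third (x w) (z w))%:R); split.
- by move=> w; case: eqP => _ //; exact: isd_point.
- by move=> w; case: eqP => // _; case: (thirdP (x w) (z w)) => h _; rewrite eq_sym (negbTE h).
- by move=> w; case: eqP => [<-|_] //; case: (thirdP (x w) (z w)) => _ h; rewrite eq_sym (negbTE h).
- move=> c; apply: le_trans (s3 c) _.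
  have -> : \sum_d g d * s d c = \sum_w P w * (\sum_d ((x w == d) && (z w == d))%:R * s d c).
    under eq_bigr do rewrite /g prE mulr_suml.
    rewrite exchange_big; apply: eq_bigr => w _; rewrite mulr_sumr.
    by apply: eq_bigr => d _; rewrite mulrA.
  rewrite /f prE -big_split /=; apply: ler_sum => w _; rewrite -mulrDr ler_wpM2l // sum3.
  by move: (x w) (z w) c => [[]|] [[]|] [[]|]; rewrite /= ?mul0r ?mul1r ?addr0 ?add0r ?lexx.
Qed.

End Couplings.

(** * Flexibility over normalized lists *)

Section Flexibility.
Variables (R : realFieldType) (T : finType).
Notation col := {ffun T -> C3}.
Implicit Types (U V W S : {set T}) (m : T -> T -> nat) (rho : T -> nat)
  (M : T -> T -> C3 -> C3 -> bool) (b : T -> C3).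

(** For epsilon = 1/5 these are 2 epsilon at the basepoint and 1/2 - epsilon elsewhere. *)
Definition p4 (beta c : C3) : R := if c == beta then 2 / 5 else 3 / 10.

(* Every list is identified with [C3]: [M x y i j] means that color [i] at [x] conflicts with color [j]
   at [y]. A partial matching between two lists extends to a bijection, so at most [m x y] bijections
   cover all conflicts. *)
Definition cov U m M := (forall x y i j, M x y i j = M y x j i) /\
  forall x y, x \in U -> y \in U -> x != y -> exists s : seq {ffun C3 -> C3},
    [/\ (size s <= m x y)%N, forall f : {ffun C3 -> C3}, f \in s -> injective f &
      forall i j, M x y i j -> exists2 f : {ffun C3 -> C3}, f \in s & j = f i].

Definition ok U M (phi : col) := forall x y, x \in U -> y \in U -> x != y -> ~~ M x y (phi x) (phi y).

Definition marg U rho b (L : col -> R) := forall v, v \in U ->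
  (forall c, 1 / 5 <= pr L (fun phi => phi v == c)) /\
  (rho v = 4%N -> forall c, pr L (fun phi => phi v == c) = p4 (b v) c).

(* [w] is a random outcome and [mu w v] is the color missing from the list of the 3-vertex [v]. *)
Definition adm U rho (Om : finType) (P : Om -> R) (mu : Om -> T -> C3) :=
  forall v, v \in U -> rho v = 3%N -> forall c, 1 / 5 <= pr P (fun w => mu w v == c).

Definition solves U M rho b (Om : finType) (P : Om -> R) (mu : Om -> T -> C3) (K : Om -> col -> R) :=
  [/\ forall w, isd (K w),
      forall w phi, 0 < P w -> 0 < K w phi -> ok U M phi /\
        (forall v, v \in U -> rho v = 3%N -> phi v != mu w v) &
      marg U rho b (bind P K)].

(** The sample space is arbitrary and may carry more than the missing colors [mu]; in this way a
    coloring already chosen can become part of the outcome. *)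
Definition flex U m rho := forall M b (Om : finType) (P : Om -> R) mu,
  cov U m M -> isd P -> adm U rho P mu -> exists K, solves U M rho b P mu K.

Definition good U M rho b (L : col -> R) :=
  [/\ isd L, forall phi, 0 < L phi -> ok U M phi & marg U rho b L].

(* Flexibility when there are no 3-vertices: the lists are then not random. *)
Definition lawful U m rho := forall M b, cov U m M -> exists L, good U M rho b L.

Lemma bind_unit (A : finType) (P : unit -> R) (K : unit -> A -> R) a : isd P -> bind P K a = K tt a.
Proof.
by case=> _; rewrite /bind !(big_pred1 tt) => [e|[]|[]] //; rewrite e mul1r.
Qed.

Lemma isd_unit : isd (fun _ : unit => 1 : R).
Proof. by split=> // ; rewrite (big_pred1 tt) // => -[]. Qed.

Lemma eq_pr_fun (A : finType) (P Q : A -> R) E : P =1 Q -> pr P E = pr Q E.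
Proof. by move=> h; apply: eq_bigr. Qed.

Lemma eq_isd (A : finType) (P Q : A -> R) : P =1 Q -> isd P -> isd Q.
Proof. by move=> h [a e]; split=> [x|]; rewrite -?h // -e; apply: eq_bigr. Qed.

Lemma eq_marg U rho b (L L' : col -> R) : L =1 L' -> marg U rho b L -> marg U rho b L'.
Proof.
move=> h g v vU; have [a e] := g v vU.
by split=> [c|r c]; rewrite -(eq_pr_fun _ h) ?a ?e.
Qed.

Lemma flex_lawful U m rho : (forall v, v \in U -> rho v != 3%N) -> flex U m rho -> lawful U m rho.
Proof.
move=> n3 fl M b c; have [] := fl M b unit (fun _ => 1) (fun _ _ => None) c isd_unit.
  by move=> v /n3 /eqP.
move=> K [k0 k1 k2]; exists (K tt); split=> //.
  by move=> phi h; case: (k1 tt phi ltr01 h).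
by apply: eq_marg k2 => phi; rewrite bind_unit //; exact: isd_unit.
Qed.

Lemma lawful_flex U m rho : (forall v, v \in U -> rho v != 3%N) -> lawful U m rho -> flex U m rho.
Proof.
move=> n3 lw M b Om P mu c [P0 P1] _; have [L [l0 l1 l2]] := lw M b c.
exists (fun _ => L); split=> //.
  by move=> w phi _ /l1 h; split=> // v /n3 /eqP.
apply: eq_marg l2 => phi.
by rewrite /bind -mulr_suml P1 mul1r.
Qed.

Definition merge U (phi psi : col) : col := [ffun v => if v \in U then phi v else psi v].

(** The kernel [N] sees the outcome and the coloring of [U]; only its average has to have the right
    marginals on [W], and the law on [U] stays as it was. *)
Lemma extend U W M rho b (Om : finType) (P : Om -> R) mu K (N : Om -> col -> col -> R) :
  (forall x y i j, M x y i j = M y x j i) -> isd P -> [disjoint U & W] -> solves U M rho b P mu K ->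
  (forall w phi, isd (N w phi)) ->
  (forall w phi psi, 0 < P w -> 0 < K w phi -> 0 < N w phi psi ->
    [/\ ok W M psi, forall v, v \in W -> rho v = 3%N -> psi v != mu w v &
      forall x y, x \in U -> y \in W -> ~~ M x y (phi x) (psi y)]) ->
  marg W rho b (bind P (fun w => bind (K w) (N w))) ->
  exists K', solves (U :|: W) M rho b P mu K'.
Proof.
move=> Msym [P0 P1] dUW [k0 k1 k2] n0 n1 n2.
have nU y : y \in W -> y \in U = false by move=> yW; apply/negbTE; apply: contraL yW => yU; rewrite (disjointFr dUW yU).
exists (fun w => bind (K w) (fun phi => push (merge U phi) (N w phi))); split.
- by move=> w; apply: isd_bind => // phi; apply: isd_push.
- move=> w chi Pw /bind_gt0[|phi psi|phi [kp /push_gt0[|psi [<- np]]]].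
  + by case: (k0 w).
  + by apply: (isd_push _ (n0 _ _)).1.
  + by case: (n0 w phi).
  have [o1 l1] := k1 w phi Pw kp; have [o2 l2 c2] := n1 w phi psi Pw kp np.
  split=> [x y|v]; rewrite !inE => /orP[] xU.
  + move=> /orP[] yU nxy; rewrite !ffunE xU ?yU ?(nU y) //; [exact: o1|exact: c2].
  + move=> /orP[] yU nxy; rewrite !ffunE (nU x) // ?yU ?(nU y) //; [by rewrite Msym; apply: c2|exact: o2].
  + by rewrite ffunE xU; apply: l1.
  + by rewrite ffunE (nU v) //; apply: l2.
have prU v c : v \in U -> pr (bind P (fun w => bind (K w) (fun phi => push (merge U phi) (N w phi)))) (fun phi => phi v == c)
   = pr (bind P K) (fun phi => phi v == c).
  move=> vU; rewrite !pr_bind; apply: eq_bigr => w _; congr (_ * _); rewrite pr_bind prE.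
  apply: eq_bigr => phi _; congr (_ * _); rewrite pr_push.
  under eq_pr => psi do rewrite /merge ffunE vU.
  by case: (_ == _); [apply: pr_all|apply: pr_none => //; case: (n0 w phi)].
have prW v c : v \in W -> pr (bind P (fun w => bind (K w) (fun phi => push (merge U phi) (N w phi)))) (fun phi => phi v == c)
   = pr (bind P (fun w => bind (K w) (N w))) (fun phi => phi v == c).
  move=> vW; rewrite !pr_bind; apply: eq_bigr => w _; congr (_ * _); rewrite !pr_bind.
  apply: eq_bigr => phi _; congr (_ * _); rewrite pr_push.
  by apply: eq_pr => psi; rewrite /merge ffunE nU.
move=> v; rewrite inE => /orP[] vV.
  by have [a e] := k2 v vV; split=> [c|r c]; rewrite prU // ?a ?e.
by have [a e] := n2 v vV; split=> [c|r c]; rewrite prW // ?a ?e.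
Qed.

End Flexibility.

(** * Coloring one part after the other *)

Section Gluing.
Variables (R : realFieldType) (T : finType).
Notation col := {ffun T -> C3}.
Implicit Types (U V W S : {set T}) (m : T -> T -> nat) (rho : T -> nat)
  (M : T -> T -> C3 -> C3 -> bool) (b : T -> C3).

Lemma cov0 U m M x y i j : cov U m M -> x \in U -> y \in U -> x != y -> m x y = 0%N -> ~~ M x y i j.
Proof.
move=> [_ c] xU yU n e; have [s [sz _ h]] := c x y xU yU n.
by apply/negP => /h[f]; move: sz; rewrite e leqn0 => /nilP ->.
Qed.

Lemma cov1 U m M x y : cov U m M -> x \in U -> y \in U -> x != y -> m x y = 1%N ->
  exists f : {ffun C3 -> C3}, injective f /\ forall i j, M x y i j -> j = f i.
Proof.
move=> [_ c] xU yU n e; have [s [sz si h]] := c x y xU yU n.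
case: s sz si h => [|f [|? ?]]; rewrite e // => _ si h.
  exists [ffun i => i]; split=> [i j|i j /h[]//]; by rewrite !ffunE.
exists f; split=> [|i j /h[g]]; first by apply: si; rewrite inE.
by rewrite inE => /eqP ->.
Qed.

Lemma cov2 U m M x y : cov U m M -> x \in U -> y \in U -> x != y -> m x y = 2%N ->
  exists f g : {ffun C3 -> C3}, [/\ injective f, injective g & forall i j, M x y i j -> j = f i \/ j = g i].
Proof.
move=> [_ c] xU yU n e; have [s [sz si h]] := c x y xU yU n.
have idi : injective [ffun i : C3 => i] by move=> i j; rewrite !ffunE.
case: s sz si h => [|f [|g [|? ?]]]; rewrite e // => _ si h.
- by exists [ffun i => i], [ffun i => i]; split=> // i j /h[].
- exists f, f; split=> [||i j /h[k]]; try by apply: si; rewrite inE.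
  by rewrite inE => /eqP -> ->; left.
- exists f, g; split=> [||i j /h[k]]; try by apply: si; rewrite !inE eqxx ?orbT.
  by rewrite !inE => /orP[/eqP ->|/eqP ->] ->; [left|right].
Qed.

Lemma covS U U' m m' M : cov U m M -> U' \subset U -> (forall x y, x \in U' -> y \in U' -> m x y <= m' x y)%N ->
  cov U' m' M.
Proof.
move=> [h c] /subsetP s le; split=> // x y xU yU n.
have [l [l1 l2 l3]] := c x y (s x xU) (s y yU) n.
by exists l; split=> //; apply: leq_trans l1 (le _ _ xU yU).
Qed.

Lemma flex_sub U m m' rho : (forall x y, x \in U -> y \in U -> m x y <= m' x y)%N -> flex R U m' rho -> flex R U m rho.
Proof. by move=> le fl M b Om P mu c; apply: fl; apply: covS c _ le. Qed.

(** Both kinds of vertices have full lists, and the demand on the law of a 4-vertex is the stronger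
    one. *)
Lemma flex_mono U m rho rho' :
  (forall v, v \in U -> rho v = rho' v \/ rho v = 6%N /\ rho' v = 4%N) ->
  flex R U m rho' -> flex R U m rho.
Proof.
move=> h fl M b Om P mu c dP ad.
have [|K [k0 k1 k2]] := fl M b Om P mu c dP.
  by move=> v vU e; apply: ad => //; case: (h v vU) => [->|[_ f]] //; rewrite f in e.
exists K; split=> //.
  move=> w phi a a'; have [o l] := k1 w phi a a'; split=> // v vU e; apply: l => //.
  by case: (h v vU) => [<-|[f _]] //; rewrite f in e.
move=> v vU; have [a e] := k2 v vU; split=> // f; apply: e.
by case: (h v vU) => [<-|[g _]] //; rewrite g in f.
Qed.

Lemma pr_pair (A B : finType) (P : A -> R) (K : A -> B -> R) (E : A -> B -> bool) :
  pr (fun w : A * B => P w.1 * K w.1 w.2) (fun w => E w.1 w.2) = \sum_a P a * pr (K a) (E a).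
Proof.
rewrite /pr -(pair_big_dep xpredT E (fun a c => P a * K a c)) /=.
by apply: eq_bigr => a _; rewrite mulr_sumr.
Qed.

(** The color of [x] removes one color at [v], and each color is removed with mass at least 1/5
    because [x] has such a law. So [v] is a 3-vertex once the coloring of the rest is made part of
    the outcome. *)
Lemma color_first V m rho S rho' : S \subset V -> (forall x y, m x y = m y x) ->
  flex R (V :\: S) m rho -> flex R S m rho' ->
  (forall v, v \in S -> (rho' v = rho v /\ forall y, y \in V :\: S -> m v y = 0%N) \/
     [/\ rho v = 6%N, rho' v = 3%N & exists2 x, x \in V :\: S & m v x = 1%N /\
        forall y, y \in V :\: S -> y != x -> m v y = 0%N]) ->
  flex R V m rho.
Proof.
move=> SV ms flU flS leg M b Om P mu cV dP ad; set U := V :\: S in flU leg *.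
have UV : U \subset V by rewrite subsetDl.
have dUS : [disjoint U & S] by rewrite disjoints_subset; apply/subsetP => x; rewrite !inE => /andP[].
have neUS x y : x \in U -> y \in S -> x != y.
  by move=> xU yS; apply: contraTneq yS => <-; rewrite (disjointFr dUS xU).
have [K1 s1] := flU M b Om P mu (covS cV UV (fun x y _ _ => leqnn _)) dP (fun v vU => ad v (subsetP UV v vU)).
have [k0 k1 k2] := s1.
have xf v : exists q : T * {ffun C3 -> C3}, v \in S -> rho v = 6%N -> rho' v = 3%N ->
    [/\ q.1 \in U, injective q.2, forall i j, M q.1 v i j -> j = q.2 i & forall y, y \in U -> y != q.1 -> m v y = 0%N].
  case: (boolP (v \in S)) => vS; last by exists (v, [ffun i => i]).
  case: (leg v vS) => [[e _]|[e6 e3 [x xU [m1 m0]]]]; first by exists (v, [ffun i => i]) => _ a b'; move: e; rewrite a b'.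
  have [f [fi fM]] := cov1 cV (subsetP UV _ xU) (subsetP SV _ vS) (neUS _ _ xU vS) (etrans (ms x v) m1).
  by exists (x, f).
have [q qP] := fin_all_exists xf.
pose P2 (w : Om * col) := P w.1 * K1 w.1 w.2.
pose mu2 (w : Om * col) v := if rho v == 3%N then mu w.1 v else (q v).2 (w.2 (q v).1).
have dP2 : isd P2.
  split=> [w|]; first by rewrite mulr_ge0 //; [case: dP|case: (k0 w.1)].
  rewrite -[LHS]/(pr P2 (fun w => (fun _ _ => true) w.1 w.2)) pr_pair -(proj2 dP); apply: eq_bigr => w _.
  by rewrite -[pr _ _]/(\sum_phi K1 w phi) (proj2 (k0 w)) mulr1.
have [|K2 [l0 l1 l2]] := flS M b _ P2 mu2 (covS cV SV (fun x y _ _ => leqnn _)) dP2.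
  move=> v vS e3 c; rewrite /mu2; case: (leg v vS) => [[e _]|[e6 _ _]].
    rewrite -e e3 eqxx (pr_pair P K1 (fun w _ => mu w v == c)).
    have -> : \sum_a P a * pr (K1 a) (fun=> mu a v == c) = pr P (fun w => mu w v == c).
      rewrite prE; apply: eq_bigr => w _; congr (_ * _); case: (_ == _); first exact: pr_all.
      by apply: pr_none => //; case: (k0 w).
    by apply: ad => //; [exact: (subsetP SV)|rewrite -e].
  have [q1 q2 q3 q4] := qP v vS e6 e3; rewrite e6 /= (pr_pair P K1 (fun _ phi => (q v).2 (phi (q v).1) == c)) -pr_bind.
  have [g fg gf] : bijective (q v).2 by exact: (@injF_bij (option bool : finType)).
  rewrite (@eq_pr _ _ _ _ (fun phi : col => phi (q v).1 == g c)); first by case: (k2 _ q1).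
  by move=> phi /=; rewrite -{1}[c]gf (can_eq fg).
rewrite -(setID V S) setUC (setIidPr SV) -/U.
apply: (@extend _ _ U S M rho b Om P mu K1 (fun w phi => K2 (w, phi))) => //.
- by case: cV.
- move=> w phi psi Pw kp np; have P2p : 0 < P2 (w, phi) by rewrite mulr_gt0.
  have [o l] := l1 (w, phi) psi P2p np; split=> // [v vS e|x y xU yS].
    have e' : rho' v = 3%N by case: (leg v vS) => [[->]|[_ ->]].
    by have := l v vS e'; rewrite /mu2 e eqxx.
  case: (leg y yS) => [[_ z]|[e6 e3 _]].
    by apply: (cov0 _ _ cV (subsetP UV _ xU) (subsetP SV _ yS) (neUS _ _ xU yS)); rewrite ms z.
  have [q1 q2 q3 q4] := qP y yS e6 e3; have := l y yS e3; rewrite /mu2 e6 /=.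
  case: (eqVneq x (q y).1) => [->|nx] ne; first by apply: contra ne => /q3 ->.
  by apply: (cov0 _ _ cV (subsetP UV _ xU) (subsetP SV _ yS) (neUS _ _ xU yS)); rewrite ms q4.
have eqb : bind P2 K2 =1 bind P (fun w => bind (K1 w) (fun phi => K2 (w, phi))).
  move=> psi; rewrite /bind (eq_bigr (fun p => P p.1 * K1 p.1 p.2 * K2 (p.1, p.2) psi)) => [|[]//].
  rewrite -(pair_bigA _ (fun w phi => P w * K1 w phi * K2 (w, phi) psi)) /=.
  by apply: eq_bigr => w _; rewrite mulr_sumr; apply: eq_bigr => phi _; rewrite mulrA.
have := eq_marg eqb l2; rewrite /marg => mg v vS; have [a e] := mg v vS; split=> // r4 c; apply: e.
by case: (leg v vS) => [[->]|[e6]] //; rewrite e6 in r4.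
Qed.

(** The law on [W] is conditioned on the color of [x] alone; averaging over that color gives the
    marginals. *)
Lemma attach U W M rho b (Om : finType) (P : Om -> R) mu K m x (La : C3 -> col -> R) :
  cov (U :|: W) m M -> isd P -> [disjoint U & W] -> solves U M rho b P mu K ->
  (forall v, v \in W -> rho v != 3%N) -> x \in U ->
  (forall y z, y \in U -> z \in W -> y != x -> m y z = 0%N) ->
  (forall c, isd (La c)) ->
  (forall c psi, 0 < La c psi -> ok W M psi /\ forall z, z \in W -> ~~ M x z c (psi z)) ->
  marg W rho b (fun psi => \sum_c pr (bind P K) (fun phi => phi x == c) * La c psi) ->
  exists K', solves (U :|: W) M rho b P mu K'.
Proof.
move=> cV dP dUW s1 n3 xU m0 l0 l1 l2.
have [k0 k1 k2] := s1.
apply: (extend (N := fun _ phi => La (phi x))) s1 _ _ _ => //.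
- by case: cV.
- move=> w phi psi _ _ /l1 [o nM]; split=> // [v /n3 /eqP//|y z yU zW].
  case: (eqVneq y x) => [->|ne]; first exact: nM.
  apply: (cov0 _ _ cV); rewrite ?inE ?yU ?zW ?orbT //; last exact: m0.
  by apply: contraTneq zW => <-; rewrite (disjointFr dUW yU).
apply: eq_marg l2 => psi; rewrite /bind.
have -> : \sum_a P a * (\sum_phi K a phi * La (phi x) psi) = \sum_phi (bind P K phi) * La (phi x) psi.
  under eq_bigr do rewrite mulr_sumr.
  by rewrite exchange_big; apply: eq_bigr => phi _; rewrite /bind mulr_suml; apply: eq_bigr => w _; rewrite mulrA.
rewrite [RHS](partition_big (fun phi : col => phi x) xpredT) //=; apply: eq_bigr => c _.
by rewrite /pr mulr_suml; apply: eq_bigr => phi /eqP ->.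
Qed.

(** Draws the color of [u] from [k c], then a coloring from [L] conditioned on that color. If [k]
    averages to the law of [u] under [L], these laws average to [L]. *)
Definition retarget (L : col -> R) (u : T) (k : C3 -> C3 -> R) (c : C3) (psi : col) :=
  L psi * (k c (psi u) / pr L (fun phi => phi u == psi u)).

Lemma retarget_isd (L : col -> R) (u : T) (k : C3 -> C3 -> R) c : isd L -> (forall d, 0 < pr L (fun phi => phi u == d)) -> isd (k c) ->
  isd (retarget L u k c).
Proof.
move=> [l0 l1] pos [k0 k1]; split=> [psi|].
  by rewrite mulr_ge0 // divr_ge0 // ltW.
rewrite -k1 (partition_big (fun psi : col => psi u) xpredT) //=; apply: eq_bigr => d _.
rewrite (eq_bigr (fun psi => L psi * (k c d / pr L (fun phi : col => phi u == d)))) => [|psi /eqP e].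
  by rewrite -mulr_suml -/(pr L (fun phi : col => phi u == d)) mulrC divfK ?gt_eqF.
by rewrite /retarget e.
Qed.

Lemma retarget_gt0 (L : col -> R) (u : T) (k : C3 -> C3 -> R) c psi : isd L -> (forall d, 0 < pr L (fun phi => phi u == d)) -> isd (k c) ->
  0 < retarget L u k c psi -> 0 < L psi /\ 0 < k c (psi u).
Proof.
move=> [l0 l1] pos [k0 k1]; have [lp|lp] := ltrP 0 (L psi); last first.
  by have e : L psi = 0 by [apply/eqP; rewrite eq_le lp l0]; rewrite /retarget e mul0r ltxx.
have [kp|kp] := ltrP 0 (k c (psi u)); first by [].
by have e : k c (psi u) = 0 by [apply/eqP; rewrite eq_le kp k0]; rewrite /retarget e mul0r mulr0 ltxx.
Qed.

Lemma retarget_avg (L : col -> R) (u : T) (k : C3 -> C3 -> R) (mu : C3 -> R) psi : (forall d, 0 < pr L (fun phi => phi u == d)) ->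
  (forall d, \sum_c mu c * k c d = pr L (fun phi => phi u == d)) ->
  \sum_c mu c * retarget L u k c psi = L psi.
Proof.
move=> pos h; rewrite (eq_bigr (fun c => (mu c * k c (psi u)) * (L psi / pr L (fun phi : col => phi u == psi u)))) => [|c _].
  by rewrite -mulr_suml h mulrC divfK ?gt_eqF.
by rewrite /retarget mulrA [mu c * _]mulrC -!mulrA mulrCA; congr (_ * _); rewrite mulrCA; congr (_ * _); rewrite mulrC.
Qed.

End Gluing.

Lemma inj3 (f : C3 -> C3) : injective f ->
  [/\ f None != f (Some true), f None != f (Some false) & f (Some true) != f (Some false)].
Proof. by move=> h; rewrite !(inj_eq h). Qed.

(** * Laws across a double edge *)

Section DoubleEdge.
Variable R : realFieldType.

Definition free_choice (f g : C3 -> C3) (c d : C3) : R :=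
  if (d == f c) || (d == g c) then 0 else if f c == g c then 1 / 2 else 1.

Lemma isd_free_choice (f g : C3 -> C3) c : isd (free_choice f g c).
Proof.
rewrite /free_choice; split=> [d|]; first by case: ifP => // _; case: ifP => _; rewrite ?ler01 // divr_ge0.
by rewrite sum3; move: (f c) (g c) => [[]|] [[]|] /=; rewrite ?addr0 ?add0r // -mulr2n -mulr_natr; lra.
Qed.

(** The bad case of a double edge: the matchings agree at [c] without being equal, hence at [c]
    only. *)
Definition special (f g : C3 -> C3) (c : C3) := (f c == g c) && ~~ [&& f None == g None, f (Some true) == g (Some true) & f (Some false) == g (Some false)].

(** If the matchings agree at a single color, every other color leaves only the common image free.
    The two remaining colors then share the mass of the agreeing color, which must be 2/5. If the
    matchings agree nowhere, the free color is a permutation of the given one; if everywhere, the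
    excluded color is; then 1/5 is enough. *)
Lemma free_choice_lb (f g : C3 -> C3) (mu : C3 -> R) : injective f -> injective g -> isd mu -> (forall c, 1 / 5 <= mu c) ->
  (forall c, special f g c -> 2 / 5 <= mu c) -> forall d, 1 / 5 <= \sum_c mu c * free_choice f g c d.
Proof.
move=> /inj3 [f1 f2 f3] /inj3 [g1 g2 g3] [_ +] lb sp d; rewrite /free_choice !sum3 => tot.
have := (lb None, lb (Some true), lb (Some false)); have := (sp None, sp (Some true), sp (Some false)).
rewrite /special; move: (mu None) (mu (Some true)) (mu (Some false)) tot f1 f2 f3 g1 g2 g3 => x y z.
move: (f None) (f (Some true)) (f (Some false)) (g None) (g (Some true)) (g (Some false)).
by move=> [[]|] [[]|] [[]|] // [[]|] [[]|] [[]|] // tot _ _ _ _ _ _ [[s1 s2] s3] [[l1 l2] l3] {lb sp};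
  move: d s1 s2 s3 => [[]|] /=; rewrite ?mulr0 ?mulr1 ?addr0 ?add0r //;
  try (move=> /(_ isT)); try (move=> _ /(_ isT)); try (move=> _ _ /(_ isT)); move=> *; lra.
Qed.

(** The bound 1/2 at both ends allows single edges to other laws bounded by 1/2. Masses 1/2, 1/4,
    1/4 with 1/2 at the agreeing color are reproduced at the other end; without a single agreement
    the uniform law is. *)
Lemma double_target (f g : C3 -> C3) : injective f -> injective g -> exists mu : C3 -> R,
  [/\ isd mu, forall c, 1 / 5 <= mu c <= 1 / 2 & forall d, 1 / 5 <= \sum_c mu c * free_choice f g c d <= 1 / 2].
Proof.
move=> fi gi.
pose al := [&& f None == g None, f (Some true) == g (Some true) & f (Some false) == g (Some false)].
pose nn := [&& f None != g None, f (Some true) != g (Some true) & f (Some false) != g (Some false)].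
exists (fun c => if al || nn then 1 / 3 else if f c == g c then 1 / 2 else 1 / 4).
move: fi gi => /inj3 [f1 f2 f3] /inj3 [g1 g2 g3]; rewrite /al /nn /free_choice.
split=> [|c|d].
- split=> [c|]; first by case: ifP => _; [|case: ifP => _]; rewrite divr_ge0.
  rewrite sum3; move: f1 f2 f3 g1 g2 g3.
  move: (f None) (f (Some true)) (f (Some false)) (g None) (g (Some true)) (g (Some false)).
  by move=> [[]|] [[]|] [[]|] // [[]|] [[]|] [[]|] //= *; field.
- by case: ifP => _; [|case: ifP => _]; lra.
rewrite sum3; move: f1 f2 f3 g1 g2 g3.
move: (f None) (f (Some true)) (f (Some false)) (g None) (g (Some true)) (g (Some false)).
by move=> [[]|] [[]|] [[]|] // [[]|] [[]|] [[]|] // *; move: d => [[]|] /=; lra.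
Qed.

End DoubleEdge.

(** * Trees with prescribed laws *)

Section Trees.
Variables (R : realFieldType) (T : finType).
Notation col := {ffun T -> C3}.
Implicit Types (U V W S : {set T}) (m : T -> T -> nat) (rho : T -> nat)
  (M : T -> T -> C3 -> C3 -> bool) (b : T -> C3) (t : T -> C3 -> R).

Definition law S M t (L : col -> R) :=
  [/\ isd L, forall phi, 0 < L phi -> ok S M phi &
    forall v c, v \in S -> pr L (fun phi => phi v == c) = t v c].

Definition upd (X : Type) (v : T) (a : X) (f : T -> X) (u : T) := if u == v then a else f u.

Lemma updE (X : Type) (v : T) (a : X) f : upd v a f v = a.
Proof. by rewrite /upd eqxx. Qed.

Lemma updN (X : Type) (v : T) (a : X) f u : u != v -> upd v a f u = f u.
Proof. by rewrite /upd => /negbTE ->. Qed.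

Lemma law_isd S M t L v : law S M t L -> v \in S -> isd (t v).
Proof.
move=> [l0 l1 l2] vS; have := isd_push (fun phi : col => phi v) l0.
by apply: eq_isd => c; rewrite -l2.
Qed.

Lemma law_add S M t L x v (k : C3 -> C3 -> R) :
  (forall x y i j, M x y i j = M y x j i) -> law S M t L -> x \in S -> v \notin S ->
  (forall c, isd (k c)) -> (forall c d, 0 < k c d -> ~~ M x v c d) ->
  (forall y i j, y \in S -> y != x -> ~~ M y v i j) ->
  exists L', law (v |: S) M (upd v (fun d => \sum_c t x c * k c d) t) L'.
Proof.
move=> Ms [l0 l1 l2] xS vS k0 k1 k2; have [L0 _] := l0.
pose st (phi : col) d : col := [ffun u => upd v d phi u].
pose N phi := push (st phi) (k (phi x)).
have N0 phi : isd (N phi) by apply: isd_push.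
have neS y : y \in S -> y != v by move=> yS; apply: contraNneq vS => <-.
exists (bind L N); split; first exact: isd_bind.
  move=> chi /bind_gt0[//|phi psi|phi [Lp /push_gt0[|d [<- kd]]]]; first by case: (N0 phi).
    by case: (k0 (phi x)).
  have o := l1 phi Lp.
  have oy y : y \in S -> ~~ M y v (phi y) d.
    by move=> yS; case: (eqVneq y x) => [->|ne]; [exact: k1|exact: k2].
  move=> y z; rewrite !inE => /orP[/eqP ->|yS] /orP[/eqP ->|zS] n; rewrite !ffunE ?updE.
  - by rewrite eqxx in n.
  - by rewrite updN ?neS // Ms oy.
  - by rewrite updN ?neS // oy.
  - by rewrite !updN ?neS // o.
move=> u c; rewrite !inE pr_bind => /orP[/eqP ->|uS].
  rewrite updE (eq_bigr (fun phi => L phi * k (phi x) c)) => [|phi _]; last first.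
    rewrite pr_push; congr (_ * _); rewrite /pr (big_pred1 c) // => d /=.
    by rewrite !ffunE updE.
  rewrite (partition_big (fun phi : col => phi x) xpredT) //=; apply: eq_bigr => d _.
  by rewrite -l2 // /pr mulr_suml; apply: eq_bigr => phi /eqP ->.
rewrite updN ?neS // -l2 // prE; apply: eq_bigr => phi _; congr (_ * _).
rewrite pr_push.
under eq_pr => d do rewrite ffunE updN ?neS //.
by case: (_ == _); [apply: pr_all|apply: pr_none => //; case: (k0 (phi x))].
Qed.

Lemma law_eq S M t t' L : (forall v c, v \in S -> t v c = t' v c) -> law S M t L -> law S M t' L.
Proof. by move=> h [a d e]; split=> // v c vS; rewrite e // h. Qed.

(* Trees up to paired double edges between vertices of potential 6. *)
Inductive tr m rho : {set T} -> Prop :=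
| tr1 v : tr m rho [set v]
| tr_pair0 x y : x != y -> m x y = 2%N -> rho x = 6%N -> rho y = 6%N -> tr m rho [set y; x]
| tr_add S x v : tr m rho S -> x \in S -> v \notin S -> m x v = 1%N ->
    (forall y, y \in S -> y != x -> m y v = 0%N) -> tr m rho (v |: S)
| tr_addp S x y z : tr m rho S -> x \in S -> y \notin S -> z \notin S -> y != z ->
    m x y = 1%N -> m y z = 2%N -> rho y = 6%N -> rho z = 6%N ->
    (forall u, u \in S -> u != x -> m u y = 0%N) ->
    (forall u, u \in S -> m u z = 0%N) -> tr m rho (z |: (y |: S)).

(** Vertices of potential 6 may take any law with masses between 1/5 and 1/2, which leaves room for
    double edges; the others follow [t0]. *)
Definition good_target rho S t0 t :=
  forall v, v \in S -> [/\ isd (t v), rho v <> 6%N -> t v =1 t0 v,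
    rho v = 6%N -> forall c, 1 / 5 <= t v c & forall c, t v c <= 1 / 2].

Lemma law_point M t v : M v v = M v v -> isd (t v) -> exists L, law [set v] M t L.
Proof.
move=> _ tv; exists (push (fun c => [ffun _ => c] : col) (t v)); split.
- exact: isd_push.
- by move=> phi _ y z; rewrite !inE => /eqP -> /eqP ->; rewrite eqxx.
move=> u c; rewrite inE => /eqP ->; rewrite pr_push /pr (big_pred1 c) // => d /=.
by rewrite ffunE.
Qed.

Lemma uniform3 : isd (fun _ : C3 => 1 / 3 : R).
Proof. by split=> [c|]; rewrite ?sum3 ?divr_ge0 //; field. Qed.

Lemma law_double S M t L x v m : cov (v |: S) m M -> law S M t L -> x \in S -> v \notin S ->
  m x v = 2%N -> (forall y, y \in S -> y != x -> m y v = 0%N) ->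
  (forall f g : {ffun C3 -> C3}, injective f -> injective g -> (forall i j, M x v i j -> j = f i \/ j = g i) ->
    exists L', law (v |: S) M (upd v (fun d => \sum_c t x c * free_choice R f g c d) t) L') .
Proof.
move=> cV lw xS vS m2 m0 f g fi gi h; apply: (law_add (x := x) cV.1 lw xS vS).
- by move=> c; exact: isd_free_choice.
- move=> c d; apply: contraTN => /h [->|->]; rewrite /free_choice eqxx ?orbT ltxx //.
move=> y i j yS n; apply: (cov0 _ _ cV); rewrite ?inE ?eqxx ?yS ?orbT ?m0 //.
by apply: contraNneq vS => <-.
Qed.

Lemma law_couple S M t L x v m (a : C3 -> R) : cov (v |: S) m M -> law S M t L -> x \in S -> v \notin S ->
  m x v = 1%N -> (forall y, y \in S -> y != x -> m y v = 0%N) ->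
  isd a -> (forall c d, t x c + a d <= 1) ->
  exists L', law (v |: S) M (upd v a t) L'.
Proof.
move=> cV lw xS vS m1 m0 da le.
have nxv : x != v by apply: contraNneq vS => <-.
have [f [fi h]] := cov1 cV (setU1r v xS) (setU11 v S) nxv m1.
have [k [k0 k1 k2]] := coupling fi (law_isd lw xS) da (fun c => le c (f c)).
have q1 c d : 0 < k c d -> ~~ M x v c d by apply: contraTN => /h ->; rewrite k1 ltxx.
have q2 y i j : y \in S -> y != x -> ~~ M y v i j.
  move=> yS n; apply: (cov0 _ _ cV); rewrite ?inE ?eqxx ?yS ?orbT ?m0 //.
  by apply: contraNneq vS => <-.
have [L' l'] := law_add cV.1 lw xS vS k0 q1 q2.
by exists L'; apply: law_eq l' => u c _; rewrite /upd; case: ifP => _.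
Qed.

(** Two laws bounded by 1/2 can always be coupled along a single edge, so the tree is built step by
    step. A double edge takes the laws of [double_target], and therefore its ends need potential
    6. *)
Lemma tr_law m rho S : tr m rho S -> forall M t0, cov S m M ->
  (forall v, v \in S -> rho v <> 6%N -> isd (t0 v) /\ forall c, t0 v c <= 1 / 2) ->
  exists t L, law S M t L /\ good_target rho S t0 t.
Proof.
pose sel (t0 : T -> C3 -> R) (v : T) : C3 -> R := if rho v == 6%N then (fun _ => 1 / 3) else t0 v.
have selP (t0 : T -> C3 -> R) v : (rho v <> 6%N -> isd (t0 v) /\ forall c, t0 v c <= 1 / 2) ->
  [/\ isd (sel t0 v), rho v <> 6%N -> sel t0 v =1 t0 v, rho v = 6%N -> forall c, 1 / 5 <= sel t0 v c & forall c, sel t0 v c <= 1 / 2].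
  rewrite /sel; case: eqP => [e _|n /(_ n) [a h]]; split=> //; try exact: uniform3; move=> *; lra.
elim=> [v|x y nxy m2 x6 y6|{}S x v trS IH xS vS m1 m0|{}S x y z trS IH xS yS zS nyz m1 m2 y6 z6 m0 m0'] M t0 cV h.
- have sv := selP t0 v (h v (set11 v)); have [|L l] := @law_point M (sel t0) v (erefl _); first by case: sv.
  by exists (sel t0), L; split=> // u; rewrite inE => /eqP ->.
- have [f [g [fi gi hM]]] := cov2 cV (setU1r y (set11 x)) (setU11 y _) nxy m2.
  have [mu [mu1 mu2 mu3]] := double_target R fi gi.
  have [L l] := @law_point M (fun _ => mu) x (erefl _) mu1.
  have yx : y \notin [set x] by rewrite inE eq_sym.
  have m0 u : u \in [set x] -> u != x -> m u y = 0%N by rewrite inE => ->.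
  have [L' l'] := law_double cV l (set11 x) yx m2 m0 fi gi hM.
  exists (upd y (fun d => \sum_c mu c * free_choice R f g c d) (fun _ => mu)), L'; split=> // u.
  rewrite !inE => /orP[] /eqP ->.
  + rewrite updE y6; split=> // [|_ c|c]; try by case/andP: (mu3 c).
    by have := law_isd l' (setU11 y _); rewrite updE.
  + by rewrite updN // x6; split=> // [_ c|c]; case/andP: (mu2 c).
- have cS := covS cV (subsetUr _ _) (fun x y _ _ => leqnn _).
  have [|t [L [l g]]] := IH M t0 cS.
    by move=> u uS; apply: h; rewrite inE uS orbT.
  have [s1 s2 s3 s4] := selP t0 v (h v (setU11 v S)).
  have le c d : t x c + sel t0 v d <= 1 by have [_ _ _ /(_ c)] := g x xS; have := s4 d; lra.
  have [L' l'] := law_couple cV l xS vS m1 m0 s1 le.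
  exists (upd v (sel t0 v) t), L'; split=> // u; rewrite inE inE => /orP[/eqP ->|uS]; first by rewrite updE.
  by rewrite updN; [exact: g|apply: contraNneq vS => <-].
- have sS : S \subset z |: (y |: S) by rewrite setUA subsetUr.
  have cS := covS cV sS (fun x y _ _ => leqnn _).
  have cy := covS cV (subsetUr _ _) (fun x y _ _ => leqnn _).
  have [|t [L [l g]]] := IH M t0 cS.
    by move=> u uS; apply: h; rewrite !inE uS !orbT.
  have zyS : z \notin y |: S by rewrite !inE negb_or eq_sym nyz.
  have [f [g' [fi gi hM]]] := cov2 cV (setU1r z (setU11 y S)) (setU11 z _) nyz m2.
  have [mu [mu1 mu2 mu3]] := double_target R fi gi.
  have le c d : t x c + mu d <= 1 by have [_ _ _ /(_ c)] := g x xS; case/andP: (mu2 d); lra.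
  have [L1 l1] := law_couple cy l xS yS m1 m0 mu1 le.
  have m0z u : u \in y |: S -> u != y -> m u z = 0%N.
    by rewrite !inE => /orP[/eqP ->|/m0' -> //]; rewrite eqxx.
  have [L2 l2] := law_double cV l1 (setU11 y S) zyS m2 m0z fi gi hM.
  exists (upd z (fun d => \sum_c mu c * free_choice R f g' c d) (upd y mu t)), L2; split.
    by apply: law_eq l2 => u c _; rewrite /upd; case: ifP => // _; rewrite eqxx.
  have neS u w : w \notin S -> u \in S -> u != w by move=> wS uS; apply: contraNneq wS => <-.
  have i2 := law_isd l2 (setU11 z _); rewrite updE updE in i2.
  move=> u; rewrite !inE => /orP[/eqP ->|/orP[/eqP ->|uS]].
  + by rewrite updE z6; split=> // [_ c|c]; case/andP: (mu3 c).
  + by rewrite updN // updE y6; split=> // [_ c|c]; case/andP: (mu2 c).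
  + by rewrite !updN ?neS //; exact: g.
Qed.

(** The law used for a 3-vertex once its missing color [a] is known. A missing color has masses at
    most 3/5, so on average each color gets at least 1/5. *)
Definition off (a c : C3) : R := if c == a then 0 else 1 / 2.

Lemma off_isd a : isd (off a).
Proof. by split=> [c|]; rewrite /off ?sum3; [case: ifP => //; lra|case: a => [[]|] /=; lra]. Qed.

Lemma p4_isd a : isd (p4 R a).
Proof. by split=> [c|]; rewrite /p4 ?sum3; [case: ifP; lra|case: a => [[]|] /=; lra]. Qed.

Lemma p4_bd a c : 3 / 10 <= p4 R a c <= 2 / 5.
Proof. by rewrite /p4; case: ifP => _; lra. Qed.

Lemma off_avg (Om : finType) (P : Om -> R) (mu : Om -> C3) d : isd P ->
  (forall c, 1 / 5 <= pr P (fun w => mu w == c)) -> 1 / 5 <= \sum_w P w * off (mu w) d.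
Proof.
move=> dP q.
have -> : \sum_w P w * off (mu w) d = 1 / 2 * (1 - pr P (fun w => mu w == d)).
  rewrite -prC // prE mulr_sumr; apply: eq_bigr => w _; rewrite /off eq_sym /=.
  by case: (_ == _) => /=; ring.
suff : pr P (fun w => mu w == d) <= 3 / 5 by lra.
have : \sum_c pr P (fun w => mu w == c) = 1.
  by rewrite -(pr_partition P xpredT mu) pr_all.
by rewrite sum3; have := (q None, q (Some true), q (Some false)); case=> [[q1 q2] q3]; case: d => [[]|]; lra.
Qed.

(** For each outcome the targets [off] and [p4] are bounded by 1/2, so [tr_law] applies to every
    outcome separately. *)
Lemma tr_flex m rho S : tr m rho S -> (forall v, v \in S -> rho v \in [:: 3; 4; 6]%N) -> flex R S m rho.
Proof.
move=> trS r3 M b Om P mu cV dP ad.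
pose t0 w v := if rho v == 3%N then off (mu w v) else p4 R (b v).
have ex w : exists q : (T -> C3 -> R) * (col -> R), law S M q.1 q.2 /\ good_target rho S (t0 w) q.1.
  have [|t [L h]] := tr_law trS (t0 := t0 w) cV; last by exists (t, L).
  move=> v vS n6; rewrite /t0; case: eqP => _.
    by split=> [|c]; [exact: off_isd|rewrite /off; case: ifP; lra].
  by split=> [|c]; [exact: p4_isd|case/andP: (p4_bd (b v) c); lra].
have [F FP] := fin_all_exists ex.
exists (fun w => (F w).2); split=> [w|w phi _ Lp|v vS].
- by case: (FP w) => [[]].
- have [[l0 l1 l2] g] := FP w; split; first exact: l1.
  move=> v vS v3; apply/eqP => ph; have [_ t1 _ _] := g v vS.
  have : pr (F w).2 (fun phi => phi v == mu w v) = 0.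
    by rewrite l2 // t1 ?v3 // /t0 v3 /off !eqxx.
  have [L0 _] := l0.
  apply/eqP; rewrite gt_eqF // (lt_le_trans Lp) // /pr (bigD1 phi) /= ?ph ?eqxx // lerDl.
  exact: sumr_ge0.
have mE c : pr (bind P (fun w => (F w).2)) (fun phi => phi v == c) = \sum_w P w * (F w).1 v c.
  by rewrite pr_bind; apply: eq_bigr => w _; case: (FP w) => [[_ _ ->]].
have tE w : rho v <> 6%N -> (F w).1 v =1 t0 w v by move=> n; case: (FP w) => _ g; case: (g v vS) => _ /(_ n).
have [P0 P1] := dP.
have := r3 v vS; rewrite !inE => /or3P[] /eqP rv; (split=> [c|]; first rewrite mE); rewrite ?rv //.
- under eq_bigr => w _ do rewrite tE ?rv // /t0 rv.
  by apply: (off_avg (mu := fun w => mu w v)) => // d; apply: ad.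
- under eq_bigr => w _ do rewrite tE ?rv // /t0 rv /=.
  by rewrite -mulr_suml P1 mul1r; case/andP: (p4_bd (b v) c); lra.
- move=> _ c; rewrite mE; under eq_bigr => w _ do rewrite tE ?rv // /t0 rv /=.
  by rewrite -mulr_suml P1 mul1r.
- rewrite -[X in X <= _]mul1r -[X in X * _]P1 mulr_suml; apply: ler_sum => w _; apply: ler_wpM2l => //.
  by case: (FP w) => _ g; have [_ _ /(_ rv) h _] := g v vS; exact: h.
Qed.

End Trees.

(** * Attaching a part along an edge or a double edge *)

Section Attachments.
Variables (R : realFieldType) (T : finType).
Notation col := {ffun T -> C3}.
Implicit Types (U V W S : {set T}) (m : T -> T -> nat) (rho : T -> nat)
  (M : T -> T -> C3 -> C3 -> bool) (b : T -> C3).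

Lemma isd_marg (L : col -> R) v : isd L -> isd (fun c => pr L (fun phi => phi v == c)).
Proof. by move=> l; apply: eq_isd (isd_push (fun phi : col => phi v) l). Qed.

Lemma le35 (a : C3 -> R) : isd a -> (forall c, 1 / 5 <= a c) -> forall c, a c <= 3 / 5.
Proof.
move=> [_]; rewrite sum3 => e h c; have := (h None, h (Some true), h (Some false)).
by case=> [[h1 h2] h3]; case: c => [[]|]; lra.
Qed.

Lemma solves_isd U M rho b (Om : finType) (P : Om -> R) mu K : isd P -> solves U M rho b P mu K -> isd (bind P K).
Proof. by move=> dP [k0 _ _]; apply: isd_bind. Qed.

(** Only the colors of [x] and [u] interact, so it suffices to couple these two; [retarget] carries
    the coupling over to the law [L] on [W]. *)
Lemma glue_edge U W M rho b (Om : finType) (P : Om -> R) mu K m x u L :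
  cov (U :|: W) m M -> isd P -> [disjoint U & W] -> solves U M rho b P mu K ->
  (forall v, v \in W -> rho v != 3%N) -> x \in U -> u \in W -> m x u = 1%N ->
  (forall y z, y \in U -> z \in W -> (y != x) || (z != u) -> m y z = 0%N) ->
  good W M rho b L ->
  (forall c d, pr (bind P K) (fun phi => phi x == c) + pr L (fun phi => phi u == d) <= 1) ->
  exists K', solves (U :|: W) M rho b P mu K'.
Proof.
move=> cV dP dUW s1 n3 xU uW m1 m0 [l0 l1 l2] le.
have neq y z : y \in U -> z \in W -> y != z.
  by move=> yU; apply: contraTneq => <-; rewrite (disjointFr dUW yU).
have inU y : y \in U -> y \in U :|: W by rewrite inE => ->.
have inW y : y \in W -> y \in U :|: W by rewrite inE orbC => ->.
have [f [fi hM]] := cov1 cV (inU _ xU) (inW _ uW) (neq _ _ xU uW) m1.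
have [k [k0 k1 k2]] := coupling fi (isd_marg x (solves_isd dP s1)) (isd_marg u l0) (fun c => le c (f c)).
have pos d : 0 < pr L (fun phi => phi u == d).
  by have [/(_ d) h _] := l2 u uW; apply: lt_le_trans h; rewrite divr_gt0.
have zero y z : y \in U -> z \in W -> y != x -> m y z = 0%N by move=> yU zW n; apply: m0 => //; rewrite n.
apply: (attach (La := retarget L u k) cV dP dUW s1 n3 xU zero).
- by move=> c; exact: retarget_isd.
- move=> c psi /(retarget_gt0 l0 pos (k0 c)) [/l1 o kp]; split=> // z zW.
  case: (eqVneq z u) => [->|n]; first by apply: contraTN kp => /hM ->; rewrite k1 ltxx.
  by apply: (cov0 _ _ cV (inU _ xU) (inW _ zW) (neq _ _ xU zW)); apply: m0; rewrite ?n ?orbT.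
apply: eq_marg l2 => psi; rewrite (retarget_avg psi pos) //.
Qed.

Lemma attach_double U M rho b (Om : finType) (P : Om -> R) mu K m x z (f g : C3 -> C3) :
  cov (z |: U) m M -> isd P -> z \notin U -> solves U M rho b P mu K ->
  rho z = 6%N -> x \in U -> m x z = 2%N -> (forall y, y \in U -> y != x -> m y z = 0%N) ->
  injective f -> injective g -> (forall i j, M x z i j -> j = f i \/ j = g i) ->
  (forall c, special f g c -> 2 / 5 <= pr (bind P K) (fun phi => phi x == c)) ->
  exists K', solves (z |: U) M rho b P mu K'.
Proof.
rewrite setUC => cV dP zU s1 z6 xU m2 m0 fi gi hM sp.
have neq y : y \in U -> y != z by move=> yU; apply: contraNneq zU => <-.
have inU y : y \in U -> y \in U :|: [set z] by rewrite inE => ->.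
have inW : z \in U :|: [set z] by rewrite !inE eqxx orbT.
have dUz : [disjoint U & [set z]] by rewrite disjoint_sym disjoints1.
have dK := solves_isd dP s1; have [_ _ k2] := s1.
have n3 v : v \in [set z] -> rho v != 3%N by rewrite inE => /eqP ->; rewrite z6.
have zero y v : y \in U -> v \in [set z] -> y != x -> m y v = 0%N by move=> yU; rewrite inE => /eqP ->; apply: m0.
apply: (attach (La := fun c => push (fun d => [ffun _ => d] : col) (free_choice R f g c)) cV dP dUz s1 n3 xU zero).
- by move=> c; apply: isd_push; apply: isd_free_choice.
- move=> c psi /push_gt0[|d [<- kd]]; first by case: (isd_free_choice R f g c).
  split=> [y v|v]; rewrite !inE => /eqP ->; first by move=> /eqP ->; rewrite eqxx.
  by rewrite ffunE; apply: contraTN kd => /hM [->|->]; rewrite /free_choice eqxx ?orbT ltxx.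
move=> v; rewrite inE => /eqP ->; split=> [d|]; last by rewrite z6.
have fl := free_choice_lb fi gi (isd_marg x dK) (fun c => proj1 (k2 x xU) c) sp d.
apply: le_trans fl _; rewrite /pr exchange_big /=; apply: ler_sum => c _.
rewrite -mulr_sumr; apply: ler_wpM2l; first by apply: pr_ge0; case: dK.
rewrite -[X in _ <= X]/(pr (push _ _) _) pr_push /pr (big_pred1 d) // => e /=; by rewrite ffunE.
Qed.

Lemma special_uniq (f g : C3 -> C3) c d : injective f -> injective g -> special f g c -> special f g d -> c = d.
Proof.
move=> /inj3 [f1 f2 f3] /inj3 [g1 g2 g3]; rewrite /special.
by move: c d => [[]|] [[]|] // /andP[/eqP h n] /andP[/eqP h' _]; move: n f1 f2 f3 g1 g2 g3; rewrite h h' !eqxx /=;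
  do ?[case: (f _) => [[]|]]; do ?[case: (g _) => [[]|]].
Qed.

(** The color to be given mass 2/5 at a double edge; by [special_uniq] one color suffices, and
    [None] is the default if no color is special. *)
Definition sp_color (f g : C3 -> C3) : C3 := odflt None [pick c | special f g c].

Lemma sp_colorE (f g : C3 -> C3) c : injective f -> injective g -> special f g c -> c = sp_color f g.
Proof.
move=> fi gi h; rewrite /sp_color; case: pickP => [d /(special_uniq fi gi h)//|/(_ c)].
by rewrite h.
Qed.

(* The single 3-vertex [y] of a graph can be colored with the law of a 4-vertex,
   coupled with its missing color. *)
Lemma couple_missing U M rho b (Om : finType) (P : Om -> R) mu y (L : col -> R) m :
  cov U m M -> isd P -> y \in U -> rho y = 3%N -> adm U rho P mu ->
  (forall v, v \in U -> v != y -> rho v != 3%N) -> good U M (upd y 4%N rho) b L ->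
  exists K, solves U M rho b P mu K /\ forall c, pr (bind P K) (fun phi => phi y == c) = p4 R (b y) c.
Proof.
move=> cV dP yU y3 ad n3 [l0 l1 l2].
pose q c := pr P (fun w => mu w y == c).
have dq : isd q by exact: (eq_isd _ (isd_push (fun w => mu w y) dP)).
have [y1 y2] := l2 y yU; have {}y2 := y2 (updE _ _ _).
have [|k [k0 k1 k2]] := coupling (a := q) (b := p4 R (b y)) (f := id) (fun _ _ => id) dq (p4_isd R _).
  by move=> c; have := le35 dq (fun c => ad y yU y3 c) c; case/andP: (p4_bd R (b y) c); lra.
have pos d : 0 < pr L (fun phi => phi y == d).
  by rewrite y2; case/andP: (p4_bd R (b y) d); lra.
have av psi : bind P (fun w => retarget L y k (mu w y)) psi = L psi.
  rewrite -(retarget_avg (mu := q) (k := k) psi pos) => [|d]; last by rewrite k2 y2.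
  rewrite /bind (partition_big (fun w => mu w y) xpredT) //=; apply: eq_bigr => c _.
  by rewrite /q /pr mulr_suml; apply: eq_bigr => w /eqP ->.
exists (fun w => retarget L y k (mu w y)); split; last by move=> c; rewrite -y2; apply: eq_pr_fun.
split=> [w|w phi Pw|].
- exact: retarget_isd.
- move=> /(retarget_gt0 l0 pos (k0 _)) [/l1 o kp]; split=> // v vU v3.
  case: (eqVneq v y) => [->|n]; last by have := n3 v vU n; rewrite v3.
  by apply: contraTneq kp => ->; rewrite k1 ltxx.
apply: (eq_marg (L := L)) => [psi|v vU]; first by rewrite av.
have [a e] := l2 v vU; split=> // v4; apply: e; rewrite updN //.
by apply: contraTneq (eqxx 4%N) => e; rewrite -{1}v4 e y3.
Qed.

End Attachments.

(** [a * (N + 1) - x] encodes the order by potential [a] with ties broken by larger size [x]: sizes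
    are at most [N], so a difference of potential outweighs them. *)
Lemma lex_le (a b : int) (x y N : nat) : a * N.+1%:Z - x%:Z <= b * N.+1%:Z - y%:Z ->
  (x <= N)%N -> a <= b.
Proof. by move=> h le; rewrite leNgt; apply/negP => lt; have : (b + 1) * N.+1%:Z <= a * N.+1%:Z by [rewrite ler_pM2r //; lia]; lia. Qed.

Lemma lex_lt (a b : int) (x y N : nat) : a * N.+1%:Z - x%:Z <= b * N.+1%:Z - y%:Z ->
  (x < y)%N -> a + 1 <= b.
Proof. by move=> h le; rewrite leNgt; apply/negP => lt; have : b * N.+1%:Z <= a * N.+1%:Z by [rewrite ler_pM2r //; lia]; lia. Qed.

(** * Potential and criticality *)

Section Potential.
Variable (T : finType).
Implicit Types (A B C U V W S : {set T}) (m : T -> T -> nat) (rho : T -> nat).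

Definition gr m := (forall x y, m x y = m y x) /\ forall x, m x x = 0%N.
(* Edges inside [A :&: B] are counted twice. *)
Definition ed m A B : nat := (\sum_(x in A) \sum_(y in B) m x y)%N.
(** [ed m A A] counts each edge twice, so the factor 2 amounts to 4 per edge. *)
Definition pot m rho A : int := \sum_(v in A) (rho v)%:Z - 2 * (ed m A A)%:Z.
Definition valid rho := forall v : T, rho v \in [:: 3; 4; 6]%N.

Lemma big_setUd (X : Type) (idx : X) (op : Monoid.com_law idx) A B (F : T -> X) : [disjoint A & B] ->
  \big[op/idx]_(x in A :|: B) F x = op (\big[op/idx]_(x in A) F x) (\big[op/idx]_(x in B) F x).
Proof. by move=> d; rewrite -bigU //; apply: eq_bigl => x; rewrite !inE. Qed.

Lemma edC m A B : gr m -> ed m A B = ed m B A.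
Proof. by move=> [s _]; rewrite /ed exchange_big; apply: eq_bigr => y _; apply: eq_bigr => x _. Qed.

Lemma edUl m A B C : [disjoint A & B] -> ed m (A :|: B) C = (ed m A C + ed m B C)%N.
Proof. by move=> d; rewrite /ed big_setUd. Qed.

Lemma edUr m A B C : [disjoint A & B] -> ed m C (A :|: B) = (ed m C A + ed m C B)%N.
Proof.
move=> d; rewrite /ed -big_split /=; apply: eq_bigr => x _.
by rewrite big_setUd.
Qed.

Lemma ed1l m x B : ed m [set x] B = (\sum_(y in B) m x y)%N.
Proof. by rewrite /ed big_set1. Qed.

Lemma ed11 m x y : ed m [set x] [set y] = m x y.
Proof. by rewrite ed1l big_set1. Qed.

Lemma ed_sum m A B : ed m A B = (\sum_(x in A) ed m [set x] B)%N.
Proof. by apply: eq_bigr => x _; rewrite ed1l. Qed.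

Lemma ed0r m A : ed m A set0 = 0%N.
Proof. by rewrite /ed big1 // => x _; rewrite big_set0. Qed.

Lemma edS m A A' B B' : A \subset A' -> B \subset B' -> (ed m A B <= ed m A' B')%N.
Proof.
move=> sA sB; rewrite -(setID A' A) (setIidPr sA) edUl; last first.
  by rewrite disjoint_sym disjoints_subset subsetDr.
apply: leq_trans (leq_addr _ _).
rewrite -(setID B' B) (setIidPr sB) edUr ?leq_addr //.
by rewrite disjoint_sym disjoints_subset subsetDr.
Qed.

Lemma ed_le m A B x y : x \in A -> y \in B -> (m x y <= ed m A B)%N.
Proof. by rewrite -!sub1set -ed11; apply: edS. Qed.

Lemma ed_gt0 m A B : (0 < ed m A B)%N -> exists x y, [/\ x \in A, y \in B & (0 < m x y)%N].
Proof.
rewrite lt0n => h; apply: NNPP => n; move/eqP: h; apply; rewrite /ed big1 // => x xA.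
rewrite big1 // => y yB; apply/eqP; rewrite -leqn0 leqNgt; apply/negP => p.
by apply: n; exists x, y.
Qed.

Lemma ed_eq0 m A B x y : ed m A B = 0%N -> x \in A -> y \in B -> m x y = 0%N.
Proof. by move=> e xA yB; apply/eqP; rewrite -leqn0 -e ed_le. Qed.

Lemma ed_eq1 m v A : ed m [set v] A = 1%N ->
  exists x, [/\ x \in A, m v x = 1%N & forall y, y \in A -> y != x -> m v y = 0%N].
Proof.
move=> e; have [|u [x [+ xA p]]] := @ed_gt0 m [set v] A; first by rewrite e.
rewrite inE => /eqP eu; rewrite {u}eu in p; exists x; move: e; rewrite ed1l (bigD1 x) //= => e.
split=> // [|y yA n]; first by lia.
have : (\sum_(i in A | i != x) m v i = 0)%N by lia.
by move/eqP; rewrite sum_nat_eq0 => /forallP/(_ y); rewrite yA n => /eqP.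
Qed.

Lemma potU m rho A B : gr m -> [disjoint A & B] ->
  pot m rho (A :|: B) = pot m rho A + pot m rho B - 4 * (ed m A B)%:Z.
Proof.
move=> g d; rewrite /pot edUl // !edUr // (edC B A g) big_setUd //=.
by rewrite !PoszD; ring.
Qed.

Lemma pot1 m rho v : gr m -> pot m rho [set v] = rho v.
Proof. by move=> [_ g]; rewrite /pot big_set1 ed11 g; lia. Qed.

Lemma pot_upd m rho W y r : y \in W -> pot m (upd y r rho) W = pot m rho W + r%:Z - (rho y)%:Z.
Proof.
move=> yW; rewrite /pot (bigD1 y) //= updE [in RHS](bigD1 y) //=.
rewrite (eq_bigr (fun v => (rho v)%:Z)) => [|v /andP[_ n]]; last by rewrite updN.
lia.
Qed.

Lemma pot2 m rho x y : gr m -> x != y -> pot m rho [set x; y] = (rho x)%:Z + (rho y)%:Z - 4 * (m x y)%:Z.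
Proof. by move=> g n; rewrite potU ?disjoints1 ?inE // !pot1 // ed11. Qed.

End Potential.

Section Critical.
Variables (R : realFieldType) (T : finType).
Notation col := {ffun T -> C3}.
Implicit Types (A B C U V W S : {set T}) (m : T -> T -> nat) (rho : T -> nat)
  (M : T -> T -> C3 -> C3 -> bool) (b : T -> C3).

Definition crit U m rho := ~ flex R U m rho /\
  forall U' m', gr m' -> U' \subset U -> (forall x y, x \in U' -> y \in U' -> m' x y <= m x y)%N ->
    (U' <> U \/ exists x y, [/\ x \in U', y \in U' & (m' x y < m x y)%N]) -> flex R U' m' rho.

Definition neck U m := exists h (f : 'I_(h.*2.+1) -> T),
  [/\ (0 < h)%N, injective f, U = f @: setT & forall i j, m (f i) (f j) = I_mult i j].

Definition C2 U m rho := exists x y, [/\ x != y, U = [set x; y], m x y = 2%N, rho x = 6%N & rho y = 4%N].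

Definition concl U m rho :=
  pot m rho U <= 0 \/ C2 U m rho \/ neck U m /\ forall v, v \in U -> rho v = 6%N.

(** Lexicographic in the size and the number of 3-vertices. The second entry is there because a
    3-vertex will be raised to a 4-vertex on the same vertex set. *)
Definition meas U rho := (#|U| * #|T|.+1 + #|[set v in U | rho v == 3%N]|)%N.

Definition IHyp n := forall U m rho, gr m -> valid rho -> crit U m rho ->
  (meas U rho < n)%N -> concl U m rho.

Lemma meas_sub U W rho rho' : W \proper U -> (meas W rho' < meas U rho)%N.
Proof.
move=> /proper_card h; rewrite /meas.
have : (#|[set v in W | rho' v == 3%N]| <= #|T|)%N by exact: max_card.
nia.
Qed.

Lemma flex0 m rho : flex R set0 m rho.
Proof.
move=> M b Om P mu cV dP ad; exists (fun _ phi => (phi == [ffun _ => None])%:R); split=> [w|w phi _ _|v].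
- exact: isd_point.
- by split=> [x y|v]; rewrite inE.
- by rewrite inE.
Qed.

Lemma nonflex_crit U m rho : gr m -> ~ flex R U m rho ->
  exists W m', [/\ gr m', W \subset U, forall x y, x \in W -> y \in W -> (m' x y <= m x y)%N & crit W m' rho].
Proof.
have [n] := ubnP (#|U| + ed m U U)%N; elim: n U m => // n IH U m le g nf.
case: (classic (crit U m rho)) => [c|nc]; first by exists U, m.
have [W [m' [g' s le' [ne nf']]]] : exists W m', [/\ gr m', W \subset U, forall x y, x \in W -> y \in W -> (m' x y <= m x y)%N &
   (W <> U \/ exists x y, [/\ x \in W, y \in W & (m' x y < m x y)%N]) /\ ~ flex R W m' rho].
  apply: NNPP => h; apply: nc; split=> // W m' g' s le' ne; apply: NNPP => nf'; apply: h.
  by exists W, m'.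
have leW : (ed m' W W <= ed m W W)%N.
  by apply: leq_sum => x xW; apply: leq_sum => y yW; apply: le'.
have leU := edS m s s.
have lt : (#|W| + ed m' W W < n)%N.
  case: ne => [ne|[x [y [xW yW lt]]]].
    have : (#|W| < #|U|)%N by apply: proper_card; rewrite properEneq s andbT; apply/eqP.
    lia.
  have : (#|W| <= #|U|)%N by exact: subset_leq_card.
  suff : (ed m' W W < ed m W W)%N by lia.
  rewrite /ed (bigD1 x) //= [X in (_ < X)%N](bigD1 x) //= -addSn; apply: leq_add; last first.
    by apply: leq_sum => z /andP[zW _]; apply: leq_sum => u uW; apply: le'.
  rewrite (bigD1 y) //= [X in (_ < X)%N](bigD1 y) //= -addSn; apply: leq_add => //.
  by apply: leq_sum => u /andP[uW _]; apply: le'.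
have [W2 [m2 [g2 s2 le2 c2]]] := IH W m' lt g' nf'.
exists W2, m2; split=> //; first exact: subset_trans s2 s.
move=> x y xW yW; apply: leq_trans (le2 x y xW yW) (le' _ _ _ _); exact: (subsetP s2).
Qed.

(** The form in which the induction is used: a minimal nonflexible subgraph of [S] is critical. It
    may have fewer edges than [m] on [W], which only lowers the potential; a pair of potentials 6
    and 4 with more than two edges has potential at most -2. Of a necklace only the potentials 6 are
    recorded. *)
Lemma nonflex_pot n S m rho : IHyp n -> gr m -> valid rho -> (meas S rho < n)%N -> ~ flex R S m rho ->
  exists W, [/\ W \subset S, W != set0, ~ flex R W m rho &
   pot m rho W <= 0 \/ (C2 W m rho \/ forall v, v \in W -> rho v = 6%N)].
Proof.
move=> ih g va lt nf; have [W [m' [g' s le c]]] := nonflex_crit g nf.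
have lt' : (meas W rho < n)%N.
  by case: (eqVproper s) => [->//|p]; apply: ltn_trans lt; apply: meas_sub.
have nfW : ~ flex R W m rho by move=> f; apply: (proj1 c); apply: flex_sub f.
have leW : (ed m' W W <= ed m W W)%N.
  by apply: leq_sum => x xW; apply: leq_sum => y yW; apply: le.
exists W; split=> //; first by apply: contra_notN nfW => /eqP ->; exact: flex0.
case: (ih W m' rho g' va c lt') => [p|[[x [y [n' eW e r6 r4]]]|[_ h]]]; last by right; right.
  by left; apply: le_trans p; rewrite /pot; lia.
have m2 : (2 <= m x y)%N by rewrite -e; apply: le; rewrite eW !inE eqxx ?orbT.
case: (eqVneq (m x y) 2%N) => [e2|ne]; first by right; left; exists x, y.
by left; rewrite eW pot2 // r6 r4; lia.
Qed.

Section Fixed.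
Variables (V : {set T}) (m : T -> T -> nat) (rho : T -> nat).
Hypotheses (gm : gr m) (va : valid rho) (cr : crit V m rho) (ih : IHyp (meas V rho)) (potV : 0 < pot m rho V).

Lemma sub_flex W : W \proper V -> flex R W m rho.
Proof.
move=> /andP[s /negP n]; apply: (proj2 cr) => //; left => e; apply: n; by rewrite e.
Qed.

Lemma sub_flex' W rho' : W \proper V -> (forall v, v \in W -> rho v = rho' v) -> flex R W m rho'.
Proof. by move=> p e; apply: flex_mono (sub_flex p) => v /e ->; left. Qed.

Lemma r346 v : rho v = 3%N \/ rho v = 4%N \/ rho v = 6%N.
Proof. by have := va v; rewrite !inE => /or3P[] /eqP ->; auto. Qed.

(** Masses at most 2/5 at the 4-vertex and at most 3/5 at its neighbor satisfy the coupling
    condition. *)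
Lemma leaf4_flex v x : v \in V -> rho v = 4%N -> x \in V :\ v -> m x v = 1%N ->
  (forall y, y \in V :\ v -> y != x -> m y v = 0%N) -> flex R V m rho.
Proof.
move=> vV v4 xV m1 m0 M b Om P mu cV dP ad.
have pV : V :\ v \proper V by exact: properD1.
have eV : (V :\ v) :|: [set v] = V by rewrite setUC setD1K.
have ad' : adm (V :\ v) rho P mu by move=> u; rewrite !inE => /andP[_ uV]; apply: ad.
have cA : cov (V :\ v) m M by apply: covS cV (proper_sub pV) _ => *.
have [K s1] := sub_flex pV b cA dP ad'.
have [k0 k1 k2] := s1; have dK := solves_isd dP s1.
have [L [l0 l1 l2]] := @law_point R T M (fun u => p4 R (b u)) v (erefl _) (p4_isd R _).
rewrite -eV; apply: (glue_edge (u := v) (L := L) (m := m) _ dP _ s1 _ xV) => //.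
- by rewrite eV.
- by rewrite disjoint_sym disjoints1 !inE eqxx.
- by move=> u; rewrite inE => /eqP ->; rewrite v4.
- by rewrite inE.
- move=> y z yV; rewrite inE => /eqP -> /orP[n|]; last by rewrite eqxx.
  exact: m0.
- split=> // u; rewrite inE => /eqP ->; split=> [c|_ c]; rewrite l2 ?inE //.
  by case/andP: (p4_bd R (b v) c); lra.
- move=> c d; rewrite l2 ?inE //; case/andP: (p4_bd R (b v) d).
  have [/(fun f => le35 (isd_marg x dK) f c) /= + _] := k2 x xV; lra.
Qed.

(** Take [B] of least potential and, among those, largest. Coloring [B] first turns each 6-vertex
    with an edge to [B] into a 3-vertex. If the rest were not flexible, it would contain [W] of new
    potential at most 0; joining [W] to [B] recovers 3 and pays 4 for each edge, so [B] would not be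
    minimal. *)
Lemma gap A : A \proper V -> A != set0 -> pot m rho V + 1 <= pot m rho A.
Proof.
move=> pA nA; rewrite leNgt; apply/negP => lt.
pose F B : int := pot m rho B * #|T|.+1%:Z - #|B|%:Z.
pose Q B := (B \proper V) && (B != set0).
have QA : Q A by rewrite /Q pA.
case: (arg_minP F QA) => B /andP[pB nB] minB.
have [sB _] := andP pB.
have potB : pot m rho B <= pot m rho V.
  by have := lex_le (minB A QA) (max_card _); lia.
have grow C : C \proper V -> B \proper C -> pot m rho B + 1 <= pot m rho C.
  move=> pC BC; have QC : Q C by rewrite /Q pC -card_gt0 (leq_ltn_trans _ (proper_card BC)).
  exact: lex_lt (minB C QC) (proper_card BC).
have add W : W \subset V -> [disjoint B & W] -> W != set0 ->
    pot m rho B + 1 <= pot m rho (B :|: W) \/ (B :|: W = V /\ pot m rho B <= pot m rho V).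
  move=> sW dW nW; have sU : B :|: W \subset V by rewrite subUset sB.
  case: (eqVproper sU) => [e|p]; [by right|left; apply: grow => //].
  rewrite properE subsetUl /= subUset subxx /=; apply/negP => WB.
  by move: dW; rewrite disjoint_sym => /disjoint_setI0; rewrite (setIidPl WB) => /eqP; apply/negP.
pose S := V :\: B.
have eB : V :\: S = B by rewrite /S setDDr setDv set0U; apply/setIidPr.
have outB v : v \in S -> [/\ v \in V, v \notin B & [disjoint B & [set v]]].
  by rewrite inE => /andP[v1 v2]; split=> //; rewrite disjoint_sym disjoints1.
have addv v : v \in S -> pot m rho B + 1 <= pot m rho (B :|: [set v]) \/ (B :|: [set v] = V /\ pot m rho B <= pot m rho V).
  move=> /outB[v1 v2 d]; apply: add; rewrite ?sub1set //.
  by apply/set0Pn; exists v; rewrite inE.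
have e1 v : v \in S -> (4 * ed m [set v] B <= rho v)%N.
  move=> vS; have [v1 v2 d] := outB v vS; case: (addv v vS) => [h|].
  - by move: h; rewrite potU // pot1 // (edC B _ gm); lia.
  - by case=> [h1 h2]; move: h2; rewrite -h1 potU // pot1 // (edC B _ gm); lia.
have e4 v : v \in S -> rho v = 4%N -> ed m [set v] B = 0%N.
  move=> vS v4; have [vV vB d] := outB v vS; have := e1 v vS; rewrite v4 => le.
  case: (addv v vS) => [h|[h1 _]].
  - by move: h; rewrite potU // pot1 // (edC B _ gm) v4; lia.
  apply/eqP; rewrite -leqn0 leqNgt; apply/negP => p.
  have eB1 : V :\ v = B.
    by rewrite -h1 setUC setU1K.
  have ev : ed m [set v] B = 1%N by move: p le; clear; lia.
  have [x [xB mx m0]] := ed_eq1 ev.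
  apply: (proj1 cr); apply: (@leaf4_flex v x vV v4); rewrite ?eB1 //.
    by rewrite (proj1 gm).
  by move=> y yB n; rewrite (proj1 gm); apply: m0.
pose rho' v := if (v \in S) && (ed m [set v] B == 1%N) then 3%N else rho v.
have chg v : v \in S -> ed m [set v] B = 1%N -> rho v = 6%N.
  by move=> vS e; have := e1 v vS; have := e4 v vS; case: (r346 v) => [|[]] ->; lia.
have rhoE v : v \in S -> (rho v = rho' v + 3 * ed m [set v] B)%N.
  move=> vS; rewrite /rho' vS /=; case: eqP => [e|n]; first by rewrite e (chg v vS e).
  by have := e1 v vS; case: (r346 v) => [|[]] ->; lia.
have va' : valid rho' by move=> v; rewrite /rho'; case: ifP.
have pS : S \proper V.
  rewrite properE subsetDl /=; apply/negP => /subsetP h.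
  by have /set0Pn[x xB] := nB; have := h x (subsetP sB _ xB); rewrite inE xB.
apply: (proj1 cr); apply: (@color_first _ _ V m rho S rho'); rewrite ?eB ?proper_sub //.
- by case: gm.
- exact: sub_flex.
- apply: NNPP => nf.
  have [W [sW nW nfW alt]] := nonflex_pot ih gm va' (meas_sub _ _ pS) nf.
  have sWV : W \subset V := subset_trans sW (proper_sub pS).
  have pW : W \proper V := sub_proper_trans sW pS.
  (* Some vertex of [W] was lowered to 3, which rules out the [C2] and the necklace. *)
  have [v [vW v1]] : exists v, v \in W /\ ed m [set v] B = 1%N.
    apply: NNPP => h; apply: nfW; apply: sub_flex' => // v vW; rewrite /rho'.
    by case: ifP => // /andP[_ /eqP e]; case: h; exists v.
  have vS := subsetP sW v vW.
  have v3 : rho' v = 3%N by rewrite /rho' vS v1.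
  have le0 : pot m rho' W <= 0.
    case: alt => // -[[x [y [_ eW _ x6 y4]]]|all6]; last by have := all6 v vW; rewrite v3.
    by move: vW; rewrite eW !inE => /orP[] /eqP e; move: v3; rewrite e ?x6 ?y4.
  have dW : [disjoint B & W].
    rewrite disjoint_sym disjoints_subset; apply/subsetP => u /(subsetP sW).
    by rewrite !inE => /andP[].
  have potW : pot m rho W = pot m rho' W + 3 * (ed m W B)%:Z.
    rewrite /pot (ed_sum m W B); have -> : \sum_(v0 in W) (rho v0)%:Z = \sum_(v0 in W) (rho' v0)%:Z + 3 * (\sum_(x in W) ed m [set x] B)%N%:Z.
      rewrite (big_morph Posz PoszD (erefl _)) mulr_sumr -big_split /=; apply: eq_bigr => u uW.
      by rewrite rhoE ?(subsetP sW) //; lia.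
    by ring.
  have q1 : (1 <= ed m W B)%N by rewrite -v1; apply: edS; rewrite ?sub1set.
  have potBW : pot m rho (B :|: W) < pot m rho B.
    by rewrite (potU _ gm dW) potW (edC B W gm); move: q1 le0; clear; lia.
  case: (add W sWV dW nW) => [h|[h1 h2]]; first by move: potBW h; clear; lia.
  by move: potBW h2; rewrite h1; clear; lia.
move=> v vS; case: (eqVneq (ed m [set v] B) 1%N) => [e|n]; [right|left].
  split; [exact: chg|by rewrite /rho' vS e|].
  by have [x [xB mx m0]] := ed_eq1 e; exists x.
have e0 : ed m [set v] B = 0%N by have := e1 v vS; case: (r346 v) => [|[]] ->; lia.
split=> [|y yB]; first by rewrite /rho' (negbTE n) andbF.
by apply: (ed_eq0 e0); rewrite ?inE.
Qed.

End Fixed.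
End Critical.

(** * Degrees, charges and cuts of a critical graph *)

Section Degrees.
Variables (R : realFieldType) (T : finType).
Notation col := {ffun T -> C3}.
Implicit Types (A B C U W S : {set T}) (M : T -> T -> C3 -> C3 -> bool) (b : T -> C3).
Variables (V : {set T}) (m : T -> T -> nat) (rho : T -> nat).
Hypotheses (gm : gr m) (va : valid rho) (cr : crit R V m rho) (ih : IHyp R T (meas V rho)) (potV : 0 < pot m rho V).

Lemma mC x y : m x y = m y x. Proof. by case: gm. Qed.
Lemma mxx x : m x x = 0%N. Proof. by case: gm. Qed.

Lemma valid_upd y r : r \in [:: 3; 4; 6]%N -> valid (upd y r rho).
Proof. by move=> h v; rewrite /upd; case: ifP. Qed.

(** A nonflexible set avoiding [y] would be nonflexible for [rho] itself, although it is a proper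
    subset of [V]. *)
Lemma upd_nonflex y r : y \in V -> r \in [:: 3; 4; 6]%N ->
  forall S, S \subset V -> (S \proper V \/ (meas V (upd y r rho) < meas V rho)%N) -> ~ flex R S m (upd y r rho) ->
  exists W, [/\ W \subset S, y \in W, ~ flex R W m (upd y r rho) & pot m (upd y r rho) W <= 0 \/
    (C2 W m (upd y r rho) \/ forall v, v \in W -> upd y r rho v = 6%N)].
Proof.
move=> yV hr S sV alt nf.
have lt : (meas S (upd y r rho) < meas V rho)%N by case: alt => [p|//]; [exact: meas_sub|case: (eqVproper sV) => [->//|p _]; exact: meas_sub].
have [W [sW nW nfW h]] := nonflex_pot ih gm (valid_upd y hr) lt nf.
exists W; split=> //; apply: contra_notT nfW => yW.
apply: (sub_flex' gm cr); last by move=> v vW; rewrite updN //; apply: contraNneq yW => <-.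
by apply/properP; split; [exact: subset_trans sW sV|exists y].
Qed.

(** The 3-vertex is given the law of a 4-vertex whose basepoint is the special color of the double
    edge. *)
Lemma double36_flex x y : V = [set x; y] -> x != y -> m x y = 2%N -> rho x = 6%N -> rho y = 3%N -> flex R V m rho.
Proof.
move=> eV n m2 x6 y3 M b Om P mu cV dP ad.
have yV : y \in V by rewrite eV !inE eqxx orbT.
have xV : x \in V by rewrite eV !inE eqxx.
have n' : y != x by rewrite eq_sym.
have m2' : m y x = 2%N by rewrite mC.
have [f [g [fi gi hM]]] := cov2 cV yV xV n' m2'.
pose b' := upd y (sp_color f g) b.
have sy : [set y] \subset V by rewrite sub1set.
have cy : cov [set y] m M by apply: covS cV sy _ => *.
have [L [l0 l1 l2]] := @law_point R T M (fun u => p4 R (b' u)) y (erefl _) (p4_isd R _).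
have ady : adm [set y] rho P mu by move=> v; rewrite inE => /eqP ->; apply: ad.
have n3 v : v \in [set y] -> v != y -> rho v != 3%N by rewrite inE => ->.
have gL : good [set y] M (upd y 4%N rho) b' L.
  split=> // u; rewrite inE => /eqP ->; split=> [c|_ c]; rewrite l2 ?inE //.
  by case/andP: (p4_bd R (b' y) c); lra.
have [K [s1 K1]] := couple_missing cy dP (set11 y) y3 ady n3 gL.
have xy : x \notin [set y] by rewrite inE.
have cV' : cov (x |: [set y]) m M by rewrite -eV.
have m0 u : u \in [set y] -> u != y -> m u x = 0%N by rewrite inE => ->.
have spP c : special f g c -> 2 / 5 <= pr (bind P K) (fun phi => phi y == c).
  by move=> /(sp_colorE fi gi) ->; rewrite K1 /b' updE /p4 eqxx.
have [K2 [k0 k1 k2]] := attach_double cV' dP xy s1 x6 (set11 y) m2' m0 fi gi hM spP.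
exists K2; rewrite eV; split=> // v vV; have [a _] := k2 v vV; split=> // v4.
by move: vV; rewrite !inE => /orP[] /eqP e; move: v4; rewrite e ?x6 ?y3.
Qed.

(** Raising a lone 3-vertex to a 4-vertex keeps the graph nonflexible, since [couple_missing] would
    transfer a coloring law back. The measure drops, and the potential rises by only 1, so [gap]
    leaves a [C2], treated by [double36_flex]. *)
Lemma unique3 y : y \in V -> rho y = 3%N -> ~ (forall v, v \in V -> v != y -> rho v <> 3%N).
Proof.
move=> yV y3 un.
have lt : (meas V (upd y 4%N rho) < meas V rho)%N.
  rewrite /meas ltn_add2l; apply: proper_card; apply/properP; split; last first.
    by exists y; rewrite !inE ?yV ?y3 // updE andbF.
  by apply/subsetP => v; rewrite !inE /upd; case: ifP => //; rewrite andbF.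
have nf : ~ flex R V m (upd y 4%N rho).
  move=> fl; apply: (proj1 cr) => M b Om P mu cV dP ad.
  have [|L gL] := flex_lawful _ fl b cV.
    by move=> v vV; rewrite /upd; case: (eqVneq v y) => // n; apply/eqP; exact: un.
  have [|K [h _]] := couple_missing cV dP yV y3 ad _ gL; last by exists K.
  by move=> v vV n; apply/eqP; exact: un.
have [W [sW yW nfW alt]] := @upd_nonflex y 4%N yV isT V (subxx V) (or_intror lt) nf.
have potW := pot_upd m rho 4%N yW; rewrite y3 in potW.
have key : pot m rho W <= 0 -> False.
  move=> le; case: (eqVproper sW) => [e|p]; first by move: le potV; rewrite e; clear; lia.
  have nW : W != set0 by apply/set0Pn; exists y.
  by have := gap gm va cr ih potV p nW; move: le potV; clear; lia.
case: alt => [le|[[x [z [n eW m2 x6 z4]]]|h]].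
- by apply: key; move: le; rewrite potW; clear; lia.
- have ez : y = z.
    by move: yW; rewrite eW !inE => /orP[] /eqP // e; move: x6; rewrite -e updE.
  have x6' : rho x = 6%N by rewrite updN ?ez in x6.
  case: (eqVproper sW) => [e|p].
    by apply: (proj1 cr); apply: (@double36_flex x y); rewrite ?ez // -?e // -ez.
  have nW : W != set0 by apply/set0Pn; exists y.
  have := gap gm va cr ih potV p nW; move: potV; rewrite eW -ez pot2 // ?ez // m2 x6' -ez y3; clear; lia.
- by have := h y yW; rewrite updE.
Qed.

Definition dg v := ed m [set v] V.
Definition charge v : int := (rho v)%:Z - 2 * (dg v)%:Z.

Lemma disjD A : [disjoint A & V :\: A].
Proof. by rewrite disjoint_sym disjoints_subset subsetDr. Qed.

Lemma UD A : A \subset V -> A :|: (V :\: A) = V.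
Proof. by move=> s; rewrite -{2}(setID V A) (setIidPr s). Qed.

Lemma chE A : \sum_(v in A) charge v = \sum_(v in A) (rho v)%:Z - 2 * (ed m A V)%:Z.
Proof.
by rewrite (ed_sum m A V) (big_morph Posz PoszD (erefl _)) mulr_sumr -sumrB.
Qed.

Lemma potVE : pot m rho V = \sum_(v in V) charge v.
Proof. by rewrite chE. Qed.

Lemma potE A : A \subset V -> pot m rho A = \sum_(v in A) charge v + 2 * (ed m A (V :\: A))%:Z.
Proof.
move=> sA; have e : ed m A V = (ed m A A + ed m A (V :\: A))%N by rewrite -edUr ?UD ?disjD.
rewrite /pot chE e.
by rewrite PoszD; ring.
Qed.

Lemma gap1 A : A \proper V -> A != set0 -> 2 <= pot m rho A.
Proof. by move=> p n; have := gap gm va cr ih potV p n; move: potV; clear; lia. Qed.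

(** This is [gap] for the complement of [A], as the potentials of the two sides exceed that of [V]
    by 4 for each edge between them. *)
Lemma bridge_bound A : A \proper V -> A != set0 -> pot m rho A + 1 <= 4 * (ed m A (V :\: A))%:Z.
Proof.
move=> p n; have sA := proper_sub p.
have pD : V :\: A \proper V.
  rewrite properEneq subsetDl andbT; apply: contraNneq n => e; rewrite -subset0.
  by apply/subsetP => x xA; have := subsetP sA x xA; rewrite -{1}e inE xA.
have nD : V :\: A != set0 by rewrite setD_eq0; case/andP: p.
have := gap gm va cr ih potV pD nD; rewrite -{1}(UD sA) potU ?disjD //; clear; lia.
Qed.

Lemma two_vertices v : V <> [set v].
Proof.
move=> e; apply: (proj1 cr); rewrite e; apply: tr_flex; first exact: tr1.
by move=> u _; apply: va.
Qed.

Lemma properV1 v : v \in V -> [set v] \proper V.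
Proof. by move=> vV; rewrite properEneq sub1set vV andbT; apply/eqP => e; exact: (@two_vertices v). Qed.

Lemma set1n0 v : [set v] != set0 :> {set T}.
Proof. by apply/set0Pn; exists v; rewrite inE. Qed.

Lemma dgE v : v \in V -> dg v = ed m [set v] (V :\ v).
Proof. by move=> vV; rewrite /dg -{1}(setD1K vV) edUr ?disjoints1 ?inE ?eqxx // ed11 mxx. Qed.

Lemma dg_lb v : v \in V -> (rho v + 1 <= 4 * dg v)%N.
Proof.
move=> vV; have := bridge_bound (properV1 vV) (set1n0 v); rewrite pot1 // -dgE //; clear; lia.
Qed.

Lemma connected A : A \proper V -> A != set0 -> exists x y, [/\ x \in A, y \in V :\: A & (0 < m x y)%N].
Proof.
move=> p n; apply: ed_gt0; have := bridge_bound p n; have := gap1 p n; clear; lia.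
Qed.

End Degrees.

(** * Induced paths and the trees they form *)

Section InducedPaths.
Variables (T : finType) (m : T -> T -> nat).
Hypothesis gm : gr m.
Implicit Types (A S : {set T}) (s : seq T).

(** Induced in the underlying simple graph: consecutive vertices may be joined by several edges, and
    no other two are adjacent. *)
Fixpoint ipath (x : T) s : bool :=
  if s is v :: s' then [&& (0 < m x v)%N, x != v, all (fun w => (w != x) && (m x w == 0%N)) s' & ipath v s']
  else true.

(** The new path leaves [x] for the last vertex that is adjacent to it, or starts at [x] if the path
    already passes there later. *)
Lemma ipath_step s v x : ipath v s -> (exists2 w, w \in v :: s & (w == x) || (0 < m x w)%N) ->
  exists s', [/\ ipath x s', {subset s' <= v :: s} & last x s' = last v s].
Proof.
elim: s v => [|v2 s IH] v iv h.
  move: h => [w]; rewrite inE => /eqP -> /orP[/eqP ->|p]; first by exists [::].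
  exists [:: v]; split=> //=; rewrite p !andbT /=.
  by apply: contraTneq p => ->; case: gm => _ ->.
have i1 : ipath v2 s by case/and4P: iv.
case: (classic (exists2 w, w \in v2 :: s & (w == x) || (0 < m x w)%N)) => [h2|nh].
  by have [s' [i s1 l]] := IH v2 i1 h2; exists s'; split=> // u /s1 hu; rewrite in_cons hu orbT.
have [w] := h; rewrite in_cons => /orP[/eqP ->|wS] hw; last by case: nh; exists w.
case: (eqVneq v x) hw => [<-|n] /= hw.
  by exists (v2 :: s); split=> // u uS; rewrite in_cons uS orbT.
have nx u : u \in v2 :: s -> (u != x) && (m x u == 0%N).
  move=> uS; apply/andP; split; first by apply/negP => e; apply: nh; exists u; rewrite ?e.
  by rewrite -leqn0 leqNgt; apply/negP => e; apply: nh; exists u; rewrite ?e ?orbT.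
exists (v :: v2 :: s); split=> //.
change ([&& (0 < m x v)%N, x != v, all (fun w => (w != x) && (m x w == 0%N)) (v2 :: s) & ipath v (v2 :: s)]).
by rewrite hw eq_sym n iv andbT; apply/allP => u uS; apply: nx.
Qed.

Lemma ipath_notin s x : ipath x s -> x \notin s.
Proof.
case: s => //= v s /and4P[_ n /allP a _]; rewrite inE negb_or n /=.
by apply/negP => /a; rewrite eqxx.
Qed.

Lemma ipath_nbr s x v : ipath x s -> v \in s -> exists2 a, a \in x :: s & (0 < m v a)%N.
Proof.
elim: s x => // y s IH x /and4P[p _ _ i]; rewrite in_cons => /orP[/eqP ->|vs].
  by exists x; rewrite ?inE ?eqxx // (proj1 gm).
by have [a aS h] := IH y i vs; exists a => //; rewrite in_cons aS orbT.
Qed.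

Lemma ipath_inner s x v : ipath x s -> v \in s -> v != last x s ->
  exists a b, [/\ a \in x :: s, b \in x :: s, a != b, (0 < m v a)%N & (0 < m v b)%N].
Proof.
elim: s x => // y s IH x /= /and4P[p n /allP a i]; rewrite in_cons => /orP[/eqP ->|vs] l.
  case: s l i a {IH} => [|z s] l /=; first by rewrite eqxx in l.
  move=> /and4P[q _ _ _] /(_ z (mem_head z s)) /andP[nz _].
  by exists x, z; split; rewrite ?inE ?eqxx ?orbT // 1?eq_sym // (proj1 gm).
have [c [d [h1 h2 h3 h4 h5]]] := IH y i vs l.
by exists c, d; split=> //; rewrite in_cons ?h1 ?h2 orbT.
Qed.

Definition lk A := [rel x y | [&& x \in A, y \in A & (0 < m x y)%N]].

Lemma lk_sym A : connect_sym (lk A).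
Proof. by apply: sym_connect_sym => x y /=; rewrite (proj1 gm) andbCA. Qed.

Lemma ipath_connect A x y : connect (lk A) x y -> x \in A ->
  exists s, [/\ ipath x s, {subset s <= A} & last x s = y].
Proof.
move=> /connectP[p + ->]; elim: p x => [|v p IH] x /=; first by exists [::].
move=> /andP[/and3P[xA vA mv] pv] _; have [s [i sA l]] := IH v pv vA.
have [|s' [i' sS l']] := ipath_step (x := x) i.
  by exists v; rewrite ?mem_head // mv orbT.
exists s'; split=> //; last by rewrite l'.
by move=> u /sS; rewrite in_cons => /orP[/eqP ->|/sA].
Qed.

Lemma connect_ipath A x s : ipath x s -> x \in A -> {subset s <= A} -> forall v, v \in s -> connect (lk A) x v.
Proof.
elim: s x => // y s IH x /= /and4P[p _ _ i] xA sA v; have yA : y \in A by apply: sA; rewrite mem_head.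
have xy : connect (lk A) x y by apply: connect1; rewrite /= xA yA.
rewrite in_cons => /orP[/eqP -> //|vs]; apply: connect_trans xy _; apply: IH => // u us.
by apply: sA; rewrite in_cons us orbT.
Qed.

(** With this dummy potential [tr] records only the shape of a tree; the condition on the ends of
    double edges is restored by [tr_conv]. *)
Definition all6 : T -> nat := fun _ => 6%N.

(** Multiplicities at most 2 and no two double edges at a vertex of [s], so that the double edges
    along a path are disjoint. *)
Definition iso2 A s := forall v a, v \in s -> a \in A -> (m v a <= 2)%N /\
  forall b, b \in A -> a != b -> m v a = 2%N -> m v b != 2%N.

Lemma tr_conv rho rho' S : tr m rho S ->
  (forall x y, x \in S -> y \in S -> m x y = 2%N -> rho' x = 6%N /\ rho' y = 6%N) -> tr m rho' S.
Proof.
elim=> [v|x y n m2 _ _|{}S x v trS IH xS vS m1 m0|{}S x y z trS IH xS yS zS nyz m1 m2 _ _ m0 m0'] h.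
- exact: tr1.
- by have [] := h x y; rewrite ?inE ?eqxx ?orbT // => ? ?; apply: tr_pair0.
- apply: (tr_add _ xS vS m1 m0); apply: IH => a b aS bS; apply: h; by rewrite inE ?aS ?bS orbT.
- have [||//|y6 z6] := h y z; rewrite ?inE ?eqxx ?orbT //.
  apply: (tr_addp _ xS yS zS nyz m1 m2 y6 z6 m0 m0'); apply: IH => a b aS bS; apply: h; by rewrite !inE ?aS ?bS !orbT.
Qed.

Lemma setU_cons S v s : S :|: [set u in v :: s] = (v |: S) :|: [set u in s].
Proof. by apply/setP => u; rewrite !inE; case: (u == v); rewrite ?orbT. Qed.

(** A double edge ahead is added together with the single edge leading to it, by [tr_addp]; by
    [iso2] the next edge is single again. As two vertices may be consumed at once, the induction is
    on the length. *)
Lemma add_path A s S y : {subset S <= A} -> {subset s <= A} -> tr m all6 S -> y \in S -> ipath y s -> m y (head y s) != 2%N ->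
  (forall v, v \in s -> v \notin S) -> (forall u v, u \in S -> u != y -> v \in s -> m u v = 0%N) ->
  iso2 A s -> tr m all6 (S :|: [set v in s]).
Proof.
have [n] := ubnP (size s); elim: n s S y => // n IH [|v s] S y lt SA sA trS yS; rewrite /= ?ltnS in lt *.
  by move=> *; rewrite (_ : [set u in [::]] = set0) ?setU0 //; apply/setP => u; rewrite !inE.
move=> /and4P[p n1 /allP a i] n2 nS z0 is2; rewrite setU_cons.
have vS := nS v (mem_head v s).
have mle : (m y v <= 2)%N by rewrite (proj1 gm); case: (is2 v y (mem_head v s) (SA y yS)).
have vA : v \in A by apply: sA; rewrite mem_head.
have sA' : {subset s <= A} by move=> u us; apply: sA; rewrite in_cons us orbT.
have SA' : {subset v |: S <= A} by move=> u; rewrite !inE => /orP[/eqP ->|/SA].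
have m1 : m y v = 1%N by move: mle n2 p; clear; lia.
have z1 u : u \in S -> u != y -> m u v = 0%N by move=> uS un; apply: z0 => //; rewrite mem_head.
have vs := ipath_notin i.
have iss : iso2 A s by move=> u w us wA; apply: is2 => //; rewrite in_cons us orbT.
have ay u : u \in s -> m y u = 0%N by move=> /a /andP[_ /eqP].
have zs u w : u \in S -> w \in s -> m u w = 0%N.
  by move=> uS ws; case: (eqVneq u y) => [->|un]; [exact: ay|apply: z0; rewrite ?in_cons ?ws ?orbT].
have sS u : u \in s -> u \notin S by move=> us; apply: nS; rewrite in_cons us orbT.
case: (eqVneq (m v (head v s)) 2%N) => [m2|n3]; last first.
  apply: (IH _ _ v) => //; first exact: tr_add trS yS vS m1 z1.
  - by rewrite !inE eqxx.
  - move=> u us; rewrite !inE negb_or sS // andbT; by apply: contraNneq vs => <-.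
  - by move=> u w; rewrite !inE => /orP[/eqP ->|uS _ ws]; [rewrite eqxx|exact: zs].
case: s lt a i is2 vs iss ay zs sS m2 nS z0 sA sA' => [|w s] lt a i is2 vs iss ay zs sS m2 nS z0 sA sA'.
  by move: m2; rewrite /= (proj2 gm).
rewrite /= in m2; move: i => /= /and4P[_ nvw /allP avs iw]; rewrite setU_cons.
have wS := sS w (mem_head w s).
have ws := ipath_notin iw.
have wA : w \in A by apply: sA'; rewrite mem_head.
have sA2 : {subset s <= A} by move=> u us; apply: sA'; rewrite in_cons us orbT.
apply: (IH _ _ w) => //.
- by rewrite /= in lt; lia.
- by move=> u; rewrite !inE => /or3P[/eqP ->|/eqP ->|/SA].
- by apply: (tr_addp trS yS vS wS nvw m1 m2) => // u uS; apply: zs; rewrite ?mem_head.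
- by rewrite !inE eqxx.
- case: s iw iss ws vs sA2 {lt a avs is2 ay zs sS nS z0 sA sA'} => [|z s] iw iss ws vs sA2; first by rewrite /= (proj2 gm).
  have [_ h] := iss w v (mem_head _ _) vA; apply: h; [by apply: sA2; rewrite mem_head| |by rewrite (proj1 gm)].
  by move: vs; rewrite !in_cons !negb_or eq_sym => /and3P[_ + _]; rewrite eq_sym.
- move=> u us; rewrite !inE !negb_or sS ?in_cons ?us ?orbT // andbT; apply/andP; split.
    by apply: contraNneq ws => <-.
  by apply: contraNneq vs => <-; rewrite in_cons us orbT.
- move=> u x; rewrite !inE => /orP[/eqP ->|/orP[/eqP ->|uS]]; first by rewrite eqxx.
    by move=> _ xs; have /andP[_ /eqP] := avs x xs.
  by move=> _ xs; apply: zs; rewrite ?in_cons ?xs ?orbT.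
- by move=> u x us xA; apply: iss => //; rewrite in_cons us orbT.
Qed.

Lemma path_tr A s x : {subset x :: s <= A} -> ipath x s -> iso2 A s -> tr m all6 [set v in x :: s].
Proof.
have e0 (z : T) r : [set v in z :: r] = [set z] :|: [set v in r] by apply/setP => u; rewrite !inE.
case: s => [|v s] sA i is2.
  by rewrite e0 (_ : [set u in [::]] = set0) ?setU0; [exact: tr1|apply/setP => u; rewrite !inE].
case: (eqVneq (m x v) 2%N) => [m2|n2]; rewrite e0; last first.
  have xA : x \in A by apply: sA; rewrite mem_head.
  apply: (@add_path A _ _ x) => //; [by move=> u; rewrite inE => /eqP ->|by move=> u us; apply: sA; rewrite in_cons us orbT|exact: tr1|by rewrite inE| |].
    by move=> u us; rewrite inE; apply: contraNneq (ipath_notin i) => <-.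
  by move=> u w; rewrite inE => ->.
rewrite setU_cons; move: i => /= /and4P[p n /allP a i].
have vs := ipath_notin i.
have xA : x \in A by apply: sA; rewrite mem_head.
have vA : v \in A by apply: sA; rewrite !inE eqxx orbT.
have sA' : {subset s <= A} by move=> u us; apply: sA; rewrite !in_cons us !orbT.
apply: (@add_path A _ _ v) => //.
- by move=> u; rewrite !inE => /orP[] /eqP ->.
- exact: tr_pair0.
- by rewrite !inE eqxx.
- case: s i is2 a sA' {vs sA} => [|z s] i is2 a sA'; first by rewrite /= (proj2 gm).
  have [_ h] := is2 v x (mem_head _ _) xA; apply: h; [by apply: sA'; rewrite mem_head| |by rewrite (proj1 gm)].
  by have /andP[] := a z (mem_head z s); rewrite eq_sym.
- move=> u us; rewrite !inE negb_or; have /andP[-> _] := a u us; rewrite andbT.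
  by apply: contraNneq vs => <-.
- move=> u w; rewrite !inE => /orP[/eqP ->|/eqP -> _ ws]; first by rewrite eqxx.
  by have /andP[_ /eqP] := a w ws.
- by move=> u w us wA; apply: is2 => //; rewrite in_cons us orbT.
Qed.

End InducedPaths.

Section LegalTrees.
Variables (R : realFieldType) (T : finType).
Variables (V : {set T}) (m : T -> T -> nat) (rho : T -> nat).
Hypotheses (gm : gr m) (va : valid rho) (cr : crit R V m rho).

(** Such a tree could be colored last: a 6-vertex with one outer edge becomes a 3-vertex, the double
    edges keep ends of potential 6, and [tr_flex] applies. *)
Lemma legal_tree S : tr m (all6 (T := T)) S -> S \subset V -> S != set0 ->
  (forall v, v \in S -> ed m [set v] (V :\: S) = 0%N \/ rho v = 6%N /\ ed m [set v] (V :\: S) = 1%N) ->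
  (forall x y, x \in S -> y \in S -> m x y = 2%N -> rho x = 6%N /\ ed m [set x] (V :\: S) = 0%N) -> False.
Proof.
move=> trS sV nS leg dbl; apply: (proj1 cr).
pose rho' v := if (v \in S) && (ed m [set v] (V :\: S) == 1%N) then 3%N else rho v.
apply: (@color_first _ _ V m rho S rho') => //; first by case: gm.
- apply: (sub_flex gm cr); rewrite properEneq subsetDl andbT; apply: contraNneq nS => e.
  rewrite -subset0; apply/subsetP => x xS; have := subsetP sV x xS; by rewrite -e inE xS.
- apply: tr_flex; last by move=> v _; rewrite /rho'; case: ifP => // _; apply: va.
  apply: tr_conv trS _ => x y xS yS m2; rewrite /rho'.
  have [x6 ->] := dbl x y xS yS m2; have [y6 ->] := dbl y x yS xS (etrans (proj1 gm y x) m2).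
  by rewrite x6 y6 !andbF.
- move=> v vS; case: (leg v vS) => [e|[v6 e]]; [left|right]; rewrite /rho' vS e /=.
    by split=> // y yD; apply: (ed_eq0 e) => //; rewrite inE.
  by split=> //; have [x [xD m1 m0]] := ed_eq1 e; exists x.
Qed.

End LegalTrees.

(** * Discharging *)

Section Small.
Variables (R : realFieldType) (T : finType).
Implicit Types (A B C U W S : {set T}).
Variables (V : {set T}) (m : T -> T -> nat) (rho : T -> nat).
Hypotheses (gm : gr m) (va : valid rho) (cr : crit R V m rho) (ih : IHyp R T (meas V rho)) (potV : 0 < pot m rho V).
Notation d v := (dg V m v).
Notation ch v := (charge V m rho v).

Lemma dg_split v S : S \subset V -> d v = (ed m [set v] S + ed m [set v] (V :\: S))%N.
Proof. by move=> sS; rewrite -edUr ?disjD // UD. Qed.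

Lemma mult_le2 x y : x \in V -> y \in V -> (m x y <= 2)%N.
Proof.
move=> xV yV; case: (eqVneq x y) => [->|n]; first by rewrite (proj2 gm).
have s : [set x; y] \subset V by rewrite subUset !sub1set xV.
have e := pot2 rho gm n; have rx := r346 va x; have ry := r346 va y.
have : 0 < pot m rho [set x; y].
  case: (eqVproper s) => [->//|p]; have := gap1 gm va cr ih potV p; rewrite /=.
  have n0 : [set x; y] != set0 by apply/set0Pn; exists x; rewrite !inE eqxx.
  by move=> /(_ n0); clear; lia.
by rewrite e; move: rx ry; clear; lia.
Qed.

Lemma ed_ge1 v S a : a \in S -> (m v a <= ed m [set v] S)%N.
Proof. by move=> aS; apply: ed_le; rewrite ?inE. Qed.

Lemma ed_ge2 v S a b : a \in S -> b \in S -> a != b -> (m v a + m v b <= ed m [set v] S)%N.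
Proof.
move=> aS bS n; rewrite ed1l (bigD1 a) //= leq_add2l (bigD1 b) ?leq_addr //.
by rewrite bS eq_sym.
Qed.

Lemma dg_bd v : v \in V -> [\/ rho v = 3%N /\ (1 <= d v)%N, rho v = 4%N /\ (2 <= d v)%N | rho v = 6%N /\ (2 <= d v)%N].
Proof.
move=> vV; have := dg_lb gm va cr ih potV vV; case: (r346 va v) => [|[]] -> h.
- by constructor 1; split=> //; move: h; clear; lia.
- by constructor 2; split=> //; move: h; clear; lia.
- by constructor 3; split=> //; move: h; clear; lia.
Qed.

Definition small := [set v in V | 0 <= ch v].
Definition posv := [set v in V | 0 < ch v].

Lemma small_sub : small \subset V. Proof. by apply/subsetP => v; rewrite inE => /andP[]. Qed.
Lemma pos_small : posv \subset small.
Proof. by apply/subsetP => v; rewrite !inE => /andP[-> /ltW]. Qed.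

Lemma posP v : v \in posv -> rho v = 6%N /\ d v = 2%N \/ rho v = 3%N /\ d v = 1%N.
Proof.
rewrite inE /charge => /andP[vV]; case: (dg_bd vV) => -[-> h]; [right|left|left]; split=> //; lia.
Qed.

Lemma zeroP v : v \in small -> v \notin posv -> rho v = 6%N /\ d v = 3%N \/ rho v = 4%N /\ d v = 2%N.
Proof.
rewrite !inE /charge => /andP[vV]; rewrite vV /=; case: (dg_bd vV) => -[-> h]; [right|right|left]; split=> //; lia.
Qed.

Lemma bigP v : v \in V -> v \notin small -> [\/ rho v = 3%N /\ (2 <= d v)%N, rho v = 4%N /\ (3 <= d v)%N | rho v = 6%N /\ (4 <= d v)%N].
Proof.
rewrite !inE /charge => vV; rewrite vV /=; case: (dg_bd vV) => -[-> h] h2;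
 [constructor 1|constructor 2|constructor 3]; split=> //; lia.
Qed.

Lemma small_le3 v : v \in small -> (d v <= 3)%N.
Proof.
move=> vs; case: (boolP (v \in posv)) => [/posP|/(zeroP vs)] [] [_ ->] //.
Qed.

(** A vertex of nonnegative charge has degree at most 3 and a positive one at most 2. Two neighbors
    in [S], or one edge into [S] for a positive vertex, therefore use up what [legal_tree]
    demands. *)
Lemma small_ok v S : v \in small -> S \subset V ->
  v \in posv /\ (0 < ed m [set v] S)%N \/ (exists a b, [/\ a \in S, b \in S, a != b, (0 < m v a)%N & (0 < m v b)%N]) ->
  (ed m [set v] (V :\: S) = 0%N \/ rho v = 6%N /\ ed m [set v] (V :\: S) = 1%N) /\
  (forall u, u \in S -> m v u = 2%N -> rho v = 6%N /\ ed m [set v] (V :\: S) = 0%N).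
Proof.
move=> vs sS h; have ds := dg_split v sS.
have [q1 q2] : [/\ (0 < ed m [set v] S)%N & v \notin posv -> (2 <= ed m [set v] S)%N].
  case: h => [[vp e]|[a [b [aS bS n ma mb]]]]; first by rewrite vp.
  by have := ed_ge2 v aS bS n; split=> [|_]; lia.
have q3 u : u \in S -> m v u = 2%N -> (2 <= ed m [set v] S)%N /\ (v \notin posv -> (3 <= ed m [set v] S)%N).
  move=> uS mu; split=> [|vp]; first by rewrite -mu; exact: ed_ge1.
  case: h => [[vp' _]|[a [b [aS bS n ma mb]]]]; first by rewrite vp' in vp.
  case: (eqVneq u a) => [e|ne]; first by have := ed_ge2 v aS bS n; rewrite -e mu; move: mb; clear; lia.
  by have := ed_ge2 v uS aS ne; rewrite mu; move: ma; clear; lia.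
case: (boolP (v \in posv)) => vp.
  case: (posP vp) => -[r e]; rewrite r; move: ds; rewrite e => ds; split.
  - by case: (ed m [set v] (V :\: S)) ds => [|[|k]] ds; [left|right|move: q1 ds; clear; lia].
  - by move=> u uS mu; split=> //; have [h1 _] := q3 u uS mu; move: h1 ds; clear; lia.
  - by left; move: q1 ds; clear; lia.
  - by move=> u uS mu; have [h1 _] := q3 u uS mu; move: h1 ds; clear; lia.
have {}q2 := q2 vp; case: (zeroP vs vp) => -[r e]; rewrite r; move: ds; rewrite e => ds; split.
- by case: (ed m [set v] (V :\: S)) ds => [|[|k]] ds; [left|right|move: q2 ds; clear; lia].
- by move=> u uS mu; split=> //; have [_ /(_ vp) h1] := q3 u uS mu; move: h1 ds; clear; lia.
- by left; move: q2 ds; clear; lia.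
- by move=> u uS mu; have [_ /(_ vp) h1] := q3 u uS mu; move: h1 ds; clear; lia.
Qed.

Lemma small_iso2 s : {subset s <= small} -> iso2 m V s.
Proof.
move=> ss v a vs aV; have vS := ss v vs; split; first by apply: mult_le2 => //; exact: (subsetP small_sub).
move=> b bV n ma; apply/eqP => mb.
have := ed_ge2 v aV bV n; rewrite ma mb; have := small_le3 vS; rewrite /dg; clear; lia.
Qed.

(** An induced path between two positive vertices would be a legal tree: its inner vertices have two
    neighbors on it, and a positive end needs only one. *)
Lemma one_pos p q : p \in posv -> q \in posv -> connect (lk m small) p q -> p = q.
Proof.
move=> pp qp c; apply/eqP/negPn/negP => n.
have ps := subsetP pos_small p pp; have qs := subsetP pos_small q qp.
have [s [i ss l]] := ipath_connect gm c ps.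
have sA : {subset p :: s <= V}.
  by move=> u; rewrite in_cons => /orP[/eqP ->|/ss h]; exact: (subsetP small_sub).
have [a aS0 ma] : exists2 a, a \in s & (0 < m p a)%N.
  case: s i l {ss sA} => [_ e|a s /= /and4P[h _ _ _] _]; first by rewrite -e eqxx in n.
  by exists a; rewrite ?mem_head.
pose S := [set v in p :: s]; have sS : S \subset V by apply/subsetP => u; rewrite inE => /sA.
have ok v : v \in S -> v \in small /\ (v \in posv /\ (0 < ed m [set v] S)%N \/
    (exists a b, [/\ a \in S, b \in S, a != b, (0 < m v a)%N & (0 < m v b)%N])).
  rewrite inE in_cons => /orP[/eqP ->|vs].
    split=> //; left; split=> //.
    have aS : a \in S by rewrite inE in_cons aS0 orbT.
    exact: leq_trans ma (ed_ge1 p aS).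
  split; first exact: ss.
  case: (eqVneq v (last p s)) => [e|ne]; [left|right].
    rewrite {1}e l; split=> //; have [u uS h] := ipath_nbr gm i vs.
    have uS1 : u \in S by rewrite inE.
    exact: leq_trans h (ed_ge1 v uS1).
  by have [u [b [h1 h2 h3 h4 h5]]] := ipath_inner gm i vs ne; exists u, b; split; rewrite ?inE.
apply: (@legal_tree R T V m rho gm va cr S) => //.
- exact: (path_tr gm sA i (small_iso2 ss)).
- by apply/set0Pn; exists p; rewrite !inE eqxx.
- by move=> v /ok [v1 v2]; have [] := small_ok v1 sS v2.
- by move=> x y /ok [v1 v2] yS mxy; have [_ h] := small_ok v1 sS v2; apply: (h y).
Qed.

Definition cp p := [set v in small | connect (lk m small) p v].

Lemma cpE p v : (v \in cp p) = (v \in small) && connect (lk m small) p v.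
Proof. by rewrite /cp in_set. Qed.

Lemma cp_sub p : cp p \subset small. Proof. by apply/subsetP => v; rewrite cpE => /andP[]. Qed.
Lemma cp_subV p : cp p \subset V. Proof. exact: subset_trans (cp_sub p) small_sub. Qed.
Lemma cp_self p : p \in posv -> p \in cp p.
Proof. by move=> pp; rewrite cpE connect0 (subsetP pos_small). Qed.

Lemma cp_disj p q u v : p \in posv -> q \in posv -> p != q -> u \in cp p -> v \in cp q -> u != v /\ m u v = 0%N.
Proof.
move=> pp qp n; rewrite !cpE => /andP[us pu] /andP[vs qv]; split.
  apply: contra n => /eqP e; apply/eqP; apply: one_pos => //; apply: connect_trans pu _.
  by rewrite lk_sym // e.
apply/eqP; rewrite -leqn0 leqNgt; apply: contra n => h; apply/eqP; apply: one_pos => //.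
apply: connect_trans pu _; apply: (connect_trans (y := v)); last by rewrite lk_sym.
by apply: connect1; rewrite /= us vs.
Qed.

(** By [one_pos] a positive vertex is determined by its component of small vertices, so it stands
    for that component. *)
Definition near_roots y := [set p in posv | [exists v in cp p, (0 < m y v)%N]].

Lemma branch y p : y \in V -> y \notin small -> p \in near_roots y ->
  exists s, [/\ ipath m y s, {subset s <= cp p}, last y s = p & s <> [::]].
Proof.
move=> yV yS; rewrite inE => /andP[pp /existsP[v /andP[vc mv]]].
have [vs pv] : v \in small /\ connect (lk m small) v p.
  by move: vc; rewrite cpE => /andP[-> h]; rewrite lk_sym.
have [s [i ss l]] := ipath_connect gm pv vs.
have [|s' [i' ss' l']] := ipath_step gm (x := y) i.
  by exists v; rewrite ?mem_head // mv orbT.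
exists s'; split=> //; last first.
- by move=> e; move: l'; rewrite e /= l => e'; move: yS; rewrite e' (subsetP pos_small).
- by rewrite l'.
move=> u /ss'; rewrite in_cons => /orP[/eqP -> //|us].
rewrite cpE ss //; apply: (connect_trans (y := v)); first by rewrite lk_sym.
exact: (connect_ipath i vs ss).
Qed.

(** Induced paths from [y] to all its roots form a tree that uses an edge at [y] for each root. If
    the bound failed, [y] would have at most one outer edge, and none unless its potential is 6, so
    the tree would be legal. *)
Lemma star_bound y : y \in V -> y \notin small ->
  (#|near_roots y| + (if rho y == 6%N then 2 else 1) <= d y)%N.
Proof.
move=> yV yS; rewrite leqNgt; apply/negP => big.
have br p : exists s, p \in near_roots y -> [/\ ipath m y s, {subset s <= cp p}, last y s = p & s <> [::]].
  case: (boolP (p \in near_roots y)) => h; last by exists [::].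
  by have [s hs] := branch yV yS h; exists s.
have [s sP] := fin_all_exists br.
pose h p := head y (s p).
have Qp p : p \in near_roots y -> p \in posv by rewrite inE => /andP[].
have hs p : p \in near_roots y -> h p \in s p.
  by move=> /sP [_ _ _ n]; rewrite /h; case: (s p) n => // a l _; exact: mem_head.
have hm p : p \in near_roots y -> (0 < m y (h p))%N.
  by move=> /sP [+ _ _ n]; rewrite /h; case: (s p) n => // a l _ /= /and4P[].
have hu p u : p \in near_roots y -> u \in s p -> (0 < m y u)%N -> u = h p.
  move=> /sP [+ _ _ _]; rewrite /h; case: (s p) => // a l /= /and4P[_ _ /allP z _].
  by rewrite in_cons => /orP[/eqP -> //|/z /andP[_ /eqP ->]].
pose U (Q : {set T}) := y |: \bigcup_(p in Q) [set v in s p].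
have UP (Q : {set T}) v : reflect (v = y \/ exists2 p, p \in Q & v \in s p) (v \in U Q).
  rewrite !inE; apply: (iffP orP) => [[/eqP ->|/bigcupP[p pQ]]|[->|[p pQ vp]]]; [by left| |by left|].
    by rewrite inE => vp; right; exists p.
  by right; apply/bigcupP; exists p; rewrite ?inE.
have sV p v : p \in near_roots y -> v \in s p -> v \in V.
  by move=> /sP [_ sc _ _] /sc; apply: (subsetP (cp_subV p)).
have UV (Q : {set T}) : Q \subset near_roots y -> U Q \subset V.
  by move=> sQ; apply/subsetP => v /UP [->//|[p pQ]]; apply: sV; exact: (subsetP sQ).
have ny p v : p \in near_roots y -> v \in s p -> v != y.
  by move=> pQ vp; apply: contraNneq (ipath_notin (let: And4 i _ _ _ := sP p pQ in i)) => <-.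
have sep p q u v : p \in near_roots y -> q \in near_roots y -> p != q -> u \in s p -> v \in s q -> u != v /\ m u v = 0%N.
  move=> pQ qQ n up vq; have [_ sp _ _] := sP p pQ; have [_ sq _ _] := sP q qQ.
  exact: cp_disj (Qp p pQ) (Qp q qQ) n (sp u up) (sq v vq).
have is2 p : p \in near_roots y -> iso2 m V (s p).
  move=> pQ; have [_ sp _ _] := sP p pQ; apply: small_iso2 => u /sp; exact: (subsetP (cp_sub p)).
have grow (Q0 : {set T}) : Q0 \subset near_roots y -> tr m (all6 (T := T)) (U Q0) -> forall Q : {set T}, Q0 \subset Q -> Q \subset near_roots y ->
    (forall p, p \in Q -> p \notin Q0 -> m y (h p) != 2%N) -> tr m (all6 (T := T)) (U Q).
  move=> sQ0 tr0 Q; have [n] := ubnP #|Q :\: Q0|; elim: n Q => // n IH Q lt s0 sQ nd.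
  case: (set_0Vmem (Q :\: Q0)) => [e|[p pD]].
    suff -> : Q = Q0 by []. by apply/eqP; rewrite eqEsubset s0 andbT -setD_eq0 e.
  have [pQ pn] : p \in Q /\ p \notin Q0 by move: pD; rewrite inE => /andP[].
  have pQs := subsetP sQ p pQ.
  have -> : U Q = U (Q :\ p) :|: [set v in s p].
    by rewrite /U (big_setD1 p) //= setUA [y |: _]setUC -setUA setUC.
  have s' : Q :\ p \subset near_roots y by apply: subset_trans sQ; exact: subsetDl.
  apply: (add_path gm (A := V) (y := y)).
  - exact/subsetP/UV.
  - by move=> v; apply: sV.
  - apply: IH => //.
    + have -> : Q :\ p :\: Q0 = (Q :\: Q0) :\ p by rewrite !setDDl setUC.
      by move: lt; rewrite (cardsD1 p (Q :\: Q0)) pD.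
    + apply/subsetP => q qQ; rewrite !inE (subsetP s0) // andbT; by apply: contraNneq pn => <-.
    + by move=> q; rewrite inE => /andP[_]; apply: nd.
  - by apply/UP; left.
  - by case: (sP p pQs).
  - exact: nd.
  - move=> v vp; apply/negP => /UP [e|[q]]; first by have := ny p v pQs vp; rewrite e eqxx.
    rewrite in_setD1 => /andP[qp qQ] vq; have [] := sep q p v v (subsetP sQ q qQ) pQs qp vq vp.
    by rewrite eqxx.
  - move=> u v /UP [->|[q]]; first by rewrite eqxx.
    by rewrite in_setD1 => /andP[qp qQ] uq _ vp; case: (sep q p u v (subsetP sQ q qQ) pQs qp uq vp).
  - exact: is2.
pose S := U (near_roots y); have sS : S \subset V by exact: UV.
have sumle : (\sum_(p in near_roots y) m y (h p) <= ed m [set y] S)%N.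
  rewrite ed1l -(big_imset (fun v => m y v)) /=; last first.
    move=> p q pQ qQ e; apply/eqP/negPn/negP => n.
    by have [] := sep p q _ _ pQ qQ n (hs p pQ) (hs q qQ); rewrite e eqxx.
  rewrite [X in (_ <= X)%N](bigID (mem (h @: near_roots y))) /=; apply: leq_trans (leq_addr _ _).
  rewrite [X in (X <= _)%N](eq_bigl (fun v => (v \in S) && (v \in h @: near_roots y))) // => v.
  case: (boolP (v \in h @: near_roots y)) => [/imsetP[p pQ ->]|]; rewrite ?andbF // andbT; apply/esym/UP.
  by right; exists p => //; apply: hs.
have ds := dg_split y sS.
pose Dbl := [set p in near_roots y | m y (h p) == 2%N].
have sum2 : (#|near_roots y| + #|Dbl| <= \sum_(p in near_roots y) m y (h p))%N.
  have -> : #|Dbl| = (\sum_(p in near_roots y | m y (h p) == 2%N) 1)%N.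
    by rewrite -sum1_card; apply: eq_bigl => p; rewrite in_set.
  rewrite -sum1_card big_mkcondr -big_split /=; apply: leq_sum => p pQ; have := hm p pQ.
  by case: eqP => [->//|_]; rewrite addn0.
have Dsub : Dbl \subset near_roots y by apply/subsetP => p; rewrite inE => /andP[].
(* A branch that starts with a double edge can only be the initial one, because [tr] never attaches
   a double edge to an old vertex; hence there must not be two. *)
have D1 : (#|Dbl| <= 1)%N.
  by move: big ds sumle sum2; case: ifP => _; clear; lia.
have trD : tr m (all6 (T := T)) (U Dbl).
  case: (set_0Vmem Dbl) => [->|[p pD]].
    by rewrite /U big_set0 setU0; exact: tr1.
  have -> : Dbl = [set p] by apply/eqP; rewrite eq_sym eqEcard sub1set pD cards1.
  have pQ := subsetP Dsub p pD; have [i _ _ _] := sP p pQ.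
  rewrite /U big_set1 (_ : _ |: _ = [set v in y :: s p]); last by apply/setP => v; rewrite !inE.
  apply: (path_tr gm (A := V)) => //; last exact: is2.
  by move=> v; rewrite in_cons => /orP[/eqP -> //|]; apply: sV.
have trS : tr m (all6 (T := T)) S.
  apply: (grow _ Dsub trD _ Dsub (subxx _)) => p pQ; by rewrite inE pQ.
have ok v : v \in S -> v != y -> v \in small /\ (v \in posv /\ (0 < ed m [set v] S)%N \/
    (exists a b, [/\ a \in S, b \in S, a != b, (0 < m v a)%N & (0 < m v b)%N])).
  move=> /UP [->|[p pQ vp] _]; first by rewrite eqxx.
  have [i sc l _] := sP p pQ; split; first by apply: (subsetP (cp_sub p)); apply: sc.
  have inS a : a \in y :: s p -> a \in S.
    by rewrite in_cons => /orP[/eqP ->|ap]; apply/UP; [left|right; exists p].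
  case: (eqVneq v (last y (s p))) => [e|ne]; [left|right].
    rewrite {1}e l; split; first exact: Qp.
    by have [a aS ma] := ipath_nbr gm i vp; exact: leq_trans ma (ed_ge1 v (inS a aS)).
  by have [a [b [h1 h2 h3 h4 h5]]] := ipath_inner gm i vp ne; exists a, b; split=> //; apply: inS.
have bnd := bigP yV yS.
apply: (@legal_tree R T V m rho gm va cr S) => //.
- by apply/set0Pn; exists y; apply/UP; left.
- move=> v vS; case: (eqVneq v y) => [->|n]; last by have [v1 v2] := ok v vS n; have [] := small_ok v1 sS v2.
  move: big; case: eqP => [r6|r6] big.
    by case: (ed m [set y] (V :\: S)) ds => [|[|k]] ds; [left|right|move: ds big sumle sum2; clear; lia].
  by left; move: ds big sumle sum2; clear; lia.
- move=> u v uS vS muv; case: (eqVneq u y) => [eu|n]; last by have [v1 v2] := ok u uS n; have [_ k] := small_ok v1 sS v2; apply: (k v).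
  subst u; have [e|[p pQ vp]] := UP _ _ vS; first by move: muv; rewrite e (proj2 gm).
  have ev : v = h p by apply: hu => //; rewrite muv.
  have pD : p \in Dbl by rewrite inE pQ -ev muv eqxx.
  have D0 : (0 < #|Dbl|)%N by apply/card_gt0P; exists p.
  by move: big; case: eqP => r6 big; [split=> //|]; move: ds big sumle sum2 D0; clear; lia.
Qed.

End Small.

(** * Gluing at 4-vertices and double leaves *)

Section Gluing2.
Variables (R : realFieldType) (T : finType).
Notation col := {ffun T -> C3}.
Implicit Types (A B C U W S : {set T}) (m : T -> T -> nat) (rho : T -> nat) (M : T -> T -> C3 -> C3 -> bool) (b : T -> C3).

Lemma solves_upd U M rho b (Om : finType) (P : Om -> R) mu K y be : rho y = 6%N ->
  solves U M (upd y 4%N rho) (upd y be b) P mu K -> solves U M rho b P mu K.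
Proof.
move=> y6 [k0 k1 k2]; split=> //.
  move=> w phi Pw kp; have [o l] := k1 w phi Pw kp; split=> // v vU v3; apply: l => //.
  by rewrite updN //; apply: contra_eqN v3 => /eqP ->; rewrite y6.
move=> v vU; have [a e] := k2 v vU; split=> // v4.
have n : v != y by apply: contra_eqN v4 => /eqP ->; rewrite y6.
by move: e; rewrite !updN // => /(_ v4).
Qed.

(* A 4-vertex has the same law in any two distributions, which can therefore be glued along it. *)
Lemma glue_vertex U W M rho b (Om : finType) (P : Om -> R) mu K m y (L : col -> R) :
  cov (U :|: W) m M -> isd P -> [disjoint U & W] -> solves U M rho b P mu K ->
  (forall v, v \in W -> rho v != 3%N) -> y \in U -> rho y = 4%N ->
  (forall u z, u \in U -> z \in W -> u != y -> m u z = 0%N) ->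
  good (y |: W) M rho b L -> exists K', solves (U :|: W) M rho b P mu K'.
Proof.
move=> cV dP dUW s1 n3 yU y4 m0 [l0 l1 l2].
have [_ _ k2] := s1; have [_ e1] := k2 y yU; have [_ e2] := l2 y (setU11 _ _).
have pos d : 0 < pr L (fun phi => phi y == d).
  by rewrite e2 //; case/andP: (p4_bd R (b y) d); lra.
pose k (c d : C3) : R := (d == c)%:R.
have k0 c : isd (k c) by exact: isd_point.
apply: (attach (La := retarget L y k) cV dP dUW s1 n3 yU m0).
- by move=> c; exact: retarget_isd.
- move=> c psi /(retarget_gt0 l0 pos (k0 c)) [/l1 o kp].
  have ec : psi y = c by move: kp; rewrite /k; case: eqP => //; rewrite ltxx.
  split=> [u v uW vW|z zW]; first by apply: o; rewrite inE ?uW ?vW orbT.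
  rewrite -ec; apply: o; rewrite ?inE ?eqxx ?zW ?orbT //.
  by apply: contraTneq zW => <-; rewrite (disjointFr dUW yU).
apply: (@eq_marg _ _ _ _ _ L) => [psi|v vW]; last by apply: l2; rewrite inE vW orbT.
rewrite (retarget_avg (mu := fun c => pr (bind P K) (fun phi => phi y == c)) psi pos) // => d.
rewrite (bigD1 d) //= /k eqxx mulr1 big1 ?addr0 => [|c n]; last by rewrite eq_sym (negbTE n) mulr0.
by rewrite e1 // e2.
Qed.

Lemma solves_good U M rho b (L : col -> R) (Om : finType) (P : Om -> R) mu : isd P ->
  (forall v, v \in U -> rho v != 3%N) -> good U M rho b L -> solves U M rho b P mu (fun _ => L).
Proof.
move=> [P0 P1] n3 [l0 l1 l2]; split=> // [w phi _ /l1 o|]; first by split=> // v /n3 /eqP.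
by apply: eq_marg l2 => psi; rewrite /bind -mulr_suml P1 mul1r.
Qed.

(** The middle vertex has mass 1/5 at a color that is special for neither double edge and 2/5 at
    both others, which serves the two double edges at once. *)
Lemma double_double_flex m rho p1 y p2 : gr m -> p1 != y -> p2 != y -> p1 != p2 -> m y p1 = 2%N -> m y p2 = 2%N ->
  m p1 p2 = 0%N -> rho p1 = 6%N -> rho p2 = 6%N -> rho y = 6%N -> flex R (p2 |: (p1 |: [set y])) m rho.
Proof.
move=> gm n1 n2 n12 m1 m2 m0 r1 r2 ry M b Om P mu cV dP ad.
have c1 : cov (p1 |: [set y]) m M by apply: covS cV (subsetUr _ _) _ => *.
have n1' : y != p1 by rewrite eq_sym.
have n2' : y != p2 by rewrite eq_sym.
have [f1 [g1 [fi1 gi1 h1]]] := cov2 c1 (setU1r p1 (set11 y)) (setU11 p1 _) n1' m1.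
have yV : y \in p2 |: (p1 |: [set y]) by rewrite !inE eqxx !orbT.
have [f2 [g2 [fi2 gi2 h2]]] := cov2 cV yV (setU11 p2 _) n2' m2.
pose c0 := third (sp_color f1 g1) (sp_color f2 g2).
pose a c : R := if c == c0 then 1 / 5 else 2 / 5.
have da : isd a.
  split=> [c|]; first by rewrite /a; case: ifP => _; lra.
  by rewrite sum3 /a; case: (c0) => [[]|] /=; lra.
have lb c : 1 / 5 <= a c by rewrite /a; case: ifP => _; lra.
have [t1 t2] := thirdP (sp_color f1 g1) (sp_color f2 g2).
have s1 c : special f1 g1 c -> 2 / 5 <= a c.
  by move=> /(sp_colorE fi1 gi1) ->; rewrite /a eq_sym (negbTE t1).
have s2 c : special f2 g2 c -> 2 / 5 <= a c.
  by move=> /(sp_colorE fi2 gi2) ->; rewrite /a eq_sym (negbTE t2).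
have [L0 l0] := @law_point R T M (fun _ => a) y (erefl _) da.
have p1y : p1 \notin [set y] by rewrite inE.
have z1 u : u \in [set y] -> u != y -> m u p1 = 0%N by rewrite inE => ->.
have [L1 l1] := law_double c1 l0 (set11 y) p1y m1 z1 fi1 gi1 h1.
have y1 : y \in p1 |: [set y] by rewrite !inE eqxx orbT.
have p2y : p2 \notin p1 |: [set y] by rewrite !inE negb_or eq_sym n12.
have z2 u : u \in p1 |: [set y] -> u != y -> m u p2 = 0%N.
  by rewrite !inE => /orP[/eqP ->//|/eqP ->]; rewrite eqxx.
have [L2 [L20 L21 L22]] := law_double cV l1 y1 p2y m2 z2 fi2 gi2 h2.
exists (fun _ => L2); apply: solves_good => //.
  by move=> v; rewrite !inE => /or3P[] /eqP ->; rewrite ?r1 ?r2 ?ry.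
split=> // v vV; split; last by move: vV; rewrite !inE => /or3P[] /eqP ->; rewrite ?r1 ?r2 ?ry.
move=> c; rewrite L22 //; move: vV; rewrite !inE => /or3P[] /eqP ->.
- rewrite updE.
  under eq_bigr => d _ do rewrite updN //.
  exact: free_choice_lb.
- by rewrite updN // updE; exact: free_choice_lb.
- by rewrite !updN.
Qed.

Lemma flex_upd U m rho y : rho y = 6%N -> flex R U m (upd y 4%N rho) -> flex R U m rho.
Proof.
move=> y6; apply: flex_mono => v vU; case: (eqVneq v y) => [->|n]; last by rewrite updN //; left.
by rewrite updE; right.
Qed.

(** A 4-vertex has masses at most 2/5 and [u] at most 3/5, so the bridge can be coupled whatever the
    two laws are. *)
Lemma bridge_glue U W m rho x u : (forall v, v \in W -> rho v != 3%N) -> [disjoint U & W] ->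
  x \in U -> u \in W -> m x u = 1%N ->
  (forall y z, y \in U -> z \in W -> (y != x) || (z != u) -> m y z = 0%N) ->
  rho x = 4%N -> flex R U m rho -> flex R W m rho -> flex R (U :|: W) m rho.
Proof.
move=> n3 dUW xU uW m1 m0 x4 fU fW M b Om P mu cV dP ad.
have cU : cov U m M by apply: covS cV (subsetUl _ _) _ => *.
have cW : cov W m M by apply: covS cV (subsetUr _ _) _ => *.
have [|K s1] := fU M b Om P mu cU dP; first by move=> v vU; apply: ad; rewrite inE vU.
have [L gL] := flex_lawful n3 fW b cW.
have [_ _ k2] := s1; have [_ e1] := k2 x xU; have [l0 _ l2] := gL; have [e2 _] := l2 u uW.
apply: (glue_edge cV dP dUW s1 n3 xU uW m1 m0 gL) => c d.
rewrite e1 //; have := le35 (isd_marg u l0) e2 d; case/andP: (p4_bd R (b x) c); lra.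
Qed.

Lemma vertex_glue U W m rho y : (forall v, v \in W -> rho v != 3%N) -> [disjoint U & W] -> y \in U -> rho y = 4%N ->
  (forall u z, u \in U -> z \in W -> u != y -> m u z = 0%N) ->
  flex R U m rho -> flex R (y |: W) m rho -> flex R (U :|: W) m rho.
Proof.
move=> n3 dUW yU y4 m0 fU fW M b Om P mu cV dP ad.
have cU : cov U m M by apply: covS cV (subsetUl _ _) _ => *.
have cW : cov (y |: W) m M by apply: covS cV _ _ => //; apply: setSU; rewrite sub1set.
have [|K s1] := fU M b Om P mu cU dP; first by move=> v vU; apply: ad; rewrite inE vU.
have [|L gL] := flex_lawful _ fW b cW; last exact: glue_vertex cV dP dUW s1 n3 yU y4 m0 gL.
by move=> v; rewrite !inE => /orP[/eqP ->|/n3 //]; rewrite y4.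
Qed.

(** With [x] lowered to a 4-vertex its basepoint may be placed on the special color of the double
    edge, which then has mass 2/5. *)
Lemma double_leaf U m rho x z : gr m -> flex R U m (upd x 4%N rho) -> x \in U -> z \notin U -> rho x = 6%N -> rho z = 6%N ->
  m x z = 2%N -> (forall y, y \in U -> y != x -> m y z = 0%N) -> flex R (z |: U) m rho.
Proof.
move=> gm fU xU zU x6 z6 m2 m0 M b Om P mu cV dP ad.
have cU : cov U m M by apply: covS cV (subsetUr _ _) _ => *.
have nxz : x != z by apply: contraNneq zU => <-.
have [f [g [fi gi hM]]] := cov2 cV (setU1r z xU) (setU11 z _) nxz m2.
have [|K s1] := fU M (upd x (sp_color f g) b) Om P mu cU dP.
  move=> v vU; rewrite /upd; case: ifP => // _; apply: ad; by rewrite inE vU orbT.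
have z6' : upd x 4%N rho z = 6%N by rewrite updN // eq_sym.
have [|K2 s2] := attach_double cV dP zU s1 z6' xU m2 m0 fi gi hM; last by exists K2; exact: solves_upd s2.
move=> c /(sp_colorE fi gi) ->; have [_ _ k2] := s1; have [_ ->] := k2 x xU; rewrite ?updE //.
by rewrite /p4 eqxx.
Qed.

End Gluing2.

Lemma ed_one (T : finType) (m : T -> T -> nat) (A B : {set T}) u x : ed m A B = 1%N -> u \in A -> x \in B -> m u x = 1%N ->
  forall a b, a \in A -> b \in B -> (a != u) || (b != x) -> m a b = 0%N.
Proof.
move=> e uA xB m1 a b aA bB h; apply/eqP; rewrite -leqn0 leqNgt; apply/negP => p.
suff : (m u x + m a b <= ed m A B)%N by rewrite e m1; move: p; clear; lia.
case: (eqVneq a u) h => [->|n] /= h.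
  have uA' : [set u] \subset A by rewrite sub1set.
  by apply: leq_trans (edS m uA' (subxx B)); apply: ed_ge2 => //; rewrite eq_sym.
rewrite ed_sum (bigD1 u) //= leq_add ?ed_le ?inE // (bigD1 a) /= ?aA //.
by apply: leq_trans (leq_addr _ _); rewrite ed_le ?inE.
Qed.

(** * Sets joined to the rest by a single edge *)

Section Bridges.
Variables (R : realFieldType) (T : finType).
Implicit Types (A B C U W S : {set T}).
Variables (V : {set T}) (m : T -> T -> nat) (rho : T -> nat).
Hypotheses (gm : gr m) (va : valid rho) (cr : crit R V m rho) (ih : IHyp R T (meas V rho)) (potV : 0 < pot m rho V).
Notation d v := (dg V m v).
Notation ch v := (charge V m rho v).
Notation small := (small V m rho).
Notation posv := (posv V m rho).

Lemma pot_pos A : A \subset V -> A != set0 -> 0 < pot m rho A.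
Proof.
move=> s n; case: (eqVproper s) => [->//|p]; have := gap1 gm va cr ih potV p n; clear; lia.
Qed.

(** Induction along the path to the positive vertex. A 3-vertex [x] would be alone outside [A],
    against [unique3]; at a 4-vertex the sides are glued. A 6-vertex is lowered to 4 and glued
    unless it lies on a double edge xa. Then x and a are absorbed into [A], whose potential is
    unchanged since 6 + 6 - 4 - 8 = 0, and the bridge moves along the path. *)
Lemma bridge_no3 s A u x : A \proper V -> (forall v, v \in A -> rho v != 3%N) -> pot m rho A <= 2 ->
  u \in A -> x \in V :\: A -> m u x = 1%N -> ed m A (V :\: A) = 1%N ->
  ipath m x s -> {subset x :: s <= small :\: A} -> last x s \in posv -> False.
Proof.
have [n] := ubnP (size s); elim: n s A u x => // n IH s A u x lt pA n3 potA uA xB mux e1 ip sub lp.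
have sA := proper_sub pA; set B := V :\: A in xB e1.
have xV : x \in V by move: xB; rewrite inE => /andP[].
have xA : x \notin A by move: xB; rewrite inE => /andP[].
have xs : x \in small by have := sub x (mem_head _ _); rewrite in_setD => /andP[].
have mxu : m x u = 1%N by rewrite (proj1 gm).
have nx : forall y z, y \in B -> z \in A -> (y != x) || (z != u) -> m y z = 0%N.
  by move=> y z yB zA h; rewrite (proj1 gm); apply: (ed_one e1 uA xB mux) => //; rewrite orbC.
have dBA : [disjoint B & A] by rewrite disjoint_sym disjD.
have BUA : B :|: A = V by rewrite setUC UD.
have A0 : A != set0 by apply/set0Pn; exists u.
have pB : B \proper V by apply/properP; split; [exact: subsetDl|exists u; rewrite ?(subsetP sA) // inE uA].
have ux : u \in V := subsetP sA u uA.
have edx : ed m [set x] A = 1%N.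
  apply/eqP; rewrite eqn_leq; apply/andP; split; last by rewrite -mxu ed_le ?inE.
  by rewrite (edC _ _ gm) -e1; apply: edS; rewrite ?sub1set.
case: (r346 va x) => [x3|[x4|x6]].
- have dx : d x = 1%N by case: (boolP (x \in posv)) => [/(posP gm va cr ih potV)|/(zeroP gm va cr ih potV xs)] []; rewrite x3 => -[].
  have Bx : B :\ x = set0.
    apply/eqP/negPn/negP => nB.
    have pBx : B :\ x \proper V by apply: sub_proper_trans pB; exact: subsetDl.
    have [a [b []]] := connected gm va cr ih potV pBx nB; rewrite !in_setD1 => /andP[ax aB].
    rewrite in_setD in_setD1 negb_and negbK => /andP[+ bV].
    case: (eqVneq b x) => [-> _|bx /= bB] mab.
      have : (m x u + m x a <= ed m [set x] V)%N.
        apply: ed_ge2 => //; first by move: aB; rewrite inE => /andP[].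
        by apply: contraTneq aB => <-; rewrite inE uA.
      by rewrite -/(dg V m x) dx mxu (proj1 gm); move: mab; clear; lia.
    have bA : b \in A by move: bB; rewrite in_setD bV andbT negbK.
    by move: mab; rewrite (nx a b) // ax.
  apply: (unique3 gm va cr ih potV xV x3) => v vV vx v3.
  case: (boolP (v \in A)) => vA; first by have := n3 v vA; rewrite v3.
  by have : v \in B :\ x by [rewrite !inE vx vA]; rewrite Bx inE.
- apply: (proj1 cr); rewrite -BUA; apply: (bridge_glue n3 dBA xB uA mxu nx x4); exact: (sub_flex gm cr).
pose r4 := upd x 4%N rho.
have n3' v : v \in A -> r4 v != 3%N.
  by move=> vA; rewrite /r4 updN ?n3 //; apply: contraNneq xA => <-.
have fA : flex R A m r4.
  by apply: (sub_flex' gm cr pA) => v vA; rewrite /r4 updN //; apply: contraNneq xA => <-.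
have fAx : flex R ([set x] :|: A) m r4.
  apply: (bridge_glue (x := x) (u := u) n3') => //.
  - by rewrite disjoints1.
  - by rewrite inE.
  - by move=> y z; rewrite inE => /eqP -> zA h; apply: nx => //.
  - by rewrite /r4 updE.
  - by apply: tr_flex; [exact: tr1|move=> v _; exact: valid_upd].
case: (classic (flex R B m r4)) => [fB|nfB].
  apply: (proj1 cr); apply: (flex_upd x6); rewrite -BUA.
  by apply: (bridge_glue n3' dBA xB uA mxu nx) => //; rewrite /r4 updE.
have [W [sW xW nfW alt]] := upd_nonflex (r := 4%N) gm va cr ih xV isT (proper_sub pB) (or_introl pB) nfB.
have potW : pot m rho W = pot m r4 W + 2 by rewrite /r4 pot_upd // x6; clear; lia.
have dWA : [disjoint W & A] by apply: disjointWl dBA.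
have eWA : ed m W A = 1%N.
  apply/eqP; rewrite eqn_leq; apply/andP; split; last by rewrite -edx; apply: edS; rewrite ?sub1set.
  by rewrite (edC _ _ gm) -e1; apply: edS.
have potWA := potU rho gm dWA; rewrite eWA in potWA.
have sWA : W :|: A \subset V by rewrite subUset sA (subset_trans sW) // subsetDl.
have WA0 : W :|: A != set0 by apply/set0Pn; exists x; rewrite inE xW.
have posWA := pot_pos sWA WA0.
case: alt => [le|[[a [z [az eW m2 a6 z4]]]|h6]]; last by have := h6 x xW; rewrite updE.
  by rewrite -/r4 in le; move: potWA posWA; rewrite potW; move: le potA; clear; lia.
have ez : x = z by move: xW; rewrite eW !inE => /orP[] /eqP // e; move: a6; rewrite -e updE.
subst z; rewrite updN // in a6.
have aW : a \in W by rewrite eW !inE eqxx.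
have aB := subsetP sW a aW; have [aV aA] : a \in V /\ a \notin A by move: aB; rewrite inE => /andP[].
have mxa : m x a = 2%N by rewrite (proj1 gm).
have dx : (d x <= 3)%N := small_le3 gm va cr ih potV xs.
have xa0 w : w \in V -> w != u -> w != a -> m x w = 0%N.
  move=> wV wu wa.
  have : (m x u + m x a + m x w <= d x)%N.
    rewrite /dg ed1l (bigD1 u) //= -addnA leq_add2l (bigD1 a) /=; last by rewrite aV; apply: contraNneq aA => ->.
    by rewrite leq_add2l (bigD1 w) /= ?leq_addr // wV wu wa.
  by rewrite mxu mxa; move: dx; clear; lia.
case: s lt ip sub lp => [|v s] lt ip sub lp.
  case: (posP gm va cr ih potV lp) => -[]; rewrite /= ?x6 // => _ dx2.
  have : (m x u + m x a <= d x)%N by apply: ed_ge2 => //; apply: contraNneq aA => <-.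
  by rewrite dx2 mxu mxa.
move: ip => /= /and4P[xv nxv /allP as0 ip].
have vsA : v \in small :\: A by apply: sub; rewrite !inE eqxx orbT.
have [vs vA] : v \in small /\ v \notin A by move: vsA; rewrite in_setD => /andP[].
have vV := subsetP (small_sub V m rho) v vs.
have va' : v = a.
  apply/eqP/negPn/negP => n'; move: xv; rewrite xa0 //; by apply: contraNneq vA => ->.
subst v.
have aneq : a \notin [set x] :|: A by rewrite !inE negb_or az.
have eaA y : y \in A -> m y a = 0%N by move=> yA; rewrite (proj1 gm); apply: nx => //; rewrite az.
pose A' := a |: ([set x] :|: A).
have sA' : A' \subset V by rewrite !subUset !sub1set aV xV.
have potA' : pot m rho A' <= 2.
  have p1 : pot m rho ([set x] :|: A) = 6 + pot m rho A - 4.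
    by rewrite potU ?disjoints1 // pot1 // edx x6; clear; lia.
  have p2 : pot m rho A' = 6 + (6 + pot m rho A - 4) - 8.
    rewrite /A' potU ?disjoints1 // pot1 // p1 a6.
    have -> : ed m [set a] ([set x] :|: A) = 2%N.
      rewrite edUr ?disjoints1 // ed11 m2 ed1l big1 ?addn0 // => y yA; rewrite (proj1 gm); exact: eaA.
    by clear; lia.
  by rewrite p2; move: potA; clear; lia.
case: (eqVproper sA') => [eV|pA'].
  apply: (proj1 cr); rewrite -eV; apply: (double_leaf (x := x) gm fAx) => //.
  - by rewrite !inE eqxx.
  - by move=> y; rewrite !inE => /orP[/eqP ->|yA _]; [rewrite eqxx|exact: eaA].
have A'0 : A' != set0 by apply/set0Pn; exists a; exact: setU11.
have bb := bridge_bound gm va cr ih potV pA' A'0.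
have pos' := pot_pos sA' A'0.
have eaA' : ed m [set a] A' = 2%N.
  rewrite /A' edUr ?disjoints1 // edUr ?disjoints1 // !ed11 m2 (proj2 gm) ed1l big1 // => y yA.
  by rewrite (proj1 gm); exact: eaA.
have eD : ed m A' (V :\: A') = ed m [set a] (V :\: A').
  rewrite {1}/A' edUl ?disjoints1 // edUl ?disjoints1 // [X in (_ + (X + _))%N]/ed big_set1 big1 => [|w].
    rewrite [X in (_ + (_ + X))%N]/ed big1 ?addn0 // => y yA; apply: big1 => w.
    rewrite in_setD => /andP[wA' wV]; rewrite (proj1 gm); apply: nx => //.
      by rewrite in_setD wV andbT; apply: contra wA' => wA; rewrite !inE wA !orbT.
    by apply/orP; left; apply: contra wA' => /eqP ->; rewrite !inE eqxx !orbT.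
  rewrite in_setD => /andP[wA' wV]; apply: xa0 => //; apply: contra wA' => /eqP ->; rewrite !inE ?eqxx ?uA ?orbT //.
have da := dg_split m a sA'; rewrite eaA' -eD in da.
case: s lt ip sub lp as0 => [|w s] lt ip sub lp as0.
  case: (posP gm va cr ih potV lp) => -[]; rewrite /= ?a6 // => _ da2.
  by move: da bb pos'; rewrite da2; clear; lia.
have da3 := small_le3 gm va cr ih potV vs.
have ntail := ipath_notin ip.
have ws : {subset w :: s <= small :\: A'}.
  move=> v vw; have /andP[vx _] := as0 v vw.
  have : v \in small :\: A by apply: sub; rewrite !in_cons -in_cons vw !orbT.
  rewrite !in_setD => /andP[vA1 ->]; rewrite andbT !inE !negb_or vx vA1 /= andbT.
  by apply: contraNneq ntail => <-.
have wD : w \in V :\: A'.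
  have := ws w (mem_head _ _); rewrite !in_setD => /andP[-> w1]; exact: (subsetP (small_sub V m rho)).
have aA' : a \in A' by exact: setU11.
move: ip => /= /and4P[maw _ _ ip].
have e1' : ed m A' (V :\: A') = 1%N.
  have := ed_ge1 m a wD; rewrite -eD; move: maw da da3; clear; lia.
have maw1 : m a w = 1%N.
  have := ed_ge1 m a wD; rewrite -eD e1'; move: maw; clear; lia.
apply: (IH s A' a w) => //.
- by move: lt; rewrite /=; clear; lia.
- by move=> v; rewrite !inE => /or3P[/eqP ->|/eqP ->|/n3 //]; rewrite ?a6 ?x6.
Qed.

End Bridges.

(** * Components of small vertices and their outer neighbors *)

Section Discharging.
Variables (R : realFieldType) (T : finType).
Implicit Types (A B C U W S : {set T}).
Variables (V : {set T}) (m : T -> T -> nat) (rho : T -> nat).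
Hypotheses (gm : gr m) (va : valid rho) (cr : crit R V m rho) (ih : IHyp R T (meas V rho)) (potV : 0 < pot m rho V).
Notation d v := (dg V m v).
Notation ch v := (charge V m rho v).
Notation small := (small V m rho).
Notation posv := (posv V m rho).
Notation cp p := (cp V m rho p).
Notation Qs y := (near_roots V m rho y).

Definition Np p := [set y in V :\: small | p \in Qs y].

Lemma NpP p y : reflect [/\ y \in V, y \notin small & p \in Qs y] (y \in Np p).
Proof.
by rewrite /Np in_set in_setD; apply: (iffP andP) => [[/andP[]]|[]] *; split=> //; apply/andP.
Qed.

Lemma QsP y p : reflect (p \in posv /\ exists2 v, v \in cp p & (0 < m y v)%N) (p \in Qs y).
Proof.
rewrite /near_roots in_set; apply: (iffP andP) => [[pp /existsP[v /andP[? ?]]]|[pp [v ? ?]]]; split=> //; first by exists v.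
by apply/existsP; exists v; apply/andP.
Qed.

Lemma cp_nbr p v w : v \in cp p -> w \in V -> (0 < m v w)%N -> w \in cp p \/ (w \in V /\ w \notin small).
Proof.
rewrite !cpE => /andP[vs pv] wV mvw; case: (boolP (w \in small)) => ws; [left|by right].
by apply: connect_trans pv _; apply: connect1; rewrite /= vs ws.
Qed.

Lemma cp_out p v w : p \in posv -> v \in cp p -> w \in V -> w \notin cp p -> (0 < m v w)%N -> w \in Np p.
Proof.
move=> pp vc wV wc mvw; have [h|[_ ws]] := cp_nbr vc wV mvw; first by rewrite h in wc.
by apply/NpP; split=> //; apply/QsP; split=> //; exists v => //; rewrite (proj1 gm).
Qed.

Lemma cp0 p : p \in posv -> cp p != set0.
Proof. by move=> pp; apply/set0Pn; exists p; exact: cp_self. Qed.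

Lemma Np0 p : p \in posv -> Np p = set0 -> V = cp p.
Proof.
move=> pp e; apply/eqP; rewrite eq_sym; apply/negPn/negP => n.
have pK : cp p \proper V by rewrite properEneq n cp_subV.
have [v [w [vc]]] := connected gm va cr ih potV pK (cp0 pp).
rewrite in_setD => /andP[wc wV] mvw; have := cp_out pp vc wV wc mvw; by rewrite e inE.
Qed.

Lemma cp_ch p v : p \in posv -> v \in cp p -> v != p -> ch v = 0.
Proof.
move=> pp; rewrite cpE => /andP[vs pv] n.
have vn : v \notin posv by apply: contra n => vp; rewrite (one_pos gm va cr ih potV pp vp pv).
move: vs vn; rewrite !inE => /andP[-> h] /=; rewrite -leNgt => h'; by apply/eqP; rewrite eq_le h h'.
Qed.

Lemma sum_ch p C : p \in posv -> C \subset cp p -> \sum_(v in C) ch v = if p \in C then ch p else 0.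
Proof.
move=> pp /subsetP s; case: ifP => pC.
  by rewrite (bigD1 p) //= big1 ?addr0 // => v /andP[vC n]; apply: cp_ch pp _ n; exact: s.
rewrite big1 // => v vC; apply: (cp_ch pp (s v vC)); apply: contraFneq pC => <- //.
Qed.

Lemma ch_pos6 p : p \in posv -> rho p = 6%N -> ch p = 2 /\ d p = 2%N.
Proof. by move=> /(posP gm va cr ih potV) [] [r e]; rewrite r // /charge r e. Qed.

Lemma cp_no3 p v : p \in posv -> rho p = 6%N -> v \in cp p -> rho v != 3%N.
Proof.
move=> pp p6 vc; case: (eqVneq v p) => [->|n]; first by rewrite p6.
have vs : v \in small by move: vc; rewrite cpE => /andP[].
have vn : v \notin posv.
  by apply: contra n => vp; move: vc; rewrite cpE => /andP[_ pv]; rewrite (one_pos gm va cr ih potV pp vp pv).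
by case: (zeroP gm va cr ih potV vs vn) => -[->].
Qed.

Lemma gap0 A : A \subset V -> A != set0 -> pot m rho V <= pot m rho A.
Proof.
move=> s n; case: (eqVproper s) => [->//|p]; have := gap gm va cr ih potV p n; clear; lia.
Qed.

Lemma sum_ed y : (\sum_(p in Qs y) ed m [set y] (cp p) <= d y)%N.
Proof.
rewrite /dg ed1l (eq_bigr (fun p => \sum_(v in V | v \in cp p) m y v)%N) => [|p _]; last first.
  rewrite ed1l; apply: eq_bigl => v; case: (boolP (v \in cp p)) => vc; rewrite ?andbF // andbT.
  by rewrite (subsetP (cp_subV V m rho p) v vc).
rewrite (exchange_big_dep (mem V)) /= => [|p v _ /andP[]//]; apply: leq_sum => v vV.
rewrite sum_nat_const -[X in (_ <= X)%N]mul1n leq_mul2r; apply/orP; right.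
apply/card_le1_eqP => p q; move=> /and3P[pQ _ pv] /and3P[qQ _ qv].
have [pp _] := QsP _ _ pQ; have [qp _] := QsP _ _ qQ.
apply/eqP/negPn/negP => n; have [] := cp_disj gm va cr ih potV qp pp n qv pv; by rewrite eqxx.
Qed.

Section AllToOne.
Variables (p y : T).
Hypotheses (pp : p \in posv) (p6 : rho p = 6%N) (Npy : Np p = [set y]).
Let K := cp p.
Let e1 := ed m K [set y].
Let A := y |: K.
Let B := V :\: K.

Lemma a1_y : [/\ y \in V, y \notin small, p \in Qs y & y \notin K].
Proof.
have /NpP[yV ys pQ] : y \in Np p by rewrite Npy inE.
by split=> //; apply: contra ys => h; apply: (subsetP (cp_sub V m rho p)).
Qed.

Lemma a1_out v w : v \in K -> w \in V -> w \notin K -> w != y -> m v w = 0%N.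
Proof.
move=> vK wV wK wy; apply/eqP; rewrite -leqn0 leqNgt; apply/negP => h.
by have := cp_out pp vK wV wK h; rewrite Npy inE (negbTE wy).
Qed.

Lemma a1_AV : A \subset V.
Proof. by have [yV _ _ _] := a1_y; rewrite subUset sub1set yV cp_subV. Qed.

Lemma a1_edB C : C \subset K -> ed m B C = ed m [set y] C.
Proof.
move=> /subsetP CK; have [yV _ _ yK] := a1_y.
have yB : y \in B by rewrite in_setD yV yK.
rewrite -(setD1K yB) edUl ?disjoints1 ?setD11 // [X in (_ + X)%N]/ed big1 ?addn0 // => u.
rewrite in_setD1 in_setD => /and3P[uy uK uV]; apply: big1 => v vC.
by rewrite (proj1 gm); apply: a1_out => //; exact: CK.
Qed.

(** The charge of the component sits at [p], where it is 2, and all outer edges go to [y]. *)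
Lemma a1_potK : pot m rho K = 2 + 2 * e1%:Z.
Proof.
rewrite (potE m rho (cp_subV V m rho p)) (sum_ch pp (subxx _)) cp_self // (proj1 (ch_pos6 pp p6)).
by rewrite (edC _ _ gm) -/B a1_edB // (edC _ _ gm).
Qed.

Lemma a1_e1 : (2 <= e1)%N.
Proof.
have [yV _ _ yK] := a1_y.
have pK : K \proper V by apply/properP; split; [exact: cp_subV|exists y].
have := bridge_bound gm va cr ih potV pK (cp0 pp).
rewrite a1_potK (edC _ _ gm) -/B a1_edB // (edC _ _ gm) -/e1; clear; lia.
Qed.

Lemma a1_potA : pot m rho A = 2 + (rho y)%:Z - 2 * e1%:Z.
Proof.
have [_ _ _ yK] := a1_y.
by rewrite potU ?disjoints1 // pot1 // a1_potK (edC _ K gm) -/e1; clear; lia.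
Qed.

Lemma a1_BK : B :|: K = V.
Proof. by rewrite setUC UD // cp_subV. Qed.

Lemma a1_dBK : [disjoint B & K].
Proof. by rewrite disjoint_sym disjD. Qed.

Lemma a1_pB : B \proper V.
Proof.
apply/properP; split; first exact: subsetDl.
by exists p; rewrite ?(subsetP (cp_subV V m rho p)) ?cp_self // in_setD cp_self.
Qed.

Lemma a1_dy : A = V -> d y = e1.
Proof.
move=> eA; rewrite /dg -eA edUr; first by rewrite ed11 (proj2 gm) (edC _ K gm).
by have [_ _ _ yK] := a1_y; rewrite disjoints1.
Qed.

(** At a 4-vertex [y] the two sides could be glued; a 3-vertex contradicts [unique3] if [A] is
    everything and the lower bound on the potential of [A] otherwise. *)
Lemma a1_y6 : rho y = 6%N /\ A \proper V.
Proof.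
have [yV ys pQ yK] := a1_y; have h := a1_potA; have e2 := a1_e1.
have big := bigP gm va cr ih potV yV ys.
have nAV : A = V -> rho y = 3%N.
  move=> eA; have dy := a1_dy eA; move: h; rewrite eA => h; move: potV; rewrite h.
  by case: big => -[-> d0] //; move: d0; rewrite dy; clear; lia.
have no3 v : v \in K -> rho v != 3%N by exact: cp_no3.
case: (eqVproper a1_AV) => [eA|pA].
  exfalso; apply: (unique3 gm va cr ih potV yV (nAV eA)) => v; rewrite -eA => /setU1P[->|/no3 /eqP //].
  by rewrite eqxx.
split=> //; have A0 : A != set0 by apply/set0Pn; exists y; exact: setU11.
have g1 := gap1 gm va cr ih potV pA A0; rewrite h in g1.
case: big => -[ry _] //; first by move: g1 e2; rewrite ry; clear; lia.
exfalso; apply: (proj1 cr); rewrite -a1_BK; apply: (vertex_glue (y := y)) => //.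
- exact: a1_dBK.
- by rewrite in_setD yV yK.
- move=> u z; rewrite in_setD => /andP[uK uV] zK uy; rewrite (proj1 gm); exact: a1_out.
- exact: (sub_flex gm cr a1_pB).
- exact: (sub_flex gm cr pA).
Qed.

Lemma a1_e23 : e1 = 2%N \/ e1 = 3%N.
Proof.
have [y6 pA] := a1_y6; have A0 : A != set0 by apply/set0Pn; exists y; exact: setU11.
have g1 := gap1 gm va cr ih potV pA A0; move: g1 a1_e1; rewrite a1_potA y6; clear.
by case: (e1) => [|[|[|[|k]]]]; [| |left|right|lia].
Qed.

(** If both sides stayed flexible with [y] lowered to 4, they could be glued along [y]. Failure on
    the outer side yields the double edge. Failure on the side of [K] would make [K] a single vertex
    joined to [y] by a double edge, which [double_leaf] adds to the outer side. *)
Lemma a1_double : e1 = 2%N -> exists z, [/\ z \in V, z \notin A, rho z = 6%N & m y z = 2%N].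
Proof.
move=> e2; have [yV ys pQ yK] := a1_y; have [y6 pA] := a1_y6.
have yB : y \in B by rewrite in_setD yV yK.
have potVB : pot m rho V = pot m rho B - 2.
  by rewrite -{1}a1_BK potU ?a1_dBK // a1_edB // a1_potK (edC _ K gm) -/e1 e2; clear; lia.
have no3 v : v \in K -> rho v != 3%N by exact: cp_no3.
pose r4 := upd y 4%N rho.
have no3' v : v \in K -> r4 v != 3%N.
  by move=> vK; rewrite /r4 updN ?no3 //; apply: contraNneq yK => <-.
have out u z : u \in B -> z \in K -> u != y -> m u z = 0%N.
  by rewrite in_setD => /andP[uK uV] zK uy; rewrite (proj1 gm); exact: a1_out.
have potW W : y \in W -> pot m rho W = pot m r4 W + 2.
  by move=> yW; rewrite /r4 pot_upd // y6; clear; lia.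
have sBV : B \subset V by exact: subsetDl.
case: (classic (flex R B m r4)) => [fB|nfB]; last first.
  have [W [sW yW nfW alt]] := upd_nonflex (r := 4%N) gm va cr ih yV isT sBV (or_introl a1_pB) nfB.
  have dWK : [disjoint W & K] by apply: disjointWl a1_dBK.
  have eWK : ed m W K = ed m [set y] K.
    apply/eqP; rewrite eqn_leq [X in _ && X]edS ?sub1set // andbT -(a1_edB (subxx K)); exact: edS.
  have pWK : pot m rho (W :|: K) = pot m rho W - 2.
    by rewrite potU // eWK a1_potK (edC _ K gm) -/e1 e2; clear; lia.
  have sWK : W :|: K \subset V by rewrite subUset cp_subV (subset_trans sW).
  have WK0 : W :|: K != set0 by apply/set0Pn; exists y; rewrite inE yW.
  have pos := gap0 sWK WK0; rewrite pWK in pos.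
  case: alt => [le|[[x [z [xz eW m2 x6 z4]]]|h6]]; last by have := h6 y yW; rewrite updE.
    by exfalso; rewrite -/r4 in le; move: pos; rewrite (potW W yW); move: le potV; clear; lia.
  have ez : y = z by move: yW; rewrite eW !inE => /orP[] /eqP // e; move: x6; rewrite -e updE.
  subst z; rewrite updN // in x6.
  have xB : x \in B by apply: (subsetP sW); rewrite eW !inE eqxx.
  move: xB; rewrite in_setD => /andP[xK xV]; exists x; split=> //; last by rewrite (proj1 gm).
  by rewrite in_setU1 negb_or xz.
case: (classic (flex R A m r4)) => [fA|nfA].
  exfalso; apply: (proj1 cr); apply: (flex_upd y6); rewrite -a1_BK; apply: (vertex_glue (y := y)) => //.
  - exact: a1_dBK.
  - by rewrite /r4 updE.
have [W [sW yW nfW alt]] := upd_nonflex (r := 4%N) gm va cr ih yV isT a1_AV (or_introl pA) nfA.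
pose W' := W :\ y.
have sW' : W' \subset K.
  by apply/subsetP => v; rewrite in_setD1 => /andP[vy /(subsetP sW)]; rewrite !inE (negbTE vy).
have yW' : y \notin W' by rewrite setD11.
have potW' : pot m rho W = 6 + pot m rho W' - 4 * (ed m [set y] W')%:Z.
  by rewrite -(setD1K yW) potU ?disjoints1 // pot1 // y6.
have dBW' : [disjoint B & W'] by apply: disjointWr a1_dBK.
have potD : pot m rho (B :|: W') = pot m rho B + pot m rho W - 6.
  by rewrite potU // a1_edB // potW'; clear; lia.
have sD : B :|: W' \subset V by rewrite subUset sBV (subset_trans sW') // cp_subV.
have D0 : B :|: W' != set0 by apply/set0Pn; exists y; rewrite inE yB.
case: alt => [le|[[x [z [xz eW m2 x6 z4]]]|h6]]; last by have := h6 y yW; rewrite updE.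
  exfalso; have := gap0 sD D0; rewrite -/r4 in le; rewrite potD potVB (potW W yW); move: le; clear; lia.
have ez : y = z by move: yW; rewrite eW !inE => /orP[] /eqP // e; move: x6; rewrite -e updE.
subst z; rewrite updN // in x6.
case: (eqVproper sD) => [eD|pD]; last first.
  have := gap gm va cr ih potV pD D0; rewrite potD potVB {1}eW pot2 // m2 x6 y6; clear; lia.
exfalso; apply: (proj1 cr).
have eK : K = [set x].
  have -> : [set x] = W'.
    rewrite /W' eW; apply/setP => v; rewrite !inE; case: (eqVneq v y) => [->|] /=; last by rewrite orbF.
    by rewrite eq_sym (negbTE xz).
  apply/eqP; rewrite eqEsubset sW' andbT; apply/subsetP => v vK.
  have : v \in B :|: W' by rewrite eD (subsetP (cp_subV V m rho p)).
  by rewrite in_setU in_setD vK.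
rewrite -a1_BK setUC eK; apply: (double_leaf (x := y) gm fB) => //.
- by rewrite /B eK in_setD inE eqxx.
- by rewrite (proj1 gm).
- by move=> u uB uy; apply: out => //; rewrite eK inE.
Qed.

End AllToOne.
End Discharging.

(** * The discharging rule *)

Section Bad.
Variables (R : realFieldType) (T : finType).
Implicit Types (A B C U W S : {set T}).
Variables (V : {set T}) (m : T -> T -> nat) (rho : T -> nat).
Hypotheses (gm : gr m) (va : valid rho) (cr : crit R V m rho) (ih : IHyp R T (meas V rho)) (potV : 0 < pot m rho V).
Notation d v := (dg V m v).
Notation ch v := (charge V m rho v).
Notation small := (small V m rho).
Notation posv := (posv V m rho).
Notation cp p := (cp V m rho p).
Notation Qs y := (near_roots V m rho y).
Notation Np p := (Np V m rho p).

Lemma ed_only A y : A \subset V -> y \in A -> (forall v w, v \in A -> v != y -> w \in V :\: A -> m v w = 0%N) ->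
  d y = (ed m [set y] A + ed m A (V :\: A))%N.
Proof.
move=> sA yA z; rewrite (dg_split m y sA); congr (_ + _)%N.
rewrite -{2}(setD1K yA) edUl ?disjoints1 ?setD11 // [X in (_ = _ + X)%N]/ed big1 ?addn0 // => v.
by rewrite in_setD1 => /andP[vy vA]; apply: big1 => w; apply: z.
Qed.

Lemma bridge_y A y p : A \proper V -> (forall v, v \in A -> rho v != 3%N) -> pot m rho A <= 2 -> y \in A ->
  y \notin small -> p \in Qs y -> (forall v, v \in cp p -> v \notin A) -> ed m A (V :\: A) = 1%N -> False.
Proof.
move=> pA n3 potA yA ys pQ cA e1; have yV := subsetP (proper_sub pA) y yA.
have [s [i sc l n]] := branch gm yV ys pQ; case: s i sc l n => // x s /= /and4P[myx _ _ i] sc l _.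
have sub : {subset x :: s <= small :\: A}.
  by move=> v /sc vc; rewrite in_setD cA // (subsetP (cp_sub V m rho p)).
have xD : x \in V :\: A.
  by have := sub x (mem_head _ _); rewrite !in_setD => /andP[-> h]; exact: (subsetP (small_sub V m rho)).
have m1 : m y x = 1%N by have := ed_le m yA xD; rewrite e1; move: myx; clear; lia.
apply: (bridge_no3 gm va cr ih potV pA n3 potA yA xD m1 e1 i sub).
by rewrite l; have [] := QsP _ _ _ _ _ pQ.
Qed.

Lemma sum_ed2 y p1 p2 : p1 \in Qs y -> p2 \in Qs y -> p1 != p2 -> (ed m [set y] (cp p1) + ed m [set y] (cp p2) <= d y)%N.
Proof.
move=> q1 q2 n; apply: leq_trans (sum_ed gm va cr ih potV y).
by rewrite (bigD1 p1) //= leq_add2l (bigD1 p2) ?leq_addr //= q2 eq_sym.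
Qed.

Lemma sum_ed3 y p1 p2 p3 : p1 \in Qs y -> p2 \in Qs y -> p3 \in Qs y -> p1 != p2 -> p1 != p3 -> p2 != p3 ->
  (ed m [set y] (cp p1) + ed m [set y] (cp p2) + ed m [set y] (cp p3) <= d y)%N.
Proof.
move=> q1 q2 q3 n n1 n2; apply: leq_trans (sum_ed gm va cr ih potV y).
rewrite (bigD1 p1) //= -addnA leq_add2l (bigD1 p2) /=; last by rewrite q2 eq_sym.
by rewrite leq_add2l (bigD1 p3) ?leq_addr //= q3 ![p3 == _]eq_sym n1.
Qed.

Lemma Qs_ed y p : p \in Qs y -> (0 < ed m [set y] (cp p))%N.
Proof. by move=> /QsP [_ [v vc h]]; apply: leq_trans h _; apply: ed_ge1. Qed.

Lemma Qs_pos y p : p \in Qs y -> p \in posv. Proof. by case/QsP. Qed.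

Lemma cp_notin p q v : p \in posv -> q \in posv -> p != q -> v \in cp p -> v \notin cp q.
Proof.
by move=> pp qp n vp; apply/negP => vq; have [] := cp_disj gm va cr ih potV pp qp n vp vq; rewrite eqxx.
Qed.

Lemma cp_big p y : y \notin small -> y \notin cp p.
Proof. by move=> ys; apply: contra ys => h; exact: (subsetP (cp_sub V m rho p)). Qed.

(** The five edges at [y] must be two to each closed component and one to the third. The two closed
    components with [y] then have potential 2 and a single outer edge, which [bridge_y] forbids. *)
Lemma bad5 y p1 p2 p3 : d y = 5%N -> p1 \in posv -> p2 \in posv -> rho p1 = 6%N -> rho p2 = 6%N ->
  Np p1 = [set y] -> Np p2 = [set y] -> p3 \in Qs y -> p1 != p2 -> p1 != p3 -> p2 != p3 -> False.
Proof.
move=> dy pp1 pp2 r1 r2 N1 N2 q3 n12 n13 n23.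
have [yV ys q1 yK1] := a1_y N1; have [_ _ q2 yK2] := a1_y N2.
have [y6 _] := a1_y6 gm va cr ih potV pp1 r1 N1.
have := sum_ed3 q1 q2 q3 n12 n13 n23; rewrite dy.
have e1 := a1_e1 gm va cr ih potV pp1 r1 N1; have e2 := a1_e1 gm va cr ih potV pp2 r2 N2.
rewrite [ed m (_ p1) _](edC _ _ gm) in e1; rewrite [ed m (_ p2) _](edC _ _ gm) in e2.
have e3 := Qs_ed q3 => les.
have E1 : ed m [set y] (cp p1) = 2%N by move: e1 e2 e3 les; clear; lia.
have E2 : ed m [set y] (cp p2) = 2%N by move: e1 e2 e3 les; clear; lia.
pose A1 := y |: cp p1; pose A := cp p2 :|: A1.
have sA : A \subset V by rewrite !subUset !cp_subV sub1set yV.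
have yA : y \in A by rewrite !in_setU in_set1 eqxx orbT.
have n21 : p2 != p1 by rewrite eq_sym.
have c21 v : v \in cp p2 -> v \notin A1.
  move=> v2; rewrite in_setU1 negb_or (cp_notin pp2 pp1 n21 v2) andbT.
  by apply: contraNneq yK2 => <-.
have d2 : [disjoint cp p2 & A1].
  by rewrite disjoints_subset; apply/subsetP => v /c21; rewrite in_setC.
have pp3 := Qs_pos q3.
have out v w : v \in A -> v != y -> w \in V :\: A -> m v w = 0%N.
  move=> vA vy; rewrite in_setD => /andP[wA wV].
  have [wy w1 w2] : [/\ w != y, w \notin cp p1 & w \notin cp p2].
    split; apply: contra wA; first by move=> /eqP ->.
      by move=> h; rewrite in_setU in_setU1 h !orbT.
    by move=> h; rewrite in_setU h.
  move: vA; rewrite in_setU in_setU1 (negbTE vy) /= => /orP[v2|v1].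
    exact: (a1_out gm pp2 N2 v2).
  exact: (a1_out gm pp1 N1 v1).
have eyA : ed m [set y] A = 4%N.
  by rewrite /A edUr // /A1 edUr ?disjoints1 // ed11 (proj2 gm) E1 E2.
have := ed_only sA yA out; rewrite dy eyA => eD.
have eA : ed m A (V :\: A) = 1%N by move: eD; clear; lia.
have potA : pot m rho A = 2.
  have eA1 : ed m (cp p2) A1 = 2%N.
    rewrite /A1 edUr ?disjoints1 // (edC _ [set y] gm) E2 [X in (_ + X)%N]/ed big1 ?addn0 // => v v2.
    by apply: big1 => w w1; case: (cp_disj gm va cr ih potV pp2 pp1 n21 v2 w1).
  have p1E := a1_potA gm va cr ih potV pp1 r1 N1; rewrite (edC _ _ gm) E1 y6 in p1E.
  have p2E := a1_potK gm va cr ih potV pp2 r2 N2; rewrite (edC _ _ gm) E2 in p2E.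
  by rewrite /A potU // p2E p1E eA1.
have c3 v : v \in cp p3 -> v \notin A.
  move=> v3; rewrite in_setU in_setU1 !negb_or.
  have n31 : p3 != p1 by rewrite eq_sym.
  have n32 : p3 != p2 by rewrite eq_sym.
  rewrite (cp_notin pp3 pp2 n32 v3) (cp_notin pp3 pp1 n31 v3) andbT.
  by apply: contraNneq (cp_big p3 ys) => <-.
have pA : A \proper V.
  apply/properP; split=> //; exists p3; first by apply: (subsetP (cp_subV V m rho p3)); exact: cp_self.
  by apply: c3; exact: cp_self.
apply: (bridge_y pA _ _ yA ys q3 c3 eA); last by rewrite potA.
move=> v; rewrite in_setU in_setU1 => /or3P[v2|/eqP ->|v1]; [|by rewrite y6|].
  exact: (cp_no3 gm va cr ih potV pp2 r2 v2).
exact: (cp_no3 gm va cr ih potV pp1 r1 v1).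
Qed.

(** If three edges go to the component of [p1], that component with [y] is joined to the rest by one
    edge. If two do, the others form the double edge of [a1_double], and the bridge argument is
    repeated one vertex further. What survives is a path of two double edges with center [y],
    settled by [double_double_flex]. *)
Lemma bad4 y p1 p2 : d y = 4%N -> p1 \in posv -> rho p1 = 6%N ->
  Np p1 = [set y] -> p2 \in Qs y -> p1 != p2 -> False.
Proof.
move=> dy pp1 r1 N1 q2 n12.
have [yV ys q1 yK1] := a1_y N1; have yK2 := cp_big p2 ys; have pp2 := Qs_pos q2.
have [y6 pA1] := a1_y6 gm va cr ih potV pp1 r1 N1.
have n21 : p2 != p1 by rewrite eq_sym.
have := sum_ed2 q1 q2 n12; rewrite dy => les.
have e2 := Qs_ed q2.
have no3 v : v \in y |: cp p1 -> rho v != 3%N.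
  rewrite in_setU1 => /orP[/eqP ->|v1]; [by rewrite y6|exact: (cp_no3 gm va cr ih potV pp1 r1 v1)].
have c2 v : v \in cp p2 -> v \notin y |: cp p1.
  move=> v2; rewrite in_setU1 negb_or (cp_notin pp2 pp1 n21 v2) andbT.
  by apply: contraNneq yK2 => <-.
have sA1 := proper_sub pA1; have yA1 := setU11 y (cp p1).
have eyA1 : ed m [set y] (y |: cp p1) = ed m [set y] (cp p1).
  by rewrite edUr ?disjoints1 // ed11 (proj2 gm).
have out1 v w : v \in cp p1 -> w \in V -> w \notin y |: cp p1 -> m v w = 0%N.
  by move=> v1 wV; rewrite in_setU1 negb_or => /andP[wy w1]; apply: (a1_out gm pp1 N1 v1).
have potA1 := a1_potA gm va cr ih potV pp1 r1 N1; rewrite y6 in potA1.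
case: (a1_e23 gm va cr ih potV pp1 r1 N1) => E1; last first.
  have E1' : ed m [set y] (cp p1) = 3%N by rewrite (edC _ _ gm).
  apply: (bridge_y pA1 no3 _ yA1 ys q2 c2); first by rewrite potA1 E1.
  have := ed_only sA1 yA1; rewrite dy eyA1 E1' => h.
  suff : 4%N = (3 + ed m (y |: cp p1) (V :\: (y |: cp p1)))%N by clear; lia.
  apply: h => v w; rewrite in_setU1 => /orP[/eqP ->|v1 _]; first by rewrite eqxx.
  by rewrite in_setD => /andP[wA wV]; exact: out1.
have E1' : ed m [set y] (cp p1) = 2%N by rewrite (edC _ _ gm).
have [z [zV zA z6 myz]] := a1_double gm va cr ih potV pp1 r1 N1 E1.
have [zy zK1] : z != y /\ z \notin cp p1 by move: zA; rewrite in_setU1 negb_or => /andP[].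
have nbr v : v \in V -> v \notin cp p1 -> v != z -> m y v = 0%N.
  move=> vV v1 vz.
  have dz : [disjoint cp p1 & [set v; z]].
    by rewrite disjoint_sym disjoints_subset subUset !sub1set !in_setC v1.
  have : (ed m [set y] (cp p1 :|: [set v; z]) <= d y)%N.
    by apply: edS => //; rewrite !subUset cp_subV !sub1set vV zV.
  rewrite edUr // E1' edUr ?disjoints1 ?inE // !ed11 myz dy; clear; lia.
have [s [i sc l n]] := branch gm yV ys q2.
case: s i sc l n => // z' s /= /and4P[myz' _ /allP as0 i] sc l _.
have ez : z' = z.
  apply/eqP/negPn/negP => n; move: myz'; rewrite nbr //.
    by apply: (subsetP (cp_subV V m rho p2)); apply: sc; rewrite mem_head.
  by apply: (cp_notin pp2 pp1 n21); apply: sc; rewrite mem_head.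
subst z'; have zc : z \in cp p2 by apply: sc; rewrite mem_head.
have zs : z \in small := subsetP (cp_sub V m rho p2) z zc.
have mzy : m z y = 2%N by rewrite (proj1 gm).
pose A := z |: (y |: cp p1).
have sA : A \subset V by rewrite subUset sub1set zV.
have zA' : z \in A by rewrite setU11.
have ezA1 : ed m [set z] (y |: cp p1) = 2%N.
  rewrite edUr ?disjoints1 // ed11 mzy ed1l big1 // => v v1; rewrite (proj1 gm).
  exact: out1.
have potA : pot m rho A = 2.
  by rewrite potU ?disjoints1 // pot1 // z6 potA1 ezA1 E1.
have A0 : A != set0 by apply/set0Pn; exists z.
have out v w : v \in A -> v != z -> w \in V :\: A -> m v w = 0%N.
  rewrite !in_setU1 => /or3P[/eqP ->|/eqP -> _|v1 _]; first by rewrite eqxx.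
    rewrite in_setD !in_setU1 !negb_or => /andP[/and3P[wz wy w1] wV]; exact: nbr.
  by rewrite in_setD in_setU1 negb_or => /andP[/andP[_ w1] wV]; apply: out1.
have ezA : ed m [set z] A = 2%N by rewrite edUr ?disjoints1 // ed11 (proj2 gm).
have eD := ed_only sA zA' out; rewrite ezA in eD.
have dz := small_le3 gm va cr ih potV zs.
case: (eqVproper sA) => [eV|pA]; last first.
  have bb := bridge_bound gm va cr ih potV pA A0; rewrite potA in bb.
  case: s i as0 sc l => [|x s] i as0 sc l.
    have := posP gm va cr ih potV pp2; rewrite -l /= z6 => -[] [] // _ dz2.
    by move: bb eD; rewrite dz2; clear; lia.
  have ni := ipath_notin i; move: i => /= /and4P[mzx _ _ i].
  have xs : {subset x :: s <= small :\: A}.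
    move=> v vs; have vc : v \in cp p2 by apply: sc; rewrite in_cons vs orbT.
    rewrite in_setD in_setU1 negb_or c2 // (subsetP (cp_sub V m rho p2)) // !andbT.
    by apply: contraNneq ni => <-.
  have xD : x \in V :\: A.
    have := xs x (mem_head _ _); rewrite !in_setD => /andP[-> h]; exact: (subsetP (small_sub V m rho)).
  have e1 : ed m A (V :\: A) = 1%N by have := ed_le m zA' xD; move: mzx eD dz; clear; lia.
  have m1 : m z x = 1%N by have := ed_le m zA' xD; rewrite e1; move: mzx; clear; lia.
  apply: (bridge_no3 gm va cr ih potV pA _ _ zA' xD m1 e1 i xs); last by rewrite (_ : last x s = p2).
    by move=> v; rewrite in_setU1 => /orP[/eqP ->|/no3 //]; rewrite z6.
  by rewrite potA.
have Dz : V :\: A = set0 by rewrite eV setDv.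
rewrite Dz ed0r addn0 in eD.
have ez : cp p2 = [set z].
  apply/eqP; rewrite eqEsubset sub1set zc andbT; apply/subsetP => v v2; rewrite inE.
  have : v \in A by rewrite eV; exact: (subsetP (cp_subV V m rho p2)).
  by rewrite in_setU1 (negbTE (c2 v v2)) orbF.
have pz : p2 = z by have := cp_self pp2; rewrite ez inE => /eqP.
have N2 : Np p2 = [set y].
  apply/eqP; rewrite eqEsubset sub1set; apply/andP; split; last by apply/NpP.
  apply/subsetP => v /NpP [vV vs _]; rewrite inE.
  have : v \in A by rewrite eV.
  rewrite !in_setU1 => /or3P[/eqP e|//|v1]; first by rewrite e zs in vs.
  by rewrite (subsetP (cp_sub V m rho p1)) in vs.
have E2 : ed m (cp p2) [set y] = 2%N by rewrite ez ed11.
have p26 : rho p2 = 6%N by rewrite pz.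
have [w [wV wA w6 myw]] := a1_double gm va cr ih potV pp2 p26 N2 E2.
have w1 : w \in cp p1.
  move: wA; rewrite ez in_setU1 inE negb_or => /andP[wy wz]; have : w \in A by rewrite eV.
  by rewrite !in_setU1 (negbTE wy) (negbTE wz).
have ws : w \in small := subsetP (cp_sub V m rho p1) w w1.
have y0 v : v \in cp p1 -> v != w -> m y v = 0%N.
  by move=> v1 vw; have := ed_ge2 m y v1 w1 vw; rewrite E1' myw; clear; lia.
have mwy : m w y = 2%N by rewrite (proj1 gm).
pose C := cp p1 :\ w.
have sC : C \subset cp p1 by exact: subsetDl.
have C0 : C = set0.
  apply/eqP/negPn/negP => nC.
  have sCV : C \subset V by apply: subset_trans sC (cp_subV V m rho p1).
  have pC : C \proper V by apply/properP; split=> //; exists w => //; rewrite setD11.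
  have bb := bridge_bound gm va cr ih potV pC nC.
  have le : (ed m C (V :\: C) + 2 <= d w)%N.
    have -> : ed m C (V :\: C) = ed m [set w] C.
      rewrite (edC C _ gm); have wD : w \in V :\: C by rewrite in_setD setD11.
      rewrite -(setD1K wD) edUl ?disjoints1 ?setD11 // [X in (_ + X)%N]/ed big1 ?addn0 // => v.
      rewrite in_setD1 in_setD in_setD1 negb_and negbK => /and3P[vw /orP[e|v1] vV]; first by rewrite e in vw.
      apply: big1 => u; rewrite in_setD1 => /andP[uw u1]; case: (eqVneq v y) => [->|vy]; first exact: y0.
      by rewrite (proj1 gm); apply: (a1_out gm pp1 N1 u1).
    have dis : [disjoint C & [set y]].
      by rewrite disjoint_sym disjoints1; apply: contra yK1; rewrite in_setD1 => /andP[].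
    have e2w : ed m [set w] [set y] = 2%N by rewrite ed11.
    rewrite -e2w -edUr //; apply: edS => //; rewrite subUset sCV sub1set //.
  move: bb; rewrite (potE m rho sCV) (sum_ch gm va cr ih potV pp1 sC) in_setD1 (cp_self pp1) andbT.
  case: eqP => [e|e] /=.
    by have := posP gm va cr ih potV pp1; rewrite r1 => -[] [] // _; rewrite e => dw; move: le; rewrite dw; clear; lia.
  have [-> _] := ch_pos6 gm va cr ih potV pp1 r1.
  by have := small_le3 gm va cr ih potV ws; move: le; clear; lia.
have eK1 : cp p1 = [set p1].
  have e1 : cp p1 = [set w] by rewrite -(setD1K w1) -/C C0 setU0.
  by have := cp_self pp1; rewrite e1 inE => /eqP ->.
have ew : w = p1 by move: w1; rewrite eK1 inE => /eqP.
subst w; apply: (proj1 cr).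
have -> : V = z |: (p1 |: [set y]) by rewrite -eV /A eK1 [y |: _]setUC.
apply: double_double_flex => //.
- by apply: contraNneq yK1 => <-.
- by rewrite -pz.
- by case: (cp_disj gm va cr ih potV pp1 pp2 n12 w1 zc).
Qed.

(* The charge that the positive vertex [p] sends to [y]. *)
Definition wt p y : int := if y \in Np p then (if (rho p == 6%N) && (Np p == [set y]) then 2 else 1) else 0.

Lemma wt_send p : p \in posv -> Np p != set0 -> ch p <= \sum_(y in V :\: small) wt p y.
Proof.
move=> pp n0.
have eS (F : T -> int) : \sum_(y in V :\: small) (if y \in Np p then F y else 0) = \sum_(y in Np p) F y.
  rewrite -big_mkcondr; apply: eq_bigl => y; case: (boolP (y \in Np p)) => h; rewrite ?andbF // andbT.
  by have [yV ys _] := NpP _ _ _ _ _ h; rewrite in_setD ys.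
rewrite eS; have N1 : 1 <= #|Np p|%:Z by rewrite lez_nat card_gt0.
have cE : #|Np p|%:Z = \sum_(y in Np p) 1.
  by rewrite -sum1_card (big_morph Posz PoszD (erefl _)).
case: (posP gm va cr ih potV pp) => -[r dp].
  have -> : ch p = 2 by rewrite /charge r dp.
  case: (classic (exists y, Np p = [set y])) => [[y e]|ny].
    by rewrite e big_set1 r !eqxx.
  have c2 : 2 <= #|Np p|%:Z.
    rewrite lez_nat ltn_neqAle card_gt0 n0 andbT eq_sym; apply/negP => /cards1P[y e].
    by apply: ny; exists y.
  rewrite (eq_bigr (fun _ => 1)) -?cE // => y _; rewrite r eqxx /=; case: eqP => // e.
  by case: ny; exists y.
have -> : ch p = 1 by rewrite /charge r dp.
by rewrite (eq_bigr (fun _ => 1)) -?cE // => y _; rewrite r.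
Qed.

(** A root of weight 2 uses two edges at [y], so the amount received is at most the degree; together
    with [star_bound] this suffices except for a 6-vertex of degree 4 or 5, where only the
    configurations [bad4] and [bad5] exceed the charge. *)
Lemma wt_receive y : y \in V -> y \notin small -> \sum_(p in posv) wt p y <= - ch y.
Proof.
move=> yV ys.
pose t := [set p in Qs y | (rho p == 6%N) && (Np p == [set y])].
have NQ p : (y \in Np p) = (p \in Qs y) by apply/NpP/idP => [[]//|h]; split.
have -> : \sum_(p in posv) wt p y = (#|Qs y| + #|t|)%N%:Z.
  rewrite -sum1_card -[#|t|]sum1_card.
  have -> : (\sum_(p in t) 1 = \sum_(p in Qs y | (rho p == 6%N) && (Np p == [set y])) 1)%N.
    by apply: eq_bigl => p; rewrite in_set.
  rewrite [X in (_ + X)%N]big_mkcondr -big_split (big_morph Posz PoszD (erefl _)) /=.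
  rewrite (eq_bigr (fun p => if p \in Qs y then Posz (1 + (if (rho p == 6%N) && (Np p == [set y]) then 1 else 0)) else 0)) => [|p _].
    rewrite -big_mkcondr; apply: eq_bigl => p; case: (boolP (p \in Qs y)) => h; rewrite ?andbF // andbT.
    exact: Qs_pos h.
  by rewrite /wt NQ; case: (p \in Qs y) => //; case: ifP.
have tP p : p \in t -> [/\ p \in Qs y, p \in posv, rho p = 6%N & Np p = [set y]].
  by rewrite in_set => /and3P[pQ /eqP r /eqP N]; split=> //; exact: Qs_pos pQ.
have tQ : t \subset Qs y by apply/subsetP => p; rewrite in_set => /andP[].
have tQc := subset_leq_card tQ.
have star := star_bound gm va cr ih potV yV ys.
have sumb : (#|Qs y| + #|t| <= d y)%N.
  apply: leq_trans (sum_ed gm va cr ih potV y).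
  have -> : #|t| = (\sum_(p in Qs y | p \in t) 1)%N.
    by rewrite -sum1_card; apply: eq_bigl => p; case: (boolP (p \in t)) => h; rewrite ?andbF // (subsetP tQ).
  rewrite -sum1_card big_mkcondr -big_split /=; apply: leq_sum => p pQ; case: ifP => pt; last by rewrite addn0 Qs_ed.
  have [_ pp r N] := tP p pt; by have := a1_e1 gm va cr ih potV pp r N; rewrite (edC _ _ gm).
have t6 : rho y <> 6%N -> #|t| = 0%N.
  move=> n6; apply: eq_card0 => p; apply/negP => /tP [_ pp r N].
  by have [] := a1_y6 gm va cr ih potV pp r N.
have big := bigP gm va cr ih potV yV ys; rewrite /charge.
case: big => -[ry dy]; rewrite ry in star t6 *.
- have t0 : #|t| = 0%N by apply: t6.
  by move: star t0 dy; rewrite /=; clear; lia.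
- have t0 : #|t| = 0%N by apply: t6.
  by move: star t0 dy; rewrite /=; clear; lia.
rewrite /= in star; rewrite leNgt; apply/negP => bad.
have [[d4 [Q2 t1]]|[d5 [Q3 t2]]] : (d y = 4%N /\ (#|Qs y| = 2%N /\ (0 < #|t|)%N)) \/ (d y = 5%N /\ (#|Qs y| = 3%N /\ #|t| = 2%N)).
  by move: star sumb bad dy tQc; clear; lia.
- have /card_gt0P[p1 p1t] := t1; have [q1 pp1 r1 N1] := tP p1 p1t.
  have : (0 < #|Qs y :\ p1|)%N by have := cardsD1 p1 (Qs y); rewrite q1 Q2; clear; lia.
  case/card_gt0P => p2; rewrite in_setD1 => /andP[n q2].
  by apply: (bad4 d4 pp1 r1 N1 q2); rewrite eq_sym.
have [p1 p1t] : exists p1, p1 \in t by apply/card_gt0P; rewrite t2.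
have [q1 pp1 r1 N1] := tP p1 p1t.
have [p2] : exists p2, p2 \in t :\ p1 by apply/card_gt0P; have := cardsD1 p1 t; rewrite p1t t2; clear; lia.
rewrite in_setD1 => /andP[n21 p2t]; have [q2 pp2 r2 N2] := tP p2 p2t.
have [p3] : exists p3, p3 \in Qs y :\ p1 :\ p2.
  apply/card_gt0P; have := cardsD1 p1 (Qs y); have := cardsD1 p2 (Qs y :\ p1).
  by rewrite in_setD1 n21 q1 q2 Q3; clear; lia.
rewrite !in_setD1 => /and3P[n32 n31 q3].
by apply: (bad5 d5 pp1 pp2 r1 r2 N1 N2 q3); rewrite eq_sym.
Qed.

(** If every component had an outer neighbor, all positive charge could be sent away and the
    potential would be at most 0. A component without one is all of [V]. *)
Lemma all_small : exists2 p, p \in posv & V = cp p.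
Proof.
apply: NNPP => h; have n0 p : p \in posv -> Np p != set0.
  by move=> pp; apply/negP => /eqP /(Np0 gm va cr ih potV pp) e; apply: h; exists p.
have : \sum_(v in V) ch v <= 0; last by rewrite -potVE; move: potV; clear; lia.
have -> : \sum_(v in V) ch v = \sum_(v in posv) ch v + \sum_(v in V :\: small) ch v.
  rewrite (bigID (mem small)) /=; congr (_ + _); last by apply: eq_bigl => v; rewrite in_setD andbC.
  rewrite (bigID (mem posv)) /= [X in _ + X]big1 ?addr0 => [|v /andP[/andP[vV vs] vn]].
    apply: eq_bigl => v; case: (boolP (v \in posv)) => vp; rewrite ?andbF // andbT.
    by have vs := subsetP (pos_small V m rho) v vp; rewrite vs (subsetP (small_sub V m rho)).
  by move: vs vn; rewrite !inE vV /= => a b; apply/eqP; rewrite eq_le a leNgt b.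
apply: le_trans (_ : \sum_(p in posv) \sum_(y in V :\: small) wt p y + \sum_(v in V :\: small) ch v <= 0).
  by rewrite lerD2r; apply: ler_sum => p pp; apply: wt_send => //; exact: n0.
rewrite exchange_big -big_split /=; apply: sumr_le0 => y; rewrite in_setD => /andP[ys yV].
by rewrite -lerBrDr sub0r; exact: wt_receive.
Qed.

End Bad.

Section Forcing.
Variable R : realFieldType.

(** * Closing a cycle *)

(* The last vertex must take color [k] when its two neighbors exclude [x] and [z]. *)
Definition forced (x z k : C3) := [&& x != z, x != k & z != k].

Section OneLaw.
Variables (A : finType) (N : A -> R) (X Z : A -> C3) (a b : C3).
Hypotheses (dN : isd N) (hX : forall c, pr N (fun w => X w == c) = off R a c) (hZ : forall c, pr N (fun w => Z w == c) = off R b c).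

Lemma pr_le_ev (E F : pred A) : (forall w, 0 < N w -> E w -> F w) -> pr N E <= pr N F.
Proof. by move=> h; apply: pr_mono => //; case: dN. Qed.

Lemma supp_neq (Y : A -> C3) e w : pr N (fun w => Y w == e) = 0 -> 0 < N w -> Y w != e.
Proof.
have [N0 _] := dN => h Nw; apply/negP => /eqP e1; have : N w <= pr N (fun w => Y w == e).
  by rewrite /pr (bigD1 w) ?e1 ?eqxx //= lerDl; apply: sumr_ge0.
by rewrite h => le; have := lt_le_trans Nw le; rewrite ltxx.
Qed.

Lemma X_off w : 0 < N w -> X w != a.
Proof. by apply: (supp_neq (Y := X)); rewrite hX /off eqxx. Qed.
Lemma Z_off w : 0 < N w -> Z w != b.
Proof. by apply: (supp_neq (Y := Z)); rewrite hZ /off eqxx. Qed.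

Lemma avail_lb c : (1 / 2 * (a == c)%:R + 1 / 2 * (b == c)%:R : R) <= pr N (fun w => (X w != c) && (Z w != c)).
Proof.
have N0 := proj1 dN.
have le := prU (fun w => X w == c) (fun w => Z w == c) N0.
have e : pr N (fun w => (X w != c) && (Z w != c)) = 1 - pr N (predU (fun w => X w == c) (fun w => Z w == c)).
  by rewrite -prC //; apply: eq_pr => w /=; rewrite negb_or.
rewrite e; rewrite hX hZ /off in le; move: le; rewrite ![c == _]eq_sym.
by case: (a == c); case: (b == c) => /=; lra.
Qed.

(** One of [a], [b] differs from [k], say [a]. Since [X] avoids [a], forcing [k] pins [X] to a
    single color, of mass at most 1/2. *)
Lemma forced_neq k : a != b -> pr N (fun w => forced (X w) (Z w) k) <= 1 / 2.
Proof.
move=> ab; case: (eqVneq b k) => [bk|bk].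
  have ak : k != a by rewrite -bk eq_sym.
  apply: le_trans (_ : pr N (fun w => X w == third k a) <= _); last first.
    by rewrite hX /off; case: ifP => _ //; lra.
  by apply: pr_le_ev => w Nw /and3P[_ xk _]; apply/eqP; apply: third_uniq => //; exact: X_off.
apply: le_trans (_ : pr N (fun w => Z w == third k b) <= _); last first.
  by rewrite hZ /off; case: ifP => _ //; lra.
apply: pr_le_ev => w Nw /and3P[_ _ zk]; apply/eqP; apply: third_uniq => //; [by rewrite eq_sym|exact: Z_off].
Qed.

Lemma forced_eq k : a = b -> a != k -> pr N (fun w => forced (X w) (Z w) k) = 0.
Proof.
move=> ab ak; apply: pr_none; first by case: dN.
move=> w Nw; apply/negP => /and3P[xz xk zk]; case/negP: xz; apply/eqP.
have n : k != a by rewrite eq_sym.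
by rewrite (third_uniq n xk (X_off Nw)); apply/esym/third_uniq => //; rewrite ab; exact: Z_off.
Qed.

End OneLaw.

Section Tilt.
Variables (Om A : finType) (P : Om -> R) (N : Om -> A -> R) (X Z : A -> C3) (a b : Om -> C3).
Hypotheses (dP : isd P) (dN : forall w, isd (N w)).
Hypotheses (hX : forall w c, pr (N w) (fun v => X v == c) = off R (a w) c)
  (hZ : forall w c, pr (N w) (fun v => Z v == c) = off R (b w) c).
Hypotheses (qa : forall c, 1 / 5 <= pr P (fun w => a w == c)) (qb : forall c, 1 / 5 <= pr P (fun w => b w == c)).

Definition avg (N' : Om -> A -> R) (E : pred A) := \sum_w P w * pr (N' w) E.
Definition Eq k := pr P (fun w => (a w == k) && (b w == k)).

Lemma avg_le (N1 N2 : Om -> A -> R) (E F : pred A) : (forall w, pr (N1 w) E <= pr (N2 w) F) -> avg N1 E <= avg N2 F.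
Proof. by move=> h; apply: ler_sum => w _; apply: ler_wpM2l => //; case: dP. Qed.

Lemma avail_avg c : 1 / 5 <= avg N (fun v => (X v != c) && (Z v != c)).
Proof.
have h : 1 / 2 * pr P (fun w => a w == c) + 1 / 2 * pr P (fun w => b w == c) <= avg N (fun v => (X v != c) && (Z v != c)).
  rewrite !prE !mulr_sumr -big_split; apply: ler_sum => w _ /=.
  have /(ler_wpM2l (proj1 dP w)) := avail_lb (dN w) (hX w) (hZ w) c.
  by apply: le_trans; rewrite le_eqVlt; apply/orP; left; apply/eqP; ring.
by apply: le_trans h; have := qa c; have := qb c; lra.
Qed.

Lemma avg1 (N' : Om -> A -> R) (E F : pred A) : (forall w, isd (N' w)) -> (forall v, ~~ (E v && F v)) -> avg N' E + avg N' F <= 1.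
Proof.
move=> d dis; rewrite /avg -big_split -(proj2 dP); apply: ler_sum => w _ /=; rewrite -mulrDr -[X in _ <= X]mulr1.
apply: ler_wpM2l; first by case: dP.
have -> : pr (N' w) E + pr (N' w) F = pr (N' w) (predU E F); last exact: pr_le1.
rewrite !prE -big_split; apply: eq_bigr => v _ /=; have := dis v.
by case: (E v); case: (F v) => //= _; ring.
Qed.

Lemma forced_split k : avg N (fun v => forced (X v) (Z v) k) <=
  Eq k + \sum_(w | a w != b w) P w * pr (N w) (fun v => forced (X v) (Z v) k).
Proof.
rewrite /avg (bigID (fun w => a w == b w)) /= lerD2r /Eq prE.
rewrite [X in _ <= X](bigID (fun w => a w == b w)) /= -[X in X <= _]addr0; apply: lerD; last first.
  by apply: sumr_ge0 => w _; apply: mulr_ge0 => //; case: dP.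
apply: ler_sum => w /eqP e; apply: ler_wpM2l; first by case: dP.
case: (eqVneq (a w) k) => [ak|ak] /=; last by rewrite (forced_eq (dN w) (hX w) (hZ w) e ak).
by rewrite -e ak eqxx; apply: pr_le1.
Qed.

Lemma forced_unequal k : \sum_(w | a w != b w) P w * pr (N w) (fun v => forced (X v) (Z v) k) <= 1 / 2 * (1 - Eq k).
Proof.
rewrite /Eq -prC // prE mulr_sumr [X in _ <= X](bigID (fun w => a w != b w)) /= -[X in X <= _]addr0; apply: lerD; last first.
  by apply: sumr_ge0 => w _; apply: mulr_ge0; [lra|apply: mulr_ge0; [exact: (proj1 dP)|exact: ler0n]].
apply: ler_sum => w ab; have n : ~~ ((a w == k) && (b w == k)).
  by apply: contra ab => /andP[/eqP -> /eqP ->]; rewrite eqxx.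
rewrite n mulr1 mulrC; apply: ler_wpM2r; [by case: dP|exact: (forced_neq (dN w) (hX w) (hZ w))].
Qed.

(* Since at most one color can be forced with probability above 3/5, it suffices to move
   the excess mass of that color to colorings where it is not forced. *)
Lemma tilt : exists N' : Om -> A -> R, [/\ forall w, isd (N' w), forall w v, 0 < P w -> 0 < N' w v -> 0 < N w v,
  forall c, 1 / 5 <= avg N' (fun v => (X v != c) && (Z v != c)), forall k, avg N' (fun v => forced (X v) (Z v) k) <= 3 / 5 &
  (forall E : pred A, avg N E <= avg N' E) \/ exists k, [/\ 1 / 5 < Eq k, forall E : pred A, avg N E - (1 / 2 * Eq k - 1 / 10) <= avg N' E &
    forall E : pred A, (forall v, E v -> ~~ forced (X v) (Z v) k) -> avg N E <= avg N' E]].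
Proof.
case: (classic (forall k, avg N (fun v => forced (X v) (Z v) k) <= 3 / 5)) => [h|h].
  by exists N; split=> //; [exact: avail_avg|left].
have [k big] : exists k, 3 / 5 < avg N (fun v => forced (X v) (Z v) k).
  by apply: NNPP => n; apply: h => k; rewrite leNgt; apply/negP => l; apply: n; exists k.
set F := avg N _ in big; pose G := \sum_(w | a w != b w) P w * pr (N w) (fun v => forced (X v) (Z v) k).
have s1 : F <= Eq k + G := forced_split k; have s2 : G <= 1 / 2 * (1 - Eq k) := forced_unequal k.
have Ele : Eq k <= 3 / 5.
  apply: le_trans (_ : pr P (fun w => a w == k) <= _); first by apply: pr_mono => [|w _ /andP[]//]; case: dP.
  by apply: (le35 (a := fun c => pr P (fun w => a w == c))) => //; apply: (eq_isd _ (isd_push a dP)).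
have G0 : 0 < G by lra.
(* Only outcomes with [a w != b w] can be tilted. [l] is the fraction of their forced mass [G] that
   has to move for the total to drop to 3/5. *)
pose l := (F - 3 / 5) / G.
have lG : l * G = F - 3 / 5 by rewrite /l divfK // gt_eqF.
have l0 : 0 <= l by rewrite divr_ge0 //; lra.
have l1 : l <= 1 by rewrite ler_pdivrMr // mul1r; lra.
pose fo (v : A) := forced (X v) (Z v) k.
pose cond w v := N w v * (~~ fo v)%:R / pr (N w) (fun v => ~~ fo v).
pose N' w := if a w != b w then (fun v => (1 - l) * N w v + l * cond w v) else N w.
have half w : a w != b w -> pr (N w) (fun v => ~~ fo v) = 1 - pr (N w) fo /\ 1 / 2 <= pr (N w) (fun v => ~~ fo v).
  move=> ab; have e : pr (N w) (fun v => ~~ fo v) = 1 - pr (N w) fo by rewrite -prC.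
  by split=> //; rewrite e; have := forced_neq (dN w) (hX w) (hZ w) k ab; rewrite -/fo; lra.
have dc w : a w != b w -> isd (cond w).
  move=> /half [_ hf]; have pos : 0 < pr (N w) (fun v => ~~ fo v) by lra.
  split=> [v|]; first by rewrite /cond mulr_ge0 ?invr_ge0 ?(ltW pos) // mulr_ge0 //; case: (dN w).
  by rewrite /cond -mulr_suml -prE divff // gt_eqF.
have dN' w : isd (N' w).
  by rewrite /N'; case: ifP => // ab; apply: isd_mix (dN w) (dc w ab); rewrite l0.
have prN' w (E : pred A) : a w != b w -> pr (N w) E - l * pr (N w) (fun v => E v && fo v) <= pr (N' w) E.
  move=> ab; have [_ hf] := half w ab; rewrite /N' ab pr_mix.
  have pos : 0 < pr (N w) (fun v => ~~ fo v) by lra.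
  have : pr (N w) (predI E (predC fo)) <= pr (cond w) E.
    rewrite !prE; apply: ler_sum => v _; rewrite /cond /= -mulrA -mulrA; apply: ler_wpM2l; first by case: (dN w).
    case: (E v); rewrite ?mulr0 // mulr1; case: (fo v); rewrite /= ?mul0r // mul1r.
    by rewrite invf_ge1 // pr_le1.
  move=> /(ler_wpM2l l0); rewrite (pr_split (N w) E fo) /= => le.
  have -> : pr (N w) (fun v => E v && fo v) = pr (N w) (predI E fo) by [].
  by move: le; lra.
have loss (E : pred A) : avg N E - l * (\sum_(w | a w != b w) P w * pr (N w) (fun v => E v && fo v)) <= avg N' E.
  rewrite /avg [\sum_w P w * pr (N w) E](bigID (fun w => a w != b w)) [X in _ <= X](bigID (fun w => a w != b w)) /=.
  have e : \sum_(w | ~~ (a w != b w)) P w * pr (N w) E = \sum_(w | ~~ (a w != b w)) P w * pr (N' w) E.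
    by apply: eq_bigr => w /negbTE ab; rewrite /N' ab.
  rewrite e addrAC lerD2r mulr_sumr -sumrB; apply: ler_sum => w ab.
  by rewrite mulrCA -mulrBr; apply: ler_wpM2l; [case: dP|exact: prN'].
have sub0 (E : pred A) : (forall v, E v -> ~~ fo v) -> avg N E <= avg N' E.
  move=> dis; have := loss E; rewrite big1 ?mulr0 ?subr0 // => w _.
  by rewrite pr_none ?mulr0 // => [|v _]; [case: (dN w)|apply/negP => /andP[/dis /negP]].
have F' : avg N' fo = 3 / 5.
  have -> : avg N' fo = F - l * G; last by rewrite lG; ring.
  rewrite /F /G /avg mulr_sumr [X in X = _](bigID (fun w => a w != b w)) [in X in _ = X - _](bigID (fun w => a w != b w)) /=.
  have e : \sum_(w | ~~ (a w != b w)) P w * pr (N w) fo = \sum_(w | ~~ (a w != b w)) P w * pr (N' w) fo.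
    by apply: eq_bigr => w /negbTE ab; rewrite /N' ab.
  rewrite -/fo e [X in _ = X]addrAC; congr (_ + _); rewrite -sumrB; apply: eq_bigr => w ab.
  rewrite /N' ab pr_mix.
  have -> : pr (cond w) fo = 0 by rewrite prE big1 // => v _; rewrite /cond; case: (fo v); rewrite /= ?mulr0 ?mul0r.
  by rewrite -/fo; ring.
exists N'; split=> //.
- move=> w v Pw; rewrite /N'; case: ifP => // ab Nv; rewrite lt_def; case: (dN w) => -> // _; rewrite andbT.
  by apply: contraTneq Nv => e; rewrite /cond e !mul0r !mulr0 addr0 ltxx.
- move=> c; case: (eqVneq c k) => [->|ck].
    apply: le_trans (_ : avg N' fo <= _); first by rewrite F'; lra.
    by apply: avg_le => w; apply: pr_mono => [|v _ /and3P[_ -> ->]//]; case: (dN' w).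
  apply: le_trans (avail_avg c) (sub0 _ _) => v /andP[xc zc]; apply/negP => /and3P[xz xk zk].
  have kc : k != c by rewrite eq_sym.
  by move: xz; rewrite (third_uniq kc xk xc) (third_uniq kc zk zc) eqxx.
- move=> k'; case: (eqVneq k' k) => [->|nk]; first by rewrite -/fo F'.
  have : avg N' fo + avg N' (fun v => forced (X v) (Z v) k') <= 1.
    apply: avg1 => // v; apply/negP => /andP[/and3P[xz xk zk] /and3P[_ xk' zk']].
    have kk : k != k' by rewrite eq_sym.
    by move: xz; rewrite (third_uniq kk xk xk') (third_uniq kk zk zk') eqxx.
  by rewrite F'; lra.
right; exists k; split; [by lra| |exact: sub0].
move=> E; apply: le_trans (loss E); rewrite lerD2l lerN2.
(* The moved mass is [F - 3/5]; the bounds on [F] and [G] give at most [Eq k / 2 - 1/10]. *)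
apply: le_trans (_ : l * G <= _); last by rewrite lG; lra.
apply: ler_wpM2l => //; apply: ler_sum => w _; apply: ler_wpM2l; first by case: dP.
by apply: pr_mono => [|v _ /andP[]//]; case: (dN w).
Qed.

End Tilt.
End Forcing.

(** * Chains closed by a last vertex *)

Section RandomColorings.
Variables (R : realFieldType) (T : finType).
Notation col := {ffun T -> C3}.
Implicit Types (A B C U W S : {set T}) (m : T -> T -> nat) (rho : T -> nat) (M : T -> T -> C3 -> C3 -> bool) (b : T -> C3).

(** Unlike [good], this keeps the coloring as a function of the outcome, so that vertices colored
    later can be correlated with it. *)
Definition rc U M rho b (Om : finType) (P : Om -> R) (phi : Om -> col) :=
  [/\ isd P, forall w, 0 < P w -> ok U M (phi w) &
    forall v, v \in U -> (forall c, 1 / 5 <= pr P (fun w => phi w v == c)) /\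
      (rho v = 4%N -> forall c, pr P (fun w => phi w v == c) = p4 R (b v) c)].

Lemma rc_good U M rho b (Om : finType) (P : Om -> R) (phi : Om -> col) : rc U M rho b P phi -> exists L : col -> R, good U M rho b L.
Proof.
move=> [dP o h]; exists (push phi P); split.
- exact: isd_push.
- by move=> psi /push_gt0[|w [<- /o]]; case: dP.
- by move=> v /h [a e]; split=> [c|v4 c]; rewrite pr_push ?a ?e.
Qed.

Lemma good_rc U M rho b (L : col -> R) : good U M rho b L -> rc U M rho b L id.
Proof. by case. Qed.

Lemma rc_ext U W M rho b (Om : finType) (P : Om -> R) (phi : Om -> col) (N : Om -> col -> R) :
  (forall x y i j, M x y i j = M y x j i) -> [disjoint U & W] -> rc U M rho b P phi -> (forall w, isd (N w)) ->
  (forall w psi, 0 < P w -> 0 < N w psi -> ok W M psi /\ forall x y, x \in U -> y \in W -> ~~ M x y (phi w x) (psi y)) ->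
  (forall v, v \in W -> (forall c, 1 / 5 <= avg P N (fun psi => psi v == c)) /\
     (rho v = 4%N -> forall c, avg P N (fun psi => psi v == c) = p4 R (b v) c)) ->
  rc (U :|: W) M rho b (fun w : Om * col => P w.1 * N w.1 w.2) (fun w => merge U (phi w.1) w.2).
Proof.
move=> Ms dUW [dP o h] dN oN hN; have [P0 P1] := dP.
have nU y : y \in W -> y \in U = false by move=> yW; apply/negbTE; apply: contraL yW => yU; rewrite (disjointFr dUW yU).
split.
- split=> [w|]; first by rewrite mulr_ge0 //; case: (dN w.1).
  rewrite -[LHS]/(pr _ (fun w : Om * col => (fun _ _ => true) w.1 w.2)) (pr_pair P N (fun _ _ => true)) -P1.
  by apply: eq_bigr => w _; rewrite -[pr _ _]/(\sum_psi N w psi) (proj2 (dN w)) mulr1.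
- move=> [w psi] /= pos.
  have [Pw Nw] : 0 < P w /\ 0 < N w psi.
    have [p0 n0] : 0 <= P w /\ 0 <= N w psi by case: (dN w).
    by split; rewrite lt_def ?p0 ?n0 andbT; apply: contraTneq pos => ->; rewrite ?mul0r ?mulr0 ltxx.
  have o1 := o w Pw; have [o2 c2] := oN w psi Pw Nw.
  move=> x y; rewrite !inE => /orP[] xU /orP[] yU nxy; rewrite !ffunE ?xU ?yU ?(nU x) ?(nU y) //.
  + exact: o1.
  + exact: c2.
  + by rewrite Ms; apply: c2.
  + exact: o2.
have prU v c : v \in U -> pr (fun w : Om * col => P w.1 * N w.1 w.2) (fun w => merge U (phi w.1) w.2 v == c) = pr P (fun w => phi w v == c).
  move=> vU; rewrite (eq_pr _ (F := fun w => (fun a (_ : col) => phi a v == c) w.1 w.2)) => [|w]; last by rewrite /= ffunE vU.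
  rewrite (pr_pair P N (fun a _ => phi a v == c)) prE; apply: eq_bigr => w _; congr (_ * _).
  by case: (_ == _); [exact: pr_all|apply: pr_none => //; case: (dN w)].
have prW v c : v \in W -> pr (fun w : Om * col => P w.1 * N w.1 w.2) (fun w => merge U (phi w.1) w.2 v == c) = avg P N (fun psi => psi v == c).
  move=> vW; rewrite (eq_pr _ (F := fun w => (fun _ (psi : col) => psi v == c) w.1 w.2)) => [|w]; last by rewrite /= ffunE nU.
  by rewrite (pr_pair P N (fun _ psi => psi v == c)).
move=> v; rewrite inE => /orP[] vV.
  by have [a e] := h v vV; split=> [c|r c]; rewrite prU // ?a ?e.
by have [a e] := hN v vV; split=> [c|r c]; rewrite prW // ?a ?e.
Qed.

Lemma close_vertex U M rho b (Om : finType) (P : Om -> R) (phi : Om -> col) p s t (fs ft : C3 -> C3) :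
  (forall x y i j, M x y i j = M y x j i) -> p \notin U -> rc U M rho b P phi -> rho p = 6%N ->
  (forall i j, M s p i j -> j = fs i) -> (forall i j, M t p i j -> j = ft i) ->
  (forall x i j, x \in U -> x != s -> x != t -> ~~ M x p i j) ->
  (forall c, 1 / 5 <= pr P (fun w => (fs (phi w s) != c) && (ft (phi w t) != c))) ->
  (forall k, pr P (fun w => forced (fs (phi w s)) (ft (phi w t)) k) <= 3 / 5) ->
  exists L : col -> R, good (p |: U) M rho b L.
Proof.
move=> Ms pU h p6 hs ht h0 av fo; have [dP _ _] := h.
have [K [k0 k1 k2 k3]] := closing dP av fo.
have dUp : [disjoint U & [set p]] by rewrite disjoint_sym disjoints1.
rewrite setUC; apply: (rc_good (phi := fun w : Om * col => merge U (phi w.1) w.2)).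
apply: (rc_ext (N := fun w => push (fun c => [ffun _ => c] : col) (K w))) h _ _ _ => //.
- by move=> w; exact: isd_push.
- move=> w psi Pw /push_gt0[|c [<- Kc]]; first by case: (k0 w).
  split=> [x y|x y xU]; rewrite !inE => /eqP ->; first by move=> /eqP ->; rewrite eqxx.
  rewrite ffunE; case: (eqVneq x s) => [->|ns]; first by apply: contraTN Kc => /hs ->; rewrite k1 ltxx.
  case: (eqVneq x t) => [->|nt]; first by apply: contraTN Kc => /ht ->; rewrite k2 ltxx.
  exact: h0.
move=> v; rewrite inE => /eqP ->; split; last by rewrite p6.
move=> c; apply: le_trans (k3 c) _; apply: ler_sum => w _; apply: ler_wpM2l; first by case: dP.
by rewrite pr_push /pr (big_pred1 c) // => d /=; rewrite ffunE.
Qed.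

Section Chain.
Variables (U C : {set T}) (p s t : T) (o : T -> T) (m : T -> T -> nat) (rho : T -> nat).
Hypotheses (gm : gr m) (dUC : [disjoint U & C]) (pU : p \notin U) (pC : p \notin C)
  (trC : tr m (all6 (T := T)) C) (nd : forall x y, x \in C -> y \in C -> m x y <> 2%N)
  (sC : s \in C) (tC : t \in C) (st : s != t) (mps : m p s = 1%N) (mpt : m p t = 1%N)
  (mp0 : forall x, x \in U :|: C -> x != s -> x != t -> m p x = 0%N) (p6 : rho p = 6%N)
  (out : forall l, l \in C -> [/\ rho l = 6%N, o l \in U, m (o l) l = 1%N & forall u, u \in U -> u != o l -> m u l = 0%N] \/
    (rho l = 4%N /\ forall u, u \in U -> m u l = 0%N)).
Notation V := (p |: (U :|: C)).
Variables (M : T -> T -> C3 -> C3 -> bool) (b : T -> C3).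
Hypothesis cV : cov V m M.

Let CV : C \subset V. Proof. by rewrite setUA subsetUr. Qed.
Let UV : U \subset V. Proof. by rewrite setUA setUAC subsetUr. Qed.
Let pV : p \in V. Proof. by rewrite !inE eqxx. Qed.
Let neUC u l : u \in U -> l \in C -> u != l.
Proof. by move=> uU; apply: contraTneq => <-; rewrite (disjointFr dUC uU). Qed.

Lemma subchain_kernel (D : {set T}) (Om : finType) (t0 : Om -> T -> C3 -> R) : D \subset C -> tr m (all6 (T := T)) D ->
  (forall w l, l \in D -> isd (t0 w l) /\ forall c, t0 w l c <= 1 / 2) ->
  exists N : Om -> col -> R, forall w, [/\ isd (N w), forall psi, 0 < N w psi -> ok D M psi &
    forall l c, l \in D -> pr (N w) (fun psi => psi l == c) = t0 w l c].
Proof.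
move=> sD trD h.
(* Declaring every vertex a 3-vertex makes [tr_law] prescribe all laws; this is allowed since the
   chain has no double edge. *)
have tr3 : tr m (fun _ => 3%N) D.
  by apply: tr_conv trD _ => x y xD yD e; case: (nd (subsetP sD x xD) (subsetP sD y yD) e).
have cD := covS cV (subset_trans sD CV) (fun x y _ _ => leqnn (m x y)).
have ex w : exists N : col -> R, [/\ isd N, forall psi, 0 < N psi -> ok D M psi &
    forall l c, l \in D -> pr N (fun psi => psi l == c) = t0 w l c].
  have [|t1 [L [[l0 l1 l2] g]]] := tr_law (t0 := t0 w) tr3 cD; first by move=> v vD _; apply: h.
  by exists L; split=> // l c lD; rewrite l2 //; have [_ -> //] := g l lD.
by have [N hN] := fin_all_exists ex; exists N.
Qed.

Lemma chain_kernel (Om : finType) (t0 : Om -> T -> C3 -> R) :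
  (forall w l, l \in C -> isd (t0 w l) /\ forall c, t0 w l c <= 1 / 2) ->
  exists N : Om -> col -> R, forall w, [/\ isd (N w), forall psi, 0 < N w psi -> ok C M psi &
    forall l c, l \in C -> pr (N w) (fun psi => psi l == c) = t0 w l c].
Proof. exact: subchain_kernel (subxx C) trC. Qed.

Lemma chain_matchings : exists (g : T -> C3 -> C3) (fs ft : C3 -> C3),
  [/\ injective fs, injective ft, (forall i j, M s p i j -> j = fs i), (forall i j, M t p i j -> j = ft i) &
   forall l, l \in C -> rho l = 6%N -> injective (g l) /\ forall i j, M (o l) l i j -> j = g l i].
Proof.
have nsp : s != p by apply: contraNneq pC => <-.
have ntp : t != p by apply: contraNneq pC => <-.
have [fs [fsi hs]] := cov1 cV (subsetP CV s sC) pV nsp (etrans (proj1 gm s p) mps).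
have [ft [fti ht]] := cov1 cV (subsetP CV t tC) pV ntp (etrans (proj1 gm t p) mpt).
have ex l : exists g : C3 -> C3, l \in C -> rho l = 6%N -> injective g /\ forall i j, M (o l) l i j -> j = g i.
  case: (boolP (l \in C)) => lC; last by exists id.
  case: (out lC) => [[l6 oU m1 _]|[l4 _]]; last by exists id; rewrite l4.
  have [g hg] := cov1 cV (subsetP UV _ oU) (subsetP CV l lC) (neUC oU lC) m1; by exists g.
have [g hg] := fin_all_exists ex; by exists g, fs, ft.
Qed.

Variables (g : T -> C3 -> C3) (fs ft : C3 -> C3).
Hypotheses (fsi : injective fs) (fti : injective ft) (hs : forall i j, M s p i j -> j = fs i)
  (ht : forall i j, M t p i j -> j = ft i)
  (hg : forall l, l \in C -> rho l = 6%N -> injective (g l) /\ forall i j, M (o l) l i j -> j = g l i).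
Variables (Om : finType) (P : Om -> R) (phi : Om -> col).
Hypothesis rU : rc U M rho b P phi.

(** The color forbidden at [l] by its outer neighbor: seen from the chain, a 6-vertex is a 3-vertex
    with this missing color. *)
Definition mis w l := g l (phi w (o l)).

Lemma inj_eqE (f : C3 -> C3) : injective f -> exists f', cancel f' f /\ forall x y, (f x == y) = (x == f' y).
Proof.
move=> fi; have [f' ff' f'f] : bijective f by exact: (@injF_bij (option bool : finType)).
by exists f'; split=> // x y; rewrite -{1}(f'f y) inj_eq.
Qed.

Lemma mis_marg l c : l \in C -> rho l = 6%N -> 1 / 5 <= pr P (fun w => mis w l == c) <= 3 / 5.
Proof.
move=> lC l6; have [gi _] := hg lC l6; have [g' [_ hg']] := inj_eqE gi.
case: (out lC) => [[_ oU _ _]|[]]; last by rewrite l6.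
have [dP _ /(_ _ oU) [lb _]] := rU.
have e : pr P (fun w => mis w l == c) = pr P (fun w => phi w (o l) == g' c).
  by apply: eq_pr => w; rewrite /mis hg'.
rewrite e lb /=; apply: (le35 (a := fun c => pr P (fun w => phi w (o l) == c))) => //.
exact: (eq_isd _ (isd_push (fun w => phi w (o l)) dP)).
Qed.

Lemma chain_close (N : Om -> col -> R) :
  (forall w, isd (N w)) ->
  (forall w psi, 0 < P w -> 0 < N w psi -> ok C M psi /\ forall l, l \in C -> rho l = 6%N -> psi l != mis w l) ->
  (forall l, l \in C -> (forall c, 1 / 5 <= avg P N (fun psi => psi l == c)) /\
     (rho l = 4%N -> forall c, avg P N (fun psi => psi l == c) = p4 R (b l) c)) ->
  (forall c, 1 / 5 <= avg P N (fun psi => (fs (psi s) != c) && (ft (psi t) != c))) ->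
  (forall k, avg P N (fun psi => forced (fs (psi s)) (ft (psi t)) k) <= 3 / 5) ->
  exists L : col -> R, good V M rho b L.
Proof.
move=> dN oN mN av fo.
have nU y : y \in C -> y \in U = false by move=> yW; apply/negbTE; apply: contraL yW => yU; rewrite (disjointFr dUC yU).
have rUC : rc (U :|: C) M rho b (fun w : Om * col => P w.1 * N w.1 w.2) (fun w => merge U (phi w.1) w.2).
  apply: rc_ext rU _ _ _ => //; first by case: cV.
  move=> w psi Pw Nw; have [o1 mi] := oN w psi Pw Nw; split=> // x l xU lC.
  have z0 : m x l = 0%N -> ~~ M x l (phi w x) (psi l).
    by move=> e; apply: (cov0 _ _ cV (subsetP UV x xU) (subsetP CV l lC) (neUC xU lC) e).
  case: (out lC) => [[l6 oU m1 m0]|[l4 m0]]; last by apply: z0; exact: m0.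
  case: (eqVneq x (o l)) => [->|n]; last by apply: z0; exact: m0.
  have [_ h] := hg lC l6; apply: contra (mi l lC l6) => /h ->; exact: eqxx.
have pUC : p \notin U :|: C by rewrite inE negb_or pU.
have pe (E : C3 -> C3 -> bool) : pr (fun w : Om * col => P w.1 * N w.1 w.2)
    (fun w => E (merge U (phi w.1) w.2 s) (merge U (phi w.1) w.2 t)) = avg P N (fun psi => E (psi s) (psi t)).
  rewrite (eq_pr _ (F := fun w => (fun _ (psi : col) => E (psi s) (psi t)) w.1 w.2)) => [|w].
    by rewrite (pr_pair P N (fun _ psi => E (psi s) (psi t))).
  by rewrite /= !ffunE !nU.
apply: (close_vertex (s := s) (t := t) (fs := fs) (ft := ft) _ pUC rUC p6 hs ht).
- by case: cV.
- move=> x i j xUC xs xt; have xV : x \in V by rewrite in_setU1 xUC orbT.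
  have xp : x != p by apply: contraNneq pUC => <-.
  by apply: (cov0 _ _ cV xV pV xp); rewrite (proj1 gm) mp0.
- by move=> c; rewrite (pe (fun x z => (fs x != c) && (ft z != c))).
- by move=> k; rewrite (pe (fun x z => forced (fs x) (ft z) k)).
Qed.

Lemma avg_off (a : Om -> C3) (c : C3) : avg P (fun w => off R (a w)) (fun d => d == c) = 1 / 2 * (1 - pr P (fun w => a w == c)).
Proof.
have [dP _ _] := rU; rewrite -prC // prE mulr_sumr; apply: eq_bigr => w _.
rewrite /pr (big_pred1 c) // /off eq_sym /=; by case: (_ == _) => /=; ring.
Qed.

Lemma off_inj (f : C3 -> C3) a c : injective f -> off R (f a) (f c) = off R a c.
Proof. by move=> fi; rewrite /off inj_eq. Qed.

Lemma p4_inj (f : C3 -> C3) a c : injective f -> p4 R (f a) (f c) = p4 R a c.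
Proof. by move=> fi; rewrite /p4 inj_eq. Qed.

Definition Eab k := pr P (fun w => (fs (mis w s) == k) && (ft (mis w t) == k)).

(** Tilting costs an event at most [Eab k / 2 - 1/10], so a color missing with mass q keeps 1/5 as
    soon as [Eab k + q <= 4/5]. For the ends this holds at colors not read as [k] by [p], and the
    color read as [k] loses nothing because its presence excludes forcing [k]. *)
Lemma chain_tilt : (forall l, l \in C -> rho l = 6%N) ->
  (forall k, 1 / 5 < Eab k -> forall l c, l \in C -> l != s -> l != t -> Eab k + pr P (fun w => mis w l == c) <= 4 / 5) ->
  exists L : col -> R, good V M rho b L.
Proof.
move=> a6 cond; have [dP _ _] := rU.
have [|N hN] := @chain_kernel Om (fun w l => off R (mis w l)).
  by move=> w l lC; split; [exact: off_isd|move=> c; rewrite /off; case: ifP => _ //; lra].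
have dN w : isd (N w) by case: (hN w).
have [fs' [fsK hfs]] := inj_eqE fsi; have [ft' [ftK hft]] := inj_eqE fti.
have hX w c : pr (N w) (fun psi => fs (psi s) == c) = off R (fs (mis w s)) c.
  rewrite (eq_pr _ (F := fun psi : col => psi s == fs' c)) => [|psi]; last by rewrite /= hfs.
  by case: (hN w) => _ _ -> //; rewrite -{2}(fsK c) off_inj.
have hZ w c : pr (N w) (fun psi => ft (psi t) == c) = off R (ft (mis w t)) c.
  rewrite (eq_pr _ (F := fun psi : col => psi t == ft' c)) => [|psi]; last by rewrite /= hft.
  by case: (hN w) => _ _ -> //; rewrite -{2}(ftK c) off_inj.
have qs c : 1 / 5 <= pr P (fun w => fs (mis w s) == c).
  by rewrite (eq_pr _ (F := fun w => mis w s == fs' c)) => [|w /=]; [case/andP: (mis_marg (fs' c) sC (a6 s sC))|rewrite hfs].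
have qt c : 1 / 5 <= pr P (fun w => ft (mis w t) == c).
  by rewrite (eq_pr _ (F := fun w => mis w t == ft' c)) => [|w /=]; [case/andP: (mis_marg (ft' c) tC (a6 t tC))|rewrite hft].
have [N' [dN' sN' av fo gain]] := tilt dP dN hX hZ qs qt.
have mg l c : l \in C -> avg P N (fun psi => psi l == c) = 1 / 2 * (1 - pr P (fun w => mis w l == c)).
  move=> lC; rewrite -avg_off; apply: eq_bigr => w _; congr (_ * _).
  by case: (hN w) => _ _ -> //; rewrite /pr (big_pred1 c).
have lbN l c : l \in C -> 1 / 5 <= avg P N (fun psi => psi l == c).
  by move=> lC; rewrite mg //; case/andP: (mis_marg c lC (a6 l lC)); lra.
apply: (chain_close dN') => //.
- move=> w psi Pw /(sN' w psi Pw) Nw; have [_ o1 h1] := hN w; split; first exact: o1.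
  by move=> l lC _; apply: (supp_neq (dN w) (Y := fun psi : col => psi l)) => //; rewrite h1 // /off eqxx.
move=> l lC; split=> [c|]; last by rewrite a6.
case: gain => [gain|[k [Ek loss gain]]]; first exact: le_trans (lbN l c lC) (gain _).
have tot (a : Om -> C3) c' : (forall c, 1 / 5 <= pr P (fun w => a w == c)) -> c' != k ->
    pr P (fun w => a w == c') + pr P (fun w => a w == k) <= 4 / 5.
  move=> lb n; have : \sum_c pr P (fun w => a w == c) = 1 by rewrite -(pr_partition P xpredT a) pr_all.
  by rewrite (sum3d _ n); have := lb (third c' k); lra.
have fin q : avg P N (fun psi => psi l == c) = 1 / 2 * (1 - q) -> Eab k + q <= 4 / 5 -> 1 / 5 <= avg P N' (fun psi => psi l == c).
  move=> e le.
  have l1 : avg P N (fun psi => psi l == c) - (1 / 2 * Eab k - 1 / 10) <= avg P N' (fun psi => psi l == c) := loss _.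
  by rewrite e in l1; move: le l1; lra.
have Ek' : 1 / 5 < Eab k := Ek.
have [P0 _] := dP.
case: (eqVneq l s) => [els|ls].
  case: (eqVneq (fs c) k) => [ek|nk].
    apply: le_trans (lbN l c lC) (gain _ _) => psi /eqP e; apply/negP => /and3P[_ + _].
    by rewrite -els e ek eqxx.
  apply: fin (mg l c lC) _; rewrite els.
  have := tot (fun w => fs (mis w s)) (fs c) qs nk.
  have : Eab k <= pr P (fun w => fs (mis w s) == k) by apply: pr_mono => // w _ /andP[].
  rewrite (eq_pr _ (E := fun w => fs (mis w s) == fs c) (F := fun w => mis w s == c)) => [|w]; last by rewrite /= inj_eq.
  lra.
case: (eqVneq l t) => [elt|lt].
  case: (eqVneq (ft c) k) => [ek|nk].
    apply: le_trans (lbN l c lC) (gain _ _) => psi /eqP e; apply/negP => /and3P[_ _ +].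
    by rewrite -elt e ek eqxx.
  apply: fin (mg l c lC) _; rewrite elt.
  have := tot (fun w => ft (mis w t)) (ft c) qt nk.
  have : Eab k <= pr P (fun w => ft (mis w t) == k) by apply: pr_mono => // w _ /andP[].
  rewrite (eq_pr _ (E := fun w => ft (mis w t) == ft c) (F := fun w => mis w t == c)) => [|w]; last by rewrite /= inj_eq.
  lra.
by apply: fin (mg l c lC) _; apply: cond.
Qed.

(* The end [s] is a 4-vertex; the missing color [a] of the other end may be virtual. *)
Lemma chain_alpha (a : Om -> C3) : rho s = 4%N -> (rho t = 6%N -> forall w, a w = mis w t) ->
  (forall c, 1 / 5 <= pr P (fun w => a w == c)) ->
  (rho t = 4%N -> forall c, 1 / 2 * (1 - pr P (fun w => a w == c)) = p4 R (b t) c) ->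
  exists L : col -> R, good V M rho b L.
Proof.
move=> s4 at6 qa at4; have [dP _ _] := rU; have [P0 P1] := dP.
pose t0 w l := if l == t then off R (a w) else if rho l == 6%N then off R (mis w l) else p4 R (b l).
have [|N hN] := @chain_kernel Om t0.
  move=> w l lC; have offP x : isd (off R x) /\ forall c, off R x c <= 1 / 2.
    by split; [exact: off_isd|move=> c; rewrite /off; case: ifP => _ //; lra].
  rewrite /t0; case: ifP => // _; case: ifP => // _.
  by split; [exact: p4_isd|move=> c; case/andP: (p4_bd R (b l) c); lra].
have dN w : isd (N w) by case: (hN w).
have [fs' [fsK hfs]] := inj_eqE fsi; have [ft' [ftK hft]] := inj_eqE fti.
have hX w c : pr (N w) (fun psi => fs (psi s) == c) = p4 R (fs (b s)) c.
  rewrite (eq_pr _ (F := fun psi : col => psi s == fs' c)) => [|psi]; last by rewrite /= hfs.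
  by case: (hN w) => _ _ -> //; rewrite /t0 (negbTE st) s4 -{2}(fsK c) p4_inj.
have hZ w c : pr (N w) (fun psi => ft (psi t) == c) = off R (ft (a w)) c.
  rewrite (eq_pr _ (F := fun psi : col => psi t == ft' c)) => [|psi]; last by rewrite /= hft.
  by case: (hN w) => _ _ -> //; rewrite /t0 eqxx -{2}(ftK c) off_inj.
have qft c : pr P (fun w => ft (a w) == c) = pr P (fun w => a w == ft' c) by apply: eq_pr => w; rewrite hft.
have qa' c : 1 / 5 <= pr P (fun w => ft (a w) == c) by rewrite qft.
have qa3 c : pr P (fun w => ft (a w) == c) <= 3 / 5.
  by apply: (le35 (a := fun c => pr P (fun w => ft (a w) == c))) => //; exact: (eq_isd _ (isd_push (fun w => ft (a w)) dP)).
have lin (x y : R) (E : pred Om) : \sum_w P w * (x + y * (E w)%:R) = x + y * pr P E.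
  rewrite prE mulr_sumr -[X in X + _]mul1r -P1 mulr_suml -big_split; apply: eq_bigr => w _ /=; ring.
apply: (chain_close dN).
- move=> w psi Pw Nw; have [_ o1 h1] := hN w; split; first exact: o1.
  move=> l lC l6; apply: (supp_neq (dN w) (Y := fun psi : col => psi l)) => //; rewrite h1 // /t0 l6 /=.
  by case: eqP => [elt|_]; rewrite /off ?eqxx // -elt in at6 *; rewrite at6 // eqxx.
- move=> l lC.
  have mg c : avg P N (fun psi => psi l == c) = \sum_w P w * t0 w l c.
    by apply: eq_bigr => w _; case: (hN w) => _ _ ->.
  have mo (a' : Om -> C3) c : \sum_w P w * off R (a' w) c = 1 / 2 * (1 - pr P (fun w => a' w == c)).
    by rewrite -avg_off; apply: eq_bigr => w _; rewrite /pr (big_pred1 c).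
  have ub (a' : Om -> C3) c : (forall c, 1 / 5 <= pr P (fun w => a' w == c)) -> 1 / 5 <= 1 / 2 * (1 - pr P (fun w => a' w == c)).
    move=> lb; have d' : isd (fun c => pr P (fun w => a' w == c)) by exact: (eq_isd _ (isd_push a' dP)).
    have l1 : pr P (fun w => a' w == c) <= 3 / 5 := le35 d' lb c.
    by lra.
  case: (eqVneq l t) => [elt|lt].
    by subst l; split=> [c|t4 c]; rewrite mg /t0 eqxx mo; [apply: ub|apply: at4].
  case: (out lC) => [[l6 _ _ _]|[l4 _]].
    split=> [c|]; last by rewrite l6.
    by rewrite mg /t0 (negbTE lt) l6 /= mo; apply: ub => c'; case/andP: (mis_marg c' lC l6).
  have e c : avg P N (fun psi => psi l == c) = p4 R (b l) c.
    by rewrite mg /t0 (negbTE lt) l4 /= -mulr_suml P1 mul1r.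
  by split=> [c|_ c]; rewrite e //; case/andP: (p4_bd R (b l) c); lra.
(* Given [w], the end [s] excludes [c] with mass at most 2/5, and [t] does so with mass 1/2, or 0
   when [ft (a w) = c]. *)
- move=> c; apply: le_trans (_ : \sum_w P w * (1 / 10 + 1 / 2 * (ft (a w) == c)%:R) <= _).
    by rewrite lin; have := qa' c; lra.
  apply: ler_sum => w _; apply: ler_wpM2l => //.
  have N0 := proj1 (dN w).
  have le := prU (fun psi : col => fs (psi s) == c) (fun psi : col => ft (psi t) == c) N0.
  have e : pr (N w) (fun psi => (fs (psi s) != c) && (ft (psi t) != c)) = 1 - pr (N w) (predU (fun psi : col => fs (psi s) == c) (fun psi : col => ft (psi t) == c)).
    by rewrite -prC //; apply: eq_pr => psi /=; rewrite negb_or.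
  rewrite hX hZ /off eq_sym in le; rewrite e; case/andP: (p4_bd R (fs (b s)) c) => _ h4.
  by move: le; case: (_ == c) => /=; lra.
(* If [ft (a w) = k], forcing [k] still requires [fs (psi s) != k], of mass at most 7/10. Otherwise
   it pins [fs (psi s)] to [ft (a w)], of mass at most 2/5. The average is at most 2/5 + 3/10 *
   3/5. *)
- move=> k; apply: (@le_trans _ _ (\sum_w P w * (2 / 5 + 3 / 10 * (ft (a w) == k)%:R))); last first.
    by rewrite lin; have := qa3 k; lra.
  apply: ler_sum => w _; apply: ler_wpM2l => //; case: (eqVneq (ft (a w)) k) => [ek|nk] /=.
    apply: le_trans (_ : pr (N w) (fun psi => fs (psi s) != k) <= _).
      by apply: pr_mono => [|psi _ /and3P[]//]; case: (dN w).
    have -> : pr (N w) (fun psi => fs (psi s) != k) = 1 - pr (N w) (fun psi => fs (psi s) == k) by rewrite -prC.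
    by rewrite hX; case/andP: (p4_bd R (fs (b s)) k); lra.
  apply: le_trans (_ : pr (N w) (fun psi => fs (psi s) == ft (a w)) <= _); last first.
    by rewrite hX; case/andP: (p4_bd R (fs (b s)) (ft (a w))); lra.
  apply: pr_mono => [|psi Np /and3P[xz xk zk]]; first by case: (dN w).
  have za : ft (psi t) != ft (a w).
    by apply: (supp_neq (dN w) (Y := fun psi : col => ft (psi t))) => //; rewrite hZ /off eqxx.
  have ez := third_uniq nk za zk; apply/negPn/negP => xa.
  by move: xz; rewrite ez (third_uniq nk xa xk) eqxx.
Qed.

(** [third k k] and [third k (third k k)] are the two colors other than [k], so the left side is the
    probability that two independent ends force [k]. *)
Lemma off_prod_bound (x y k : C3) : (off R x (third k k) * off R y (third k (third k k)) +
  off R x (third k (third k k)) * off R y (third k k) : R) <= 1 / 4 + 1 / 4 * ((x == k) && (y == k))%:R.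
Proof. by rewrite /off; move: x y k => [[]|] [[]|] [[]|] /=; lra. Qed.

(* With probability 2/5 the two arms at the interior 4-vertex [j] are colored independently;
   otherwise the chain is colored so as to restore the law of [j]. *)
Lemma chain_beta (A B : {set T}) (j j1 j2 : T) : C = j |: (A :|: B) -> [disjoint A & B] -> j \notin A :|: B ->
  tr m (all6 (T := T)) A -> tr m (all6 (T := T)) B -> s \in A -> t \in B -> rho s = 6%N -> rho t = 6%N -> rho j = 4%N ->
  j1 \in A -> j2 \in B -> m j1 j = 1%N -> m j2 j = 1%N ->
  (forall x, x \in A -> x != j1 -> m x j = 0%N) -> (forall x, x \in B -> x != j2 -> m x j = 0%N) ->
  (forall x y, x \in A -> y \in B -> m x y = 0%N) ->
  (forall c, pr P (fun w => mis w s == c) <= 2 / 5) -> exists L : col -> R, good V M rho b L.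
Proof.
move=> eC dAB jAB trA trB sA tB s6 t6 j4 j1A j2B m1 m2 mA mB mAB qs4.
have [dP _ _] := rU; have [P0 P1] := dP.
have AC : A \subset C by rewrite eC setUA setUAC subsetUr.
have BC : B \subset C by rewrite eC setUA subsetUr.
have jC : j \in C by rewrite eC setU11.
have jV := subsetP CV j jC.
have neA x : x \in A -> x != j by move=> xA; apply: contraNneq jAB => <-; rewrite inE xA.
have neB x : x \in B -> x != j by move=> xB; apply: contraNneq jAB => <-; rewrite inE xB orbT.
have AV x : x \in A -> x \in V by move=> xA; apply: (subsetP CV); apply: (subsetP AC).
have BV x : x \in B -> x \in V by move=> xB; apply: (subsetP CV); apply: (subsetP BC).
have nBA x : x \in B -> x \in A = false by move=> xB; apply/negbTE; apply: contraL xB => xA; rewrite (disjointFr dAB xA).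
have [h1 [h1i hh1]] := cov1 cV (AV _ j1A) jV (neA _ j1A) m1.
have [h2 [h2i hh2]] := cov1 cV (BV _ j2B) jV (neB _ j2B) m2.
pose tg w l := if rho l == 6%N then off R (mis w l) else p4 R (b l).
have tgP w l : isd (tg w l) /\ forall c, tg w l c <= 1 / 2.
  rewrite /tg; case: ifP => _; split; try exact: off_isd; try exact: p4_isd.
    by move=> c; rewrite /off; case: ifP => _ //; lra.
  by move=> c; case/andP: (p4_bd R (b l) c); lra.
have [NA hA] := @subchain_kernel A Om tg AC trA (fun w l _ => tgP w l).
have [NB hB] := @subchain_kernel B Om tg BC trB (fun w l _ => tgP w l).
have dNA w : isd (NA w) by case: (hA w).
have dNB w : isd (NB w) by case: (hB w).
(* [j] takes its basepoint whenever both arms allow it; as the arms are independent with masses at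
   most 1/2, this has probability at least 1/4. *)
pose pk x y := if (b j != x) && (b j != y) then b j else third x y.
have pkP x y : pk x y != x /\ pk x y != y.
  by rewrite /pk; case: ifP => [/andP[]//|_]; exact: thirdP.
pose F (ab : col * col) : col := [ffun v => if v == j then pk (h1 (ab.1 j1)) (h2 (ab.2 j2)) else if v \in A then ab.1 v else ab.2 v].
pose Pr2 w (ab : col * col) := NA w ab.1 * NB w ab.2.
have dPr2 w : isd (Pr2 w) by exact: isd_prod.
pose N1 w := push F (Pr2 w).
have dN1 w : isd (N1 w) by exact: isd_push.
have indep w (E E' : pred C3) x y : x \in A -> y \in B -> pr (N1 w) (fun psi => E (psi x) && E' (psi y)) =
    pr (NA w) (fun a => E (a x)) * pr (NB w) (fun a => E' (a y)).
  move=> xA yB; rewrite pr_push -pr_prod; apply: eq_pr => ab.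
  by rewrite !ffunE (negbTE (neA x xA)) (negbTE (neB y yB)) xA nBA.
have mgA w l c : l \in A -> pr (N1 w) (fun psi => psi l == c) = tg w l c.
  move=> lA; case: (hA w) => _ _ <- //; rewrite -[RHS]mulr1 -(pr_all (dNB w) (E := xpredT)) //.
  rewrite -(indep w (fun d => d == c) (fun _ => true) l t) //.
  by apply: eq_pr => psi; rewrite andbT.
have mgB w l c : l \in B -> pr (N1 w) (fun psi => psi l == c) = tg w l c.
  move=> lB; case: (hB w) => _ _ <- //; rewrite -[RHS]mul1r -(pr_all (dNA w) (E := xpredT)) //.
  by rewrite -(indep w (fun _ => true) (fun d => d == c) s l).
pose gj w c := pr (N1 w) (fun psi => psi j == c).
have dgj w : isd (gj w) by exact: isd_marg.
have [h1' [_ hE1]] := inj_eqE h1i; have [h2' [_ hE2]] := inj_eqE h2i.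
have gb w : 1 / 4 <= gj w (b j).
  have le12 l c : tg w l c <= 1 / 2 by case: (tgP w l).
  have e : gj w (b j) = (1 - tg w j1 (h1' (b j))) * (1 - tg w j2 (h2' (b j))).
    have eA : tg w j1 (h1' (b j)) = pr (NA w) (fun a => h1 (a j1) == b j).
      by case: (hA w) => _ _ <- //; apply: eq_pr => a; rewrite hE1.
    have eB : tg w j2 (h2' (b j)) = pr (NB w) (fun a => h2 (a j2) == b j).
      by case: (hB w) => _ _ <- //; apply: eq_pr => a; rewrite hE2.
    rewrite eA eB -!prC // -(indep w (fun d => h1 d != b j) (fun d => h2 d != b j)) // /gj !pr_push.
    apply: eq_pr => ab; rewrite !ffunE eqxx (negbTE (neA _ j1A)) (negbTE (neB _ j2B)) j1A nBA // /pk.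
    rewrite ![b j == _]eq_sym; case: ifP => [_|n]; first by rewrite eqxx.
    apply/negP => /eqP e; have [t1 t2] := thirdP (h1 (ab.1 j1)) (h2 (ab.2 j2)).
    by rewrite e in t1 t2; rewrite ![_ == b j]eq_sym t1 t2 in n.
  by rewrite e; have := le12 j1 (h1' (b j)); have := le12 j2 (h2' (b j)); nra.
(* The law that completes [gj] to [p4]. The bound 1/4 on [gj] at the basepoint makes it nonnegative
   and at most 1/2, as the coupled chain requires. *)
pose tj w c := (p4 R (b j) c - 2 / 5 * gj w c) / (3 / 5).
have tjP w : isd (tj w) /\ forall c, tj w c <= 1 / 2.
  have [g0 g1] := dgj w; have gb' := gb w.
  have gle c : c != b j -> gj w c <= 3 / 4.
    by move=> n; move: g1; rewrite (sum3d _ n); have := g0 (third c (b j)); lra.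
  have gle1 : gj w (b j) <= 1 by exact: pr_le1.
  split; first split=> [c|].
  - rewrite /tj divr_ge0 //; last by lra.
    by rewrite /p4; case: (eqVneq c (b j)) => [->|/gle]; lra.
  - rewrite -mulr_suml sumrB -mulr_sumr g1 (proj2 (p4_isd R (b j))); lra.
  move=> c; rewrite /tj ler_pdivrMr; last by lra.
  by rewrite /p4; case: (eqVneq c (b j)) => [->|n]; [|have := g0 c]; lra.
pose t0 w l := if l == j then tj w else tg w l.
have [|N2 hN2] := @chain_kernel Om t0; first by move=> w l _; rewrite /t0; case: ifP.
have dN2 w : isd (N2 w) by case: (hN2 w).
pose N w psi := (1 - 3 / 5) * N1 w psi + 3 / 5 * N2 w psi.
have dN w : isd (N w) by apply: isd_mix => //; lra.
have mgN w l c : l \in C -> l != j -> pr (N w) (fun psi => psi l == c) = tg w l c.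
  move=> lC lj; have e2 : pr (N2 w) (fun psi => psi l == c) = tg w l c.
    by case: (hN2 w) => _ _ ->; rewrite // /t0 (negbTE lj).
  have e1 : pr (N1 w) (fun psi => psi l == c) = tg w l c.
    have/orP[lA|lB] : (l \in A) || (l \in B) by move: lC; rewrite eC in_setU1 (negbTE lj) in_setU.
      exact: (mgA w l c lA).
    exact: (mgB w l c lB).
  by rewrite pr_mix e1 e2; ring.
have mgj w c : pr (N w) (fun psi => psi j == c) = p4 R (b j) c.
  rewrite pr_mix -/(gj w c); case: (hN2 w) => _ _ ->; rewrite // /t0 eqxx /tj.
  by field.
have sj : s != j := neA s sA. have tj' : t != j := neB t tB.
have [fs' [fsK hfs]] := inj_eqE fsi; have [ft' [ftK hft]] := inj_eqE fti.
have tgs w c : tg w s (fs' c) = off R (fs (mis w s)) c by rewrite /tg s6 /= -{2}(fsK c) off_inj.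
have tgt w c : tg w t (ft' c) = off R (ft (mis w t)) c by rewrite /tg t6 /= -{2}(ftK c) off_inj.
have hX w c : pr (N w) (fun psi => fs (psi s) == c) = off R (fs (mis w s)) c.
  by rewrite (eq_pr _ (F := fun psi : col => psi s == fs' c)) ?mgN ?tgs // => psi /=; rewrite hfs.
have hZ w c : pr (N w) (fun psi => ft (psi t) == c) = off R (ft (mis w t)) c.
  by rewrite (eq_pr _ (F := fun psi : col => psi t == ft' c)) ?mgN ?tgt // => psi /=; rewrite hft.
have hX2 w c : pr (N2 w) (fun psi => fs (psi s) == c) = off R (fs (mis w s)) c.
  rewrite (eq_pr _ (F := fun psi : col => psi s == fs' c)) => [|psi]; last by rewrite /= hfs.
  by case: (hN2 w) => _ _ ->; rewrite // /t0 (negbTE sj) tgs.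
have hZ2 w c : pr (N2 w) (fun psi => ft (psi t) == c) = off R (ft (mis w t)) c.
  rewrite (eq_pr _ (F := fun psi : col => psi t == ft' c)) => [|psi]; last by rewrite /= hft.
  by case: (hN2 w) => _ _ ->; rewrite // /t0 (negbTE tj') tgt.
have hXA w c : pr (NA w) (fun psi => fs (psi s) == c) = off R (fs (mis w s)) c.
  rewrite (eq_pr _ (F := fun psi : col => psi s == fs' c)) => [|psi]; last by rewrite /= hfs.
  by case: (hA w) => _ _ ->.
have hZB w c : pr (NB w) (fun psi => ft (psi t) == c) = off R (ft (mis w t)) c.
  rewrite (eq_pr _ (F := fun psi : col => psi t == ft' c)) => [|psi]; last by rewrite /= hft.
  by case: (hB w) => _ _ ->.
have qs c : 1 / 5 <= pr P (fun w => fs (mis w s) == c).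
  by rewrite (eq_pr _ (F := fun w => mis w s == fs' c)) => [|w /=]; [case/andP: (mis_marg (fs' c) sC s6)|rewrite hfs].
have qt c : 1 / 5 <= pr P (fun w => ft (mis w t) == c).
  by rewrite (eq_pr _ (F := fun w => mis w t == ft' c)) => [|w /=]; [case/andP: (mis_marg (ft' c) tC t6)|rewrite hft].
have okN1 w psi : 0 < N1 w psi -> ok C M psi /\ forall l, l \in C -> l != j -> rho l = 6%N -> psi l != mis w l.
  move=> /push_gt0[|ab [<- pab]]; first by case: (dPr2 w).
  have [a0 b0] : 0 < NA w ab.1 /\ 0 < NB w ab.2.
    have [p0 n0] : 0 <= NA w ab.1 /\ 0 <= NB w ab.2 by case: (dNA w); case: (dNB w).
    by split; rewrite lt_def ?p0 ?n0 andbT; apply: contraTneq pab; rewrite /Pr2 => ->; rewrite ?mul0r ?mulr0 ltxx.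
  have [_ okA mA'] := hA w; have [_ okB mB'] := hB w; have Ms := proj1 cV.
  have cAj x : x \in A -> ~~ M x j (ab.1 x) (F ab j).
    move=> xA; case: (eqVneq x j1) => [->|n]; last by apply: (cov0 _ _ cV (AV x xA) jV (neA x xA)); exact: mA.
    rewrite ffunE eqxx; have [k1 _] := pkP (h1 (ab.1 j1)) (h2 (ab.2 j2)); by apply: contra k1 => /hh1 ->.
  have cBj x : x \in B -> ~~ M x j (ab.2 x) (F ab j).
    move=> xB; case: (eqVneq x j2) => [->|n]; last by apply: (cov0 _ _ cV (BV x xB) jV (neB x xB)); exact: mB.
    rewrite ffunE eqxx; have [_ k1] := pkP (h1 (ab.1 j1)) (h2 (ab.2 j2)); by apply: contra k1 => /hh2 ->.
  have cAB x y : x \in A -> y \in B -> ~~ M x y (ab.1 x) (ab.2 y).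
    move=> xA yB; have xy : x != y by apply: contraTneq yB => <-; rewrite (disjointFr dAB xA).
    by apply: (cov0 _ _ cV (AV x xA) (BV y yB) xy); exact: mAB.
  have FA x : x \in A -> F ab x = ab.1 x by move=> xA; rewrite ffunE (negbTE (neA x xA)) xA.
  have FB x : x \in B -> F ab x = ab.2 x by move=> xB; rewrite ffunE (negbTE (neB x xB)) nBA.
  split=> [x y|l].
    rewrite eC !in_setU1 !in_setU => /or3P[/eqP ->|xA|xB] /or3P[/eqP ->|yA|yB] xy.
    - by rewrite eqxx in xy.
    - by rewrite (FA y yA) Ms cAj.
    - by rewrite (FB y yB) Ms cBj.
    - by rewrite (FA x xA); exact: cAj.
    - by rewrite (FA x xA) (FA y yA); exact: okA.
    - by rewrite (FA x xA) (FB y yB); exact: cAB.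
    - by rewrite (FB x xB); exact: cBj.
    - by rewrite (FB x xB) (FA y yA) Ms cAB.
    - by rewrite (FB x xB) (FB y yB); exact: okB.
  rewrite eC in_setU1 in_setU => /or3P[/eqP ->|lA|lB] lj l6; first by rewrite eqxx in lj.
    by rewrite FA //; apply: (supp_neq (dNA w) (Y := fun psi : col => psi l)) => //; rewrite mA' // /tg l6 /= /off eqxx.
  by rewrite FB //; apply: (supp_neq (dNB w) (Y := fun psi : col => psi l)) => //; rewrite mB' // /tg l6 /= /off eqxx.
apply: (chain_close dN).
- move=> w psi Pw Npos; have [p1 p2] : 0 <= N1 w psi /\ 0 <= N2 w psi by case: (dN1 w); case: (dN2 w).
  have [q1|q1] : 0 < N1 w psi \/ 0 < N2 w psi.
    case: (ltrP 0 (N1 w psi)) => h; [by left|right].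
    by move: Npos; rewrite /N; lra.
    have [o1 l1] := okN1 w psi q1; split=> // l lC l6; apply: l1 => //.
    by apply: contra_eqN l6 => /eqP ->; rewrite j4.
  have [_ o1 h3] := hN2 w; split; first exact: o1.
  move=> l lC l6; apply: (supp_neq (dN2 w) (Y := fun psi : col => psi l)) => //; rewrite h3 // /t0.
  by case: eqP => [e|_]; [rewrite e j4 in l6|rewrite /tg l6 /= /off eqxx].
- move=> l lC; case: (eqVneq l j) => [->|lj].
    have e c : avg P N (fun psi => psi j == c) = p4 R (b j) c.
      by rewrite /avg; under eq_bigr => w _ do rewrite mgj; rewrite -mulr_suml P1 mul1r.
    by split=> [c|_ c]; rewrite e //; case/andP: (p4_bd R (b j) c); lra.
  have e c : avg P N (fun psi => psi l == c) = \sum_w P w * tg w l c.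
    by apply: eq_bigr => w _; rewrite mgN.
  case: (out lC) => [[l6 _ _ _]|[l4 _]].
    split=> [c|]; last by rewrite l6.
    rewrite e; under eq_bigr => w _ do rewrite /tg l6 /=.
    have -> : \sum_w P w * off R (mis w l) c = 1 / 2 * (1 - pr P (fun w => mis w l == c)).
      by rewrite -avg_off; apply: eq_bigr => w _; rewrite /pr (big_pred1 c).
    by case/andP: (mis_marg c lC l6); lra.
  have e4 c : avg P N (fun psi => psi l == c) = p4 R (b l) c.
    by rewrite e; under eq_bigr => w _ do rewrite /tg l4 /=; rewrite -mulr_suml P1 mul1r.
  by split=> [c|_ c]; rewrite e4 //; case/andP: (p4_bd R (b l) c); lra.
- exact: avail_avg dP dN hX hZ qs qt.
move=> k; pose a w := fs (mis w s); pose a' w := ft (mis w t).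
have Ek : Eab k <= 2 / 5.
  apply: le_trans (_ : pr P (fun w => mis w s == fs' k) <= _); last exact: qs4.
  by apply: pr_mono => // w _ /andP[+ _]; rewrite hfs.
(* With weights 2/5 and 3/5 the bounds 1/4 and 1/2 average to 2/5, both as the constant and as the
   coefficient of the event that both ends miss [k]. Since [Eab k <= 2/5], the total is at most
   14/25. *)
apply: (@le_trans _ _ (\sum_w P w * (2 / 5 + 2 / 5 * ((a w == k) && (a' w == k))%:R))); last first.
  have -> : \sum_w P w * (2 / 5 + 2 / 5 * ((a w == k) && (a' w == k))%:R) = 2 / 5 + 2 / 5 * Eab k.
    rewrite /Eab prE mulr_sumr -[X in X + _]mul1r -P1 mulr_suml -big_split; apply: eq_bigr => w _ /=; ring.
  by lra.
apply: ler_sum => w _; apply: ler_wpM2l => //; rewrite pr_mix.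
have f1 : pr (N1 w) (fun psi => forced (fs (psi s)) (ft (psi t)) k) <= 1 / 4 + 1 / 4 * ((a w == k) && (a' w == k))%:R.
  apply: le_trans (off_prod_bound (a w) (a' w) k); rewrite -!hXA -!hZB.
  rewrite -(indep w (fun d => fs d == third k k) (fun d => ft d == third k (third k k))) //.
  rewrite -(indep w (fun d => fs d == third k (third k k)) (fun d => ft d == third k k)) //.
  apply: le_trans (prU _ _ (proj1 (dN1 w))); apply: pr_mono => [|psi _ /=]; first by case: (dN1 w).
  by rewrite /forced; move: (fs _) (ft _) (k) => [[]|] [[]|] [[]|].
have f2 : pr (N2 w) (fun psi => forced (fs (psi s)) (ft (psi t)) k) <= 1 / 2 + 1 / 2 * ((a w == k) && (a' w == k))%:R.
  case: (eqVneq (a w) (a' w)) => [e|ne].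
    case: (eqVneq (a w) k) => [ak|ak] /=; last by rewrite (forced_eq (dN2 w) (hX2 w) (hZ2 w) e ak); lra.
    by rewrite -e ak eqxx /=; have := pr_le1 (fun psi : col => forced (fs (psi s)) (ft (psi t)) k) (dN2 w); lra.
  apply: le_trans (forced_neq (dN2 w) (hX2 w) (hZ2 w) k ne) _.
  by case: (_ && _) => /=; lra.
by move: f1 f2; case: (_ && _) => /=; lra.
Qed.

End Chain.
End RandomColorings.

Lemma set_cons (T : finType) (x : T) s : [set u in x :: s] = x |: [set u in s].
Proof. by apply/setP => u; rewrite !inE. Qed.

Lemma ipath_ed (T : finType) (m : T -> T -> nat) x s : gr m -> ipath m x s ->
  (forall u v, u \in x :: s -> v \in x :: s -> (m u v <= 1)%N) ->
  [/\ forall v, v \in x :: s -> (ed m [set v] [set u in x :: s] <= 2)%N,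
     (ed m [set x] [set u in x :: s] <= (s != [::]))%N & (ed m [set last x s] [set u in x :: s] <= (s != [::]))%N].
Proof.
move=> gm; elim: s x => [|y s IH] x.
  move=> _ _; have e : ed m [set x] [set u in [:: x]] = 0%N.
    by rewrite set_cons edUr ?ed11 ?(proj2 gm) // ?disjoints1 ?inE // ed1l big1 // => u; rewrite inE.
  by split=> [v||]; rewrite /= ?e // inE => /eqP ->; rewrite e.
move=> /= /and4P[p n /allP a i] le1.
have [|h1 h2 h3] := IH y i; first by move=> u v us vs; apply: le1; rewrite in_cons ?us ?vs orbT.
have xs : x \notin y :: s.
  by rewrite in_cons negb_or n; apply/negP => /a; rewrite eqxx.
have dx : [disjoint [set x] & [set u in y :: s]] by rewrite disjoints1 inE.
have E v : ed m [set v] [set u in [:: x, y & s]] = (m v x + ed m [set v] [set u in y :: s])%N.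
  by rewrite set_cons edUr // ed11.
have x0 v : v \in s -> m x v = 0%N by move=> /a /andP[_ /eqP].
have ys := ipath_notin i.
have Ex : (ed m [set x] [set u in [:: x, y & s]] <= 1)%N.
  rewrite E (proj2 gm) add0n set_cons edUr ?disjoints1 ?inE // ed11 [X in (_ + X)%N]ed1l big1 ?addn0.
    by apply: le1; rewrite !inE eqxx ?orbT.
  by move=> u; rewrite inE; apply: x0.
have lx : (m y x <= 1)%N by apply: le1; rewrite !inE eqxx ?orbT.
split=> //; last first.
  rewrite E; case: s ys i h3 x0 {IH h1 h2 le1 xs dx E Ex a} => [|z s] ys i h3 x0; first by rewrite /= in h3 *; lia.
  rewrite (proj1 gm) x0 //=; exact: mem_last.
move=> v; rewrite in_cons => /orP[/eqP ->|]; first by apply: leq_trans Ex _.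
rewrite in_cons => /orP[/eqP ->|vs]; rewrite E.
  by have : (ed m [set y] [set u in y :: s] <= 1)%N by [apply: leq_trans h2 _; case: (s == [::])]; lia.
by rewrite (proj1 gm) x0 // add0n; apply: h1; rewrite in_cons vs orbT.
Qed.

Lemma ipath_cat (T : finType) (m : T -> T -> nat) x c1 l c2 : gr m -> ipath m x (c1 ++ l :: c2) ->
  [/\ ipath m x c1, ipath m l c2, (0 < m (last x c1) l)%N &
    forall u v, u \in x :: c1 -> v \in l :: c2 -> u != v /\ ((u != last x c1) || (v != l) -> m u v = 0%N)].
Proof.
move=> gm; elim: c1 x => [|y c1 IH] x /=.
  move=> /and4P[p n /allP a i]; split=> // u v; rewrite inE => /eqP ->; rewrite in_cons => /orP[/eqP ->|vc].
    by rewrite !eqxx.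
  by have /andP[h /eqP h'] := a v vc; rewrite eq_sym.
move=> /and4P[p n /allP a i]; have [h1 h2 h3 h4] := IH y i.
have a' u : u \in l :: c2 -> (u != x) && (m x u == 0%N) by move=> uc; apply: a; rewrite mem_cat uc orbT.
split=> //; first by rewrite p n h1 andbT /=; apply/allP => u uc; apply: a; rewrite mem_cat uc.
move=> u v; rewrite in_cons => /orP[/eqP -> /a' /andP[h /eqP h']|uc vc]; last exact: h4.
by rewrite eq_sym.
Qed.

Lemma good_weak (R : realFieldType) (T : finType) (U : {set T}) M (rho rho' : T -> nat) b (L : {ffun T -> C3} -> R) :
  (forall v, v \in U -> rho v = 4%N -> rho' v = 4%N) -> good U M rho' b L -> good U M rho b L.
Proof.
move=> h [l0 l1 l2]; split=> // v vU; have [a e] := l2 v vU; split=> // v4; apply: e; exact: h.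
Qed.

Lemma pr_fst (R : realFieldType) (A B : finType) (P : A -> R) (q : B -> R) (E : pred A) : isd q ->
  pr (fun w : A * B => P w.1 * q w.2) (fun w => E w.1) = pr P E.
Proof.
move=> dq; rewrite -[RHS]mulr1 -(pr_all dq (E := xpredT)) // -pr_prod.
by apply: eq_pr => w; rewrite andbT.
Qed.

Lemma pr_snd (R : realFieldType) (A B : finType) (P : A -> R) (q : B -> R) (E : pred B) : isd P ->
  pr (fun w : A * B => P w.1 * q w.2) (fun w => E w.2) = pr q E.
Proof. by move=> dP; rewrite -[RHS]mul1r -(pr_all dP (E := xpredT)) // -pr_prod. Qed.

Lemma rc_fst (R : realFieldType) (T : finType) (U : {set T}) M rho b (Om B : finType) (P : Om -> R) (phi : Om -> {ffun T -> C3}) (q : B -> R) :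
  rc U M rho b P phi -> isd q -> rc U M rho b (fun w : Om * B => P w.1 * q w.2) (fun w => phi w.1).
Proof.
move=> [dP o h] dq; split.
- exact: isd_prod.
- move=> w pos; apply: o; rewrite lt_def (proj1 dP) andbT; apply: contraTneq pos => ->; by rewrite mul0r ltxx.
- move=> v vU; have [a e] := h v vU.
  by split=> [c|v4 c]; rewrite (pr_fst P (fun w => phi w v == c) dq) ?a ?e.
Qed.

(** If q is the mass of a missing color, [off] averages to (1 - q) / 2; this q makes the average
    equal to [p4]. *)
Lemma virtual_isd (R : realFieldType) a : isd (fun c => 1 - 2 * p4 R a c).
Proof.
split=> [c|]; first by case/andP: (p4_bd R a c); lra.
by rewrite sum3; have := proj2 (p4_isd R a); rewrite sum3; lra.
Qed.

(** * One positive vertex and no double edge *)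

Section Cycle.
Variables (R : realFieldType) (T : finType).
Notation col := {ffun T -> C3}.
Implicit Types (A B C U W S : {set T}).
Variables (V : {set T}) (m : T -> T -> nat) (rho : T -> nat).
Hypotheses (gm : gr m) (va : valid rho) (cr : crit R V m rho) (ih : IHyp R T (meas V rho)) (potV : 0 < pot m rho V).
Notation d v := (dg V m v).
Notation ch v := (charge V m rho v).
Notation small := (small V m rho).
Notation posv := (posv V m rho).
Notation cp p := (cp V m rho p).
Variable p : T.
Hypotheses (pp : p \in posv) (Vp : V = cp p).

Lemma p_in : p \in V. Proof. by rewrite Vp cp_self. Qed.

Lemma v_zero v : v \in V -> v != p -> rho v = 6%N /\ d v = 3%N \/ rho v = 4%N /\ d v = 2%N.
Proof.
move=> vV n; have vc : v \in cp p by rewrite -Vp.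
have vs := subsetP (cp_sub V m rho p) v vc; apply: (zeroP gm va cr ih potV vs).
apply: contra n => vp; move: vc; rewrite cpE => /andP[_ pv].
by rewrite (one_pos gm va cr ih potV pp vp pv).
Qed.

Lemma p_six : rho p = 6%N /\ d p = 2%N.
Proof.
case: (posP gm va cr ih potV pp) => // -[p3 _]; exfalso.
by apply: (unique3 gm va cr ih potV p_in p3) => v vV /(v_zero vV) [] [->].
Qed.

Lemma no3 v : v \in V -> rho v != 3%N.
Proof.
move=> vV; case: (eqVneq v p) => [->|n]; first by rewrite (proj1 p_six).
by case: (v_zero vV n) => -[->].
Qed.

Lemma pot_W W : W \subset V -> pot m rho W = (if p \in W then 2 else 0) + 2 * (ed m W (V :\: W))%:Z.
Proof.
move=> sW; rewrite (potE m rho sW) (sum_ch gm va cr ih potV pp) -?Vp //.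
by have [-> _] := ch_pos6 gm va cr ih potV pp (proj1 p_six).
Qed.

Lemma potV2 : pot m rho V = 2.
Proof. by rewrite pot_W // p_in setDv ed0r. Qed.

(** Sets avoiding [p] are settled by [gap], those containing [p] by [bridge_bound]. *)
Lemma e_ge2 W : W \proper V -> W != set0 -> (2 <= ed m W (V :\: W))%N.
Proof.
move=> pW nW; have := gap gm va cr ih potV pW nW; have := bridge_bound gm va cr ih potV pW nW.
rewrite potV2 pot_W ?proper_sub //; case: (p \in W); clear; lia.
Qed.

Lemma nonlaw : ~ (forall M b, cov V m M -> exists L : col -> R, good V M rho b L).
Proof. by move=> h; apply: (proj1 cr); apply: lawful_flex h => v; exact: no3. Qed.

Hypothesis nd : forall x y, x \in V -> y \in V -> (m x y <= 1)%N.
Let Q := V :\ p.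

Lemma Q_proper W : W \subset Q -> W \proper V.
Proof.
move=> sW; apply/properP; split; first by apply: subset_trans sW _; exact: subsetDl.
by exists p; [exact: p_in|apply/negP => /(subsetP sW); rewrite setD11].
Qed.

(** A set off [p] has potential twice the number of its outer edges, so at least 4, and lowering one
    vertex to 4 takes away only 2. *)
Lemma flex_four (D : {set T}) x : D \subset Q -> x \in D -> flex R D m (upd x 4%N rho).
Proof.
move=> sD xD; have pD := Q_proper sD; have xV : x \in V := subsetP (proper_sub pD) x xD.
have xp : x != p by have := subsetP sD x xD; rewrite in_setD1 => /andP[].
case: (v_zero xV xp) => -[rx _]; last first.
  by apply: (sub_flex' gm cr pD) => v _; rewrite /upd; case: eqP => // ->.
apply: NNPP => nf.
have [W [sW xW nfW alt]] := upd_nonflex (r := 4%N) gm va cr ih xV isT (proper_sub pD) (or_introl pD) nf.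
have sWQ : W \subset Q := subset_trans sW sD.
have pW := Q_proper sWQ; have nW : W != set0 by apply/set0Pn; exists x.
have e2 := e_ge2 pW nW; have potW := pot_W (proper_sub pW).
have pW' : p \notin W by apply/negP => /(subsetP sWQ); rewrite setD11.
rewrite (negbTE pW') in potW.
case: alt => [le|[[a [z [az eW m2 _ _]]]|h6]]; last by have := h6 x xW; rewrite updE.
  by move: le e2; rewrite pot_upd // potW rx; clear; lia.
have [aW zW] : a \in W /\ z \in W by rewrite eW !inE !eqxx orbT.
by have := nd (subsetP (proper_sub pW) a aW) (subsetP (proper_sub pW) z zW); rewrite m2.
Qed.

Lemma p_nbrs : exists s t, [/\ s \in Q, t \in Q, s != t, m p s = 1%N & m p t = 1%N /\
  forall x, x \in V -> x != s -> x != t -> m p x = 0%N].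
Proof.
have [p6 dp] := p_six; have pV := p_in.
have e2 : ed m [set p] Q = 2%N by rewrite -dgE.
have [|u [s [+ sQ ms]]] := @ed_gt0 _ m [set p] Q; first by rewrite e2.
rewrite inE => /eqP e; rewrite {u}e in ms.
have sV : s \in V by move: sQ; rewrite in_setD1 => /andP[].
have m1 : m p s = 1%N by have := nd pV sV; move: ms; clear; lia.
have e1 : ed m [set p] (Q :\ s) = 1%N.
  by move: e2; rewrite -{1}(setD1K sQ) edUr ?disjoints1 ?setD11 // ed11 m1; clear; lia.
have [t [tQ mt m0]] := ed_eq1 e1; move: tQ; rewrite in_setD1 => /andP[ts tQ].
exists s, t; split=> //; first by rewrite eq_sym.
split=> // x xV xs xt; case: (eqVneq x p) => [->|xp]; first by case: gm.
by apply: m0 => //; rewrite !in_setD1 xs xp xV.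
Qed.

Definition rhoX (X : {set T}) v := if v \in X then 4%N else rho v.

(** Each vertex converted from 6 to 4 takes away 2 from the potential, which is twice the number of
    outer edges; under the hypothesis it stays positive on every set. *)
Lemma conv (U' X : {set T}) : U' \subset Q -> X \subset U' -> (forall v, v \in X -> rho v = 6%N) ->
  (forall W, W \subset U' -> W != set0 -> (#|W :&: X| < ed m W (V :\: W))%N) -> flex R U' m (rhoX X).
Proof.
move=> sU sX X6 lt; apply: NNPP => nf; have pU := Q_proper sU.
have va' : valid (rhoX X) by move=> v; rewrite /rhoX; case: ifP => // _; exact: va.
have [W [sW nW nfW alt]] := nonflex_pot ih gm va' (meas_sub _ _ pU) nf.
have sWQ : W \subset Q := subset_trans sW sU.
have pW := Q_proper sWQ.
have pW' : p \notin W by apply/negP => /(subsetP sWQ); rewrite setD11.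
have potW := pot_W (proper_sub pW); rewrite (negbTE pW') add0r in potW.
have e : pot m (rhoX X) W = pot m rho W - 2 * #|W :&: X|%:Z.
  rewrite /pot; have -> : #|W :&: X|%:Z = \sum_(v in W) (if v \in X then 1 else 0).
    rewrite -big_mkcondr -sum1_card (big_morph Posz PoszD (erefl _)); apply: eq_bigl => v; exact: in_setI.
  have -> : \sum_(v in W) (rhoX X v)%:Z = \sum_(v in W) (rho v)%:Z - 2 * \sum_(v in W) (if v \in X then 1 else 0).
    rewrite mulr_sumr -sumrB; apply: eq_bigr => v _; rewrite /rhoX; case: ifP => [/X6 ->//|_]; by rewrite mulr0 subr0.
  by ring.
have lW := lt W sW nW.
case: alt => [le|[[a [z [az eW m2 _ _]]]|h6]].
- by move: le; rewrite e potW; move: lW; clear; lia.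
- have [aW zW] : a \in W /\ z \in W by rewrite eW !inE !eqxx orbT.
  by have := nd (subsetP (proper_sub pW) a aW) (subsetP (proper_sub pW) z zW); rewrite m2.
apply: nfW; apply: (sub_flex' gm cr pW) => v vW; have := h6 v vW; rewrite /rhoX.
by case: ifP.
Qed.

Section Path.
Variables (s t : T).
Hypotheses (sQ : s \in Q) (tQ : t \in Q) (st : s != t) (mps : m p s = 1%N) (mpt : m p t = 1%N)
  (mp0 : forall x, x \in V -> x != s -> x != t -> m p x = 0%N).

Lemma QV x : x \in Q -> x \in V. Proof. by rewrite in_setD1 => /andP[]. Qed.

(** Otherwise the component of [s] in [Q] would have a single outer edge, the one to [p]. *)
Lemma s_t_connected : connect (lk m Q) s t.
Proof.
apply: contraT => nc; pose W := [set v in Q | connect (lk m Q) s v].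
have WP v : (v \in W) = (v \in Q) && connect (lk m Q) s v by rewrite /W in_set.
have sW : s \in W by rewrite WP sQ connect0.
have WQ : W \subset Q by apply/subsetP => v; rewrite WP => /andP[].
have nW : W != set0 by apply/set0Pn; exists s.
have := e_ge2 (Q_proper WQ) nW; suff -> : ed m W (V :\: W) = 1%N by [].
have out v w : v \in W -> w \in V :\: W -> w != p -> m v w = 0%N.
  rewrite WP in_setD WP => /andP[vQ cv] /andP[nw wV] wp.
  have wQ : w \in Q by rewrite in_setD1 wp.
  apply/eqP; rewrite -leqn0 leqNgt; apply: contra nw => h; rewrite wQ /=.
  by apply: connect_trans cv _; apply: connect1; rewrite /= vQ wQ.
rewrite (edC _ _ gm).
have pD : p \in V :\: W by rewrite in_setD p_in andbT; apply/negP => /(subsetP WQ); rewrite setD11.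
rewrite -(setD1K pD) edUl ?disjoints1 ?setD11 // [X in (_ + X)%N]/ed big1 ?addn0; last first.
  by move=> w; rewrite in_setD1 => /andP[wp wD]; apply: big1 => v vW; rewrite (proj1 gm); apply: out.
rewrite -(setD1K sW) edUr ?disjoints1 ?setD11 // ed11 mps ed1l big1 ?addn0 // => v.
rewrite in_setD1 => /andP[vs vW]; apply: mp0 => //; first exact: QV (subsetP WQ v vW).
by apply: contraNneq nc => <-; move: vW; rewrite WP => /andP[].
Qed.

Section OnePath.
Variable c : seq T.
Hypotheses (ic : ipath m s c) (cQ : {subset c <= Q}) (lc : last s c = t).
Let C := [set v in s :: c].
Let U := Q :\: C.

Lemma C_Q : {subset s :: c <= Q}.
Proof. by move=> v; rewrite in_cons => /orP[/eqP ->|/cQ]. Qed.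

Lemma CsubQ : C \subset Q. Proof. by apply/subsetP => v; rewrite inE => /C_Q. Qed.
Lemma CsubV : C \subset V. Proof. exact: subset_trans CsubQ (subsetDl _ _). Qed.
Lemma UsubQ : U \subset Q. Proof. exact: subsetDl. Qed.
Lemma UsubV : U \subset V. Proof. exact: subset_trans UsubQ (subsetDl _ _). Qed.
Lemma dUC : [disjoint U & C]. Proof. by rewrite disjoints_subset; apply/subsetP => v; rewrite in_setD in_setC => /andP[]. Qed.
Lemma pnU : p \notin U. Proof. by rewrite in_setD setD11 andbF. Qed.
Lemma pnC : p \notin C. Proof. by apply/negP => /(subsetP CsubQ); rewrite setD11. Qed.
Lemma VE : V = p |: (U :|: C).
Proof.
by rewrite [U :|: C]setUC (UD CsubQ) setD1K // p_in.
Qed.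
Lemma sC : s \in C. Proof. by rewrite inE mem_head. Qed.
Lemma tC : t \in C. Proof. by rewrite inE -lc mem_last. Qed.
Lemma c_ne : c <> [::]. Proof. by move=> e; move: lc st; rewrite e /= => ->; rewrite eqxx. Qed.

Lemma trC : tr m (all6 (T := T)) C.
Proof.
apply: (path_tr gm (A := V)) ic _.
  by move=> v /C_Q /QV.
move=> v a vc aV; have h := nd (QV (cQ vc)) aV; split; first exact: leq_trans h _.
by move=> b bV ab ma; move: h; rewrite ma.
Qed.

Lemma ndC x y : x \in C -> y \in C -> m x y <> 2%N.
Proof. by move=> xC yC e; have := nd (subsetP CsubV x xC) (subsetP CsubV y yC); rewrite e. Qed.

Lemma edC_exact l : l \in C -> (ed m [set l] C + m l p)%N = 2%N.
Proof.
move=> lC; have [h1 h2 h3] : [/\ forall v, v \in s :: c -> (ed m [set v] C <= 2)%N, (ed m [set s] C <= 1)%N & (ed m [set t] C <= 1)%N].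
  have [|a b e] := ipath_ed gm ic; first by move=> u v us vs; apply: nd; apply: QV; exact: C_Q.
  by rewrite lc in e; split=> //; [apply: leq_trans b _|apply: leq_trans e _]; case: (c == _).
have lsc : l \in s :: c by move: lC; rewrite inE.
rewrite (proj1 gm); case: (eqVneq l s) => [->|ls].
  rewrite mps; suff : (0 < ed m [set s] C)%N by move: h2; clear; lia.
  case: c c_ne ic @C => // y c' _ /= /and4P[my _ _ _]; apply: leq_trans my _; apply: ed_ge1.
  by rewrite !inE eqxx orbT.
have lc' : l \in c by move: lsc; rewrite in_cons (negbTE ls).
case: (eqVneq l t) => [->|lt].
  rewrite mpt; have tc : t \in c by move: (lc'); case: (eqVneq l t) => // _ _; have := mem_last s c; rewrite lc in_cons eq_sym (negbTE st).
  have [a aS ma] := ipath_nbr gm ic tc; have aC : a \in C by rewrite inE.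
  by have := ed_ge1 m t aC; move: ma h3; clear; lia.
have lV := QV (C_Q lsc); rewrite mp0 // addn0.
have llast : l != last s c by rewrite lc.
have [a [b [aS bS ab ma mb]]] := ipath_inner gm ic lc' llast.
have [aC bC] : a \in C /\ b \in C by rewrite !inE.
by have := ed_ge2 m l aC bC ab; have := h1 l lsc; move: ma mb; clear; lia.
Qed.

Lemma outer_deg l : l \in C -> rho l = 6%N /\ ed m [set l] U = 1%N \/ rho l = 4%N /\ ed m [set l] U = 0%N.
Proof.
move=> lC; have lQ := subsetP CsubQ l lC; have lp : l != p by move: lQ; rewrite in_setD1 => /andP[].
have e : d l = (ed m [set l] U + ed m [set l] C + m l p)%N.
  have dp : [disjoint [set p] & U :|: C] by rewrite disjoints1 in_setU negb_or pnU pnC.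
  by rewrite /dg {1}VE (edUr _ _ dp) ed11 (edUr _ _ dUC); clear; lia.
have h := edC_exact lC.
by case: (v_zero (QV lQ) lp) => -[r dl]; [left|right]; split=> //; move: e h; rewrite dl; clear; lia.
Qed.

Lemma outer : exists o : T -> T, forall l, l \in C ->
  [/\ rho l = 6%N, o l \in U, m (o l) l = 1%N & forall u, u \in U -> u != o l -> m u l = 0%N] \/
  (rho l = 4%N /\ forall u, u \in U -> m u l = 0%N).
Proof.
have ex l : exists x, l \in C -> [/\ rho l = 6%N, x \in U, m x l = 1%N & forall u, u \in U -> u != x -> m u l = 0%N] \/
  (rho l = 4%N /\ forall u, u \in U -> m u l = 0%N).
  case: (boolP (l \in C)) => lC; last by exists l.
  case: (outer_deg lC) => -[r e].
    have [x [xU m1 m0]] := ed_eq1 e; exists x => _; left; split=> //; first by rewrite (proj1 gm).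
    by move=> u uU n; rewrite (proj1 gm) m0.
  by exists l => _; right; split=> // u uU; rewrite (proj1 gm); apply: (ed_eq0 e) => //; rewrite inE.
by have [o ho] := fin_all_exists ex; exists o.
Qed.

Section Outer.
Variable o : T -> T.
Hypothesis ho : forall l, l \in C ->
  [/\ rho l = 6%N, o l \in U, m (o l) l = 1%N & forall u, u \in U -> u != o l -> m u l = 0%N] \/
  (rho l = 4%N /\ forall u, u \in U -> m u l = 0%N).
Variables (M : T -> T -> C3 -> C3 -> bool) (b : T -> C3).
Hypothesis cV : cov V m M.

Lemma cV' : cov (p |: (U :|: C)) m M. Proof. by rewrite -VE. Qed.

Lemma mp0' x : x \in U :|: C -> x != s -> x != t -> m p x = 0%N.
Proof. by move=> xU; apply: mp0; rewrite VE in_setU1 xU orbT. Qed.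

Lemma cU : cov U m M.
Proof. by apply: covS cV UsubV _ => *. Qed.

Lemma n3U v : v \in U -> rho v != 3%N.
Proof. by move=> vU; apply: no3; exact: (subsetP UsubV). Qed.

Lemma lawU : exists L : col -> R, good U M rho b L.
Proof. exact: (flex_lawful n3U (sub_flex gm cr (Q_proper UsubQ)) b cU). Qed.

Lemma goodV (L : col -> R) : good (p |: (U :|: C)) M rho b L -> exists L : col -> R, good V M rho b L.
Proof. by rewrite -VE; exists L. Qed.

Let ps := chain_matchings gm dUC pnC sC tC mps mpt ho cV'.

Lemma use_alpha : rho s = 4%N -> exists L : col -> R, good V M rho b L.
Proof.
move=> s4; have [g [fs [ft [fsi fti hs ht hg]]]] := ps; have [L0 /good_rc rU] := lawU.
have [p6 _] := p_six.
case: (ho tC) => [[t6 _ _ _]|[t4 _]].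
  have [||||L] := @chain_alpha R T U C p s t o m rho gm dUC pnU pnC trC ndC sC tC st mp0' p6 ho M b cV' g fs ft
    fsi fti hs ht hg _ _ _ rU (mis o g id ^~ t) => //; last by move/goodV.
  - by move=> k; case/andP: (mis_marg ho hg rU k tC t6).
  - by rewrite t6.
(* A 4-vertex [t] has no outer neighbor to supply a missing color, so a virtual one is drawn
   independently. *)
have rU' := rc_fst rU (virtual_isd R (b t)); have [dP _ _] := rU.
have qE k : pr (fun w : col * C3 => L0 w.1 * (1 - 2 * p4 R (b t) w.2)) (fun w => w.2 == k) = 1 - 2 * p4 R (b t) k.
  by rewrite (pr_snd (fun d => 1 - 2 * p4 R (b t) d) (fun d => d == k) dP) /pr (big_pred1 k).
have [||||L] := @chain_alpha R T U C p s t o m rho gm dUC pnU pnC trC ndC sC tC st mp0' p6 ho M b cV' g fs ft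
    fsi fti hs ht hg _ _ _ rU' (fun w => w.2) => //; last by move/goodV.
- by rewrite t4.
- by move=> k; rewrite qE; case/andP: (p4_bd R (b t) k); lra.
- by move=> _ k; rewrite qE; lra.
Qed.

Lemma use_alpha' : rho s = 6%N -> rho t = 4%N -> exists L : col -> R, good V M rho b L.
Proof.
move=> s6 t4; have [g [fs [ft [fsi fti hs ht hg]]]] := ps; have [L0 /good_rc rU] := lawU.
have [p6 _] := p_six.
have ts : t != s by rewrite eq_sym.
have mpts x : x \in U :|: C -> x != t -> x != s -> m p x = 0%N by move=> xU xt xs; apply: mp0'.
have [||||L] := @chain_alpha R T U C p t s o m rho gm dUC pnU pnC trC ndC tC sC ts mpts p6 ho M b cV' g ft fs
    fti fsi ht hs hg _ _ _ rU (mis o g id ^~ s) => //; last by move/goodV.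
- by move=> k; case/andP: (mis_marg ho hg rU k sC s6).
- by rewrite s6.
Qed.

Lemma lawU4 x : x \in U -> exists L : col -> R, good U M rho b L /\ forall c, pr L (fun phi => phi x == c) = p4 R (b x) c.
Proof.
move=> xU; have fl := flex_four UsubQ xU.
have n3 v : v \in U -> upd x 4%N rho v != 3%N by move=> vU; rewrite /upd; case: ifP => // _; exact: n3U.
have [L gL] := flex_lawful n3 fl b cU; exists L; split.
  by apply: good_weak gL => v _ v4; rewrite /upd; case: ifP.
by case: gL => _ _ /(_ x xU) [_ e]; apply: e; rewrite updE.
Qed.

(** The outer neighbor of [s] is colored with the law of a 4-vertex, so that the color missing at
    [s] has masses at most 2/5. *)
Lemma use_beta j : j \in C -> j != s -> j != t -> rho j = 4%N -> rho s = 6%N -> rho t = 6%N -> exists L : col -> R, good V M rho b L.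
Proof.
move=> jC js jt j4 s6 t6; have [g [fs [ft [fsi fti hs ht hg]]]] := ps; have [p6 _] := p_six.
case: (ho sC) => [[_ osU _ _]|[]]; last by rewrite s6.
have [L0 [/good_rc rU qos]] := lawU4 osU.
have jc : j \in c by move: jC; rewrite inE in_cons (negbTE js).
have [c1 [c2 ec]] : exists c1 c2, c = c1 ++ j :: c2 by case/splitPr: jc => c1 c2; exists c1, c2.
have ic' := ic; rewrite ec in ic'; have [i1 i2 ml mz] := ipath_cat gm ic'.
have lt' : last j c2 = t by rewrite -lc ec last_cat.
have mem_c v : (v \in C) = [|| v == j, v \in s :: c1 | v \in c2].
  by rewrite inE ec in_cons mem_cat in_cons [v \in s :: c1]in_cons; case: (v == s); case: (v \in c1); case: (v == j).
case: c2 ec i2 lt' mz mem_c ic' => [|j2 c2] ec i2 lt' mz mem_c ic'; first by rewrite /= in lt'; rewrite lt' eqxx in jt.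
move: i2 => /= /and4P[mjj2 _ /allP aj i2].
have Cone u v : u \in C -> v \in C -> (0 < m u v)%N -> m u v = 1%N.
  by move=> uC vC h; have := nd (subsetP CsubV u uC) (subsetP CsubV v vC); move: h; clear; lia.
pose A := [set u in s :: c1]; pose B := [set u in j2 :: c2].
have AC u : u \in s :: c1 -> u \in C by rewrite mem_c => ->; rewrite orbT.
have BC u : u \in j2 :: c2 -> u \in C by rewrite mem_c => ->; rewrite !orbT.
have trp x r : ipath m x r -> {subset x :: r <= C} -> tr m (all6 (T := T)) [set u in x :: r].
  move=> i sub; apply: (path_tr gm (A := V)) i _; first by move=> v /sub; exact: (subsetP CsubV).
  move=> v a vr aV; have h : (m v a <= 1)%N by apply: nd => //; apply: (subsetP CsubV); apply: sub; rewrite in_cons vr orbT.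
  by split=> [|b' _ _ ma]; [exact: leq_trans h _|move: h; rewrite ma].
have j2in : j2 \in [:: j, j2 & c2] by rewrite !inE eqxx orbT.
have Bin u : u \in j2 :: c2 -> u \in [:: j, j2 & c2] by move=> uB; rewrite in_cons uB orbT.
have jnA : j \notin s :: c1.
  by apply/negP => jA; have [] := mz j j jA (mem_head _ _); rewrite eqxx.
have jnB : j \notin j2 :: c2.
  have := ic'; move=> /(ipath_cat gm) [_ + _ _]; exact: ipath_notin.
suff [L] : exists L : col -> R, good (p |: (U :|: C)) M rho b L by move/goodV.
apply: (@chain_beta R T U C p s t o m rho gm dUC pnU pnC trC ndC sC tC mp0' p6 ho M b cV' g fs ft
    fsi fti hs ht hg _ _ _ rU A B j (last s c1) j2 _ _ _ _ _ _ _ s6 t6 j4).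
- by apply/setP => v; rewrite mem_c !in_setU1 !in_setU !in_set.
- rewrite disjoints_subset; apply/subsetP => u; rewrite !in_set => uA; apply/negP => uB.
  by have [] := mz u u uA (Bin u uB); rewrite eqxx.
- by rewrite in_setU negb_or !in_set jnA.
- by apply: trp i1 _ => u /AC.
- by apply: trp i2 _ => u /BC.
- by rewrite in_set mem_head.
- by rewrite in_set -lt' /= mem_last.
- by rewrite in_set mem_last.
- by rewrite in_set mem_head.
- by apply: Cone => //; apply: AC; exact: mem_last.
- by rewrite (proj1 gm); apply: Cone => //; apply: BC; exact: mem_head.
- move=> x; rewrite in_set => xA n; have [_ h] := mz x j xA (mem_head _ _); by apply: h; rewrite n.
- move=> x; rewrite in_set in_cons => /orP[/eqP ->|xB] n; first by rewrite eqxx in n.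
  by rewrite (proj1 gm); have /andP[_ /eqP] := aj x xB.
- move=> x y; rewrite !in_set => xA yB; have [_ h] := mz x y xA (Bin y yB); apply: h.
  by apply/orP; right; apply: contraNneq jnB => <-.
- move=> c'; have [gi _] := hg s sC s6; have [g' [_ hg']] := inj_eqE gi.
  rewrite (eq_pr _ (F := fun phi : col => phi (o s) == g' c')) => [|phi]; last by rewrite /mis /= hg'.
  by rewrite qos; case/andP: (p4_bd R (b (o s)) (g' c')); lra.
Qed.

Lemma use_short : c = [:: t] -> rho s = 6%N -> rho t = 6%N -> exists L : col -> R, good V M rho b L.
Proof.
move=> ec s6 t6; have [g [fs [ft [fsi fti hs ht hg]]]] := ps; have [p6 _] := p_six; have [L0 /good_rc rU] := lawU.
have Cst l : l \in C -> l = s \/ l = t by rewrite inE ec !inE => /orP[] /eqP ->; auto.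
have [||L] := @chain_tilt R T U C p s t o m rho gm dUC pnU pnC trC ndC sC tC mp0' p6 ho M b cV' g fs ft
    fsi fti hs ht hg _ _ _ rU => //; last by move/goodV.
- by move=> l /Cst [] ->.
- by move=> k _ l c' /Cst [] ->; rewrite eqxx.
Qed.

(** The two components are colored independently, with 4-vertex laws at [o s] and [o t]. Both ends
    then miss [k] with probability at most 4/25, below the 1/5 at which [chain_tilt] imposes a
    condition. *)
Lemma use_apart : (forall l, l \in C -> rho l = 6%N) -> ~~ connect (lk m U) (o s) (o t) -> exists L : col -> R, good V M rho b L.
Proof.
move=> a6 nc; have [g [fs [ft [fsi fti hs ht hg]]]] := ps; have [p6 _] := p_six.
case: (ho sC) => [[s6 osU _ _]|[]]; last by rewrite a6 // sC.
case: (ho tC) => [[t6 otU _ _]|[]]; last by rewrite a6 // tC.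
pose D := [set v in U | connect (lk m U) (o s) v].
have DP v : (v \in D) = (v \in U) && connect (lk m U) (o s) v by rewrite /D in_set.
have DU : D \subset U by apply/subsetP => v; rewrite DP => /andP[].
have osD : o s \in D by rewrite DP osU connect0.
have otD : o t \in U :\: D by rewrite in_setD DP otU (negbTE nc).
have DQ : D \subset Q := subset_trans DU UsubQ.
have EQ : U :\: D \subset Q := subset_trans (subsetDl _ _) UsubQ.
have law x (S : {set T}) : S \subset U -> x \in S -> exists L : col -> R, good S M rho b L /\ forall c, pr L (fun phi => phi x == c) = p4 R (b x) c.
  move=> SU xS; have fl := flex_four (subset_trans SU UsubQ) xS.
  have n3 v : v \in S -> upd x 4%N rho v != 3%N by move=> vS; rewrite /upd; case: ifP => // _; apply: n3U; exact: (subsetP SU).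
  have cS : cov S m M by apply: covS cU SU _ => *.
  have [L gL] := flex_lawful n3 fl b cS; exists L; split.
    by apply: good_weak gL => v _ v4; rewrite /upd; case: ifP.
  by case: gL => _ _ /(_ x xS) [_ e]; apply: e; rewrite updE.
have [L1 [/good_rc r1 q1]] := law _ D DU osD.
have [L2 [g2 q2]] := law _ (U :\: D) (subsetDl _ _) otD; have [d2 o2 m2] := g2.
have [d1 _ _] := r1.
have dDE : [disjoint D & U :\: D] := disjD U D.
have avL2 (E : pred col) : avg L1 (fun _ : col => L2) E = pr L2 E by rewrite /avg -mulr_suml (proj2 d1) mul1r.
have eDE x y : x \in D -> y \in U :\: D -> m x y = 0%N.
  rewrite DP => /andP[xU cx]; rewrite in_setD DP => /andP[ny yU]; apply/eqP; rewrite -leqn0 leqNgt.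
  apply: contra ny => h; rewrite yU; apply: connect_trans cx _; apply: connect1; by rewrite /= xU yU.
have rU : rc (D :|: (U :\: D)) M rho b (fun w : col * col => L1 w.1 * L2 w.2) (fun w => merge D w.1 w.2).
  apply: (rc_ext (N := fun _ => L2) (proj1 cV) dDE r1) => //.
  - move=> w psi _ L2p; split; first exact: o2.
    move=> x y xD yE; have yU := subsetP (subsetDl _ _) y yE; have xU := subsetP DU x xD.
    apply: (cov0 _ _ cU xU yU); last exact: eDE.
    by apply: contraTneq yE => <-; rewrite (disjointFr dDE xD).
  - by move=> v vE; have [a e] := m2 v vE; split=> [c'|v4 c']; rewrite avL2 ?a ?e.
rewrite (UD DU) in rU.
have otnD : o t \in D = false by move: otD; rewrite in_setD => /andP[/negbTE].
have [||L] := @chain_tilt R T U C p s t o m rho gm dUC pnU pnC trC ndC sC tC mp0' p6 ho M b cV' g fs ft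
    fsi fti hs ht hg _ _ _ rU => //; last by move/goodV.
move=> k big; exfalso; move: big.
have [gsi _] := hg s sC s6; have [gti _] := hg t tC t6.
have [gs' [_ hgs]] := inj_eqE gsi; have [gt' [_ hgt]] := inj_eqE gti.
have [fs' [_ hfs]] := inj_eqE fsi; have [ft' [_ hft]] := inj_eqE fti.
rewrite /Eab (eq_pr _ (F := fun w : col * col => (w.1 (o s) == gs' (fs' k)) && (w.2 (o t) == gt' (ft' k)))) => [|w]; last first.
  by rewrite /mis hfs hft hgs hgt !ffunE osD otnD.
rewrite (pr_prod L1 L2 (fun a => a (o s) == gs' (fs' k)) (fun a => a (o t) == gt' (ft' k))) q1 q2.
by case/andP: (p4_bd R (b (o s)) (gs' (fs' k))); case/andP: (p4_bd R (b (o t)) (gt' (ft' k))); nra.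
Qed.

Section Average.
Variable X : bool -> {set T}.
Hypotheses (sX : forall x, X x \subset U) (X6 : forall x v, v \in X x -> rho v = 6%N)
  (convX : forall x W, W \subset U -> W != set0 -> (#|W :&: X x| < ed m W (V :\: W))%N).

(** Averages over the three basepoints of the converted vertices and over [X true] and [X false]. A
    vertex converted both times becomes uniform; one converted once has masses at most half of 1/3 +
    3/5, that is 7/15. The sum 1/3 + 7/15 is exactly the 4/5 of [chain_tilt]. *)
Lemma average_rc : exists (Om : finType) (P : Om -> R) (phi : Om -> col), rc U M rho b P phi /\
  forall v, v \in U -> [/\ forall k, (exists x, v \in X x) -> pr P (fun w => phi w v == k) <= 7 / 15 &
     forall k, (forall x, v \in X x) -> pr P (fun w => phi w v == k) = 1 / 3].
Proof.
pose bb (q : C3 * bool) v := if v \in X q.2 then q.1 else b v.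
have ex (q : C3 * bool) : exists L : col -> R, good U M (rhoX (X q.2)) (bb q) L.
  have fl := conv UsubQ (sX q.2) (@X6 q.2) (@convX q.2).
  have n3 v : v \in U -> rhoX (X q.2) v != 3%N by move=> vU; rewrite /rhoX; case: ifP => // _; exact: n3U.
  by have [L gL] := flex_lawful n3 fl (bb q) cU; exists L.
have [L gL] := fin_all_exists ex.
have dL q : isd (L q) by case: (gL q).
pose P (w : C3 * bool * col) : R := 1 / 6 * L w.1 w.2.
have prP (E : pred col) : pr P (fun w => E w.2) = 1 / 6 * \sum_i \sum_x pr (L (i, x)) E.
  rewrite /P (pr_pair (fun _ => 1 / 6) L (fun _ psi => E psi)) -mulr_sumr; congr (_ * _).
  by rewrite pair_bigA; apply: eq_bigr => -[i x] _.
have sum6 (F : C3 -> bool -> R) : \sum_i \sum_x F i x = F None true + F None false + (F (Some true) true + F (Some true) false + (F (Some false) true + F (Some false) false)).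
  by rewrite sum3 !big_bool.
have sp4 k : p4 R None k + (p4 R (Some true) k + p4 R (Some false) k) = 1.
  by rewrite /p4; case: k => [[]|] /=; lra.
have mX v x k : v \in U -> v \in X x -> forall i, pr (L (i, x)) (fun phi => phi v == k) = p4 R i k.
  move=> vU vX i; case: (gL (i, x)) => _ _ /(_ v vU) [_ e]; rewrite e /rhoX /bb /= vX //.
have lb v q k : v \in U -> 1 / 5 <= pr (L q) (fun phi => phi v == k).
  by move=> vU; case: (gL q) => _ _ /(_ v vU) [].
have ub v q k : v \in U -> pr (L q) (fun phi => phi v == k) <= 3 / 5.
  by move=> vU; apply: (le35 (isd_marg v (dL q))) => k'; exact: lb.
exists (C3 * bool * col)%type, P, (fun w => w.2); split.
  split.
  - split=> [w|]; first by rewrite /P mulr_ge0 ?divr_ge0 //; case: (dL w.1).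
    rewrite -[LHS]/(pr P (fun w => xpredT w.2)) prP sum6; under eq_pr => w do [].
    by rewrite !(pr_all (dL _)) //; lra.
  - move=> w pos; case: (gL w.1) => [[l0 _] o1 _]; apply: o1; rewrite lt_def l0 andbT.
    by apply: contraTneq pos; rewrite /P => ->; rewrite mulr0 ltxx.
  move=> v vU; split=> [k|v4 k]; rewrite (prP (fun phi => phi v == k)) sum6.
    have h i x := lb v (i, x) k vU.
    have := (h None true, h None false, h (Some true) true, h (Some true) false, h (Some false) true, h (Some false) false).
    by case=> [[[[[h1 h2] h3] h4] h5] h6]; clear h; lra.
  have e q : pr (L q) (fun phi => phi v == k) = p4 R (b v) k.
    have vX : v \in X q.2 = false by apply/negP => /X6; rewrite v4.
    by case: (gL q) => _ _ /(_ v vU) [_ e]; rewrite e /rhoX /bb vX.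
  by rewrite !e; lra.
move=> v vU; split=> k.
  move=> [x vX]; rewrite (prP (fun phi => phi v == k)) sum6.
  have h i := mX v x k vU vX i; have h' i := ub v (i, ~~ x) k vU.
  have := (h' None, h' (Some true), h' (Some false)); have := (h None, h (Some true), h (Some false)); have := sp4 k.
  by case: x {vX h h'} => /= sp [[-> ->] ->] [[h1 h2] h3]; lra.
move=> vX; rewrite (prP (fun phi => phi v == k)) sum6; have := sp4 k.
by rewrite !(mX v _ k vU (vX _)); lra.
Qed.

Lemma use_average z : (forall l, l \in C -> rho l = 6%N) -> z = s \/ z = t -> (forall x, o z \in X x) ->
  (forall l, l \in C -> l != s -> l != t -> rho (o l) = 4%N \/ exists x, o l \in X x) ->
  exists L : col -> R, good V M rho b L.
Proof.
move=> a6 zst zX lX; have [g [fs [ft [fsi fti hs ht hg]]]] := ps; have [p6 _] := p_six.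
have [Om [P [phi [rU avX]]]] := average_rc; have [[P0 _] _ mU] := rU.
have oU l : l \in C -> o l \in U by move=> lC; case: (ho lC) => [[]//|[]]; rewrite a6.
have [||L] := @chain_tilt R T U C p s t o m rho gm dUC pnU pnC trC ndC sC tC mp0' p6 ho M b cV' g fs ft
    fsi fti hs ht hg _ _ _ rU => //; last by move/goodV.
move=> k _ l k' lC ls lt.
have zE : Eab s t o g fs ft P phi k <= 1 / 3.
  case: zst zX => -> zX.
    have [gi _] := hg s sC (a6 s sC); have [g' [_ hg']] := inj_eqE gi; have [f' [_ hf']] := inj_eqE fsi.
    have [_ e] := avX _ (oU s sC); rewrite -(e (g' (f' k)) zX) /Eab.
    by apply: pr_mono => // w _ /andP[+ _]; rewrite hf' /mis hg'.
  have [gi _] := hg t tC (a6 t tC); have [g' [_ hg']] := inj_eqE gi; have [f' [_ hf']] := inj_eqE fti.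
  have [_ e] := avX _ (oU t tC); rewrite -(e (g' (f' k)) zX) /Eab.
  by apply: pr_mono => // w _ /andP[_]; rewrite hf' /mis hg'.
suff : pr P (fun w => mis o g phi w l == k') <= 7 / 15 by lra.
have [gi _] := hg l lC (a6 l lC); have [g' [_ hg']] := inj_eqE gi.
rewrite (eq_pr _ (F := fun w => phi w (o l) == g' k')) => [|w]; last by rewrite /mis hg'.
case: (lX l lC ls lt) => [r4|ex].
  have [_ e] := mU _ (oU l lC); rewrite e //; case/andP: (p4_bd R (b (o l)) (g' k')); lra.
by have [e _] := avX _ (oU l lC); apply: e.
Qed.

End Average.

(** A set [W] violating the bound of [conv] has no edge to the rest of [U], distinct chain vertices
    have distinct outer neighbors in it, and all these are converted. The sets [X] prevent this: in
    the component of [o s], the vertices [o s] and [o t] cannot both be so; in any other component,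
    the outer neighbor of the first chain vertex (for [true]) or of the last (for [false]) is left
    out. *)
Lemma use_together : (forall l, l \in C -> rho l = 6%N) -> connect (lk m U) (o s) (o t) -> rho (o s) = 6%N \/ rho (o t) = 6%N ->
  exists L : col -> R, good V M rho b L.
Proof.
move=> a6 cst r6; pose cu := connect (lk m U).
have oU l : l \in C -> [/\ o l \in U, m (o l) l = 1%N & forall u, u \in U -> u != o l -> m u l = 0%N].
  by move=> lC; case: (ho lC) => [[]//|[]]; rewrite a6.
have cuC x y : cu x y = cu y x by rewrite /cu lk_sym.
pose idx l := index l (s :: c).
have idx_inj l l' : l \in C -> idx l = idx l' -> l = l'.
  rewrite inE => lC e; have l'C : l' \in s :: c by rewrite -index_mem -/(idx l') -e index_mem.
  by rewrite -(nth_index s lC) -/(idx l) e nth_index.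
(* [o t] is converted only when the violation fails for another reason: [o s] is a 4-vertex and
   never converted, or [o t] serves a second chain vertex. *)
pose cond (x : bool) l v := if cu (o s) v then [|| v != o t, rho (o s) == 4%N | [exists l' in C, (l' != t) && (o l' == o t)]]
  else [exists j in C, (if x then (idx j < idx l)%N else (idx l < idx j)%N) && cu v (o j)].
pose X x := [set v in U | (rho v == 6%N) && [exists l in C, (o l == v) && cond x l v]].
have XP x v : reflect [/\ v \in U, rho v = 6%N & exists l, [/\ l \in C, o l = v & cond x l v]] (v \in X x).
  rewrite /X in_set; apply: (iffP and3P) => [[vU /eqP v6 /exists_inP[l lC /andP[/eqP e h]]]|[vU v6 [l [lC e h]]]]; split=> //.
  - by exists l.
  - by apply/eqP.
  - by apply/exists_inP; exists l => //; rewrite e eqxx.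
(* An edge leaving [W] goes to the chain, one for each chain vertex with outer neighbor in [W], or
   to the rest of [U]; none goes to [p]. *)
have count W : W \subset U -> ed m W (V :\: W) = (#|[set l in C | o l \in W]| + ed m W (U :\: W))%N.
  move=> sW; have pW : p \notin W by apply/negP => /(subsetP sW); apply/negP; exact: pnU.
  have eD : V :\: W = (C :|: (U :\: W)) :|: [set p].
    apply/setP => v; rewrite VE in_setD in_setU1 !in_setU in_setD in_set1.
    case: (eqVneq v p) => [->|vp] /=; first by rewrite (negbTE pW) orbT.
    rewrite orbF; case: (boolP (v \in W)) => vW /=; last by rewrite orbC.
    by rewrite orbF (disjointFr dUC (subsetP sW v vW)).
  have d1 : [disjoint C & U :\: W] by apply: disjointWr (subsetDl _ _) _; rewrite disjoint_sym; exact: dUC.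
  have d2 : [disjoint C :|: (U :\: W) & [set p]].
    by rewrite disjoint_sym disjoints1 in_setU negb_or pnC in_setD negb_and pnU orbT.
  have ep : ed m W [set p] = 0%N.
    rewrite /ed big1 // => u uW; rewrite big_set1 (proj1 gm); have uU := subsetP sW u uW.
    apply: mp0'; first by rewrite in_setU uU.
      by apply: contraTneq uU => ->; rewrite in_setD sC.
    by apply: contraTneq uU => ->; rewrite in_setD tC.
  rewrite eD (edUr _ _ d2) (edUr _ _ d1) ep addn0; congr (_ + _)%N.
  rewrite (edC _ _ gm) -sum1_card ed_sum; have -> : (\sum_(x in [set l in C | o l \in W]) 1 = \sum_(l in C | o l \in W) 1)%N.
    by apply: eq_bigl => l; rewrite in_set.
  rewrite big_mkcondr; apply: eq_bigr => l lC; have [olU ml m0] := oU l lC; rewrite ed1l; case: ifP => ow.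
    rewrite (bigD1 (o l)) //= (proj1 gm) ml big1 // => u /andP[uW n]; rewrite (proj1 gm) m0 //; exact: (subsetP sW).
  by rewrite big1 // => u uW; rewrite (proj1 gm) m0 //; [exact: (subsetP sW)|apply: contraFneq ow => <-].
have e2 W : W \subset U -> W != set0 -> (2 <= ed m W (V :\: W))%N.
  by move=> sW; apply: e_ge2; apply: Q_proper; apply: subset_trans sW UsubQ.
have convX x W : W \subset U -> W != set0 -> (#|W :&: X x| < ed m W (V :\: W))%N.
  move=> sW nW; rewrite ltnNge; apply/negP => le.
  pose J := [set l in C | o l \in W].
  have JP l : (l \in J) = (l \in C) && (o l \in W) by rewrite in_set.
  have ge2 := e2 W sW nW; have cnt := count W sW; rewrite -/J in cnt.
  have sub : W :&: X x \subset o @: J.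
    apply/subsetP => v; rewrite in_setI => /andP[vW /XP [_ _ [l [lC e _]]]]; apply/imsetP; exists l => //.
    by rewrite JP lC e.
  have c1 := subset_leq_card sub; have c2 := leq_imset_card o J.
  have closed : ed m W (U :\: W) = 0%N by move: le cnt c1 c2; clear; lia.
  have inj : {in J &, injective o} by apply/imset_injP/eqP; move: le cnt c1 c2; clear; lia.
  have eX : W :&: X x = o @: J by apply/eqP; rewrite eqEcard sub; move: le cnt c1 c2; clear; lia.
  have inX l : l \in J -> o l \in X x.
    by move=> lJ; have : o l \in W :&: X x by [rewrite eX; apply: imset_f]; rewrite in_setI => /andP[].
  have clos u v : u \in W -> cu u v -> v \in W.
    move=> uW /connectP[r + ->]; elim: r u uW => //= w r IH u uW /andP[/and3P[_ wU muw] pr]; apply: IH pr.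
    apply: contraT => wW; have : m u w = 0%N by apply: (ed_eq0 closed) => //; rewrite in_setD wW.
    by move=> e; rewrite e in muw.
  have [l0 l0J] : exists l, l \in J by apply/card_gt0P; move: ge2 cnt; rewrite closed; clear; lia.
  case: (classic (exists2 l, l \in J & cu (o s) (o l))) => [[l lJ csl]|nc].
    have olW : o l \in W by move: lJ; rewrite JP => /andP[].
    have osW : o s \in W by apply: clos olW _; rewrite cuC.
    have otW : o t \in W by apply: clos osW cst.
    have sJ : s \in J by rewrite JP sC.
    have tJ : t \in J by rewrite JP tC.
    have /XP [_ _ [l1 [_ _]]] := inX t tJ; rewrite /cond /cu cst eqxx /= => /orP[/eqP r4|/exists_inP[l' l'C /andP[l't /eqP e]]].
      by have /XP [_ + _] := inX s sJ; rewrite r4.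
    have l'J : l' \in J by rewrite JP l'C e.
    by move: l't; rewrite (inj l' t l'J tJ e) eqxx.
  have key l : l \in J -> exists2 j, j \in J & (if x then (idx j < idx l)%N else (idx l < idx j)%N).
    move=> lJ; have /XP [_ _ [l1 [l1C e]]] := inX l lJ; rewrite /cond; case: ifP => [h|_].
      by case: nc; exists l.
    move=> /exists_inP[j jC /andP[lt cj]]; have olW : o l \in W by move: lJ; rewrite JP => /andP[].
    have l1J : l1 \in J by rewrite JP l1C e.
    exists j; first by rewrite JP jC; exact: clos cj.
    by rewrite -(inj l1 l l1J lJ e).
  case: x key {inX eX sub c1 le} => key.
    have [l lJ minl] := arg_minnP idx l0J; have [j jJ lt] := key l lJ; have := minl j jJ; rewrite leqNgt lt //.
  have [l lJ maxl] := arg_maxnP idx l0J; have [j jJ lt] := key l lJ; have := maxl j jJ; rewrite /= leqNgt lt //.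
have sX x : X x \subset U by apply/subsetP => v /XP [].
have X6 x v : v \in X x -> rho v = 6%N by case/XP.
have [osU _ _] := oU s sC; have [otU _ _] := oU t tC.
have inner l : l \in C -> l != s -> l != t -> rho (o l) = 4%N \/ exists x, o l \in X x.
  move=> lC ls lt; have [olU _ _] := oU l lC; have olQ := subsetP UsubQ _ olU.
  have olp : o l != p by move: olQ; rewrite in_setD1 => /andP[].
  case: (v_zero (QV olQ) olp) => -[r _]; [right|by left].
  case: (boolP (cu (o s) (o l))) => h.
    exists true; apply/XP; split=> //; exists l; split=> //; rewrite /cond h.
    case: (eqVneq (o l) (o t)) => //= e; apply/orP; right; apply/exists_inP; exists l => //; by rewrite lt e eqxx.
  pose D := [set v in U | cu (o l) v].
  have sD : D \subset U by apply/subsetP => v; rewrite in_set => /andP[].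
  have nD : D != set0 by apply/set0Pn; exists (o l); rewrite in_set olU /cu connect0.
  have closedD : ed m D (U :\: D) = 0%N.
    rewrite /ed big1 // => u uD; apply: big1 => v; rewrite in_setD in_set => /andP[nv vU].
    move: uD; rewrite in_set => /andP[uU cu']; apply/eqP; rewrite -leqn0 leqNgt; apply: contra nv => h'; rewrite vU.
    by apply: connect_trans cu' _; apply: connect1; rewrite /= uU vU.
  have := e2 D sD nD; rewrite (count D sD) closedD addn0 => c2.
  have lJ : l \in [set l in C | o l \in D] by rewrite in_set lC in_set olU /cu connect0.
  have /card_gt0P[j] : (0 < #|[set l in C | o l \in D] :\ l|)%N.
    by move: c2; rewrite (cardsD1 l) lJ.
  rewrite in_setD1 => /andP[jl]; rewrite in_set => /andP[jC]; rewrite in_set => /andP[_ cj].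
  have nij : idx j != idx l by apply: contra jl => /eqP e; rewrite (idx_inj j l jC e).
  exists (idx j < idx l)%N; apply/XP; split=> //; exists l; split=> //; rewrite /cond (negbTE h).
  apply/exists_inP; exists j => //; rewrite cj andbT; case: ifP => // n.
  by rewrite ltn_neqAle eq_sym nij leqNgt n.
case: (eqVneq (rho (o s)) 6%N) => [s6|s6].
  apply: (@use_average X sX X6 convX s a6) => //; first by left.
  move=> x; apply/XP; split=> //; exists s; split=> //; first exact: sC.
  rewrite /cond /cu connect0; case: (eqVneq (o s) (o t)) => //= e; apply/orP; right; apply/exists_inP; exists s; first exact: sC.
  by rewrite st e eqxx.
have t6 : rho (o t) = 6%N by case: r6 => // e; rewrite e in s6.
have s4 : rho (o s) = 4%N.
  have osQ := subsetP UsubQ _ osU; have osp : o s != p by move: osQ; rewrite in_setD1 => /andP[].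
  by case: (v_zero (QV osQ) osp) => -[r _] //; rewrite r in s6.
apply: (@use_average X sX X6 convX t a6) => //; first by right.
by move=> x; apply/XP; split=> //; exists t; split=> //; [exact: tC|rewrite /cond /cu cst s4 eqxx orbT].
Qed.

End Outer.
End OnePath.
(** A 4-vertex at an end of the path is exploited by [chain_alpha], one in the interior by
    [chain_beta]. *)
Lemma all_six c : ipath m s c -> {subset c <= Q} -> last s c = t -> forall l, l \in s :: c -> rho l = 6%N.
Proof.
move=> ic cQ lc l ls; have lQ : l \in Q by move: ls; rewrite in_cons => /orP[/eqP ->|/cQ].
have six v : v \in Q -> rho v <> 4%N -> rho v = 6%N.
  by move=> vQ n4; have := vQ; rewrite in_setD1 => /andP[vp vV]; case: (v_zero vV vp) => -[].
apply: (six l lQ) => l4; apply: nonlaw => M b cV; have [o ho] := outer ic cQ lc.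
have lC : l \in [set u in s :: c] by rewrite in_set.
case: (classic (rho s = 4%N)) => [s4|/(six s sQ) s6]; first exact: (use_alpha ic cQ lc ho b cV).
case: (classic (rho t = 4%N)) => [t4|/(six t tQ) t6]; first exact: (use_alpha' ic cQ lc ho b cV).
apply: (use_beta ic cQ lc ho b cV lC _ _ l4) => //; first by apply: contra_eqN l4 => /eqP ->; rewrite s6.
by apply: contra_eqN l4 => /eqP ->; rewrite t6.
Qed.

Lemma path_false : False.
Proof.
have [c [ic cQ lc]] := ipath_connect gm s_t_connected sQ.
have a6 := all_six ic cQ lc; have [o ho] := outer ic cQ lc.
have a6' l : l \in [set u in s :: c] -> rho l = 6%N by rewrite in_set; apply: a6.
have s6 : rho s = 6%N by apply: a6; rewrite mem_head.
have t6 : rho t = 6%N by apply: a6; rewrite -lc mem_last.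
have sC0 : s \in [set u in s :: c] by rewrite in_set mem_head.
have tC0 : t \in [set u in s :: c] by rewrite in_set -lc mem_last.
case: c ic cQ lc a6 o ho a6' sC0 tC0 => [|x c] ic cQ lc a6 o ho a6' sC0 tC0; first by move: st; rewrite -lc eqxx.
case: c ic cQ lc a6 ho a6' sC0 tC0 => [|y c] ic cQ lc a6 ho a6' sC0 tC0.
  by apply: nonlaw => M b cV; apply: (use_short ic cQ lc ho b cV) => //; rewrite -lc.
set cc := [:: x, y & c] in ic cQ lc a6 ho a6' sC0 tC0.
pose C := [set u in s :: cc]; pose U := Q :\: C.
have mst : m s t = 0%N.
  have : t \in y :: c by rewrite -lc /= mem_last.
  by have /and4P[_ _ /allP a _] := ic; move=> /a /andP[_ /eqP].
have inU l : l \in C -> [/\ o l \in U, m (o l) l = 1%N & forall u, u \in U -> u != o l -> m u l = 0%N].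
  by move=> lC; case: (ho l lC) => [[]//|[]]; rewrite a6'.
have [osU mos os0] := inU s sC0; have [otU mot _] := inU t tC0.
case: (boolP (connect (lk m U) (o s) (o t))) => [cst|ncst]; last first.
  by apply: nonlaw => M b cV; exact: (use_apart ic cQ lc ho b cV).
case: (classic (rho (o s) = 6%N \/ rho (o t) = 6%N)) => [r6|r6].
  by apply: nonlaw => M b cV; exact: (use_together ic cQ lc ho b cV).
(* Now [o s] and [o t] are 4-vertices. As [s] and [t] are not adjacent, an induced path between them
   through [U] must start with [o s], contradicting [all_six] for that path. *)
pose A := s |: (t |: U).
have AQ : A \subset Q by rewrite !subUset !sub1set sQ tQ; exact: subsetDl.
have [sA tA] : s \in A /\ t \in A by rewrite !in_setU1 !eqxx orbT.
have UA : U \subset A by rewrite /A setUA subsetUr.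
have UA' v : v \in U -> v \in A by apply: (subsetP UA).
have c1 : connect (lk m A) s t.
  apply: (connect_trans (y := o s)).
    by apply: connect1; rewrite /= sA UA' // (proj1 gm) mos.
  apply: (connect_trans (y := o t)); last by apply: connect1; rewrite /= tA UA' // mot.
  apply: connect_sub cst => u v /and3P[uU vU h]; apply: connect1; by rewrite /= !UA'.
have [c' [ic' cA' lc']] := ipath_connect gm c1 sA.
have cQ' : {subset c' <= Q} by move=> v /cA'; exact: (subsetP AQ).
have b6 := all_six ic' cQ' lc'.
case: c' ic' cA' lc' cQ' b6 => [|v c'] ic' cA' lc' cQ' b6; first by move: st; rewrite -lc' eqxx.
have /and4P[msv nsv _ _] := ic'.
have vA := cA' v (mem_head _ _).
have vos : v = o s.
  move: vA; rewrite !in_setU1 eq_sym (negbTE nsv) /= => /orP[/eqP e|vU]; first by rewrite e mst in msv.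
  apply/eqP/negPn/negP => n; move: msv; rewrite (proj1 gm) os0 //.
by apply: r6; left; apply: b6; rewrite -vos !inE eqxx orbT.
Qed.

End Path.
Lemma simple_false : False.
Proof.
have [s [t [sQ tQ st mps [mpt mp0]]]] := p_nbrs.
exact: (path_false sQ tQ st mps mpt mp0).
Qed.

End Cycle.

(** * Replacing a double edge by a single edge *)

Definition shift (c : C3) : C3 := match c with None => Some true | Some true => Some false | Some false => None end.

Lemma shift_inj : injective shift. Proof. by move=> [[]|] [[]|]. Qed.
Lemma shift_neq c : shift c != c. Proof. by case: c => [[]|]. Qed.

Definition avoid2 (f g : C3 -> C3) (c : C3) : C3 := if f c == g c then shift (f c) else third (f c) (g c).

Lemma avoid2P (f g : C3 -> C3) c : avoid2 f g c != f c /\ avoid2 f g c != g c.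
Proof.
rewrite /avoid2; case: (eqVneq (f c) (g c)) => [<-|_]; first by split; exact: shift_neq.
exact: thirdP.
Qed.

Lemma inj_third (f : C3 -> C3) c d : injective f -> c != d -> f (third c d) = third (f c) (f d).
Proof.
move=> fi n; have [t1 t2] := thirdP c d.
by apply: third_uniq; rewrite (inj_eq fi).
Qed.

(** Two permutations of three colors cannot agree at exactly two of them. If they agree nowhere or
    everywhere, a color avoiding both images can be chosen injectively. *)
Lemma agreement (f g : C3 -> C3) : injective f -> injective g ->
  injective (avoid2 f g) \/ exists sp, f sp = g sp /\ forall c, c != sp -> f c != g c /\ third (f c) (g c) = f sp.
Proof.
move=> fi gi.
case: (classic (forall c, f c != g c)) => [no|some].
  left=> c d; rewrite /avoid2 (negbTE (no c)) (negbTE (no d)) => e; apply/eqP/negPn/negP => n.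
  have fn : f c != f d by rewrite (inj_eq fi).
  have gn : g c != g d by rewrite (inj_eq gi).
  have [a1 a2] := thirdP (f c) (g c); have [b1 b2] := thirdP (f d) (g d); rewrite -e in b1 b2.
  have := no (third c d); rewrite (inj_third fi n) (inj_third gi n).
  by rewrite -(third_uniq fn a1 b1) -(third_uniq gn a2 b2) eqxx.
have [sp esp] : exists sp, f sp = g sp.
  by apply: NNPP => h; apply: some => c; apply/eqP => e; apply: h; exists c.
case: (classic (forall c, c != sp -> f c != g c)) => [h|h].
  right; exists sp; split=> // c n; split; first exact: h.
  by apply/esym/third_uniq; [exact: h|rewrite (inj_eq fi) eq_sym|rewrite esp (inj_eq gi) eq_sym].
have [c [n ec]] : exists c, c != sp /\ f c = g c.
  by apply: NNPP => k; apply: h => c n; apply/eqP => e; apply: k; exists c.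
have all x : f x = g x.
  case: (eqVneq x c) => [->//|xc]; case: (eqVneq x sp) => [->//|xs].
  by rewrite (third_uniq n xc xs) (inj_third fi n) (inj_third gi n) ec esp.
left=> x y; rewrite /avoid2 !all !eqxx => /shift_inj; exact: gi.
Qed.

Lemma frac_choice (R : realFieldType) (al g1 g2 : R) : 1 / 5 <= al -> 0 <= g1 -> 0 <= g2 -> 2 / 5 <= al + g1 + g2 ->
  exists th, [/\ 0 <= th, th <= 1, 1 / 5 <= al * th + g2 & 1 / 5 <= al * (1 - th) + g1].
Proof.
move=> h1 h2 h3 h4; case: (lerP (1 / 5) g2) => h.
  by exists 0; split; rewrite ?mulr0 ?subr0 ?mulr1; lra.
have k0 : 0 <= 1 / 5 - g2 by lra.
have k1 : 1 / 5 - g2 <= al by lra.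
have [th [t0 t1 e]] := frac_exists k0 k1.
by exists th; split=> //; rewrite ?mulrBr ?mulr1 ?e; lra.
Qed.

Section PairReduction.
Variables (R : realFieldType) (T : finType).
Notation col := {ffun T -> C3}.

Definition two_point (l : R) (x y psi : col) : R := (1 - l) * (psi == x)%:R + l * (psi == y)%:R.

Lemma two_point_isd l x y : 0 <= l <= 1 -> isd (two_point l x y).
Proof. by move=> h; apply: isd_mix; [exact: h|exact: isd_point|exact: isd_point]. Qed.

Lemma two_point_gt0 l x y psi : 0 < two_point l x y psi -> psi = x \/ psi = y.
Proof.
rewrite /two_point; case: (eqVneq psi x) => [->|_]; first by left.
by case: (eqVneq psi y) => [->|_]; [right|rewrite !mulr0 addr0 ltxx].
Qed.

Lemma pr_point (A : finType) (x : A) (E : pred A) : pr (fun a => (a == x)%:R : R) E = (E x)%:R.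
Proof.
rewrite prE (bigD1 x) //= eqxx mul1r big1 ?addr0 // => a /negbTE ->; by rewrite mul0r.
Qed.

Lemma pr_two_point l x y (E : pred col) : pr (two_point l x y) E = (1 - l) * (E x)%:R + l * (E y)%:R.
Proof. by rewrite /two_point pr_mix !pr_point. Qed.

Variables (U : {set T}) (a b u w : T) (m : T -> T -> nat) (rho : T -> nat).
Hypotheses (gm : gr m) (aU : a \notin U) (bU : b \notin U) (ab : a != b) (uU : u \in U) (wU : w \in U) (uw : u != w)
  (a6 : rho a = 6%N) (b6 : rho b = 6%N) (mab : m a b = 2%N) (mua : m u a = 1%N) (mwb : m w b = 1%N)
  (ma0 : forall x, x \in U -> x != u -> m x a = 0%N) (mb0 : forall x, x \in U -> x != w -> m x b = 0%N).

Definition add_edge x y := (m x y + ((x == u) && (y == w)) + ((x == w) && (y == u)))%N.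

Lemma add_edge_gr : gr add_edge.
Proof.
split=> [x y|x]; rewrite /add_edge; first by rewrite (proj1 gm) addnAC; congr (_ + _ + _)%N; rewrite andbC.
rewrite (proj2 gm); case: (eqVneq x u) => [->|_]; first by rewrite (negbTE uw) andbF.
by rewrite andbF.
Qed.

Let V := U :|: [set a; b].
Let UV x : x \in U -> x \in V. Proof. by rewrite inE => ->. Qed.
Let aV : a \in V. Proof. by rewrite !inE eqxx orbT. Qed.
Let bV : b \in V. Proof. by rewrite !inE eqxx !orbT. Qed.
Let neU x y : x \in U -> y \in [set a; b] -> x != y.
Proof. by move=> xU; rewrite !inE => /orP[] /eqP ->; [apply: contraNneq aU => <-|apply: contraNneq bU => <-]. Qed.

Section WithCover.
Variables (M : T -> T -> C3 -> C3 -> bool) (bb : T -> C3).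
Hypothesis cV : cov V m M.

(* The matching [ta] is put on the new edge [u w] that replaces the path u, a, b, w. *)
Definition add_matching (ta : C3 -> C3) x y i j :=
  [|| M x y i j, [&& x == u, y == w & j == ta i] | [&& x == w, y == u & i == ta j]].

Lemma cov_add ta : injective ta -> cov U add_edge (add_matching ta).
Proof.
move=> tai; split=> [x y i j|x y xU yU n].
  by rewrite /add_matching (proj1 cV x y); congr (_ || _); rewrite orbC; congr (_ || _); rewrite andbCA.
have [s [sz si h]] := (proj2 cV) x y (UV xU) (UV yU) n.
have [ti tK1 tK2] : bijective ta by exact: (@injF_bij (option bool : finType)).
pose r := if (x == u) && (y == w) then [:: [ffun i => ta i]] else if (x == w) && (y == u) then [:: [ffun i => ti i]] else [::].
exists (s ++ r); split.
- rewrite size_cat /add_edge -addnA leq_add // /r; case: ifP => // _; by case: ifP.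
- move=> f; rewrite mem_cat => /orP[/si//|]; rewrite /r; case: ifP => _.
    by rewrite inE => /eqP -> i j; rewrite !ffunE; apply: tai.
  by case: ifP => _ //; rewrite inE => /eqP -> i j; rewrite !ffunE => /(can_inj tK2).
- move=> i j /or3P[/h [f fs e]|/and3P[xu yw /eqP e]|/and3P[xw yu /eqP e]].
  + by exists f => //; rewrite mem_cat fs.
  + by exists [ffun i => ta i]; rewrite ?ffunE // mem_cat /r xu yw mem_head orbT.
  + exists [ffun i => ti i]; last by rewrite ffunE e tK1.
    rewrite mem_cat /r (eqP xw) (eqP yu) eq_sym (negbTE uw) /= !eqxx mem_head orbT //.
Qed.

Lemma pair_extend (Om : finType) (P : Om -> R) (phi : Om -> col) (f h s1 s2 : C3 -> C3) (l : Om -> R) (x0 x1 y0 y1 : Om -> C3) :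
  rc U M rho bb P phi ->
  (forall i j, M u a i j -> j = f i) -> (forall i j, M w b i j -> j = h i) -> (forall i j, M a b i j -> j = s1 i \/ j = s2 i) ->
  (forall o, 0 <= l o <= 1) ->
  (forall o, 0 < P o -> [/\ x0 o != f (phi o u), y0 o != h (phi o w), y0 o != s1 (x0 o) & y0 o != s2 (x0 o)]) ->
  (forall o, 0 < P o -> [/\ x1 o != f (phi o u), y1 o != h (phi o w), y1 o != s1 (x1 o) & y1 o != s2 (x1 o)]) ->
  (forall c, 1 / 5 <= \sum_o P o * ((1 - l o) * (x0 o == c)%:R + l o * (x1 o == c)%:R)) ->
  (forall c, 1 / 5 <= \sum_o P o * ((1 - l o) * (y0 o == c)%:R + l o * (y1 o == c)%:R)) ->
  exists L : col -> R, good V M rho bb L.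
Proof.
move=> rU hf hh hs l01 h0 h1 ga gb.
pose F x y : col := [ffun v => if v == a then x else y].
have ba : b == a = false by rewrite eq_sym (negbTE ab).
have dU : [disjoint U & [set a; b]].
  by rewrite disjoint_sym disjoints_subset subUset !sub1set !in_setC aU.
have Ms := proj1 cV.
apply: rc_good (rc_ext (N := fun o => two_point (l o) (F (x0 o) (y0 o)) (F (x1 o) (y1 o))) Ms dU rU _ _ _).
- by move=> o; exact: two_point_isd.
- have okF o x y : x != f (phi o u) -> y != h (phi o w) -> y != s1 x -> y != s2 x -> ok [set a; b] M (F x y) /\
      forall v z, v \in U -> z \in [set a; b] -> ~~ M v z (phi o v) (F x y z).
    move=> k1 k2 k3 k4; have kab : ~~ M a b x y by apply/negP => /hs [] e; [rewrite e eqxx in k3|rewrite e eqxx in k4].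
    split=> [v z|v z vU].
      by rewrite !inE => /orP[] /eqP -> /orP[] /eqP ->; rewrite ?eqxx // !ffunE ?eqxx ?ba // => _; rewrite Ms.
    have vV := UV vU; rewrite !inE => /orP[] /eqP ->; rewrite ffunE ?eqxx ?ba.
      case: (eqVneq v u) => [->|n]; first by apply: contra k1 => /hf ->.
      by apply: (cov0 _ _ cV vV aV); [apply: neU; rewrite ?inE ?eqxx|exact: ma0].
    case: (eqVneq v w) => [->|n]; first by apply: contra k2 => /hh ->.
    by apply: (cov0 _ _ cV vV bV); [apply: neU; rewrite ?inE ?eqxx ?orbT|exact: mb0].
  move=> o psi Po /two_point_gt0 [->|->].
    by have [k1 k2 k3 k4] := h0 o Po; exact: okF.
  by have [k1 k2 k3 k4] := h1 o Po; exact: okF.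
move=> v; rewrite !inE => /orP[] /eqP ->; split; rewrite ?a6 ?b6 // => c.
  rewrite /avg; under eq_bigr => o _ do rewrite pr_two_point !ffunE eqxx; exact: ga.
rewrite /avg; under eq_bigr => o _ do rewrite pr_two_point !ffunE ba; exact: gb.
Qed.

Lemma weighted_le (Om : finType) (P W W' : Om -> R) : (forall o, 0 <= P o) -> (forall o, 0 < P o -> W o <= W' o) ->
  \sum_o P o * W o <= \sum_o P o * W' o.
Proof.
move=> P0 h; apply: ler_sum => o _; case: (ltrP 0 (P o)) => p; first by apply: ler_wpM2l => //; exact: h.
by have -> : P o = 0 by [apply: le_anti; rewrite p P0]; rewrite !mul0r.
Qed.

(** If [avoid2 s1 s2] is injective, the colors of [a] and [b] are injective functions of that of
    [u], and the new edge keeps [b] off the color forbidden by [w]. Otherwise the matchings of the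
    pair agree only at [sp], with image [s0], and a proper coloring of the pair has exactly one of
    [a = sp] and [b = s0]. The new edge prevents [u] from forbidding [sp] while [w] forbids [s0]. *)
Lemma pair_lossless_cover : lawful R U add_edge rho -> exists L : col -> R, good V M rho bb L.
Proof.
move=> lw.
have ua : u != a by apply: contraNneq aU => <-. have wb : w != b by apply: contraNneq bU => <-.
have [f [fi hf]] := cov1 cV (UV uU) aV ua mua.
have [h [hi hh]] := cov1 cV (UV wU) bV wb mwb.
have [s1 [s2 [s1i s2i hs]]] := cov2 cV aV bV ab mab.
have [f' [fK hf']] := inj_eqE fi; have [h' [hK hh']] := inj_eqE hi.
have hKr : cancel h' h by move=> c; apply/eqP; rewrite hh'.
have h'i : injective h' by exact: can_inj hKr.
case: (agreement s1i s2i) => [pi|[sp [e0 hsp]]].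
  have tai : injective (fun i => h' (avoid2 s1 s2 (shift (f i)))).
    by move=> i j /h'i /pi /shift_inj /fi.
  have [L gL] := lw _ bb (cov_add tai); have rU := good_rc gL; have [[L0 L1] oL mL] := gL.
  have rM : rc U M rho bb L id.
    split=> //; move=> phi /oL o x y xU yU n; apply: contra (o x y xU yU n); by rewrite /add_matching => ->.
  have key phi : 0 < L phi -> [/\ shift (f (phi u)) != f (phi u), avoid2 s1 s2 (shift (f (phi u))) != h (phi w),
      avoid2 s1 s2 (shift (f (phi u))) != s1 (shift (f (phi u))) & avoid2 s1 s2 (shift (f (phi u))) != s2 (shift (f (phi u)))].
    move=> p; have [k1 k2] := avoid2P s1 s2 (shift (f (phi u))); split=> //; first exact: shift_neq.
    have := oL phi p u w uU wU uw; rewrite /add_matching !eqxx !andTb !negb_or => /and3P[_ k _].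
    by rewrite eq_sym hh'.
  have mg (q : C3 -> C3) : injective q -> forall c, 1 / 5 <= \sum_o L o * ((1 - 0) * (q (o u) == c)%:R + 0 * (q (o u) == c)%:R).
    move=> qi c; have [q' [_ hq]] := inj_eqE qi; have [k _] := mL u uU; apply: le_trans (k (q' c)) _.
    rewrite prE le_eqVlt; apply/orP; left; apply/eqP; apply: eq_bigr => o _; rewrite hq; congr (_ * _); ring.
  apply: (pair_extend (l := fun=> 0) rM hf hh hs _ key key).
  - by move=> o; rewrite lexx ler01.
  - by apply: (mg (fun i => shift (f i))) => i j /shift_inj /fi.
  - by apply: (mg (fun i => avoid2 s1 s2 (shift (f i)))) => i j /pi /shift_inj /fi.
set s0 := s1 sp in e0 *.
have tai : injective (fun i => h' (s1 (f i))) by move=> i j /h'i /s1i /fi.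
have [L gL] := lw _ bb (cov_add tai); have rU := good_rc gL; have [[L0 L1] oL mL] := gL.
have rM : rc U M rho bb L id.
  split=> //; move=> phi /oL o x y xU yU n; apply: contra (o x y xU yU n); by rewrite /add_matching => ->.
pose A (phi : col) := f (phi u) == sp; pose B (phi : col) := h (phi w) == s0.
have AB phi : 0 < L phi -> A phi -> ~~ B phi.
  move=> p /eqP fe; have := oL phi p u w uU wU uw.
  by rewrite /add_matching !eqxx !andTb !negb_or => /and3P[_ k _]; rewrite /B hh' /s0 -fe.
have lA : 1 / 5 <= pr L A.
  by rewrite (eq_pr _ (F := fun phi : col => phi u == f' sp)) => [|phi]; [case: (mL u uU)|rewrite /A hf'].
have lB : 1 / 5 <= pr L B.
  by rewrite (eq_pr _ (F := fun phi : col => phi w == h' s0)) => [|phi]; [case: (mL w wU)|rewrite /B hh'].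
have dL : isd L by [].
have uA : pr L A <= 3 / 5.
  rewrite (eq_pr _ (F := fun phi : col => phi u == f' sp)) => [|phi]; last by rewrite /A hf'.
  apply: (le35 (a := fun c => pr L (fun phi : col => phi u == c))); last by case: (mL u uU).
  exact: (eq_isd _ (isd_push (fun phi : col => phi u) dL)).
have uB : pr L B <= 3 / 5.
  rewrite (eq_pr _ (F := fun phi : col => phi w == h' s0)) => [|phi]; last by rewrite /B hh'.
  apply: (le35 (a := fun c => pr L (fun phi : col => phi w == c))); last by case: (mL w wU).
  exact: (eq_isd _ (isd_push (fun phi : col => phi w) dL)).
pose EA c (phi : col) := ~~ A phi && ~~ B phi && (third sp (f (phi u)) == c).
pose EB c (phi : col) := ~~ A phi && ~~ B phi && (third s0 (h (phi w)) == c).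
have tot (E : C3 -> col -> bool) (q : C3) : (forall phi, 0 < L phi -> (A phi)%:R + (B phi)%:R + (E (shift q) phi)%:R + (E (shift (shift q)) phi)%:R = 1 :> R) ->
   pr L A + pr L B + pr L (E (shift q)) + pr L (E (shift (shift q))) = 1.
  move=> hE; rewrite !prE -!big_split /= -[RHS]L1; apply: eq_bigr => phi _;
  case: (ltrP 0 (L phi)) => p; first by rewrite -!mulrDr (hE phi p) mulr1.
  by have -> : L phi = 0 by [apply: le_anti; rewrite p L0]; rewrite !mul0r !addr0.
have tA : pr L A + pr L B + pr L (EA (shift sp)) + pr L (EA (shift (shift sp))) = 1.
  apply: (tot EA sp) => phi p; have := AB phi p; rewrite /EA /A /B; case: eqP => [->|/eqP n] /=.
    by move=> /(_ isT) /negbTE ->; rewrite /=; ring.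
  move=> _; case: eqP => _ /=; first ring.
  by move: n; move: (f _) (sp) => [[]|] [[]|] //= _; ring.
have tB : pr L A + pr L B + pr L (EB (shift s0)) + pr L (EB (shift (shift s0))) = 1.
  apply: (tot EB s0) => phi p; have := AB phi p; rewrite /EB /A /B; case: eqP => [_|_] /=.
    by move=> /(_ isT) /negbTE ->; rewrite /=; ring.
  move=> _; case: (eqVneq (h (phi w)) s0) => [_|n] /=; first ring.
  by move: n; move: (h _) (s0) => [[]|] [[]|] //= _; ring.
have pr0 E : 0 <= pr L E by exact: pr_ge0.
(* Where neither color is forbidden, [la] is the probability of keeping [b = s0] rather than
   [a = sp]. It gives mass 2/5 to [a != sp] and to [b != s0], each to be shared by two colors. *)
have [la [la0 la1 laA laB]] : exists la, [/\ 0 <= la, la <= 1,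
    2 / 5 <= pr L A + la * (1 - pr L A - pr L B) & 2 / 5 <= pr L B + (1 - la) * (1 - pr L A - pr L B)].
  case: (lerP (2 / 5) (pr L A)) => k; first by exists 0; split; rewrite ?mul0r ?subr0 ?mul1r; lra.
  have k0 : 0 <= 2 / 5 - pr L A by lra.
  have k1 : 2 / 5 - pr L A <= 1 - pr L A - pr L B by lra.
  have [th [t0 t1 e]] := frac_exists k0 k1.
  by exists th; split=> //; rewrite ?mulrBl ?mul1r [th * _]mulrC e; lra.
have [ta [ta0 ta1 ta2 ta3]] : exists th, [/\ 0 <= th, th <= 1, 1 / 5 <= pr L A * th + la * pr L (EA (shift (shift sp))) &
    1 / 5 <= pr L A * (1 - th) + la * pr L (EA (shift sp))].
  apply: frac_choice => //; [exact: mulr_ge0|exact: mulr_ge0|].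
  rewrite -addrA -mulrDr; have -> : pr L (EA (shift sp)) + pr L (EA (shift (shift sp))) = 1 - pr L A - pr L B by lra.
  by [].
have [tb [tb0 tb1 tb2 tb3]] : exists th, [/\ 0 <= th, th <= 1, 1 / 5 <= pr L B * th + (1 - la) * pr L (EB (shift (shift s0))) &
    1 / 5 <= pr L B * (1 - th) + (1 - la) * pr L (EB (shift s0))].
  have k : 0 <= 1 - la by lra.
  apply: frac_choice => //; [exact: mulr_ge0|exact: mulr_ge0|].
  rewrite -addrA -mulrDr; have -> : pr L (EB (shift s0)) + pr L (EB (shift (shift s0))) = 1 - pr L A - pr L B by lra.
  by [].
pose l phi : R := if A phi then ta else if B phi then tb else la.
pose x0 phi := if A phi then shift sp else sp.
pose x1 phi := if A phi then shift (shift sp) else if B phi then sp else third sp (f (phi u)).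
pose y0 phi := if A phi then s0 else if B phi then shift s0 else third s0 (h (phi w)).
pose y1 phi := if A phi then s0 else if B phi then shift (shift s0) else s0.
have sn c : shift (shift c) != c by case: c => [[]|].
have s10 c : c != sp -> s0 != s1 c by move=> n; rewrite /s0 (inj_eq s1i) eq_sym.
have s20 c : c != sp -> s0 != s2 c by move=> n; rewrite e0 (inj_eq s2i) eq_sym.
have lb (W W' : col -> R) k : (forall o, 0 < L o -> W o <= W' o) -> k = \sum_o L o * W o -> 1 / 5 <= k -> 1 / 5 <= \sum_o L o * W' o.
  by move=> hW -> /le_trans; apply; exact: weighted_le.
have l01 o : 0 <= l o <= 1.
  by rewrite /l; case: ifP => _; [rewrite ta0 ta1|case: ifP => _; [rewrite tb0 tb1|rewrite la0 la1]].
have W0 o (p q : bool) : 0 <= (1 - l o) * p%:R + l o * q%:R.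
  by have /andP[k1 k2] := l01 o; rewrite addr_ge0 // mulr_ge0 // subr_ge0.
have bt : (true : nat)%:R = 1 :> R by []. have bf : (false : nat)%:R = 0 :> R by [].
have sn' (c : C3) : shift (shift c) != shift c by exact: shift_neq.
have sn2 (c : C3) : c != shift c by rewrite eq_sym shift_neq.
have sn3 (c : C3) : c != shift (shift c) by rewrite eq_sym sn.
have cases (c d : C3) : [|| c == d, c == shift d | c == shift (shift d)] by move: c d => [[]|] [[]|].
have splitW' k1 k2 (E F : pred col) : \sum_o L o * (k1 * (E o)%:R + k2 * (F o)%:R) = k1 * pr L E + k2 * pr L F.
  by rewrite !prE !mulr_sumr -big_split; apply: eq_bigr => o _ /=; rewrite mulrDr !mulrA ![L o * _]mulrC.
have splitW k1 k2 (E F : pred col) : pr L E * k1 + k2 * pr L F = \sum_o L o * (k1 * (E o)%:R + k2 * (F o)%:R).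
  by rewrite splitW' [pr L E * _]mulrC.
apply: (pair_extend (l := l) (x0 := x0) (x1 := x1) (y0 := y0) (y1 := y1) rM hf hh hs).
- exact: l01.
- move=> o p; rewrite /x0 /y0; case: ifP => [Ao|nA].
    have := AB o p Ao; move/eqP: Ao => ->; rewrite /B => nB; split; [exact: shift_neq|by rewrite eq_sym|apply: s10|apply: s20]; exact: shift_neq.
  case: ifP => [/eqP ->|nB].
    by split; [rewrite eq_sym; exact/negbT|exact: shift_neq|exact: shift_neq|rewrite -e0; exact: shift_neq].
  have [k1 k2] := thirdP s0 (h (o w)).
  by split=> //; [rewrite eq_sym; exact/negbT|rewrite -e0].
- move=> o p; rewrite /x1 /y1; case: ifP => [Ao|nA].
    have := AB o p Ao; move/eqP: Ao => ->; rewrite /B => nB; split; [exact: sn|by rewrite eq_sym|apply: s10|apply: s20]; exact: sn.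
  case: ifP => [/eqP ->|nB].
    by split; [rewrite eq_sym; exact/negbT|exact: sn|exact: sn|rewrite -e0; exact: sn].
  have [k1 k2] := thirdP sp (f (o u)).
  by split=> //; [rewrite eq_sym; exact/negbT|exact: s10|exact: s20].
- move=> c; have/or3P[/eqP ->|/eqP ->|/eqP ->] := cases c sp.
  + apply: (lb (fun o => (B o)%:R)) lB => [o p|]; last by rewrite prE.
    case: (boolP (B o)) => Bo; last exact: W0.
    have nA : A o = false by apply/negbTE/negP => /(AB o p); rewrite Bo.
    by rewrite /x0 /x1 nA Bo eqxx mulr1 mulr1 subrK.
  + apply: (lb (fun o => (1 - ta) * (A o)%:R + la * (EA (shift sp) o)%:R)) ta3 => [o p|]; last exact: splitW.
    rewrite /l /x0 /x1 /EA; case: ifP => [_|_] /=; first by rewrite eqxx (negbTE (sn' sp)) ?bt ?bf ?mulr1 ?mulr0; lra.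
    by case: ifP => [_|_] /=; rewrite ?(negbTE (sn2 sp)) ?bt ?bf ?mulr1 ?mulr0; lra.
  + apply: (lb (fun o => ta * (A o)%:R + la * (EA (shift (shift sp)) o)%:R)) ta2 => [o p|]; last by rewrite splitW' [pr L A * _]mulrC.
    rewrite /l /x0 /x1 /EA; case: ifP => [_|_] /=; first by rewrite eqxx eq_sym (negbTE (sn' sp)) ?bt ?bf ?mulr1 ?mulr0; lra.
    by case: ifP => [_|_] /=; rewrite ?(negbTE (sn3 sp)) ?bt ?bf ?mulr1 ?mulr0; lra.
- move=> c; have/or3P[/eqP ->|/eqP ->|/eqP ->] := cases c s0.
  + apply: (lb (fun o => (A o)%:R)) lA => [o p|]; last by rewrite prE.
    case: (boolP (A o)) => Ao; last exact: W0.
    by rewrite /y0 /y1 Ao eqxx mulr1 mulr1 subrK.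
  + apply: (lb (fun o => (1 - tb) * (B o)%:R + (1 - la) * (EB (shift s0) o)%:R)) tb3 => [o p|]; last exact: splitW.
    have := AB o p; rewrite /l /y0 /y1 /EB; case: ifP => [_ /(_ isT) /negbTE -> | _ _] /=.
      by rewrite (negbTE (sn2 s0)) ?bt ?bf ?mulr1 ?mulr0; lra.
    by case: ifP => [_|_] /=; rewrite ?eqxx ?(negbTE (sn2 s0)) ?(negbTE (sn' s0)) ?bt ?bf ?mulr1 ?mulr0; lra.
  + apply: (lb (fun o => tb * (B o)%:R + (1 - la) * (EB (shift (shift s0)) o)%:R)) tb2 => [o p|]; last by rewrite splitW' [pr L B * _]mulrC.
    have := AB o p; rewrite /l /y0 /y1 /EB; case: ifP => [_ /(_ isT) /negbTE -> | _ _] /=.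
      by rewrite (negbTE (sn3 s0)) ?bt ?bf ?mulr1 ?mulr0; lra.
    by case: ifP => [_|_] /=; rewrite ?eqxx ?(negbTE (sn3 s0)) 1?eq_sym ?(negbTE (sn' s0)) ?bt ?bf ?mulr1 ?mulr0; lra.
Qed.

End WithCover.

Lemma pair_lossless : lawful R U add_edge rho -> lawful R V m rho.
Proof. by move=> lw M bb cV; exact: pair_lossless_cover. Qed.

End PairReduction.

(** * The square: a pair inserted into a C_2 *)

Section Weights.
Variables (R : realFieldType) (q : C3 -> R).
Hypotheses (hq : forall x, 3 / 10 <= q x <= 2 / 5) (q1 : \sum_x q x = 1).

Definition avg2 (k : C3 -> C3 -> R) (E : C3 -> C3 -> bool) : R := \sum_x q x * \sum_r k x r * (E x r)%:R.

Let q3 : q None + (q (Some true) + q (Some false)) = 1. Proof. by rewrite -sum3. Qed.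

Ltac crunch := rewrite /avg2 ?sum3 /off /forced /=; have := hq None; have := hq (Some true); have := hq (Some false); move: q3;
  rewrite ?mulr0 ?mulr1 ?add0r ?addr0 ?mulr1n ?mulr0n; lra.

Section Perm.
Variable g : C3 -> C3.
Hypothesis gi : injective g.

Lemma perm_marg c : 1 / 5 <= avg2 (fun x => off R (g x)) (fun _ r => r == c).
Proof.
have [] := inj3 gi; rewrite /avg2 !sum3; move: (g None) (g (Some true)) (g (Some false)) => g1 g2 g3.
move: g1 g2 g3 c => [[]|] [[]|] [[]|] [[]|] //= _ _ _; crunch.
Qed.

Lemma perm_avail c : 1 / 5 <= avg2 (fun x => off R (g x)) (fun x r => (x != c) && (r != c)).
Proof.
have [] := inj3 gi; rewrite /avg2 !sum3; move: (g None) (g (Some true)) (g (Some false)) => g1 g2 g3.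
move: g1 g2 g3 c => [[]|] [[]|] [[]|] [[]|] //= _ _ _; crunch.
Qed.

Lemma perm_forced c : avg2 (fun x => off R (g x)) (fun x r => forced x r c) <= 3 / 5.
Proof.
have [] := inj3 gi; rewrite /avg2 !sum3; move: (g None) (g (Some true)) (g (Some false)) => g1 g2 g3.
move: g1 g2 g3 c => [[]|] [[]|] [[]|] [[]|] //= _ _ _; crunch.
Qed.
End Perm.

Section Pin.
Variables (xs s0 c0 : C3).

(* Here [x] and the color of [a] are read through the matchings into [p]. The two matchings of the double
   edge agree exactly at [c0], with common value [s0], and [xs] is the color of [z] that forbids [s0] at [b].
   The outcome [r] is the color of [b] if [x = xs], and the color of [a] otherwise. *)
Definition pin x r : R := if x == xs then off R s0 r else if r == c0 then 3 / 10 else 7 / 20.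
Definition pinA x r := if x == xs then c0 else r.

Lemma pin_isd x : isd (pin x).
Proof.
split=> [r|]; first by rewrite /pin /off; do ?case: ifP => _; lra.
rewrite /pin; case: (x == xs); first by case: (off_isd R s0).
by rewrite sum3; case: (c0) => [[]|] /=; lra.
Qed.

Lemma pin_marg c : 1 / 5 <= avg2 pin (fun x r => pinA x r == c).
Proof. rewrite /pin /pinA; move: (xs) (s0) (c0) c => [[]|] [[]|] [[]|] [[]|]; crunch. Qed.

Lemma pin_avail c : 1 / 5 <= avg2 pin (fun x r => (x != c) && (pinA x r != c)).
Proof. rewrite /pin /pinA; move: (xs) (s0) (c0) c => [[]|] [[]|] [[]|] [[]|]; crunch. Qed.

Lemma pin_forced c : avg2 pin (fun x r => forced x (pinA x r) c) <= 3 / 5.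
Proof. rewrite /pin /pinA; move: (xs) (s0) (c0) c => [[]|] [[]|] [[]|] [[]|]; crunch. Qed.

End Pin.

Lemma pin_marg' (g : C3 -> C3) xs c0 c : injective g ->
  1 / 5 <= avg2 (pin xs (g xs) c0) (fun x r => (if x == xs then r else if r == c0 then third (g xs) (g x) else g xs) == c).
Proof.
move=> /inj3 []; rewrite /pin /avg2 !sum3; case: xs => [[]|]; move: (g None) (g (Some true)) (g (Some false)) => g1 g2 g3.
all: move: g1 g2 g3 => [[]|] [[]|] [[]|] //= _ _ _.
all: case: c0 => [[]|]; case: c => [[]|]; crunch.
Qed.
End Weights.

Section Square.
Variables (R : realFieldType) (T : finType) (p z a b : T) (m : T -> T -> nat) (rho : T -> nat).
Notation col := {ffun T -> C3}.
Hypotheses (un : uniq [:: p; z; a; b]) (gm : gr m) (mpz : m p z = 1%N) (mpa : m p a = 1%N) (mpb : m p b = 0%N)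
  (mza : m z a = 0%N) (mzb : m z b = 1%N) (mab : m a b = 2%N)
  (p6 : rho p = 6%N) (a6 : rho a = 6%N) (b6 : rho b = 6%N).
Notation V := (p |: [set z; a; b]).
Variables (M : T -> T -> C3 -> C3 -> bool) (bb : T -> C3).
Hypothesis cV : cov V m M.

Let zV : z \in V. Proof. by rewrite !inE eqxx !orbT. Qed.
Let aV : a \in V. Proof. by rewrite !inE eqxx !orbT. Qed.
Let bV : b \in V. Proof. by rewrite !inE eqxx !orbT. Qed.
Let pV : p \in V. Proof. by rewrite !inE eqxx. Qed.
Let ne : [/\ p != z, p != a, p != b & [/\ z != a, z != b & a != b]].
Proof. by move: un; rewrite /= !inE !negb_or -!andbA => /and5P[-> -> -> -> /andP[-> /andP[]]]. Qed.

(** The path z, b, a is colored before [p]; [x] and [av] are the colors that [z] and [a] exclude at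
    [p], and [k] supplies the randomness left once [x] is known. *)
Lemma square_close (fz fz' fa fa' t s1 s2 : C3 -> C3) (k : C3 -> C3 -> R) (av bv : C3 -> C3 -> C3) :
  cancel fz' fz -> cancel fz fz' -> cancel fa fa' -> cancel fa' fa ->
  (forall i j, M z p i j -> j = fz i) -> (forall i j, M a p i j -> j = fa i) ->
  (forall i j, M z b i j -> j = t i) -> (forall i j, M a b i j -> j = s1 i \/ j = s2 i) ->
  (forall x, isd (k x)) ->
  (forall x r, 0 < k x r -> [/\ bv x r != t (fz' x), bv x r != s1 (fa' (av x r)) & bv x r != s2 (fa' (av x r))]) ->
  let q x := p4 R (bb z) (fz' x) in
  (forall c, 1 / 5 <= avg2 q k (fun x r => av x r == c)) -> (forall c, 1 / 5 <= avg2 q k (fun x r => bv x r == c)) ->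
  (forall c, 1 / 5 <= avg2 q k (fun x r => (x != c) && (av x r != c))) ->
  (forall c, avg2 q k (fun x r => forced x (av x r) c) <= 3 / 5) ->
  exists L : col -> R, good V M rho bb L.
Proof.
move=> fzK' fzK faK faK' hz ha ht hs kd okk q ma mb av5 fo5.
have [npz npa npb [nza nzb nab]] := ne; have Ms := proj1 cV.
have q1 : \sum_x q x = 1.
  rewrite -(proj2 (p4_isd R (bb z))) [RHS](reindex fz') //; exists fz => x _; [exact: fzK'|exact: fzK].
pose F (w : C3 * C3) : col := [ffun v => if v == z then fz' w.1 else if v == a then fa' (av w.1 w.2) else bv w.1 w.2].
have Fz w : F w z = fz' w.1 by rewrite ffunE eqxx.
have Fa w : F w a = fa' (av w.1 w.2) by rewrite ffunE eq_sym (negbTE nza) eqxx.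
have Fb w : F w b = bv w.1 w.2 by rewrite ffunE eq_sym (negbTE nzb) eq_sym (negbTE nab).
pose P (w : C3 * C3) := q w.1 * k w.1 w.2.
have prP (E : C3 -> C3 -> bool) : pr P (fun w => E w.1 w.2) = avg2 q k E.
  by rewrite (pr_pair q k E); apply: eq_bigr => x _; rewrite prE.
have q0 x : 0 <= q x by case/andP: (p4_bd R (bb z) (fz' x)); rewrite /q; lra.
have dP : isd P.
  split=> [w|]; first by rewrite mulr_ge0 //; case: (kd w.1).
  have := prP (fun _ _ => true); rewrite /pr => ->; rewrite -q1 /avg2; apply: eq_bigr => x _.
  by rewrite -[X in _ * X]/(\sum_r k x r * 1) -mulr_suml (proj2 (kd x)) !mulr1.
have prz c : pr P (fun w => F w z == c) = p4 R (bb z) c.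
  rewrite (eq_pr _ (F := fun w => (fun x _ => fz' x == c) w.1 w.2)) => [|w]; last by rewrite Fz.
  rewrite (prP (fun x _ => fz' x == c)) /avg2 (bigD1 (fz c)) //= [X in _ + X]big1 => [|x nx].
    by rewrite fzK eqxx -mulr_suml (proj2 (kd _)) !mulr1 addr0 /q fzK.
  have -> : fz' x == c = false by apply: contraNF nx => /eqP <-; rewrite fzK'.
  by rewrite big1 ?mulr0 // => r _; rewrite mulr0.
have fa'E x c : (fa' x == c) = (x == fa c) by apply/eqP/eqP => [<-|->]; rewrite ?faK' ?faK.
have pU : p \notin [set z; a; b] by rewrite !inE !negb_or npz npa npb.
have rU : rc [set z; a; b] M rho bb P F.
  split=> //.
    move=> w Pw; have kw : 0 < k w.1 w.2.
      by rewrite lt_def (proj1 (kd _)) andbT; apply: contraTneq Pw => e; rewrite /P e mulr0 ltxx.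
    have [k1 k2 k3] := okk _ _ kw.
    have zb : ~~ M z b (F w z) (F w b) by rewrite Fz Fb; apply: contra k1 => /ht ->.
    have abn : ~~ M a b (F w a) (F w b).
      by rewrite Fa Fb; apply/negP => /hs [] e; [rewrite e eqxx in k2|rewrite e eqxx in k3].
    have za : ~~ M z a (F w z) (F w a) by exact: (cov0 _ _ cV zV aV nza mza).
    move=> x y; rewrite !inE -!orbA => /or3P[] /eqP -> /or3P[] /eqP ->; rewrite ?eqxx // => _; by rewrite ?zb ?abn ?za // Ms ?zb ?abn ?za.
  move=> v; rewrite !inE -!orbA => /or3P[] /eqP ->.
  - by split=> [c|_ c]; rewrite prz //; case/andP: (p4_bd R (bb z) c); lra.
  - split=> [c|]; last by rewrite a6.
    rewrite (eq_pr _ (F := fun w => (fun x r => av x r == fa c) w.1 w.2)) => [|w]; last by rewrite Fa fa'E.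
    by rewrite (prP (fun x r => av x r == fa c)).
  - split=> [c|]; last by rewrite b6.
    rewrite (eq_pr _ (F := fun w => (fun x r => bv x r == c) w.1 w.2)) => [|w]; last by rewrite Fb.
    by rewrite (prP (fun x r => bv x r == c)).
apply: (close_vertex (s := z) (t := a) (fs := fz) (ft := fa) Ms pU rU p6 hz ha).
- move=> x i j; rewrite !inE -!orbA => /or3P[] /eqP ->; rewrite ?eqxx // => _ _.
  by apply: (cov0 _ _ cV bV pV); rewrite 1?eq_sym // (proj1 gm).
- move=> c; rewrite (eq_pr _ (F := fun w => (fun x r => (x != c) && (av x r != c)) w.1 w.2)) => [|w]; first by rewrite (prP (fun x r => (x != c) && (av x r != c))).
  by rewrite /= Fz Fa fzK' faK'.
- move=> c; rewrite (eq_pr _ (F := fun w => (fun x r => forced x (av x r) c) w.1 w.2)) => [|w]; first by rewrite (prP (fun x r => forced x (av x r) c)).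
  by rewrite /= Fz Fa fzK' faK'.
Qed.

(** In the injective case [b] is a function of [a], so [z] excludes just one color of [a], which is
    taken uniform on the other two. With a single agreement the choice is described by [pin]. *)
Lemma square_good : exists L : col -> R, good V M rho bb L.
Proof.
have [npz npa npb [nza nzb nab]] := ne.
have nzp : z != p by rewrite eq_sym. have nap : a != p by rewrite eq_sym.
have [fz [fzi hz]] := cov1 cV zV pV nzp (etrans (proj1 gm z p) mpz).
have [fa [fai ha]] := cov1 cV aV pV nap (etrans (proj1 gm a p) mpa).
have [t [ti ht]] := cov1 cV zV bV nzb mzb.
have [s1 [s2 [s1i s2i hs]]] := cov2 cV aV bV nab mab.
have [fz' fzK fzK'] : bijective fz by exact: (@injF_bij (option bool : finType)).
have [fa' faK faK'] : bijective fa by exact: (@injF_bij (option bool : finType)).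
have fz'i := can_inj fzK'. have fa'i := can_inj faK'.
pose q x := p4 R (bb z) (fz' x).
have hq x : 3 / 10 <= q x <= 2 / 5 by exact: p4_bd.
have q1 : \sum_x q x = 1.
  by rewrite -(proj2 (p4_isd R (bb z))) [RHS](reindex fz') //; exists fz => x _; [exact: fzK'|exact: fzK].
case: (agreement s1i s2i) => [pi|[sp [e0 hsp]]].

  have [pi1 pK piK] : bijective (avoid2 s1 s2) by exact: (@injF_bij (option bool : finType)).
  have gi : injective (fun x => fa (pi1 (t (fz' x)))) by move=> x y /fai /(can_inj piK) /ti /fz'i.
  apply: (square_close (k := fun x => off R (fa (pi1 (t (fz' x))))) (av := fun _ r => r) (bv := fun _ r => avoid2 s1 s2 (fa' r)) fzK' fzK faK faK' hz ha ht hs).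
  - by move=> x; exact: off_isd.
  - move=> x r; rewrite /off; case: eqP => [_|n] h; first by rewrite ltxx in h.
    have [k1 k2] := avoid2P s1 s2 (fa' r); split=> //.
    by apply/eqP => e; apply: n; rewrite -e pK faK'.
  - move=> c; exact: (perm_marg hq q1 gi).
  - move=> c; have := perm_marg hq q1 gi (fa (pi1 c)); rewrite /avg2 => /le_trans; apply.
    rewrite le_eqVlt; apply/orP; left; apply/eqP; apply: eq_bigr => x _; congr (_ * _); apply: eq_bigr => r _; congr (_ * _%:R); congr nat_of_bool.
    by apply/eqP/eqP => [->|<-]; rewrite ?faK ?piK ?pK ?faK'.
  - move=> c; exact: (perm_avail hq q1 gi).
  - move=> c; exact: (perm_forced hq q1 gi).
pose s0 := s1 sp; pose g x := t (fz' x).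
have gi : injective g by move=> x y /ti /fz'i.
have [t' tK tK'] : bijective t by exact: (@injF_bij (option bool : finType)).
pose xs := fz (t' s0).
have gxs : g xs = s0 by rewrite /g /xs fzK tK'.
apply: (square_close (k := pin R xs s0 (fa sp)) (av := pinA xs (fa sp))
  (bv := fun x r => if x == xs then r else if r == fa sp then third s0 (g x) else s0) fzK' fzK faK faK' hz ha ht hs).
- exact: pin_isd.
- move=> x r; rewrite /pin /pinA /off; case: (eqVneq x xs) => [->|n].
    case: (eqVneq r s0) => [->|nr]; first by rewrite ?eqxx /= ltxx.
    by move=> _; rewrite -/(g xs) gxs faK -e0.
  have gn : s0 != g x by rewrite -gxs (inj_eq gi) eq_sym.
  case: (eqVneq r (fa sp)) => [->|nr] _.
    have [k1 k2] := thirdP s0 (g x); rewrite faK -e0; by split.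
  have ns : fa' r != sp by apply: contra nr => /eqP <-; rewrite faK'.
  have [k1 k2] := hsp _ ns; split=> //; first by rewrite /s0 (inj_eq s1i) eq_sym.
  by rewrite /s0 e0 (inj_eq s2i) eq_sym.
- move=> c; exact: (pin_marg hq q1).
- move=> c; have := pin_marg' hq q1 xs (fa sp) c gi; rewrite gxs; exact.
- move=> c; exact: (pin_avail hq q1).
- move=> c; exact: (pin_forced hq q1).
Qed.
End Square.

(** * Necklaces *)

Section Necklace.
Variable T : finType.
Implicit Types (U : {set T}) (m : T -> T -> nat).

(* The edges of [I_graph h] from [i] to its successor on the cycle, on all of [nat]. *)
Definition arc h i j : nat := (((i < h.*2) && (j == i.+1)) * (1 + ~~ odd i) + ((i == h.*2) && (j == 0)))%N.
Definition nmul h i j : nat := (arc h i j + arc h j i)%N.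

Lemma I_mult_nmul h (i j : 'I_(h.*2.+1)) : (0 < h)%N -> I_mult i j = nmul h i j.
Proof.
move=> h0; rewrite /I_mult /nmul.
have arcE (x y : 'I_(h.*2.+1)) : I_arc x y = arc h x y.
  rewrite /I_arc /arc; have := ltn_ord x; rewrite ltnS leq_eqVlt => /orP[/eqP e|lt].
    by rewrite e modnn ltnn eqxx /=; case: eqP; rewrite ?andbF.
  rewrite modn_small ?ltnS // lt (ltn_eqF lt) !addn0 andbT; case: eqP => _; rewrite ?mul0n // mul1n.
  by case: (odd x).
case: eqP => [->|_]; last by rewrite !arcE.
rewrite /arc; have -> : (j == j.+1 :> nat) = false by lia.
have -> : (val j == h.*2) && (val j == 0%N) = false by lia.
by rewrite andbF.
Qed.

Definition necklace h (f : nat -> T) U m :=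
  [/\ (0 < h)%N, forall i j, (i <= h.*2)%N -> (j <= h.*2)%N -> f i = f j -> i = j,
    forall x, x \in U <-> exists2 i, (i <= h.*2)%N & x = f i &
    forall i j, (i <= h.*2)%N -> (j <= h.*2)%N -> m (f i) (f j) = nmul h i j].

Lemma neckP U m : neck U m <-> exists h f, necklace h f U m.
Proof.
split=> [[h [f [h0 fi eU e]]]|[h [f [h0 fi eU e]]]].
  exists h, (fun i => f (inord i)); split=> // [i j li lj /fi/(congr1 val)|x|i j li lj].
  - by rewrite /= !inordK.
  - rewrite eU; split=> [/imsetP[i _ ->]|[i li ->]]; last by apply/imsetP; exists (inord i).
    by exists (val i); [exact: leq_ord|rewrite inord_val].
  - by rewrite e I_mult_nmul // !inordK.
exists h, (fun i : 'I_(h.*2.+1) => f i); split=> // [i j||i j].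
- by move=> /fi k; apply: val_inj; apply: k; exact: leq_ord.
- apply/setP => x; apply/idP/imsetP => [/eU [i li ->]|[i _ ->]].
    by exists (inord i); rewrite ?inE ?inordK.
  by apply/eU; exists (val i); first exact: leq_ord.
- by rewrite e ?I_mult_nmul //; exact: leq_ord.
Qed.

Lemma nmul_sum h i : (0 < h)%N -> (i <= h.*2)%N ->
  (\sum_(j < h.*2.+1) nmul h i j)%N = (if i == h.*2 then 2 else 3)%N.
Proof.
move=> h0 li.
have ind k c : (\sum_(j < h.*2.+1) (val j == k) * c)%N = ((k < h.*2.+1) * c)%N.
  case: ltnP => lt; last by rewrite big1 // => j _; case: eqP => // e; have := ltn_ord j; rewrite e ltnNge lt.
  rewrite (bigD1 (Ordinal lt)) //= eqxx big1 ?addn0 // => j; rewrite -val_eqE /= => /negbTE ->; by rewrite mul0n.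
have e (j : 'I_(h.*2.+1)) : nmul h i j = ((val j == i.+1) * ((i < h.*2) * (1 + ~~ odd i)) + (val j == 0) * (i == h.*2) +
    (val j == i.-1) * ((0 < i) * (1 + odd i)) + (val j == h.*2) * (i == 0))%N.
  rewrite /nmul /arc -[RHS]addnA; rewrite /=; move: (nat_of_ord j) (ltn_ord j) => k lk.
  congr (_ + _ + (_ + _))%N.
  - by case: (k == _); case: (i < _)%N; rewrite ?mul1n ?mul0n ?muln0.
  - by case: (k == _); case: (i == _).
  - case: (i) li => [_|i' li]; first by rewrite andbF mul0n muln0.
    rewrite eqSS [i' == k]eq_sym /= mul1n; case: (eqVneq k i') => [->|_]; last by rewrite andbF.
    by rewrite li.
  - by case: (k == _); case: (i == _).
under eq_bigr => j _ do rewrite e.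
rewrite !big_split /= !ind; case: eqP => [->|n]; have := odd_double h; move: li h0; lia.
Qed.

Lemma neck_facts U m : gr m -> neck U m -> (3 <= #|U|)%N /\ exists q, [/\ q \in U, ed m [set q] U = 2%N, forall y, y \in U -> (m q y <= 1)%N &
  forall x, x \in U -> x != q -> ed m [set x] U = 3%N /\ exists2 y, y \in U & m x y = 2%N].
Proof.
move=> gm N; have [h0 [f0 [hp fi0 eU0 _]]] := N; split.
  by rewrite eU0 card_imset // cardsT card_ord; lia.
have [h [f [h1 fi eU e]]] := (proj1 (neckP U m)) N.
have deg i : (i <= h.*2)%N -> ed m [set f i] U = (if i == h.*2 then 2 else 3)%N.
  move=> li; rewrite -nmul_sum // ed1l.
  have -> : U = [set f (val j) | j : 'I_(h.*2.+1)].
    apply/setP => x; apply/idP/imsetP => [/eU [j lj ->]|[j _ ->]].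
      by exists (inord j); rewrite ?inE /= ?inordK.
    by apply/eU; exists (val j); first exact: leq_ord.
  rewrite big_imset /=; last by move=> j k _ _ /fi k'; apply: val_inj; apply: k'; exact: leq_ord.
  by apply: eq_bigr => j _; rewrite e //; exact: leq_ord.
exists (f h.*2); split.
- by apply/eU; exists h.*2.
- by rewrite deg // eqxx.
- move=> y /eU [j lj ->]; rewrite e // /nmul /arc ltnn eqxx /=.
  have -> : (h.*2 == 0)%N = false by lia.
  rewrite andbF addn0; case: (eqVneq h.*2 j.+1) => [e'|_]; last by rewrite andbF; case: eqP.
  have : odd j by rewrite -[odd j]negbK -[~~ odd j]/(odd j.+1) -e' odd_double.
  by move=> ->; case: eqP => ?; lia.
- move=> x /eU [i li ->] n; have lt : (i < h.*2)%N by rewrite ltn_neqAle li andbT; apply: contraNneq n => ->.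
  rewrite deg //= (ltn_eqF lt); split=> //.
  case: (boolP (odd i)) => oi.
    have e1 : i = i.-1.+1 by case: i oi {li n lt}.
    exists (f i.-1); first by apply/eU; exists i.-1 => //; lia.
    by rewrite e //; [rewrite /nmul /arc; move: oi; rewrite e1 /=; lia|lia].
  exists (f i.+1); first by apply/eU; exists i.+1.
  by rewrite e // /nmul /arc lt eqxx (negbTE oi) /=; lia.
Qed.

Lemma pot_neck U m (rho : T -> nat) : gr m -> neck U m -> (forall v, v \in U -> rho v = 6%N) -> pot m rho U = 2.
Proof.
move=> gm N r6; have [_ [q [qU dq _ h]]] := neck_facts gm N.
rewrite /pot (ed_sum m U U) (big_morph Posz PoszD (erefl _)) mulr_sumr -sumrB (bigD1 q) //= (r6 q qU) dq.
rewrite big1 // => x /andP[xU n]; by have [-> _] := h x xU n; rewrite r6.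
Qed.

(** The new number of the old vertex [i] when two vertices are inserted at positions [k] and
    [k.+1]. *)
Definition widen k i := if (i < k)%N then i else i.+2.

(** Shifting by 2 preserves parity and hence which edges are double. For even [k] the edge from the
    predecessor of [k], which is [h.*2] for [k = 0], is a single edge, and it is the one
    replaced. *)
Lemma arc_widen h k i j : ~~ odd k -> (k <= h.*2)%N -> (i <= h.*2)%N -> (j <= h.*2)%N ->
  arc h i j = (arc h.+1 (widen k i) (widen k j) + ((i == if k == 0%N then h.*2 else k.-1) && (j == k)))%N.
Proof.
rewrite /arc /widen => ok lk li lj.
have [oi|oi] : odd i \/ ~~ odd i by case: (odd i); auto.
  case: (ltnP i k) => ik; case: (ltnP j k) => jk; rewrite /= ?negbK ?oi /= ?muln1; case: (eqVneq k 0%N) => k0; lia.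
have nk : k != 0%N -> i != k.-1 by case: (k) ok => // k' /=; rewrite negbK => ok' _; apply: contraNneq oi => ->.
case: (ltnP i k) => ik; case: (ltnP j k) => jk; rewrite /= ?negbK ?(negbTE oi) /= ; case: (eqVneq k 0%N) nk => k0 nk; try lia.
Qed.

Lemma arc_new h k j : ~~ odd k -> (k <= h.*2)%N -> (j <= h.*2)%N ->
  [/\ arc h.+1 k (widen k j) = 0%N, arc h.+1 (widen k j) k.+1 = 0%N, arc h.+1 k.+1 (widen k j) = (j == k) &
   arc h.+1 (widen k j) k = (j == if k == 0%N then h.*2 else k.-1)].
Proof.
rewrite /arc /widen => ok lk lj.
have nk : k != 0%N -> odd k.-1 by case: (k) ok => // k' /=; rewrite negbK.
case: (ltnP j k) => jk; (split; first lia; first lia; rewrite /= ?ok /=; first lia); case: (eqVneq k 0%N) nk => k0 nk; try lia.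
Qed.

Lemma necklace_insert h f U m a b k (u := f (if k == 0%N then h.*2 else k.-1)) (w := f k) : gr m -> ~~ odd k -> (k <= h.*2)%N ->
  necklace h f U (add_edge u w m) -> a \notin U -> b \notin U -> a != b -> m a b = 2%N -> m u a = 1%N -> m w b = 1%N ->
  (forall x, x \in U -> x != u -> m x a = 0%N) -> (forall x, x \in U -> x != w -> m x b = 0%N) -> neck (U :|: [set a; b]) m.
Proof.
move=> gm ok lk [h0 fi eU e] aU bU ab mab mua mwb ma0 mb0; have [sm zm] := gm.
have pk : ((if k == 0%N then h.*2 else k.-1) <= h.*2)%N by case: ifP => //; lia.
have fE i j : (i <= h.*2)%N -> (j <= h.*2)%N -> (f i == f j) = (i == j).
  by move=> li lj; apply/eqP/eqP => [/fi|->//]; apply.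
pose F n := if n == k then a else if n == k.+1 then b else if (n < k)%N then f n else f n.-2.
have Fa : F k = a by rewrite /F eqxx.
have Fb : F k.+1 = b by rewrite /F eqxx; case: eqP => // ?; lia.
have Fw i : F (widen k i) = f i.
  by rewrite /F /widen; case: (ltnP i k) => ik; rewrite ?ik; do 2?[case: eqP => [?|_]; first lia]; rewrite //; case: ltnP => //; lia.
have split3 n : (n <= h.+1.*2)%N -> n = k \/ n = k.+1 \/ exists2 i, (i <= h.*2)%N & n = widen k i.
  move=> ln; case: (ltngtP n k) => [lt|gt|]; [right; right; exists n; rewrite /widen ?lt //; lia| |by left].
  case: (eqVneq n k.+1) => [|n1]; [by right; left|right; right; exists n.-2; first lia].
  by rewrite /widen; case: ltnP => ?; lia.
have fU i : (i <= h.*2)%N -> f i \in U by move=> li; apply/eU; exists i.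
have na i : (i <= h.*2)%N -> f i != a by move=> /fU; apply: contraTneq => ->.
have nb i : (i <= h.*2)%N -> f i != b by move=> /fU; apply: contraTneq => ->.
have wi i j : widen k i = widen k j -> i = j.
  by rewrite /widen; case: (ltnP i k) => ?; case: (ltnP j k) => ?; lia.
have ma i : (i <= h.*2)%N -> m a (f i) = (i == if k == 0%N then h.*2 else k.-1).
  move=> li; rewrite sm; case: eqP => [->//|/eqP n]; apply: ma0; [exact: fU|by rewrite fE].
have mb i : (i <= h.*2)%N -> m b (f i) = (i == k).
  move=> li; rewrite sm; case: eqP => [->//|/eqP n]; apply: mb0; [exact: fU|by rewrite fE].
have arck : arc h.+1 k k.+1 = 2%N by rewrite /arc (negbTE ok); lia.
have arck' : arc h.+1 k.+1 k = 0%N by rewrite /arc; lia.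
have arc0 i : arc h.+1 i i = 0%N by rewrite /arc; lia.
apply/neckP; exists h.+1, F; split=> //.
- move=> i j /split3 [->|[->|[i' li ->]]] /split3 [->|[->|[j' lj ->]]] //; rewrite ?Fa ?Fb ?Fw => E.
  + by rewrite E eqxx in ab.
  + by have := na j' lj; rewrite -E eqxx.
  + by rewrite E eqxx in ab.
  + by have := nb j' lj; rewrite -E eqxx.
  + by have := na i' li; rewrite E eqxx.
  + by have := nb i' li; rewrite E eqxx.
  + by congr widen; exact: fi.
- move=> x; rewrite in_setU in_set2; split=> [/or3P[/eU[i li ->]|/eqP ->|/eqP ->]|[i /split3 [->|[->|[i' li ->]]] ->]].
  + by exists (widen k i); rewrite ?Fw // /widen; case: ifP => _; lia.
  + by exists k; rewrite ?Fa //; lia.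
  + by exists k.+1; rewrite ?Fb //; lia.
  + by rewrite Fa eqxx orbT.
  + by rewrite Fb eqxx !orbT.
  + by rewrite Fw fU.
move=> i j /split3 [->|[->|[i' li ->]]] /split3 [->|[->|[j' lj ->]]]; rewrite ?Fa ?Fb ?Fw ?zm /nmul ?arc0 ?arck ?arck' //.
- by have [-> _ _ ->] := arc_new ok lk lj; rewrite ma.
- by rewrite sm.
- by have [_ -> -> _] := arc_new ok lk lj; rewrite mb ?addn0.
- by have [-> _ _ ->] := arc_new ok lk li; rewrite sm ma ?addn0.
- by have [_ -> -> _] := arc_new ok lk li; rewrite sm mb.
have := e i' j' li lj; rewrite /add_edge /nmul (arc_widen ok lk li lj) (arc_widen ok lk lj li) /u /w !fE //.
by rewrite [(i' == k) && _]andbC; lia.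
Qed.

(** The edge uw has multiplicity 1 in the necklace, so it ends at an even position in one of its two
    directions, as [necklace_insert] requires. *)
Lemma neck_insert U m a b u w : gr m -> u \in U -> w \in U -> u != w -> m u w = 0%N ->
  neck U (add_edge u w m) -> a \notin U -> b \notin U -> a != b -> m a b = 2%N -> m u a = 1%N -> m w b = 1%N ->
  (forall x, x \in U -> x != u -> m x a = 0%N) -> (forall x, x \in U -> x != w -> m x b = 0%N) -> neck (U :|: [set a; b]) m.
Proof.
move=> gm uU wU uw muw /neckP [h [f N]] aU bU ab mab mua mwb ma0 mb0; have [h0 fi eU e] := N.
have [i li eu] := proj1 (eU u) uU; have [j lj ew] := proj1 (eU w) wU.
have: nmul h i j = 1%N by rewrite -e // -eu -ew /add_edge !eqxx muw (negbTE uw).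
have one i' j' : arc h i' j' = 1%N -> (i' <= h.*2)%N -> (j' <= h.*2)%N -> ~~ odd j' /\ i' = if j' == 0%N then h.*2 else j'.-1.
  rewrite /arc => E li' lj'; case: (eqVneq j' 0%N) E => [->|n] E; first by split=> //; move: E; lia.
  case: (boolP (odd i')) E => oi E; last by exfalso; move: E; lia.
  have ej : j' = i'.+1 by move: E; lia.
  by rewrite ej /= oi.
rewrite /nmul => E; have [[E1 _]|[_ E1]] : (arc h i j = 1%N /\ arc h j i = 0%N) \/ (arc h i j = 0%N /\ arc h j i = 1%N) by move: E; lia.
  have [oj ei] := one i j E1 li lj; subst i u w.
  exact: (necklace_insert gm oj lj N).
have [oi ej] := one j i E1 lj li; subst j u w; rewrite [[set a; b]]setUC.
have N' : necklace h f U (add_edge (f (if i == 0%N then h.*2 else i.-1)) (f i) m).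
  split=> // i1 j1 l1 l2; rewrite -(e i1 j1 l1 l2) /add_edge; rewrite -!addnA; congr (_ + _)%N; exact: addnC.
apply: (necklace_insert gm oi li N') => //; first by rewrite eq_sym.
by rewrite (proj1 gm).
Qed.

Lemma triangle_neck m a b p : gr m -> a != b -> a != p -> b != p -> m a b = 2%N -> m a p = 1%N -> m b p = 1%N ->
  neck [set a; b; p] m.
Proof.
move=> [sm zm] ab ap bp m1 m2 m3; apply/neckP; exists 1%N, (fun n => if n == 0%N then a else if n == 1%N then b else p); split=> //.
- move=> [|[|[|i]]] [|[|[|j]]] //= _ _ E; move: ab ap bp; rewrite E ?eqxx //=.
- move=> x; rewrite !inE -orbA; split=> [/or3P[] /eqP ->|[[|[|i]] _ ->]]; rewrite ?eqxx ?orbT //.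
  + by exists 0%N.
  + by exists 1%N.
  + by exists 2%N.
- by move=> [|[|[|i]]] [|[|[|j]]] //= _ _; rewrite ?zm ?m1 ?m2 ?m3 // sm ?m1 ?m2 ?m3.
Qed.
End Necklace.

(** * Double edges *)

Section Doubles.
Variables (R : realFieldType) (T : finType).
Implicit Types (A B C U W S : {set T}).
Variables (V : {set T}) (m : T -> T -> nat) (rho : T -> nat).
Hypotheses (gm : gr m) (va : valid rho) (cr : crit R V m rho) (ih : IHyp R T (meas V rho)) (potV : 0 < pot m rho V).
Notation d v := (dg V m v).
Variable p : T.
Hypotheses (pp : p \in posv V m rho) (Vp : V = cp V m rho p).

Let pV : p \in V := p_in pp Vp.
Let p6 : rho p = 6%N /\ d p = 2%N := p_six gm va cr ih potV pp Vp.
Let vz v : v \in V -> v != p -> rho v = 6%N /\ d v = 3%N \/ rho v = 4%N /\ d v = 2%N := @v_zero R T V m rho gm va cr ih potV p pp Vp v.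
Let eg2 W : W \proper V -> W != set0 -> (2 <= ed m W (V :\: W))%N := @e_ge2 R T V m rho gm va cr ih potV p pp Vp W.
Let d3 v : v \in V -> (d v <= 3)%N.
Proof. by move=> vV; case: (eqVneq v p) => [->|/(vz vV)]; [rewrite (proj2 p6)|case=> -[_ ->]]. Qed.
Let pot2' : pot m rho V = 2 := potV2 gm va cr ih potV pp Vp.

Lemma dg_pairs v s : uniq s -> {subset s <= V} -> (\sum_(x <- s) m v x <= d v)%N.
Proof.
move=> us sV; rewrite /dg ed1l (big_setID [set x in s]) /=.
rewrite (_ : \sum_(y in V :&: _) _ = \sum_(x <- s) m v x)%N ?leq_addr // (big_uniq _ us); apply: eq_bigl => x.
by rewrite !inE; case: (boolP (x \in s)) => [/sV ->|_]; rewrite ?andbF.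
Qed.

Lemma out_deg W : W \subset V -> (ed m W (V :\: W) + ed m W W = \sum_(v in W) d v)%N.
Proof.
move=> sW; rewrite addnC -edUr ?disjD ?UD // ed_sum //.
Qed.

(** Every proper nonempty set has at least two outer edges, and the hypothesis leaves room for only
    one. *)
Lemma full W : W \subset V -> W != set0 -> (\sum_(v in W) d v <= ed m W W + 1)%N -> W = V.
Proof.
move=> sW nW h; case: (eqVproper sW) => // pW; have := eg2 pW nW; have := out_deg sW; move: h; clear; lia.
Qed.

Lemma full_seq s : uniq s -> {subset s <= V} -> s != [::] -> (\sum_(v <- s) d v <= \sum_(x <- s) \sum_(y <- s) m x y + 1)%N ->
  [set v in s] = V.
Proof.
move=> us sV ns h.
have e (F : T -> nat) : (\sum_(x in [set v in s]) F x = \sum_(x <- s) F x)%N.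
  by rewrite (big_uniq _ us); apply: eq_bigl => x; rewrite inE.
apply: full; first by apply/subsetP => v; rewrite inE => /sV.
  by apply/set0Pn; case: s ns {us sV h e} => // x s _; exists x; rewrite inE mem_head.
have -> : ed m [set v in s] [set v in s] = (\sum_(x <- s) \sum_(y <- s) m x y)%N.
  by rewrite /ed e; apply: eq_bigr => x _; exact: e.
by rewrite e.
Qed.

Lemma double_at_p z : z \in V -> m p z = 2%N -> C2 V m rho.
Proof.
move=> zV mpz; have zp : z != p by apply: contra_eqN mpz => /eqP ->; rewrite (proj2 gm).
have E : [set v in [:: p; z]] = V.
  apply: full_seq => //=; first by rewrite inE eq_sym zp.
    by move=> v; rewrite !inE => /orP[] /eqP ->.
  rewrite !big_cons !big_nil (proj2 p6) !(proj2 gm) (proj1 gm z p) mpz; have := d3 zV; clear; lia.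
have E' : V = [set p; z] by rewrite -E; apply/setP => v; rewrite !inE.
exists p, z; split=> //; [by rewrite eq_sym|exact: (proj1 p6)|].
have : d z = 2%N by rewrite /dg E' edUr ?disjoints1 ?inE 1?eq_sym // !ed11 (proj2 gm) addn0 (proj1 gm).
by case: (vz zV zp) => -[] // _ ->.
Qed.

Section Pair.
Variables a b : T.
Hypotheses (aV : a \in V) (bV : b \in V) (ap : a != p) (bp : b != p) (mab : m a b = 2%N).
Let V' := V :\: [set a; b].

Lemma ab : a != b. Proof. by apply: contra_eqN mab => /eqP ->; rewrite (proj2 gm). Qed.
Lemma abV : [set a; b] \subset V. Proof. by rewrite subUset !sub1set aV. Qed.
Lemma pV' : p \in V'. Proof. by rewrite !inE negb_or ![p == _]eq_sym ap bp. Qed.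
Lemma V'E : V' :|: [set a; b] = V. Proof. by rewrite setUC UD // abV. Qed.
Lemma V'proper : V' \proper V.
Proof. by rewrite properEneq subsetDl andbT; apply: contraTneq aV => <-; rewrite !inE eqxx. Qed.
(** At least two edges leave the pair, which forces degree 3 and so potential 6 at both ends. *)
Lemma ab_out : ed m [set a; b] V' = 2%N /\ [/\ rho a = 6%N, d a = 3%N, rho b = 6%N & d b = 3%N].
Proof.
have pr : [set a; b] \proper V.
  by rewrite properEneq abV andbT; apply: contraTneq pV => <-; rewrite !inE negb_or ![p == _]eq_sym ap bp.
have ne : [set a; b] != set0 by apply/set0Pn; exists a; rewrite !inE eqxx.
have e4 : ed m [set a; b] [set a; b] = 4%N.
  by rewrite edUl ?disjoints1 ?inE ?ab // !edUr ?disjoints1 ?inE ?ab // !ed11 !(proj2 gm) (proj1 gm b a) mab.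
have := eg2 pr ne; have := out_deg abV; rewrite e4 big_setU1 ?inE ?ab //= big_set1 -/V'.
case: (vz aV ap) => -[-> ->]; case: (vz bV bp) => -[-> ->] /= h1 h2; split; try (by split); move: h1 h2; clear; lia.
Qed.

Lemma pair_nbr x y : x \in [set a; b] -> y \in [set a; b] -> x != y -> exists u, [/\ u \in V', m u x = 1%N & forall v, v \in V' -> v != u -> m v x = 0%N].
Proof.
move=> xab yab xy; have [_ [_ da _ db]] := ab_out.
have dx : d x = 3%N by move: xab; rewrite !inE => /orP[] /eqP ->.
have exy : m x y = 2%N.
  by move: xab yab xy; rewrite !inE => /orP[] /eqP -> /orP[] /eqP ->; rewrite ?eqxx // (proj1 gm).
have e : ed m [set x] [set a; b] = 2%N.
  have -> : [set a; b] = [set x; y].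
    by move: xab yab xy; rewrite !inE => /orP[] /eqP -> /orP[] /eqP ->; rewrite ?eqxx // setUC.
  by rewrite edUr ?disjoints1 ?inE // !ed11 (proj2 gm).
have [u [uV' mu z]] : exists u, [/\ u \in V', m x u = 1%N & forall v, v \in V' -> v != u -> m x v = 0%N].
  by apply: ed_eq1; move: dx; rewrite (dg_split _ _ abV) // e -/V'; clear; lia.
exists u; split=> [||v vV' n]; rewrite // (proj1 gm) //; exact: z.
Qed.

Lemma same_nbr u : u \in V' -> m u a = 1%N -> m u b = 1%N -> neck V m /\ forall v, v \in V -> rho v = 6%N.
Proof.
move=> uV' ua ub; have [_ [a6 da b6 db]] := ab_out; have uV := subsetP (proper_sub V'proper) u uV'.
have [ua' ub'] : u != a /\ u != b by move: uV'; rewrite !inE negb_or => /andP[/andP[-> ->]].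
have E : [set v in [:: a; b; u]] = V.
  apply: full_seq => //=; first by rewrite !inE negb_or ab 1?[a == u]eq_sym ua' /= eq_sym ub'.
    by move=> v; rewrite !inE => /or3P[] /eqP ->.
  rewrite !big_cons !big_nil da db !(proj2 gm) (proj1 gm b a) (proj1 gm a u) (proj1 gm b u) mab ua ub; have := d3 uV; clear; lia.
have E' : V = [set a; b; u] by rewrite -E; apply/setP => v; rewrite !inE orbA.
have up : u = p by apply/eqP; move: pV; rewrite E' !inE ![p == _]eq_sym (negbTE ap) (negbTE bp).
split; first by rewrite E'; apply: triangle_neck; rewrite ?ab // 1?eq_sym // (proj1 gm).
by move=> v; rewrite E' !inE -orbA => /or3P[] /eqP ->; rewrite ?a6 ?b6 // up (proj1 p6).
Qed.

Section Apart.
Variables u w : T.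
Hypotheses (uV' : u \in V') (wV' : w \in V') (uw : u != w) (mua : m u a = 1%N) (mwb : m w b = 1%N)
  (ma0 : forall x, x \in V' -> x != u -> m x a = 0%N) (mb0 : forall x, x \in V' -> x != w -> m x b = 0%N).
Notation m2 := (add_edge u w m).

(** By [pair_lossless] the contracted graph is nonflexible, and a critical subgraph of it must use
    the new edge. The pair contributes 6 + 6 - 8 - 4 - 4 = -4 to the potential, as much as the new
    edge, so [gap] bounds the potential of the subgraph below by 2. The induction leaves only cases
    of potential 2, and equality means that nothing was deleted. *)
Lemma contract : C2 V' m2 rho \/ neck V' m2 /\ forall v, v \in V' -> rho v = 6%N.
Proof.
have [_ [a6 _ b6 _]] := ab_out.
have sV' := proper_sub V'proper.
have aV' : a \notin V' by rewrite !inE eqxx.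
have bV' : b \notin V' by rewrite !inE eqxx orbT.
have n3 v : v \in V' -> rho v != 3%N by move=> /(subsetP sV'); exact: (no3 gm va cr ih potV pp Vp).
have g2 : gr m2 := add_edge_gr gm uw.
have nf : ~ flex R V' m2 rho.
  move=> fl; apply: (nonlaw gm va cr ih potV pp Vp); rewrite -/(lawful R V m rho) -V'E.
  exact: (pair_lossless aV' bV' ab uV' wV' uw a6 b6 mab mua mwb ma0 mb0 (flex_lawful n3 fl)).
have [W [m' [g' sW le cW]]] := nonflex_crit g2 nf.
have pW : W \proper V by apply: sub_proper_trans sW V'proper.
have mle x y : (m x y <= m2 x y)%N by rewrite /add_edge -addnA leq_addr.
have [x0 [y0 [x0W y0W lt]]] : exists x y, [/\ x \in W, y \in W & (m x y < m' x y)%N].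
  apply: NNPP => h; apply: (proj1 cW); apply: (flex_sub (m' := m)); last exact: (sub_flex gm cr pW).
  by move=> x y xW yW; rewrite leqNgt; apply/negP => l; apply: h; exists x, y.
have [uW wW] : u \in W /\ w \in W.
  have := leq_trans lt (le x0 y0 x0W y0W); rewrite /add_edge.
  case: (boolP ((x0 == u) && (y0 == w))) => [/andP[/eqP <- /eqP <-] //|_].
  case: (boolP ((x0 == w) && (y0 == u))) => [/andP[/eqP <- /eqP <-] //|_].
  by rewrite !addn0 ltnn.
have W0 : W != set0 by apply/set0Pn; exists u.
have Wab : [disjoint W & [set a; b]].
  rewrite disjoint_sym disjoints_subset subUset !sub1set !in_setC.
  by rewrite (contra (subsetP sW a) aV') (contra (subsetP sW b) bV').
have pot_ab : pot m rho [set a; b] = 4 by rewrite pot2 ?ab // a6 b6 mab.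
have edWx x z : z \in W -> (forall v, v \in V' -> v != z -> m v x = 0%N) -> m z x = 1%N -> ed m W [set x] = 1%N.
  move=> zW h1 h2; rewrite edC // ed1l (bigD1 z) //= (proj1 gm) h2 big1 // => v /andP[vW n].
  by rewrite (proj1 gm) h1 // (subsetP sW).
have ed_ab : ed m W [set a; b] = 2%N.
  by rewrite edUr ?disjoints1 ?inE ?ab // (edWx a u) // (edWx b w).
have pWab : pot m rho (W :|: [set a; b]) = pot m rho W - 4 by rewrite potU // pot_ab ed_ab -addrA.
have edm2 : ed m2 W W = (ed m W W + 2)%N.
  rewrite /ed /add_edge; under eq_bigr => x _ do rewrite !big_split /=.
  rewrite !big_split /= -addnA; congr (_ + _)%N.
  have one (s t : T) : s \in W -> t \in W -> (\sum_(x in W) \sum_(y in W) ((x == s) && (y == t)))%N = 1%N.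
    move=> sW' tW'; rewrite (bigD1 s) //= [X in (_ + X)%N]big1 => [|x /andP[_ /negbTE n]]; last by rewrite big1 // => y _; rewrite n.
    by rewrite (bigD1 t) //= !eqxx big1 ?addn0 // => y /andP[_ /negbTE ->].
  by rewrite !one.
have le' : (ed m' W W <= ed m2 W W)%N by apply: leq_sum => x xW; apply: leq_sum => y yW; exact: le.
have potm' : pot m' rho W = pot m rho (W :|: [set a; b]) + 2 * (ed m2 W W - ed m' W W)%N%:Z.
  rewrite pWab /pot; move: edm2 le'; move: (ed m2 W W) (ed m' W W) (ed m W W) (\sum_(v in W) _) => e2 e1 e0 s ->; clear; lia.
have sWV : W :|: [set a; b] \subset V by rewrite subUset abV (subset_trans sW sV').
have nWV : W :|: [set a; b] != set0 by apply/set0Pn; exists u; rewrite inE uW.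
have big2 : W :|: [set a; b] != V -> 3 <= pot m rho (W :|: [set a; b]).
  move=> n; have pr : W :|: [set a; b] \proper V by rewrite properEneq n.
  by have := gap gm va cr ih potV pr nWV; rewrite pot2'.
have ge2 : 2 <= pot m rho (W :|: [set a; b]).
  by case: (eqVneq (W :|: [set a; b]) V) => [->|/big2]; [rewrite pot2'|clear; lia].
have fin : pot m' rho W = 2 -> W = V' /\ forall x y, x \in W -> y \in W -> m' x y = m2 x y.
  move=> e2; have eV : W :|: [set a; b] = V.
    by apply/eqP/negPn/negP => /big2; move: potm' e2; clear; lia.
  split; first by rewrite /V' -eV setDUl setDv setU0; apply/esym/setDidPl.
  have ee : (ed m2 W W <= ed m' W W)%N by move: potm' e2 ge2; clear; lia.
  move=> x y xW yW; apply/eqP; rewrite eqn_leq le //= leqNgt; apply/negP => l.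
  move: ee; apply/negP; rewrite -ltnNge /ed (bigD1 x) //= [X in (_ < X)%N](bigD1 x) //= -addSn; apply: leq_add; last first.
    by apply: leq_sum => z /andP[zW _]; apply: leq_sum => v vW; exact: le.
  rewrite (bigD1 y) //= [X in (_ < X)%N](bigD1 y) //= -addSn; apply: leq_add => //.
  by apply: leq_sum => v /andP[vW _]; exact: le.
case: (ih g' va cW (meas_sub _ _ pW)) => [h|[c2|[N a6']]].
- by exfalso; move: h; rewrite potm'; move: ge2; clear; lia.
- have [x [y [n eW e x6 y4]]] := c2.
  have [|eV me] := fin; first by rewrite eW pot2 // x6 y4 e.
  by left; exists x, y; split=> //; rewrite -?eV // -me // eW !inE eqxx ?orbT.
have [|eV me] := fin; first exact: pot_neck.
right; rewrite -eV; split=> //; have [h [f [h0 fi eW e]]] := N; exists h, f; split=> // i j.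
by rewrite -me ?e // eW imset_f.
Qed.

Let sV' : {subset V' <= V} := subsetP (proper_sub V'proper).
Let aV' : a \notin V'. Proof. by rewrite !inE eqxx. Qed.
Let bV' : b \notin V'. Proof. by rewrite !inE eqxx orbT. Qed.
Let neV' x : x \in V' -> x != a /\ x != b.
Proof. by rewrite !inE negb_or => /andP[/andP[-> ->]]. Qed.

Lemma square_case : ~ C2 V' m2 rho.
Proof.
move=> [x [y [n eW e x6 y4]]]; have [_ [a6 _ b6 _]] := ab_out.
have inV' z : z \in V' -> z = x \/ z = y by rewrite eW !inE => /orP[] /eqP ->; auto.
have px : x = p by case: (inV' p pV') => // e'; move: y4; rewrite -e' (proj1 p6).
subst x; have yV' : y \in V' by rewrite eW !inE eqxx orbT.
have [pa pb] := neV' pV'; have [ya yb] := neV' yV'.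
have VE : V = p |: [set y; a; b] by rewrite -V'E eW -!setUA.
have VE' : V = p |: [set y; b; a] by rewrite VE -!setUA [[set a] :|: _]setUC.
apply: (nonlaw gm va cr ih potV pp Vp) => M bb cV.
have [[eu ew]|[eu ew]] : u = p /\ w = y \/ u = y /\ w = p.
  by have := uw; case: (inV' u uV') => ->; case: (inV' w wV') => ->; rewrite ?eqxx //; auto.
  have mpa : m p a = 1%N by rewrite -eu.
  have myb : m y b = 1%N by rewrite -ew.
  rewrite VE in cV *; apply: (@square_good R _ _ _ _ _ _ _ _ gm _ mpa _ _ myb mab (proj1 p6) a6 b6 _ bb cV).
  - by rewrite /= !inE !negb_or n pa pb ya yb ab.
  - by move: e; rewrite /add_edge eu ew !eqxx (negbTE n) /=; clear; lia.
  - by apply: mb0 pV' _; rewrite ew.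
  - by apply: ma0 yV' _; rewrite eu eq_sym.
have mba : m b a = 2%N by rewrite (proj1 gm).
have mpb : m p b = 1%N by rewrite -ew.
have mya : m y a = 1%N by rewrite -eu.
rewrite VE' in cV *; apply: (@square_good R _ _ _ _ _ _ _ _ gm _ mpb _ _ mya mba (proj1 p6) b6 a6 _ bb cV).
- by rewrite /= !inE !negb_or n pa pb ya yb eq_sym ab.
- by move: e; rewrite /add_edge eu ew !eqxx (negbTE n) /=; clear; lia.
- by apply: ma0 pV' _; rewrite eu.
- by apply: mb0 yV' _; rewrite ew eq_sym.
Qed.

Lemma neck_apart : neck V' m2 -> (forall v, v \in V' -> rho v = 6%N) -> m u w = 0%N -> neck V m /\ forall v, v \in V -> rho v = 6%N.
Proof.
move=> N r6 muw; have [_ [a6 _ b6 _]] := ab_out; rewrite -V'E; split.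
  exact: (neck_insert gm uV' wV' uw muw N aV' bV' ab mab mua mwb ma0 mb0).
by move=> v; rewrite in_setU in_set2 => /or3P[/r6|/eqP ->|/eqP ->].
Qed.

Lemma deg_contract x : x \in V' -> ed m2 [set x] V' = d x.
Proof.
move=> xV'; rewrite (dg_split m x (subset_trans (subxx _) (proper_sub V'proper))).
have -> : V :\: V' = [set a; b] by rewrite /V' setDDr setDv set0U; apply/setIidPr; exact: abV.
rewrite edUr ?disjoints1 ?inE ?ab // !ed11.
have -> : m x a = (x == u) by case: (eqVneq x u) => [->//|n]; exact: ma0.
have -> : m x b = (x == w) by case: (eqVneq x w) => [->//|n]; exact: mb0.
rewrite !ed1l /add_edge !big_split /= -addnA; congr (_ + (_ + _))%N.
  by rewrite (bigD1 w) //= eqxx andbT big1 ?addn0 // => y /andP[_ /negbTE ->]; rewrite andbF.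
by rewrite (bigD1 u) //= eqxx andbT big1 ?addn0 // => y /andP[_ /negbTE ->]; rewrite andbF.
Qed.

(** Contraction preserves degrees, so the vertex of degree 2 of the necklace is [p]. It lies on no
    double edge, whereas the new edge makes uw at least double; a triple edge would leave no edge to
    reach [p]. *)
Lemma neck_adj : neck V' m2 -> m u w <> 0%N -> [/\ u != p, w != p, m u w = 1%N, (forall y, y \in V' -> (m2 p y <= 1)%N) &
  forall x, x \in V' -> x != p -> exists2 y, y \in V' & m2 x y = 2%N].
Proof.
move=> N muw; have g2 : gr m2 := add_edge_gr gm uw.
have [_ [q [qV' dq q1 h]]] := neck_facts g2 N.
have pq : q = p.
  apply/eqP/negPn/negP => n; have npq : p != q by rewrite eq_sym.
  by have [] := h p pV' npq; rewrite deg_contract ?pV' // (proj2 p6).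
subst q; have m2uw : m2 u w = (m u w).+1 by rewrite /add_edge !eqxx (negbTE uw) addn0 addn1.
have up : u != p by apply/negP => /eqP e; apply: muw; have := q1 w wV'; rewrite -e m2uw; clear; lia.
have wp : w != p by apply/negP => /eqP e; apply: muw; have := q1 u uV'; rewrite -e (proj1 g2) m2uw; clear; lia.
split=> //; last by move=> x xV' n; have [_] := h x xV' n.
have [_ [_ da _ db]] := ab_out; have [ua ub] := neV' uV'; have [wa wb] := neV' wV'.
apply/eqP; rewrite eqn_leq lt0n; apply/andP; split; last exact/eqP.
rewrite leqNgt; apply/negP => l.
have E : [set v in [:: a; b; u; w]] = V.
  apply: full_seq => //=.
  - by rewrite !inE !negb_or ab ![a == _]eq_sym ![b == _]eq_sym ua ub wa wb uw.
  - by move=> v; rewrite !inE => /or4P[] /eqP -> //; exact: sV'.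
  rewrite !big_cons !big_nil da db !(proj2 gm) (proj1 gm b a) (proj1 gm a u) (proj1 gm b w) (proj1 gm w u) mab mua mwb.
  have := d3 (sV' uV'); have := d3 (sV' wV'); move: l; clear; lia.
by move: pV; rewrite -E !inE ![p == _]eq_sym (negbTE ap) (negbTE bp) (negbTE up) (negbTE wp).
Qed.

(** Here the pair ab is colored first, and u, w form a chain of two vertices closed by [p]; without
    interior vertices the condition of [chain_tilt] is void. *)
Lemma five : V' = [set p; u; w] -> u != p -> w != p -> m u w = 1%N -> rho u = 6%N -> rho w = 6%N -> False.
Proof.
move=> eV' up wp muw u6 w6; have [_ [a6 _ b6 _]] := ab_out.
have [ua ub] := neV' uV'; have [wa wb] := neV' wV'; have [pa pb] := neV' pV'.
pose U := [set a; b]. pose C := [set u; w].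
have VE : V = p |: (U :|: C) by rewrite -V'E eV' -(setUA [set p]) -(setUA [set p]) [in LHS](setUC (_ :|: _)).
have dUC : [disjoint U & C] by rewrite disjoints_subset subUset !sub1set !inE !negb_or ![a == _]eq_sym ![b == _]eq_sym ua ub wa wb.
have pU : p \notin U by rewrite !inE negb_or pa pb.
have pC : p \notin C by rewrite !inE negb_or ![p == _]eq_sym up wp.
have mwu : m w u = 1%N by rewrite (proj1 gm).
have nwu : w != u by rewrite eq_sym.
have trC : tr m (all6 (T := T)) C.
  apply: (tr_add (tr1 m _ w) (x := w)); rewrite ?inE // => y; rewrite inE => /eqP ->; by rewrite eqxx.
have ndC x y : x \in C -> y \in C -> m x y <> 2%N.
  by rewrite !inE => /orP[] /eqP -> /orP[] /eqP ->; rewrite ?(proj2 gm) ?muw ?mwu.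
have dp : (m p u + m p w = 2)%N.
  have pu : p != u by rewrite eq_sym. have pw : p != w by rewrite eq_sym.
  have s3 (F : T -> nat) : (\sum_(y in [set p; u; w]) F y = F p + (F u + F w))%N.
    by rewrite -setUA big_setU1 ?inE ?negb_or ?pu // big_setU1 ?inE //= big_set1.
  by rewrite -(proj2 p6) -deg_contract ?pV' // ed1l eV' s3 /add_edge (proj2 gm) (negbTE pu) (negbTE pw) /= !addn0.
have lu : (m u w + m u a + m u p <= d u)%N.
  apply: leq_trans (dg_pairs (s := [:: w; a; p]) u _ _) => //=; first by rewrite !big_cons big_nil addn0 addnA.
    by rewrite !inE !negb_or wa wp ap.
  by move=> v; rewrite !inE => /or3P[] /eqP -> //; exact: sV'.
have lw : (m w u + m w b + m w p <= d w)%N.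
  apply: leq_trans (dg_pairs (s := [:: u; b; p]) w _ _) => //=; first by rewrite !big_cons big_nil addn0 addnA.
    by rewrite !inE !negb_or ub up bp.
  by move=> v; rewrite !inE => /or3P[] /eqP -> //; exact: sV'.
have [mpu mpw] : m p u = 1%N /\ m p w = 1%N.
  move: lu lw dp; rewrite muw mwu mua mwb !(proj1 gm _ p); have := d3 (sV' uV'); have := d3 (sV' wV'); clear; lia.
apply: (nonlaw gm va cr ih potV pp Vp) => M bb cV.
have UV : U \proper V.
  by rewrite properEneq abV andbT; apply: contraTneq pV => <-.
have n3 v : v \in U -> rho v != 3%N by rewrite !inE => /orP[] /eqP ->; rewrite ?a6 ?b6.
have cU : cov U m M := covS cV (proper_sub UV) (fun x y _ _ => leqnn (m x y)).
have [L0 /good_rc rU] := flex_lawful n3 (sub_flex gm cr UV) bb cU.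
pose o x := if x == u then a else b.
have ou : o u = a by rewrite /o eqxx. have ow : o w = b by rewrite /o (negbTE nwu).
have Cuw l : l \in C -> l = u \/ l = w by rewrite !inE => /orP[] /eqP ->; auto.
have ho l : l \in C -> [/\ rho l = 6%N, o l \in U, m (o l) l = 1%N & forall x, x \in U -> x != o l -> m x l = 0%N] \/
    (rho l = 4%N /\ forall x, x \in U -> m x l = 0%N).
  move=> /Cuw [] ->; left; rewrite ?ou ?ow; split=> //; rewrite ?inE ?eqxx ?orbT //; try by rewrite (proj1 gm).
    move=> x; rewrite !inE => /orP[] /eqP ->; rewrite ?eqxx // => _; rewrite (proj1 gm); exact: mb0.
  move=> x; rewrite !inE => /orP[] /eqP ->; rewrite ?eqxx // => _; rewrite (proj1 gm); exact: ma0.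
have mp0 x : x \in U :|: C -> x != u -> x != w -> m p x = 0%N.
  by rewrite !inE => /orP[/orP[] /eqP ->|/orP[] /eqP ->]; rewrite ?eqxx // => _ _; [apply: ma0|apply: mb0]; rewrite ?pV' // eq_sym.
have uC : u \in C by rewrite !inE eqxx. have wC : w \in C by rewrite !inE eqxx orbT.
rewrite VE in cV *.
have [g [fs [ft [fsi fti hs ht hg]]]] := chain_matchings gm dUC pC uC wC mpu mpw ho cV.
apply: (chain_tilt gm dUC pU pC trC ndC uC wC mp0 (proj1 p6) ho cV fsi fti hs ht hg rU).
- by move=> l /Cuw [] ->.
- by move=> k _ l c' /Cuw [] ->; rewrite eqxx.
Qed.

End Apart.

Lemma pair_cases : (neck V m /\ forall v, v \in V -> rho v = 6%N) \/
  exists u w, [/\ u \in V', w \in V' & u != w] /\ [/\ m u a = 1%N, m w b = 1%N,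
   forall x, x \in V' -> x != u -> m x a = 0%N & forall x, x \in V' -> x != w -> m x b = 0%N] /\
   [/\ neck V' (add_edge u w m), m u w = 1%N, u != p, w != p & forall v, v \in V' -> rho v = 6%N].
Proof.
have aab : a \in [set a; b] by rewrite !inE eqxx. have bab : b \in [set a; b] by rewrite !inE eqxx orbT.
have [u [uV mua ma0]] := pair_nbr aab bab ab.
have nba : b != a by rewrite eq_sym ab.
have [w [wV mwb mb0]] := pair_nbr bab aab nba.
case: (eqVneq u w) => [e|uw]; first by left; apply: (same_nbr uV mua); rewrite e.
case: (contract uV wV uw mua mwb ma0 mb0) => [/(square_case uV wV uw mua mwb ma0 mb0)//|[N r6]].
case: (eqVneq (m u w) 0%N) => [e|/eqP n]; first by left; exact: (neck_apart uV wV uw mua mwb ma0 mb0 N r6 e).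
have [up wp muw _ _] := neck_adj uV wV uw mua mwb ma0 mb0 N n.
by right; exists u, w.
Qed.

End Pair.

(** If uw is an edge, the contracted necklace has another double edge ce, or [five] applies.
    Treating ce in the same way, u and w lie on no double edge of the graph and must get one from
    the new contraction, so they are the outer neighbors of c and e. Then x, y, c, e, u, w have no
    outer edge, although [p] is not among them. *)
Lemma doubles_concl x y : x \in V -> y \in V -> m x y = 2%N ->
  C2 V m rho \/ neck V m /\ forall v, v \in V -> rho v = 6%N.
Proof.
move=> aV bV mab.
case: (eqVneq x p) mab => [->|ap] mab; first by left; exact: double_at_p mab.
case: (eqVneq y p) mab => [->|bp] mab; first by left; apply: (double_at_p aV); rewrite (proj1 gm).
right; case: (pair_cases aV bV ap bp mab) => // -[u [w [[uV wV uw] [[mua mwb ma0 mb0] [N muw up wp r6]]]]].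
have [_ [_ da _ db]] := ab_out aV bV ap bp mab.
have muw0 : m u w <> 0%N by rewrite muw.
have [_ _ _ p1 part] := neck_adj aV bV ap bp mab uV wV uw mua mwb ma0 mb0 N muw0.
set V' := V :\: [set x; y] in uV wV ma0 mb0 N r6 p1 part.
have VV v : v \in V' -> v \in V by rewrite in_setD => /andP[].
have VN v : v \in V' -> v != x /\ v != y by rewrite !inE negb_or => /andP[/andP[-> ->]].
have pV1 : p \in V' := pV' ap bp.
have d3u v : v \in V' -> v != p -> d v = 3%N by move=> vV n; case: (vz (VV v vV) n) => -[e' //]; rewrite r6 // in e'.
case: (classic (exists c, [/\ c \in V', c != p, c != u & c != w])) => [[c [cV' cp cu cw]]|h]; last first.
  exfalso; apply: (five aV bV ap bp mab uV wV uw mua mwb ma0 mb0 _ up wp muw); try exact: r6.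
  rewrite -/V'; apply/setP => v; rewrite !in_setU !in_set1 -orbA; apply/idP/idP => [vV|/or3P[] /eqP -> //].
  by apply/negPn/negP; rewrite !negb_or => /and3P[n1 n2 n3]; apply: h; exists v.
have [e eV' mce] := part c cV' cp.
have g2 : gr (add_edge u w m) := add_edge_gr gm uw.
have ep : e != p by apply/negP => /eqP k; have := p1 c cV'; rewrite (proj1 g2) -k mce.
have no2 v a : a \in V -> v \in V' -> v != p -> forall t, t \in V' -> m v t = 1%N -> m v a = 1%N -> a != t -> forall z, z \in V -> m v z <> 2%N.
  move=> aV0 vV' vp t tV' m1 m2 nat0 z zV mz.
  have : (m v z + (m v t + (m v a + 0)) <= d v)%N.
    have := @dg_pairs v [:: z; t; a]; rewrite !big_cons big_nil; apply=> [|q]; last by rewrite !inE => /or3P[] /eqP -> //; exact: VV.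
    rewrite /= !inE negb_or [t == a]eq_sym nat0 !andbT; apply/andP; split; apply/negP => /eqP k.
      by move: mz; rewrite k m1.
    by move: mz; rewrite k m2.
  by rewrite mz m1 m2 d3u.
have mwu : m w u = 1%N by rewrite (proj1 gm).
have [ux uy] := VN u uV. have [wx wy] := VN w wV. have [cx cy] := VN c cV'. have [ex ey] := VN e eV'.
have no2u : forall z, z \in V -> m u z <> 2%N by apply: (no2 u x aV uV up w wV muw mua); rewrite eq_sym.
have no2w : forall z, z \in V -> m w z <> 2%N by apply: (no2 w y bV wV wp u uV mwu mwb); rewrite eq_sym.
have eu : e != u.
  apply/negP => /eqP k; move: mce; rewrite k /add_edge (negbTE cu) (negbTE cw) /= !addn0 (proj1 gm) => k'; exact: (no2u c (VV c cV') k').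
have ew : e != w.
  apply/negP => /eqP k; move: mce; rewrite k /add_edge (negbTE cu) (negbTE cw) /= !addn0 (proj1 gm) => k'; exact: (no2w c (VV c cV') k').
have mce' : m c e = 2%N by move: mce; rewrite /add_edge (negbTE cu) (negbTE cw) /= !addn0.
case: (pair_cases (VV c cV') (VV e eV') cp ep mce') => // -[u2 [w2 [[uV2 wV2 uw2] [[mua2 mwb2 ma2 mb2] [N2 muw2 _ _ _]]]]].
exfalso; have muw02 : m u2 w2 <> 0%N by rewrite muw2.
have [_ _ _ _ part2] := neck_adj (VV c cV') (VV e eV') cp ep mce' uV2 wV2 uw2 mua2 mwb2 ma2 mb2 N2 muw02.
have key v : v \in V' -> v != c -> v != e -> v != p -> (forall z, z \in V -> m v z <> 2%N) -> v = u2 \/ v = w2.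
  move=> vV' vc ve vp nz; have vV2 : v \in V :\: [set c; e] by rewrite !inE negb_or vc ve VV.
  have [z zV2 mz] := part2 v vV2 vp; have zV : z \in V by move: zV2; rewrite in_setD => /andP[].
  move: mz; rewrite /add_edge; case: (eqVneq v u2) => [->|_]; first by left.
  by case: (eqVneq v w2) => [->|_]; [right|rewrite /= !addn0 => /nz].
have uc : u != c by rewrite eq_sym. have ue : u != e by rewrite eq_sym.
have wc : w != c by rewrite eq_sym. have we : w != e by rewrite eq_sym.
have sum1 : (m u c + m u e + (m w c + m w e) = 2)%N.
  have U2 : u \in V :\: [set c; e] by rewrite !inE negb_or uc ue VV.
  have W2 : w \in V :\: [set c; e] by rewrite !inE negb_or wc we VV.
  have nu2w2 : w2 != u2 by rewrite eq_sym.
  case: (key u uV uc ue up no2u) => k1; case: (key w wV wc we wp no2w) => k2.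
  - by move: uw; rewrite k1 k2 eqxx.
  - by rewrite k1 k2 mua2 mwb2 (ma2 w2) // (mb2 u2) // -?k1 -?k2.
  - by rewrite k1 k2 mua2 mwb2 (ma2 w2) // (mb2 u2) // -?k1 -?k2.
  - by move: uw; rewrite k1 k2 eqxx.
have E : [set v in [:: x; y; c; e; u; w]] = V.
  have xy : x != y := ab mab.
  have nce : c != e by apply/negP => /eqP k; move: mce'; rewrite k (proj2 gm).
  apply: full_seq => //=.
  - by rewrite !inE !negb_or xy ![x == _]eq_sym ![y == _]eq_sym cx cy ex ey ux uy wx wy nce uw ![c == _]eq_sym ![e == _]eq_sym uc ue wc we.
  - by move=> v; rewrite !inE => /or4P[/eqP ->|/eqP ->|/eqP ->|/or3P[] /eqP ->] //; exact: VV.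
  rewrite !big_cons !big_nil da db !d3u //.
  move: mab mce' mua mwb muw mwu sum1 (proj1 gm x y) (proj1 gm c e) (proj1 gm u x) (proj1 gm w y).
  move: (proj1 gm u c) (proj1 gm u e) (proj1 gm w c) (proj1 gm w e); clear; lia.
by move: pV; rewrite -E !inE ![p == _]eq_sym (negbTE ap) (negbTE bp) (negbTE cp) (negbTE ep) (negbTE up) (negbTE wp).
Qed.

End Doubles.

Theorem crit_concl (R : realFieldType) (T : finType) (V : {set T}) (m : T -> T -> nat) (rho : T -> nat) :
  gr m -> valid rho -> crit R V m rho -> concl V m rho.
Proof.
have [n] := ubnP (meas V rho); elim: n V m rho => // n IH V m rho le gm va cr.
case: (lerP (pot m rho V) 0) => [h|potV]; first by left.
have ih : IHyp R T (meas V rho).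
  by move=> U m' rho' g' v' c' lt; apply: (IH U m' rho') => //; apply: leq_trans lt _.
have [p pp Vp] := all_small gm va cr ih potV.
right; case: (classic (exists x y, [/\ x \in V, y \in V & m x y = 2%N])) => [[x [y [xV yV mxy]]]|h].
  exact: (doubles_concl gm va cr ih potV pp Vp xV yV mxy).
exfalso; apply: (simple_false gm va cr ih potV pp Vp) => x y xV yV.
have := mult_le2 gm va cr ih potV xV yV; rewrite leq_eqVlt ltnS => /orP[/eqP e|//].
by exfalso; apply: h; exists x, y.
Qed.

(** * Normalizing the lists of a cover *)

Lemma card_C3 : #|{: C3}| = 3%N. Proof. by rewrite card_option card_bool. Qed.

Lemma label3 (V : finType) (A : {set V}) : #|A| = 3%N ->
  exists l : C3 -> V, [/\ injective l, forall i, l i \in A & forall c, c \in A -> exists i, c = l i].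
Proof.
move=> c3; have e : #|{: C3}| = #|A| by rewrite card_C3.
exists (fun c => enum_val (cast_ord e (enum_rank c))); split=> [c d /enum_val_inj /cast_ord_inj /enum_rank_inj //|i|c cA].
  exact: enum_valP.
exists (enum_val (cast_ord (esym e) (enum_rank_in cA c))).
by rewrite enum_valK cast_ordKV enum_rankK_in.
Qed.

(** [oa], [ob] and [oc] are the partial images of the three colors under an incomplete matching. *)
Lemma complete3 (oa ob oc : option C3) : (forall k, oa = Some k -> ob = Some k -> False) -> (forall k, oa = Some k -> oc = Some k -> False) ->
  (forall k, ob = Some k -> oc = Some k -> False) ->
  exists a b c : C3, [/\ a != b, a != c, b != c & [/\ forall j, oa = Some j -> j = a, forall j, ob = Some j -> j = b & forall j, oc = Some j -> j = c]].
Proof.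
have get (o : option C3) a : (if o is Some x then x == a else true) -> forall j, o = Some j -> j = a by case: o => // x /eqP -> j [].
have ab (a b c : C3) : a != b -> a != c -> b != c -> (if oa is Some x then x == a else true) -> (if ob is Some x then x == b else true) ->
    (if oc is Some x then x == c else true) -> exists a b c : C3, [/\ a != b, a != c, b != c & [/\ forall j, oa = Some j -> j = a, forall j, ob = Some j -> j = b & forall j, oc = Some j -> j = c]].
  by move=> n1 n2 n3 e1 e2 e3; exists a, b, c; split=> //; split; exact: get.
pose t := Some true; pose f := Some false.
move=> h1 h2 h3; have := ab None t f; have := ab None f t; have := ab t None f; have := ab t f None; have := ab f None t; have := ab f t None.
move: h1 h2 h3 {ab get}; case: oa => [[[]|]|]; case: ob => [[[]|]|]; case: oc => [[[]|]|] h1 h2 h3.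
all: try (by case: (h1 _ erefl erefl)); try (by case: (h2 _ erefl erefl)); try (by case: (h3 _ erefl erefl)).
all: move=> k1 k2 k3 k4 k5 k6; first [exact: k1|exact: k2|exact: k3|exact: k4|exact: k5|exact: k6].
Qed.

Lemma partial_inj (r : C3 -> C3 -> bool) : (forall i j k, r i j -> r i k -> j = k) -> (forall i j k, r i k -> r j k -> i = j) ->
  exists f : {ffun C3 -> C3}, injective f /\ forall i j, r i j -> j = f i.
Proof.
move=> h1 h2; pose g i := [pick j | r i j].
have gP i j : r i j -> g i = Some j.
  by rewrite /g => rij; case: pickP => [k /(h1 _ _ _ rij) ->//|/(_ j)]; rewrite rij.
have gI i j k : g i = Some k -> g j = Some k -> i = j.
  by rewrite /g; case: pickP => // a ra [<-]; case: pickP => // b rb [e]; apply: (h2 _ _ a) => //; rewrite -e.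
pose mk (a b c : C3) : {ffun C3 -> C3} := [ffun i => match i with None => a | Some true => b | Some false => c end].
have [a [b [c [ab ac bc [ga gb gc]]]]] : exists a b c, [/\ a != b, a != c, b != c &
    [/\ forall j, g None = Some j -> j = a, forall j, g (Some true) = Some j -> j = b & forall j, g (Some false) = Some j -> j = c]].
  have n1 k : g None = Some k -> g (Some true) = Some k -> False by move=> e1 /(gI _ _ _ e1).
  have n2 k : g None = Some k -> g (Some false) = Some k -> False by move=> e1 /(gI _ _ _ e1).
  have n3 k : g (Some true) = Some k -> g (Some false) = Some k -> False by move=> e1 /(gI _ _ _ e1).
  exact: complete3.
exists (mk a b c); split=> [i j|i j /gP]; rewrite !ffunE.
  case: i => [[]|]; case: j => [[]|] // e; move: ab ac bc; rewrite e ?eqxx //.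
by case: i => [[]|]; auto.
Qed.

Section Graph.
Variable G : mgraph.

Lemma graph_gr : gr (@mult G). Proof. by split; [exact: mult_sym|exact: mult_irr]. Qed.

(** A vertex contributes its edges once in each order; this makes the halving in [edges_in]
    exact. *)
Lemma ed_even (A : {set G}) : ~~ odd (ed (@mult G) A A).
Proof.
have [n] := ubnP #|A|; elim: n A => // n IH A le.
case: (set_0Vmem A) => [->|[x xA]]; first by rewrite ed0r.
have d : [disjoint [set x] & A :\ x] by rewrite disjoints1 !inE eqxx.
rewrite -(setD1K xA) edUl // !edUr // ed11 mult_irr add0n (edC _ [set x] graph_gr) addnA addnn oddD odd_double /=.
by apply: IH; move: le; rewrite (cardsD1 x A) xA.
Qed.

Lemma potential_pot (rho : G -> nat) : potential rho [set: G] = pot (@mult G) rho setT.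
Proof.
rewrite /potential /pot /edges_in -/(ed (@mult G) setT setT); congr (_ - _).
have := odd_double_half (ed (@mult G) setT setT); rewrite (negbTE (ed_even _)) add0n => <-.
rewrite doubleK; move: (_./2) => k; lia.
Qed.

Lemma neck_family : neck [set: G] (@mult G) -> in_family_I G.
Proof.
move=> [h [f [h0 fi eU e]]]; exists h => //.
have sf x : exists i, f i == x.
  have : x \in [set: G] by rewrite inE.
  by rewrite eU => /imsetP[i _ ->]; exists i.
exists (fun x => xchoose (sf x)); split; last by move=> x y /=; rewrite -e !(eqP (xchooseP (sf _))).
exists f => [x|i]; first by have /eqP := xchooseP (sf x).
by apply: fi; apply/eqP; exact: xchooseP (sf (f i)).
Qed.

Lemma C2_graph (rho : G -> nat) : C2 [set: G] (@mult G) rho -> is_C2 G /\ potential rho [set: G] = 2.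
Proof.
move=> [x [y [n eU e r6 r4]]]; split; last by rewrite potential_pot eU (pot2 _ graph_gr) // r6 r4 e.
split; first by rewrite -cardsT eU cards2 n.
move=> a b; have : a \in [set: G] by rewrite inE. have : b \in [set: G] by rewrite inE.
by rewrite eU !inE => /orP[] /eqP -> /orP[] /eqP ->; rewrite ?eqxx // mult_sym.
Qed.

End Graph.

Lemma Prob_colorE (R : realType) (G : mgraph) (C : dp3_cover G) (D : assignment C -> R) Phi (v : G) (c : cvert C) :
  Prob_color D Phi v c = \sum_L D L * pr (Phi L) (fun phi => phi v == c).
Proof. exact: (pr_pair D Phi (fun _ (phi : vmap C) => phi v == c)). Qed.

Lemma mem_bigcup_seq (V : finType) (Ms : seq {set V}) (x : V) : x \in \bigcup_(M <- Ms) M <-> exists2 M, M \in Ms & x \in M.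
Proof.
elim: Ms => [|M Ms IH]; first by rewrite big_nil inE; split=> // -[].
rewrite big_cons in_setU; split=> [/orP[xM|/IH [N NM xN]]|[N + xN]].
- by exists M => //; exact: mem_head.
- by exists N => //; rewrite in_cons NM orbT.
by rewrite in_cons => /orP[/eqP <-|NM]; rewrite ?xN //; apply/orP; right; apply/IH; exists N.
Qed.

Section FlexFlexible.
Variables (R : realType) (G : mgraph) (rho : G -> nat).

Lemma flex_flexible : flex R [set: G] (@mult G) rho -> flexible (1 / 5 : R) rho.
Proof.
move=> fl C D [dD lD] aD; have inT (v : G) : v \in [set: G] by rewrite inE.
have [lab labP] := fin_all_exists (fun x : G => label3 (clist_card C x)).
have li x : injective (lab x) by case: (labP x).
have lin x i : lab x i \in clist C x by case: (labP x).
have ls x c : c \in clist C x -> exists i, c = lab x i by case: (labP x) => _ _; apply.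
have ldis x y i j : lab x i = lab y j -> x = y.
  move=> e; apply/eqP/negPn/negP => n; have := disjointFr (clist_disjoint C n) (lin x i).
  by rewrite e lin.
pose M x y i j := (x != y) && cadj (lab x i) (lab y j).
have cM : cov [set: G] (@mult G) M.
  split=> [x y i j|x y _ _ n]; first by rewrite /M eq_sym (cadj_sym (d := C)).
  have [Ms [sz mt eE]] := clist_matchings C n.
  have mk (N : {set {set cvert C}}) : exists f : {ffun C3 -> C3}, N \in Ms -> injective f /\ forall i j, [set lab x i; lab y j] \in N -> j = f i.
    case: (boolP (N \in Ms)) => NM; last by exists [ffun i => i].
    have /andP[_ /trivIsetP tI] := allP mt N NM.
    have [||f [fi fP]] := @partial_inj (fun i j => [set lab x i; lab y j] \in N).
    - move=> i j k h1 h2; apply/eqP/negPn/negP => njk.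
      have ne : [set lab x i; lab y j] != [set lab x i; lab y k].
        apply/negP => /eqP /setP /(_ (lab y j)); rewrite !inE eqxx orbT => /esym /orP[] /eqP; first by move=> /ldis e; rewrite e eqxx in n.
        by move=> /li e; rewrite e eqxx in njk.
      have := tI _ _ h1 h2 ne; rewrite -setI_eq0 => /eqP /setP /(_ (lab x i)); by rewrite !inE eqxx.
    - move=> i j k h1 h2; apply/eqP/negPn/negP => nij.
      have ne : [set lab x i; lab y k] != [set lab x j; lab y k].
        apply/negP => /eqP /setP /(_ (lab x i)); rewrite !inE eqxx /= => /esym /orP[] /eqP; last by move=> /ldis e; rewrite e eqxx in n.
        by move=> /li e; rewrite e eqxx in nij.
      have := tI _ _ h1 h2 ne; rewrite -setI_eq0 => /eqP /setP /(_ (lab y k)); by rewrite !inE eqxx !orbT.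
    by exists f.
  have [F FP] := fin_all_exists mk; exists (map F Ms); split.
  - by rewrite size_map.
  - by move=> f /mapP[N NM ->]; case: (FP N NM).
  move=> i j /andP[_ aij]; have : [set lab x i; lab y j] \in edges_between (@cadj _ C) (clist C x) (clist C y).
    by apply/imsetP; exists (lab x i, lab y j) => //; rewrite inE /= !lin.
  rewrite eE => /mem_bigcup_seq [N NM hN]; exists (F N); first exact: map_f.
  by case: (FP N NM) => _; apply.
have [beta hbeta] := fin_all_exists (fun x : G => ls x _ (basepoint_in C x)).
(* The label of the missing color of a list of size 2; a full list misses nothing and gets the
   default [None]. *)
pose mu (L' : assignment C) (v : G) : C3 := if [pick c | clist C v :\: L' v == [set lab v c]] is Some c then c else None.
have muP (L' : assignment C) v c : clist C v :\: L' v = [set lab v c] -> mu L' v = c.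
  rewrite /mu => e; case: pickP => [d|/(_ c)]; last by rewrite e eqxx.
  by rewrite e => /eqP/set1_inj /li.
have aP : adm [set: G] rho D mu.
  move=> v _ r3 c; have h2 : h_of rho v = 2%N by rewrite /h_of r3.
  apply: le_trans (aD v h2 (lab v c) (lin v c)) _; apply: pr_mono; first by case: dD.
  by move=> L' _ /eqP /muP ->.
have [K [Kd Ks Km]] := fl M beta _ D mu cM dD aP.
pose out (phi : {ffun G -> C3}) : vmap C := [ffun v => lab v (phi v)].
exists (fun L' => push out (K L')).
have pc v c : Prob_color D (fun L' => push out (K L')) v (lab v c) = pr (bind D K) (fun phi => phi v == c).
  rewrite Prob_colorE pr_bind; apply: eq_bigr => L' _; congr (_ * _); rewrite pr_push.
  by apply: eq_pr => phi; rewrite ffunE (inj_eq (li v)).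
split=> [L' DL|v].
  split=> [|psi]; first exact: isd_push.
  move=> /push_gt0[|phi [<- Kp]]; first by case: (Kd L').
  have [o m3] := Ks L' phi DL Kp; split=> [v|c d].
    rewrite ffunE; have [sv cv] := lD L' DL v.
    have cD : #|clist C v :\: L' v| = (3 - h_of rho v)%N.
      by rewrite cardsD (setIidPr sv) clist_card cv.
    apply/negPn/negP => nin; have inD : lab v (phi v) \in clist C v :\: L' v by rewrite inE nin lin.
    move: cD; rewrite /h_of; case: eqP => [r3|_] cD; last by move/eqP: cD; rewrite subnn cards_eq0 => /eqP e; rewrite e inE in inD.
    have /eqP/cards1P[z ez] := cD; have ez' : z = lab v (phi v) by move: inD; rewrite ez inE => /eqP.
    by have := m3 v (inT v) r3; rewrite (muP _ _ (phi v)) ?eqxx // ez ez'.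
  move=> /imsetP[x _ ->] /imsetP[y _ ->]; rewrite !ffunE.
  case: (eqVneq x y) => [->|n]; first by rewrite (cadj_irr (d := C)).
  by have := o x y (inT x) (inT y) n; rewrite /M n.
have [lb p4v] := Km v (inT v); split=> [c /ls [i ->]|r4]; first by rewrite pc.
split=> [|c /ls [i ->] ne]; first by rewrite hbeta pc p4v // /p4 eqxx; lra.
rewrite pc p4v // /p4 -(inj_eq (li v)) -hbeta (negbTE ne); lra.
Qed.

End FlexFlexible.

(** * From flexible subgraphs back to normalized lists *)

Section Subgraph.
Variables (R : realType) (G : mgraph) (rho : G -> nat) (S : subgraph G).
Notation H := (subgraph_mgraph S).
Variables (M : G -> G -> C3 -> C3 -> bool) (b : G -> C3).
Hypothesis cM : cov (sub_verts S) (sub_mult S) M.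

Definition cadj_of (p q : (H * C3)%type) :=
  if p.1 == q.1 then p.2 != q.2 else M (val p.1) (val q.1) p.2 q.2.

Definition clist_of (x : H) : {set (H * C3)%type} := [set p | p.1 == x].

Lemma cadj_of_sym : symmetric cadj_of.
Proof.
move=> p q; rewrite /cadj_of eq_sym [p.2 == _]eq_sym; case: ifP => // _; exact: (proj1 cM).
Qed.

Lemma cadj_of_irr : irreflexive cadj_of.
Proof. by move=> p; rewrite /cadj_of !eqxx. Qed.

Lemma clist_of_disjoint x y : x != y -> [disjoint clist_of x & clist_of y].
Proof.
move=> n; rewrite -setI_eq0; apply/eqP/setP => p; rewrite !inE; apply/negP => /andP[/eqP e1 /eqP e2].
by rewrite -e1 -e2 eqxx in n.
Qed.

Lemma clist_of_union : \bigcup_x clist_of x = [set: (H * C3)%type].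
Proof. by apply/setP => p; rewrite inE; apply/bigcupP; exists p.1; rewrite ?inE. Qed.

Lemma clist_of_im x : clist_of x = [set (x, c) | c : C3].
Proof.
apply/setP => p; rewrite inE; apply/eqP/imsetP => [<-|[c _ ->] //]; by exists p.2 => //; case: p.
Qed.

Lemma clist_of_card x : #|clist_of x| = 3%N.
Proof. by rewrite clist_of_im card_imset ?card_C3 // => c d []. Qed.

Lemma clist_of_clique x : clique cadj_of (clist_of x).
Proof.
move=> p q; rewrite !inE => /eqP e1 /eqP e2 n; rewrite /cadj_of e1 e2 eqxx.
by apply: contra n => /eqP e; case: p e1 e => p1 p2 /= ->; case: q e2 => q1 q2 /= -> ->.
Qed.

Lemma clist_of_matchings x y : x != y -> exists Ms : seq {set {set (H * C3)%type}},
  [/\ (size Ms <= mult x y)%N, all (matching cadj_of) Ms & edges_between cadj_of (clist_of x) (clist_of y) = \bigcup_(N <- Ms) N].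
Proof.
move=> n; have nv : val x != val y by rewrite (inj_eq val_inj).
have [s [sz si h]] := proj2 cM (val x) (val y) (valP x) (valP y) nv.
(* Only the conflicts of [M] among the edges of [f] are kept, since the union of the matchings must
   be the exact set of edges. *)
pose N (f : {ffun C3 -> C3}) := [set [set (x, i); (y, f i)] | i in [set i | M (val x) (val y) i (f i)]].
have adj i j : cadj_of (x, i) (y, j) = M (val x) (val y) i j by rewrite /cadj_of /= (negbTE n).
exists (map N s); split.
- by rewrite size_map.
- apply/allP => _ /mapP[f fs ->]; apply/andP; split.
    apply/subsetP => e /imsetP[i]; rewrite inE => m1 ->.
    by apply/imsetP; exists ((x, i), (y, f i)); rewrite ?inE /= ?adj.
  apply/trivIsetP => e1 e2 /imsetP[i _ ->] /imsetP[j _ ->] ne; have nij : i != j by apply: contraNneq ne => ->.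
  rewrite -setI_eq0; apply/eqP/setP => p; rewrite !inE; apply/negP => /andP[/orP[] /eqP -> /orP[] /eqP [] e].
  + by rewrite e eqxx in nij.
  + by rewrite e eqxx in n.
  + by rewrite e eqxx in n.
  + by move/(si f fs): e => e; rewrite e eqxx in nij.
apply/setP => e; apply/idP/idP.
  move=> /imsetP[[[x' i] [y' j]]]; rewrite !inE /= => /and3P[/eqP -> /eqP ->]; rewrite adj => mij ->.
  have [f fs ej] := h i j mij; apply/mem_bigcup_seq; exists (N f); first exact: map_f.
  by apply/imsetP; exists i; rewrite ?inE -?ej.
move=> /mem_bigcup_seq [_ /mapP[f fs ->] /imsetP[i]]; rewrite inE => m1 ->.
by apply/imsetP; exists ((x, i), (y, f i)); rewrite ?inE /= ?eqxx ?adj.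
Qed.

Lemma basepoint_of_in x : (x, b (val x)) \in clist_of x. Proof. by rewrite inE. Qed.

Definition cover_of : dp3_cover H :=
  DPCover cadj_of_sym cadj_of_irr clist_of_disjoint clist_of_union clist_of_card clist_of_clique
    clist_of_matchings basepoint_of_in.
End Subgraph.

Lemma sum_push (R : realFieldType) (A B : finType) (f : A -> B) (P : A -> R) (F : B -> R) :
  \sum_b push f P b * F b = \sum_a P a * F (f a).
Proof.
rewrite (partition_big f xpredT) //=; apply: eq_bigr => c _; rewrite /push mulr_suml.
by apply: eq_bigr => a /eqP ->.
Qed.

Lemma push_pos (R : realFieldType) (A B : finType) (f : A -> B) (P : A -> R) a : (forall a, 0 <= P a) -> 0 < P a -> 0 < push f P (f a).
Proof.
move=> P0 p; rewrite /push (bigD1 a) //=; apply: ltr_pwDl => //; exact: sumr_ge0.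
Qed.

Section FlexibleFlex.
Variables (R : realType) (G : mgraph) (rho : G -> nat) (S : subgraph G).
Notation H := (subgraph_mgraph S).

(** Several outcomes may give the same lists, so the law of the outcome is pushed to the lists and
    the coloring is drawn from those alone; the marginals are unaffected. *)
Lemma flexible_flex : flexible (1 / 5 : R) (sub_restrict (S := S) rho) -> flex R (sub_verts S) (sub_mult S) rho.
Proof.
move=> fl M b Om P mu cM [P0 P1] aP.
pose C : dp3_cover H := cover_of b cM.
have cl (v : H) (q : H * C3) : (q \in clist C v) = (q.1 == v) by rewrite inE.
pose La w : assignment C := [ffun v : H => if rho (val v) == 3%N then clist C v :\ (v, mu w (val v)) else clist C v].
have LaE w v : La w v = if rho (val v) == 3%N then clist C v :\ (v, mu w (val v)) else clist C v by rewrite ffunE.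
have lD : list_distribution (sub_restrict (S := S) rho) (push La P).
  split; first exact: isd_push.
  move=> L' /push_gt0[//|w [<- _]] v; rewrite LaE /h_of /sub_restrict; case: eqP => _; last by split=> //; exact: (clist_card C v).
  split; first exact: subD1set.
  by have := cardsD1 (v, mu w (val v)) (clist C v); rewrite (clist_card C v : #|_| = 3%N) cl eqxx => -[].
have aD : admissible (sub_restrict (S := S) rho) (1 / 5) (push La P).
  move=> v; rewrite /h_of /sub_restrict; case: eqP => // r3 _ [x c]; rewrite cl /= => /eqP ->.
  have := aP (val v) (valP v) r3 c; rewrite -[Prob _ _]/(pr _ _) pr_push => /le_trans; apply.
  apply: pr_mono => // w _ /eqP e; rewrite LaE r3 eqxx e; apply/eqP/setP => q; rewrite !inE.
  by case: (eqVneq q (v, c)) => [->|_] /=; rewrite ?eqxx // andNb.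
have [Phi [cPhi mPhi]] := fl C (push La P) lD aD.
pose out (psi : vmap C) : {ffun G -> C3} := [ffun x => if insub x is Some v then (psi v).2 else None].
have outE psi (v : H) : out psi (val v) = (psi v).2 by rewrite ffunE valK.
(* [Phi] is constrained only at lists of positive probability; elsewhere a point mass keeps [K w] a
   law. *)
pose K w := if 0 < P w then push out (Phi (La w)) else (fun a => (a == [ffun=> None])%:R).
have Lpos w : 0 < P w -> 0 < push La P (La w) by exact: push_pos.
have KE w : 0 < P w -> K w = push out (Phi (La w)) by rewrite /K => ->.
have colP w psi : 0 < P w -> 0 < Phi (La w) psi -> is_coloring (La w) psi.
  by move=> p; have [_ h] := cPhi (La w) (Lpos w p); exact: h.
have col1 w psi (v : H) : 0 < P w -> 0 < Phi (La w) psi -> (psi v).1 = v.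
  move=> p q; have [h _] := colP w psi p q; have := h v; rewrite LaE.
  by case: ifP => _; rewrite !inE; [case/andP=> _|] => /eqP.
exists K; split.
- move=> w; rewrite /K; case: ifP => p; last exact: isd_point.
  by apply: isd_push; case: (cPhi (La w) (Lpos w p)).
- move=> w phi Pw; rewrite KE // => /push_gt0[|psi [<- q]]; first by case: (cPhi (La w) (Lpos w Pw)) => -[].
  have [h1 h2] := colP w psi Pw q; split=> [x y xU yU n|x xU r3].
    pose v : H := Sub x xU; pose z : H := Sub y yU; have nvz : v != z by rewrite -val_eqE.
    rewrite -[x]/(val v) -[y]/(val z) !outE.
    have := h2 (psi v) (psi z) (imset_f _ (in_setT _)) (imset_f _ (in_setT _)).
    by rewrite /= /cadj_of !(col1 w psi) // (negbTE nvz).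
  pose v : H := Sub x xU; rewrite -[x]/(val v) outE.
  have := h1 v; rewrite LaE r3 eqxx !inE => /andP[+ _]; apply: contra => /eqP e.
  by move: (col1 w psi v Pw q) e; case: (psi v) => q1 q2 /= -> ->.
have key (v : H) c : pr (bind P K) (fun phi => phi (val v) == c) = Prob_color (push La P) Phi v (v, c).
  rewrite Prob_colorE sum_push pr_bind; apply: eq_bigr => w _.
  case: (ltrP 0 (P w)) => p; last by have -> : P w = 0 by [apply: le_anti; rewrite p P0]; rewrite !mul0r.
  rewrite KE // pr_push; congr (_ * _); apply: pr_supp; first by case: (cPhi (La w) (Lpos w p)) => -[].
  move=> psi q; rewrite outE; move: (col1 w psi v p q); case: (psi v) => q1 q2 /= ->.
  by apply/eqP/eqP => [->|[]].
move=> x xU; pose v : H := Sub x xU; rewrite -[x]/(val v); have [lb p4v] := mPhi v.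
split=> [c|r4 c]; first by rewrite key; apply: lb; rewrite cl.
have [e1 e2] := p4v r4; rewrite key /p4; case: (eqVneq c (b (val v))) => [->|n]; first by rewrite e1; lra.
rewrite e2 ?cl //; first lra.
by apply: contra n => /eqP [->].
Qed.

End FlexibleFlex.

Theorem theorem2p2 (R : realType) (G : mgraph) (rho : G -> nat)
  (rhoP : potential_function rho) (Gcrit : critical (1 / 5 : R) rho) :
  (in_family_I G /\ forall v, rho v = 6%N) \/
  (is_C2 G /\ potential rho [set: G] = 2) \/
  potential rho [set: G] <= 0.
Proof.
have cr : crit R [set: G] (@mult G) rho.
  split; first by move=> fl; apply: (proj1 Gcrit); exact: flex_flexible.
  (* [m] is bounded by the multiplicities of the graph only on [U], so it is cut down to [U] to
     define a subgraph. *)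
  move=> U m [sm _] _ le ne; pose mU x y := if (x \in U) && (y \in U) then m x y else 0%N.
  have mUs x y : mU x y = mU y x by rewrite /mU andbC sm.
  have mUl x y : (mU x y <= mult x y)%N by rewrite /mU; case: ifP => // /andP[xU yU]; exact: le.
  have mUi x y : (0 < mU x y)%N -> (x \in U) && (y \in U) by rewrite /mU; case: ifP.
  pose S := SubGraph mUs mUl mUi.
  have pS : proper_subgraph S.
    move=> [/= eU em]; case: ne => [//|[x [y [xU yU lt]]]].
    by move: lt; rewrite -em /mU xU yU ltnn.
  apply: flex_sub (flexible_flex (proj2 Gcrit S pS)) => x y xU yU.
  by rewrite /= /mU xU yU.
case: (crit_concl (graph_gr G) rhoP cr) => [h|[/C2_graph h|[N r6]]].
- by right; right; rewrite potential_pot.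
- by right; left.
- by left; split; [exact: neck_family|move=> v; exact: r6].
Qed.
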